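(* For each $m$ there exists a positive constant $\delta$, depending on $m$, such that the following holds. Let $M^m$ be an $m$-dimensional complete noncompact Riemannian manifold isometrically immersed in $\mathbb{R}^n$, and let $x\in M$. If $$\limsup_{r\to+\infty}\frac{V(x,r)}{r^m}<\delta,$$ then $$\limsup_{R\to+\infty}\frac{\int_{B_R(x)}|H|^{m-1}\,dM}{R}>0.$$ In particular, $\int_M|H|^{m-1}\,dM=+\infty$.
   Context: $B_r(x)$ denotes the (intrinsic) geodesic ball of $M$ with center $x$ and radius $r$, $V(x,r)$ denotes its volume, $H$ is the mean curvature vector of the immersion, and $dM$ is the Riemannian volume element of $M$. *)

(* Defs.v *)
From HB Require Import structures.
From mathcomp Require Import all_boot all_order all_algebra.
From mathcomp Require Import all_classical all_reals all_analysis.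

(* Vectors are row vectors, so a Jacobian matrix acts on the right: its i-th row
   is the i-th partial derivative. *)

Set Implicit Arguments.
Unset Strict Implicit.
Unset Printing Implicit Defensive.

Import Order.TTheory GRing.Theory Num.Theory.
Import numFieldNormedType.Exports.

Local Open Scope classical_set_scope.
Local Open Scope ring_scope.

(* Lebesgue measure on R^n as an iterated product measure.  It lives on tuples,
   which carry the product (= Borel) sigma-algebra in the library. *)
Section lebesgue_tuple.
Context {R : realType}.

Local Notation mR := (measurableTypeR R).

Definition cons_pair n (p : mR * n.-tuple mR) : n.+1.-tuple mR :=
  [tuple of p.1 :: p.2].

Definition uncons_pair n (t : n.+1.-tuple mR) : mR * n.-tuple mR :=
  (thead t, [tuple of behead t]).

Lemma measurable_cons_pair n : measurable_fun setT (@cons_pair n).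
Proof. exact: measurable_cons. Qed.

Lemma measurable_uncons_pair n : measurable_fun setT (@uncons_pair n).
Proof.
apply: measurable_fun_pair; last exact: measurable_behead.
exact: measurable_tnth.
Qed.

Lemma cons_pairK n : cancel (@cons_pair n) (@uncons_pair n).
Proof.
by move=> [x t]; rewrite /uncons_pair /= theadE; congr pair; exact: val_inj.
Qed.

Lemma uncons_pairK n : cancel (@uncons_pair n) (@cons_pair n).
Proof. by move=> t; rewrite /cons_pair /= -tuple_eta. Qed.

Section step.
Variables (n : nat) (mu : {sigma_finite_measure set (n.-tuple mR) -> \bar R}).

Let mR_mu : {measure set (mR * n.-tuple mR)%type -> \bar R} :=
  (@lebesgue_measure R \x mu)%E.

(* Reproved: the library's instance for products is not found by inference. *)
Let mR_mu_sigma_finite : sigma_finite setT mR_mu.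
Proof.
have /sigma_finiteP[F [TF ndF Foo]] := sigma_finiteT (@lebesgue_measure R).
have /sigma_finiteP[G [TG ndG Goo]] := sigma_finiteT mu.
exists (fun i => F i `*` G i).
  rewrite -setXTT TF TG predeqE => -[x y]; split.
    move=> [/= [i _ Fix] [j _ Gjy]]; exists (maxn i j) => //; split.
    - by move: x Fix; exact/subsetPset/ndF/leq_maxl.
    - by move: y Gjy; exact/subsetPset/ndG/leq_maxr.
  by move=> [i _ []/= ? ?]; split; exists i.
move=> k; have [? ?] := Foo k; have [? ?] := Goo k.
split; first exact: measurableX.
by rewrite /mR_mu /= product_measure1E// lte_mul_pinfty// ge0_fin_numE.
Qed.

Definition lebesgue_step : set (n.+1.-tuple mR) -> \bar R :=
  pushforward (@lebesgue_measure R \x mu)%E (@cons_pair n).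

Let step0 : lebesgue_step set0 = 0%E.
Proof.
by rewrite /lebesgue_step /pushforward preimage_set0; exact: (measure0 mR_mu).
Qed.

Let step_ge0 A : (0 <= lebesgue_step A)%E.
Proof. exact: (measure_ge0 mR_mu). Qed.

Let step_sigma_additive : semi_sigma_additive lebesgue_step.
Proof.
move=> F mF tF mUF; rewrite /lebesgue_step /pushforward preimage_bigcup.
have mcons B : measurable B -> measurable (@cons_pair n @^-1` B).
  by move=> mB; rewrite -[X in measurable X]setTI; exact: measurable_cons_pair.
apply: (@measure_semi_sigma_additive _ _ _ mR_mu).
- by move=> i; exact: mcons.
- apply/trivIsetP => /= i j _ _ ij; rewrite -preimage_setI.
  by move/trivIsetP : tF => /(_ _ _ _ _ ij) ->//; rewrite preimage_set0.
- by rewrite -preimage_bigcup; exact: mcons.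
Qed.

HB.instance Definition _ := isMeasure.Build _ _ _ lebesgue_step
  step0 step_ge0 step_sigma_additive.

Let step_sigma_finite : sigma_finite setT lebesgue_step.
Proof.
have [G GT mG] := mR_mu_sigma_finite.
exists (fun i => @uncons_pair n @^-1` G i).
  by rewrite -preimage_bigcup -GT preimage_setT.
move=> i; have [mGi Gi] := mG i; split.
  by rewrite -[X in measurable X]setTI; exact: measurable_uncons_pair.
rewrite /lebesgue_step /pushforward -comp_preimage.
rewrite (_ : _ \o _ = id); first by rewrite preimage_id.
by apply/funext => p; exact: cons_pairK.
Qed.

HB.instance Definition _ := Measure_isSigmaFinite.Build _ _ _ lebesgue_step
  step_sigma_finite.

End step.

Fixpoint lebesgue_tuple n : {sigma_finite_measure set (n.-tuple mR) -> \bar R} :=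
  if n is k.+1 then lebesgue_step (lebesgue_tuple k)
  else dirac ([tuple] : 0.-tuple mR).

End lebesgue_tuple.

Definition row_of_tuple (R : realType) m (t : m.-tuple (measurableTypeR R)) :
  'rV[R]_m := \row_i tnth t i.

(* The norm which the library puts on 'rV[R]_n is the sup norm. *)
Definition enorm (R : realType) n (v : 'rV[R]_n) : R :=
  Num.sqrt (\sum_i v 0 i ^+ 2).

Section smooth.
Context {R : realType} {m : nat} {W : normedModType R}.

(* C^k on an open set U; the values of f outside U are irrelevant. *)
Fixpoint Ck_on (k : nat) (U : set 'rV[R]_m) (f : 'rV[R]_m -> W) : Prop :=
  (forall y, U y -> {for y, continuous f}) /\
  if k is j.+1 then
    forall i : 'I_m, (forall y, U y -> derivable f y (delta_mx 0 i)) /\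
                     Ck_on j U ('D_(delta_mx 0 i) f)
  else True.

Definition smooth_on (U : set 'rV[R]_m) (f : 'rV[R]_m -> W) : Prop :=
  forall k, Ck_on k U f.

End smooth.

(* Partial homeomorphisms are total functions, meaningful only on [cdom], resp.
   [ccod]. *)
Record chart (R : realType) (m : nat) (M : topologicalType) := Chart {
  cdom : set M;
  ccod : set 'rV[R]_m;
  cmap : M -> 'rV[R]_m;
  cinv : 'rV[R]_m -> M;
  cdom_open : open cdom;
  ccod_open : open ccod;
  cmap_cod : forall p, cdom p -> ccod (cmap p);
  cinv_dom : forall y, ccod y -> cdom (cinv y);
  cmapK : forall p, cdom p -> cinv (cmap p) = p;
  cinvK : forall y, ccod y -> cmap (cinv y) = y;
  cmap_continuous : forall p, cdom p -> {for p, continuous cmap};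
  cinv_continuous : forall y, ccod y -> {for y, continuous cinv} }.

(* Connected smooth manifolds with a Riemannian metric.  Second countability is
   built in by taking countable atlases.  [metric k y] is the matrix of the
   metric in the chart of index k, at the point of coordinates y. *)
Record riemannian_manifold (R : realType) (m : nat) := RiemannianManifold {
  carrier :> topologicalType;
  carrier_hausdorff : hausdorff_space carrier;
  carrier_connected : connected [set: carrier];
  atlas : nat -> chart R m carrier;
  atlas_cover : forall p, exists k, cdom (atlas k) p;
  atlas_smooth : forall k l,
    smooth_on [set y | ccod (atlas k) y /\ cdom (atlas l) (cinv (atlas k) y)]
      (cmap (atlas l) \o cinv (atlas k));
  metric : nat -> 'rV[R]_m -> 'M[R]_m;
  metric_smooth : forall k, smooth_on (ccod (atlas k)) (metric k);
  metric_sym : forall k y, ccod (atlas k) y -> (metric k y)^T = metric k y;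
  metric_pos : forall k y (v : 'rV[R]_m), ccod (atlas k) y -> v != 0 ->
    0 < (v *m metric k y *m v^T) 0 0;
  metric_compat : forall k l y,
    ccod (atlas k) y -> cdom (atlas l) (cinv (atlas k) y) ->
    let tau := cmap (atlas l) \o cinv (atlas k) in
    metric k y = 'J tau y *m metric l (tau y) *m ('J tau y)^T }.

Section riemannian.
Context {R : realType} {m : nat} (M : riemannian_manifold R m).

Let phi k : M -> 'rV[R]_m := cmap (atlas M k).
Let psi k : 'rV[R]_m -> M := cinv (atlas M k).

(* Borel partition of M: the points whose first chart is the one of index k. *)
Definition piece : nat -> set M := seqDU (fun k => cdom (atlas M k)).

Definition chart_at (p : M) : nat := xget 0%N [set k | piece k p].

(* \int_A f dM, for f >= 0. *)
Definition riemann_integral (A : set M) (f : M -> \bar R) : \bar R :=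
  (\sum_(k <oo)
    \int[lebesgue_tuple m]_(t in
        [set t | (phi k @` (A `&` piece k)) (row_of_tuple t)])
      (f (psi k (row_of_tuple t)) *
       (Num.sqrt (\det (metric M k (row_of_tuple t))))%:E))%E.

Definition volume (A : set M) : \bar R := riemann_integral A (cst 1%E).

Definition C1_curve (c : R -> M) : Prop :=
  continuous c /\
  forall t k, cdom (atlas M k) (c t) ->
    derivable (phi k \o c) t 1 /\ {for t, continuous (derive1 (phi k \o c))}.

Definition speed (c : R -> M) (t : R) : R :=
  let k := chart_at (c t) in
  let v := derive1 (phi k \o c) t in
  Num.sqrt ((v *m metric M k (phi k (c t)) *m v^T) 0 0).

Definition curve_length (c : R -> M) (a b : R) : \bar R :=
  (\int[lebesgue_measure]_(t in `[a, b]) (speed c t)%:E)%E.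

(* [piecewise_C1_path p q l]: a piecewise C^1 curve of length l joins p to q.
   A C^1 curve on [a, b] is the restriction of a C^1 curve on the whole line. *)
Inductive piecewise_C1_path (p : M) : M -> \bar R -> Prop :=
| path_refl : piecewise_C1_path p p 0%E
| path_snoc (c : R -> M) (a b : R) (l : \bar R) :
    C1_curve c -> a <= b -> piecewise_C1_path p (c a) l ->
    piecewise_C1_path p (c b) (l + curve_length c a b)%E.

Definition geodesic_dist (p q : M) : \bar R :=
  ereal_inf [set l | piecewise_C1_path p q l].

Definition geodesic_ball (p : M) (r : R) : set M :=
  [set q | (geodesic_dist p q < r%:E)%E].

Definition complete_manifold : Prop :=
  forall u : nat -> M,
    (forall e : R, 0 < e -> exists N : nat, forall i j,
      (N <= i)%N -> (N <= j)%N -> (geodesic_dist (u i) (u j) < e%:E)%E) ->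
    exists p, geodesic_dist (u i) p @[i --> \oo] --> 0%E.

Section immersion.
Context {n : nat} (F : M -> 'rV[R]_n).

Definition isometric_immersion : Prop :=
  forall k,
    smooth_on (ccod (atlas M k)) (F \o psi k) /\
    forall y, ccod (atlas M k) y ->
      row_free ('J (F \o psi k) y) /\
      metric M k y = 'J (F \o psi k) y *m ('J (F \o psi k) y)^T.

(* Component of v orthogonal to the row space of J (J of full row rank). *)
Definition normal_part (J : 'M[R]_(m, n)) (v : 'rV[R]_n) : 'rV[R]_n :=
  v - v *m J^T *m invmx (J *m J^T) *m J.

(* B(d_i, d_j), for the coordinate fields of the chart of index k. *)
Definition second_fundamental_form k (y : 'rV[R]_m) (i j : 'I_m) : 'rV[R]_n :=
  normal_part ('J (F \o psi k) y)
    ('D_(delta_mx 0 i) ('D_(delta_mx 0 j) (F \o psi k)) y).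

(* Trace of the second fundamental form, without a factor 1/m. *)
Definition mean_curvature (p : M) : 'rV[R]_n :=
  let k := chart_at p in
  let y := phi k p in
  \sum_i \sum_j
    invmx (metric M k y) i j *: second_fundamental_form k y i j.

End immersion.
End riemannian.

(* Main.v *)
Require Import Defs.
From HB Require Import structures.
From mathcomp Require Import all_boot all_order all_algebra.
From mathcomp Require Import all_classical all_reals all_analysis.
From mathcomp Require Import perm measurable_realfun ring lra.

Set Implicit Arguments.
Unset Strict Implicit.
Unset Printing Implicit Defensive.

Import Order.TTheory GRing.Theory Num.Theory.
Import numFieldNormedType.Exports.

Local Open Scope classical_set_scope.
Local Open Scope ring_scope.

(** The tangential part of the position field [F - F y] has divergence [m + <H, F - F y>].  Tested against
    cutoffs of the distance to [y], which are only Lipschitz, this bounds the decrease of the ratio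
    [V(y, s) / s^m] by the integral of [|H|] over the ball.  For small [s] the ratio is bounded below by a
    constant depending on [m] only; so if [V(x, r)] is small compared with [r^m], then around each point of
    the half ball there is a radius at which [|H|] controls the volume, and a Vitali covering gives
    [V(x, r/2) <= C r \int_{B_r(x)} |H|].  If [\int_{B_s(x)} |H|^{m-1}] were at most [eps s] for all
    [s <= r], then by Young's inequality the smallness of the ratio would persist under halving of the
    radius, down to scales where it contradicts the lower bound.  Hence around each point [y] of a large ball
    there is [s] with [\int_{B_s(y)} |H|^{m-1} >= eps s].  The ball meets all the spheres centered at [x],
    and a Vitali selection among such [B_s(y)], with [y] on these spheres, has total radius of the
    order of [r]. *)

(** * Continuously differentiable functions on row vectors *)

(** The linear rate is forced by scaling. If [V(x, s)] is of order [s^m] and the curvature integral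
    of order [s], then with [lam] of order [1 / s] both terms of Young's inequality are of order
    [s^(m-1)], and the factor [s] of the half ball bound restores [s^m]; so smallness of the ratio
    reproduces itself exactly at [s / 2]. For [m = 1] the exponent is zero and the curvature
    integral is the volume itself. Integration by parts against a Lipschitz cutoff is done in
    charts, by difference quotients along a constant vector. Near each point the field is frozen at
    its value there, at an arbitrarily small cost, and smooth bumps glue the local inequalities.
    This yields an inequality between two radii [a < b], to be summed over fine subdivisions. The
    size of the field enters through chord at most distance. Once monotonicity and the lower bound
    for small balls are known, only the metric and functions of balls remain. The spheres replace a
    ray: two balls are disjoint as soon as their intervals of distances to [x] are, so the last
    selection takes place on the real line. *)

Section calculus.
Context {R : realType}.

Lemma differentiable_eps (V W : normedModType R) (f : V -> W) (L : {linear V -> W}) x :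
  continuous L ->
  (forall e, 0 < e -> \forall v \near (0 : V), `|f (v + x) - f x - L v| <= e * `|v|) ->
  differentiable f x /\ 'd f x = L :> (V -> W).
Proof.
move=> Lc H.
have E : f \o shift x = cst (f x) + L +o_ 0 id.
  apply/eqaddoP => e e0; near=> v.
  rewrite [X in `|X|](_ : _ = f (v + x) - f x - L v); first by near: v; exact: H.
  rewrite -[LHS]/(f (v + x) - (f x + L v)).
  by rewrite opprD addrA.
have dE := diff_unique Lc E.
split=> //; apply/diff_locallyP; rewrite dE; split=> //.
Unshelve. all: by end_near. Qed.

Lemma mvt_bound (g : R -> R) (c e s : R) :
  (forall t, `|t| <= `|s| -> derivable g t 1 /\ `|derive1 g t - c| <= e) ->
  `|g s - g 0 - c * s| <= e * `|s|.
Proof.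
move=> H.
have der (t : R) : `|t| <= `|s| -> is_derive t 1 g (derive1 g t).
  by move=> /H[dg _]; rewrite derive1E; exact: derivableP.
have cont (t : R) : `|t| <= `|s| -> {for t, continuous g}.
  by move=> /H[/derivable1_diffP /differentiable_continuous].
have [s0|s0] := leP 0 s.
- have [||u /andP[u0 us] E] := @MVT_segment _ g (derive1 g) 0 s s0.
  + move=> x; rewrite in_itv /= => /andP[x0 xs]; apply: der.
    by rewrite !ger0_norm // ltW.
  + apply: derivable_within_continuous => x; rewrite in_itv /= => /andP[x0 xs].
    by apply: (H x _).1; rewrite !ger0_norm.
  move: u0 us; rewrite !bnd_simp => u0 us.
  rewrite E subr0 -mulrBl normrM; apply: ler_wpM2r => //.
  by apply: (H u _).2; rewrite !ger0_norm.
- have [||u /andP[u0 us] E] := @MVT_segment _ g (derive1 g) s 0 (ltW s0).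
  + move=> x; rewrite in_itv /= => /andP[x0 xs]; apply: der.
    by rewrite !ler0_norm ?lerN2 // ltW.
  + apply: derivable_within_continuous => x; rewrite in_itv /= => /andP[x0 xs].
    by apply: (H x _).1; rewrite !ler0_norm ?lerN2 // ltW.
  move: u0 us; rewrite !bnd_simp => u0 us.
  rewrite (_ : g s - g 0 = derive1 g u * s); last by rewrite -opprB E sub0r mulrN opprK.
  rewrite -mulrBl normrM; apply: ler_wpM2r => //.
  by apply: (H u _).2; rewrite !ler0_norm ?lerN2 // ltW.
Qed.

Lemma is_derive_line (V W : normedModType R) (f : V -> W) (a v : V) (t : R) :
  derivable f (a + t *: v) v ->
  derivable (fun u : R => f (a + u *: v)) t 1 /\
  derive1 (fun u : R => f (a + u *: v)) t = 'D_v f (a + t *: v).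
Proof.
move=> df.
have E : (fun h : R => h^-1 *: (((fun u : R => f (a + u *: v)) \o shift t) (h *: (1 : R)) - f (a + t *: v))) =
    (fun h : R => h^-1 *: ((f \o shift (a + t *: v)) (h *: v) - f (a + t *: v))).
  apply/funext => h /=; congr (_ *: (f _ - _)).
  by rewrite [h%:A]mulr1 scalerDl addrCA.
split; first by rewrite /derivable E.
by rewrite derive1E /derive E.
Qed.

Lemma is_derive_comp_line (V W : normedModType R) (f : V -> W) (a v : V) (t : R) :
  differentiable f (a + t *: v) ->
  derivable (fun u : R => f (a + u *: v)) t 1 /\
  derive1 (fun u : R => f (a + u *: v)) t = 'D_v f (a + t *: v).
Proof. by move=> df; apply: is_derive_line; exact: diff_derivable. Qed.

End calculus.

Lemma near_continuous (T T' : topologicalType) (f g : T -> T') (y : T) :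
  (\forall z \near y, f z = g z) -> {for y, continuous g} -> {for y, continuous f}.
Proof.
move=> fg cg A; rewrite (nbhs_singleton fg) => /cg; apply: filterS2 fg => z fz; rewrite /= fz //.
Qed.

Section continuity.
Context {R : realType} {T : topologicalType}.
Implicit Types (f g : T -> R).

Lemma cont_cst (c : R) y : {for y, continuous ((fun=> c) : T -> R)}.
Proof. exact: cst_continuous. Qed.

Lemma cont_add f g y : {for y, continuous f} -> {for y, continuous g} ->
  {for y, continuous (fun z => f z + g z)}.
Proof. by move=> cf cg; exact: (continuousD cf cg). Qed.

Lemma cont_mul f g y : {for y, continuous f} -> {for y, continuous g} ->
  {for y, continuous (fun z => f z * g z)}.
Proof. by move=> cf cg; exact: (continuousM cf cg). Qed.

Lemma cont_opp f y : {for y, continuous f} -> {for y, continuous (fun z => - f z)}.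
Proof. by move=> cf; exact: (continuousN cf). Qed.

Lemma cont_inv f y : f y != 0 -> {for y, continuous f} -> {for y, continuous (fun z => (f z)^-1)}.
Proof. by move=> f0 cf; exact: (cvgV f0 cf). Qed.

Lemma cont_sqrt f y : {for y, continuous f} -> {for y, continuous (fun z => Num.sqrt (f z))}.
Proof. by move=> cf; apply: (continuous_comp cf); exact: sqrt_continuous. Qed.

Lemma cont_sum (I : Type) (r : seq I) (P : pred I) (F : I -> T -> R) y :
  (forall i, P i -> {for y, continuous (F i)}) ->
  {for y, continuous (fun z => \sum_(i <- r | P i) F i z)}.
Proof.
move=> cF; elim: r => [|i r IH].
  rewrite (_ : (fun _ => _) = fun=> 0); first exact: cont_cst.
  by apply/funext => z; rewrite big_nil.
have [Pi|Pi] := boolP (P i); last first.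
  rewrite (_ : (fun _ => _) = fun z => \sum_(j <- r | P j) F j z) //.
  by apply/funext => z; rewrite big_cons (negPf Pi).
rewrite (_ : (fun _ => _) = fun z => F i z + \sum_(j <- r | P j) F j z).
  by apply: cont_add => //; exact: cF.
by apply/funext => z; rewrite big_cons Pi.
Qed.

End continuity.

Section partials.
Context {R : realType} {m : nat}.
Implicit Types (f g : 'rV[R]_m -> R) (U : set 'rV[R]_m).

Local Notation "''e_' i" := (delta_mx 0 i : 'rV[R]_m) (at level 8, i at level 2).

Lemma norm_delta i : `|'e_i| <= 1.
Proof.
rewrite [leLHS]mx_normrE; apply: bigmax_le => // -[a b] _ /=.
by rewrite !mxE; case: (_ && _); rewrite ?normr1 ?normr0.
Qed.

Lemma norm_coord (v : 'rV[R]_m) i : `|v 0 i| <= `|v|.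
Proof. by rewrite [leRHS]mx_normrE; exact: (le_bigmax _ _ (0, i)). Qed.

Lemma norm_le_coord (v : 'rV[R]_m) (e : R) : 0 <= e -> (forall i, `|v 0 i| <= e) -> `|v| <= e.
Proof.
move=> e0 H; rewrite [leLHS]mx_normrE; apply: bigmax_le => // -[a b] _ /=.
by rewrite ord1.
Qed.

Lemma near0_norm_lt (V : normedModType R) (r : R) : 0 < r -> \forall v \near (0 : V), `|v| < r.
Proof. by move=> r0; apply/nbhs_ballP; exists r => // v; rewrite -ball_normE /= sub0r normrN. Qed.

Definition gradl f y : 'rV[R]_m -> R := fun v => \sum_i v 0 i * 'D_'e_i f y.

Lemma gradl_is_linear f y : linear (gradl f y).
Proof.
move=> a u v; rewrite /gradl scaler_sumr -big_split /=; apply: eq_bigr => i _.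
by rewrite !mxE mulrDl -mulrA.
Qed.
HB.instance Definition _ f y := GRing.isLinear.Build R 'rV[R]_m R _ (gradl f y) (gradl_is_linear f y).

Lemma gradl_bound f y v : `|gradl f y v| <= (\sum_i `|'D_'e_i f y|) * `|v|.
Proof.
rewrite mulr_suml; apply: le_trans (ler_norm_sum _ _ _) _.
apply: ler_sum => i _; rewrite normrM mulrC; apply: ler_wpM2l => //; exact: norm_coord.
Qed.

Lemma gradl_continuous f y : continuous (gradl f y : 'rV[R]_m -> R).
Proof.
apply: bounded_linear_continuous; apply/linear_boundedP.
near=> k => v; apply: (le_trans (gradl_bound f y v)).
by apply: ler_wpM2r => //; near: k; exact: nbhs_pinfty_ge.
Unshelve. all: by end_near. Qed.

Definition trunc_row (v : 'rV[R]_m) (k : nat) : 'rV[R]_m :=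
  \row_i (if (i < k)%N then v 0 i else 0).

(** Walk from [y] to [y + v] by switching on one coordinate of [v] at a time. On each leg the mean
    value inequality compares the increment with the partial derivative at [y], and all legs stay in
    the cube where the partial derivatives are close to their values at [y]. *)
Lemma partials_differentiable f y :
  (forall i, \forall z \near y, derivable f z 'e_i) ->
  (forall i, {for y, continuous ('D_'e_i f)}) ->
  differentiable f y.
Proof.
move=> df cf.
suff H : forall e, 0 < e -> \forall v \near (0 : 'rV[R]_m), `|f (v + y) - f y - gradl f y v| <= e * `|v|.
  exact: (differentiable_eps (@gradl_continuous f y) H).1.
move=> e e0.
have [r r0 Hr] : exists2 r, 0 < r & forall z, `|z - y| < r ->
    forall i, derivable f z 'e_i /\ `|'D_'e_i f z - 'D_'e_i f y| <= e / m.+1%:R.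
  have : \forall z \near y, forall i : 'I_m, derivable f z 'e_i /\
      `|'D_'e_i f z - 'D_'e_i f y| <= e / m.+1%:R.
    apply: (@filter_forall _ 'I_m (fun i z => derivable f z 'e_i /\
      `|'D_'e_i f z - 'D_'e_i f y| <= e / m.+1%:R) (nbhs y)) => i; near=> z; split; first by near: z; exact: df.
    rewrite distrC; near: z; have /cvgrPdist_le := cf i; apply.
    by rewrite divr_gt0.
  move=> /nbhs_ballP[r /= r0 Hr]; exists r => // z zy; apply: Hr.
  by rewrite -ball_normE /= distrC.
near=> v.
have vr : `|v| < r by near: v; exact: (@near0_norm_lt 'rV[R]_m r r0).
pose w k := y + trunc_row v k.
have w0 : w 0%N = y.
  by rewrite /w (_ : trunc_row v 0 = 0) ?addr0 //; apply/rowP => i; rewrite !mxE.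
have wm : w m = v + y.
  by rewrite /w addrC; congr (_ + _); apply/rowP => i; rewrite !mxE ltn_ord.
have wS (k : 'I_m) : w k.+1 = w k + v 0 k *: 'e_k.
  rewrite /w -addrA; congr (_ + _); apply/rowP => i; rewrite !mxE eqxx /= ltnS leq_eqVlt.
  by have [/val_inj ->|/=] := eqVneq (i : nat) k;
    rewrite ?ltnn ?eqxx ?mulr1 ?add0r // => /negPf; rewrite -(inj_eq val_inj) => ->; rewrite mulr0 addr0.
have tr k : `|trunc_row v k| <= `|v|.
  apply: norm_le_coord => // i; rewrite mxE; case: ifP => _; last by rewrite normr0.
  exact: norm_coord.
have step (k : 'I_m) : `|f (w k.+1) - f (w k) - 'D_'e_k f y * v 0 k| <= e / m.+1%:R * `|v 0 k|.
  pose g t := f (w k + t *: 'e_k).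
  have := @mvt_bound R g ('D_'e_k f y) (e / m.+1%:R) (v 0 k).
  rewrite /g scale0r addr0 -wS; apply => t ts.
  have zr : `|w k + t *: 'e_k - y| < r.
    rewrite /w addrAC (addrC y) addrK; apply: le_lt_trans vr.
    apply: norm_le_coord => // i; rewrite !mxE eqxx /=.
    have [->|ne] := eqVneq i k.
      by rewrite ltnn add0r mulr1; apply: (le_trans ts); exact: norm_coord.
    rewrite mulr0 addr0; case: ifP => _; rewrite ?normr0 //; exact: norm_coord.
  have [d1 d2] := Hr _ zr k.
  have [d3 ->] := is_derive_line d1.
  by split.
have -> : f (v + y) - f y - gradl f y v =
    \sum_(k < m) (f (w k.+1) - f (w k) - 'D_'e_k f y * v 0 k).
  have fy : f y = f (w 0%N) by rewrite w0.
  rewrite sumrB -wm fy; congr (_ - _); last first.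
    by apply: eq_bigr => i _; rewrite mulrC.
  by rewrite -(telescope_sumr (fun k => f (w k))) // big_mkord.
apply: le_trans (ler_norm_sum _ _ _) _.
apply: (@le_trans _ _ (\sum_(k < m) e / m.+1%:R * `|v|)).
  apply: ler_sum => k _; apply: (le_trans (step k)); apply: ler_wpM2l; last exact: norm_coord.
  by rewrite divr_ge0 // ltW.
rewrite sumr_const card_ord -[leLHS]mulr_natl mulrA; apply: ler_wpM2r => //.
rewrite mulrA ler_pdivrMr ?ltr0n // mulrC; apply: ler_wpM2l; first exact: ltW.
by rewrite ler_nat.
Unshelve. all: by end_near. Qed.

Lemma gradlE f y v : differentiable f y -> 'D_v f y = \sum_i v 0 i * 'D_'e_i f y.
Proof.
move=> df; rewrite deriveE // [in LHS](row_sum_delta v) linear_sum /=.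
by apply: eq_bigr => i _; rewrite linearZ /= -deriveE.
Qed.

Lemma open_near U y : open U -> U y -> \forall z \near y, U z.
Proof. by move=> oU Uy; apply: open_nbhs_nbhs. Qed.

Lemma continuous_radius f y (e : R) : {for y, continuous f} -> 0 < e ->
  exists2 r : R, 0 < r & forall z, `|z - y| < r -> `|f z - f y| < e.
Proof.
move=> cf e0; have /cvgrPdist_lt /(_ _ e0) /nbhs_ballP[r /= r0 Hr] := cf.
exists r => // z zy; rewrite distrC; apply: Hr.
by rewrite -ball_normE /= distrC.
Qed.

Lemma open_radius U y : open U -> U y ->
  exists2 r : R, 0 < r & forall z, `|z - y| < r -> U z.
Proof.
move=> oU Uy; have /nbhs_ballP[r /= r0 Hr] := open_near oU Uy.
by exists r => // z zy; apply: Hr; rewrite -ball_normE /= distrC.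
Qed.

(** Differentiability is stored because the product and chain rules start from it; [C1_partials]
    supplies it from continuous partial derivatives. *)
Record C1 U f : Prop := MkC1 {
  C1_diff : forall y, U y -> differentiable f y;
  C1_cont : forall i y, U y -> {for y, continuous ('D_'e_i f)} }.

Lemma C1_intro U f : open U -> (forall y, U y -> differentiable f y) ->
  (forall i, exists2 g : 'rV[R]_m -> R, (forall y, U y -> 'D_'e_i f y = g y) &
     (forall y, U y -> {for y, continuous g})) -> C1 U f.
Proof.
move=> oU df H; split=> // i y Uy; have [g fg cg] := H i.
apply: near_continuous (cg _ Uy).
by apply: filterS (open_near oU Uy) => z /fg.
Qed.

Lemma C1_partials U f : open U -> (forall i y, U y -> derivable f y 'e_i) ->
  (forall i y, U y -> {for y, continuous ('D_'e_i f)}) -> C1 U f.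
Proof.
move=> oU df cf; split=> // y Uy; apply: partials_differentiable => i; last exact: cf.
by apply: filterS (open_near oU Uy) => z /df.
Qed.

Lemma C1_continuous U f y : C1 U f -> U y -> {for y, continuous f}.
Proof. by move=> [df _] /df /differentiable_continuous. Qed.

Lemma derive_eq_on U f g y v : open U -> U y -> (forall z, U z -> f z = g z) ->
  'D_v f y = 'D_v g y.
Proof.
by move=> oU Uy fg; apply: near_eq_derive; apply: filterS (open_near oU Uy) => z /fg.
Qed.

Lemma C1_eq U f g : open U -> (forall z, U z -> f z = g z) -> C1 U g -> C1 U f.
Proof.
move=> oU fg Cg; apply: C1_partials => // i y Uy.
  have dg : derivable g y 'e_i by apply: diff_derivable; exact: (C1_diff Cg Uy).
  by apply: near_eq_derivable dg; apply: filterS (open_near oU Uy) => z /fg.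
apply: (@near_continuous _ _ _ ('D_'e_i g)); last exact: (C1_cont Cg Uy).
by apply: filterS (open_near oU Uy) => z Uz; exact: (derive_eq_on _ oU Uz fg).
Qed.

Lemma C1_cst U (c : R) : C1 U (fun=> c).
Proof.
split=> [y _|i y _]; first exact: differentiable_cst.
rewrite (_ : 'D_'e_i _ = fun=> 0); first exact: cst_continuous.
by apply/funext => z; rewrite derive_cst.
Qed.

Lemma derive_coord i v y : 'D_v (fun z : 'rV[R]_m => z 0 i) y = v 0 i.
Proof.
rewrite -[fun z => _]/(fun z : 'rV[R]_m => id z 0 i).
have := @derive_mx R _ _ _ id y v (@derivable_id _ _ _ _).
by rewrite derive_id => /rowP /(_ i); rewrite mxE.
Qed.

Lemma C1_coord U i : C1 U (fun z => z 0 i).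
Proof.
split=> [y _|j y _]; first exact: differentiable_coord.
rewrite (_ : 'D_'e_j _ = fun=> 'e_j 0 i); first exact: cst_continuous.
by apply/funext => z; rewrite derive_coord.
Qed.

Lemma derive_add f g v y : differentiable f y -> differentiable g y ->
  'D_v (fun z => f z + g z) y = 'D_v f y + 'D_v g y.
Proof. by move=> df dg; rewrite -[LHS]/('D_v (f + g) y) deriveD //; exact: diff_derivable. Qed.

Lemma derive_mul f g v y : differentiable f y -> differentiable g y ->
  'D_v (fun z => f z * g z) y = 'D_v f y * g y + f y * 'D_v g y.
Proof.
move=> df dg; rewrite -[LHS]/('D_v (f * g) y) deriveM; try exact: diff_derivable.
by rewrite addrC; congr (_ + _); rewrite [LHS]mulrC.
Qed.

Lemma C1D U f g : open U -> C1 U f -> C1 U g -> C1 U (fun z => f z + g z).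
Proof.
move=> oU Cf Cg; apply: C1_intro => // [y Uy|i].
  exact: (differentiableD (C1_diff Cf Uy) (C1_diff Cg Uy)).
exists (fun z => 'D_'e_i f z + 'D_'e_i g z) => y Uy.
  by rewrite derive_add //; [exact: (C1_diff Cf Uy)|exact: (C1_diff Cg Uy)].
by apply: cont_add; [exact: (C1_cont Cf Uy)|exact: (C1_cont Cg Uy)].
Qed.

Lemma C1M U f g : open U -> C1 U f -> C1 U g -> C1 U (fun z => f z * g z).
Proof.
move=> oU Cf Cg; apply: C1_intro => // [y Uy|i].
  exact: (differentiableM (C1_diff Cf Uy) (C1_diff Cg Uy)).
exists (fun z => 'D_'e_i f z * g z + f z * 'D_'e_i g z) => y Uy.
  by rewrite derive_mul //; [exact: (C1_diff Cf Uy)|exact: (C1_diff Cg Uy)].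
have [cf cg] := (C1_continuous Cf Uy, C1_continuous Cg Uy).
by apply: cont_add; apply: cont_mul => //; [exact: (C1_cont Cf Uy)|exact: (C1_cont Cg Uy)].
Qed.

Lemma C1N U f : open U -> C1 U f -> C1 U (fun z => - f z).
Proof.
move=> oU Cf; apply: C1_eq (C1M oU (C1_cst U (-1)) Cf) => // z _.
by rewrite mulN1r.
Qed.

Lemma C1B U f g : open U -> C1 U f -> C1 U g -> C1 U (fun z => f z - g z).
Proof. by move=> oU Cf Cg; apply: C1D => //; exact: C1N. Qed.

Lemma C1_sum U (I : Type) (r : seq I) (P : pred I) (F : I -> 'rV[R]_m -> R) : open U ->
  (forall i, C1 U (F i)) -> C1 U (fun z => \sum_(i <- r | P i) F i z).
Proof.
move=> oU CF; elim: r => [|i r IH].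
  by apply: C1_eq (C1_cst U 0) => // z _; rewrite big_nil.
have [Pi|Pi] := boolP (P i).
  by apply: C1_eq (C1D oU (CF i) IH) => // z _; rewrite big_cons Pi.
by apply: C1_eq IH => // z _; rewrite big_cons (negPf Pi).
Qed.

Lemma C1_prod U (I : Type) (r : seq I) (P : pred I) (F : I -> 'rV[R]_m -> R) : open U ->
  (forall i, C1 U (F i)) -> C1 U (fun z => \prod_(i <- r | P i) F i z).
Proof.
move=> oU CF; elim: r => [|i r IH].
  by apply: C1_eq (C1_cst U 1) => // z _; rewrite big_nil.
have [Pi|Pi] := boolP (P i).
  by apply: C1_eq (C1M oU (CF i) IH) => // z _; rewrite big_cons Pi.
by apply: C1_eq IH => // z _; rewrite big_cons (negPf Pi).
Qed.

Lemma differentiable_bigsum (I : Type) (r : seq I) (F : I -> 'rV[R]_m -> R) y :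
  (forall i, differentiable (F i) y) -> differentiable (fun z => \sum_(i <- r) F i z) y.
Proof.
move=> dF; elim: r => [|i r IH].
  rewrite (_ : (fun _ => _) = cst 0); first exact: differentiable_cst.
  by apply/funext => z; rewrite big_nil.
rewrite (_ : (fun _ => _) = F i + (fun z => \sum_(j <- r) F j z)); first exact: differentiableD.
by apply/funext => z; rewrite big_cons.
Qed.

Lemma derive_bigsum (I : Type) (r : seq I) (F : I -> 'rV[R]_m -> R) v y :
  (forall i, differentiable (F i) y) ->
  'D_v (fun z => \sum_(i <- r) F i z) y = \sum_(i <- r) 'D_v (F i) y.
Proof.
move=> dF; elim: r => [|i r IH].
  rewrite big_nil (_ : (fun _ => _) = cst 0) ?derive_cst //.
  by apply/funext => z; rewrite big_nil.
rewrite big_cons -IH -derive_add //; last exact: differentiable_bigsum.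
by congr ('D_v _ y); apply/funext => z; rewrite big_cons.
Qed.

Lemma differentiable_bigprod (I : Type) (r : seq I) (F : I -> 'rV[R]_m -> R) y :
  (forall i, differentiable (F i) y) -> differentiable (fun z => \prod_(i <- r) F i z) y.
Proof.
move=> dF; elim: r => [|i r IH].
  rewrite (_ : (fun _ => _) = cst 1); first exact: differentiable_cst.
  by apply/funext => z; rewrite big_nil.
rewrite (_ : (fun _ => _) = F i * (fun z => \prod_(j <- r) F j z)); first exact: differentiableM.
by apply/funext => z; rewrite big_cons.
Qed.

Lemma derive_bigprod (I : eqType) (r : seq I) (F : I -> 'rV[R]_m -> R) v y : uniq r ->
  (forall i, differentiable (F i) y) ->
  'D_v (fun z => \prod_(i <- r) F i z) y =
    \sum_(k <- r) 'D_v (F k) y * \prod_(i <- r | k != i) F i y.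
Proof.
move=> ur dF; elim: r ur => [_|i r IH /= /andP[ir ur]].
  rewrite big_nil (_ : (fun _ => _) = cst 1) ?derive_cst //.
  by apply/funext => z; rewrite big_nil.
rewrite big_cons.
rewrite (_ : (fun _ => _) = fun z => F i z * (\prod_(j <- r) F j z)); last first.
  by apply/funext => z; rewrite big_cons.
rewrite derive_mul //; last exact: differentiable_bigprod.
rewrite IH // big_cons eqxx /=; congr (_ * _ + _).
  rewrite [in LHS]big_seq [in RHS]big_seq_cond; apply: eq_bigl => j.
  by have [jr|//] := boolP (j \in r); case: eqVneq => // ji; rewrite -ji (negPf ir) in jr *.
rewrite mulr_sumr [in LHS]big_seq [in RHS]big_seq; apply: eq_bigr => k kr.
rewrite big_cons ifT; first by rewrite mulrCA.
by apply: contraNneq ir => <-.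
Qed.

Lemma C1V U f : open U -> (forall y, U y -> f y != 0) -> C1 U f -> C1 U (fun z => (f z)^-1).
Proof.
move=> oU f0 Cf.
apply: C1_intro => // [y Uy|i].
  exact: (differentiableV (C1_diff Cf Uy) (f0 _ Uy)).
exists (fun z => - (f z * f z)^-1 * 'D_'e_i f z) => y Uy.
  rewrite -[LHS]/('D_'e_i (fun z => (f z)^-1) y) deriveV ?f0 //.
  by apply: diff_derivable; exact: (C1_diff Cf Uy).
apply: cont_mul; last exact: (C1_cont Cf Uy).
apply: cont_opp; apply: cont_inv; first by rewrite mulf_neq0 // f0.
by apply: cont_mul; exact: (C1_continuous Cf).
Qed.

Lemma C1_sqrt U f : open U -> (forall y, U y -> 0 < f y) -> C1 U f -> C1 U (fun z => Num.sqrt (f z)).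
Proof.
move=> oU f0 Cf.
have ds y : U y -> differentiable (@Num.sqrt R) (f y).
  move=> Uy; have [dd _] := is_derive1_sqrt (f0 y Uy).
  exact/derivable1_diffP.
apply: C1_intro => // [y Uy|i].
  exact: (differentiable_comp (C1_diff Cf Uy) (ds _ Uy)).
exists (fun z => (2 * Num.sqrt (f z))^-1 * 'D_'e_i f z) => y Uy.
  have dcomp := differentiable_comp (C1_diff Cf Uy) (ds _ Uy).
  have df := C1_diff Cf Uy.
  rewrite -[LHS]/('D_'e_i (@Num.sqrt R \o f) y) deriveE // diff_comp //=; last exact: ds.
  rewrite -[X in 'd _ _ X](deriveE _ df) -[X in 'd _ _ X = _]mulr1 [LHS]linearZ mulrC; congr (_ * _).
  by have [dd <-] := is_derive1_sqrt (f0 y Uy); symmetry; apply: deriveE; apply/derivable1_diffP.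
apply: cont_mul; last exact: (C1_cont Cf Uy).
apply: cont_inv; first by rewrite mulf_neq0 // gt_eqF // sqrtr_gt0 f0.
by apply: cont_mul; [exact: cont_cst|exact: (cont_sqrt (C1_continuous Cf Uy))].
Qed.

End partials.

Section composition.
Context {R : realType} {m p : nat}.
Local Notation "''e_' i" := (delta_mx 0 i) (at level 8, i at level 2).

Lemma differentiable_row (W : normedModType R) (tau : W -> 'rV[R]_p) y :
  (forall a, differentiable (fun z => tau z 0 a : R) y) -> differentiable tau y.
Proof.
move=> dt.
rewrite (_ : tau = \sum_(a < p) (fun z => tau z 0 a *: ('e_a : 'rV[R]_p))).
  by apply: differentiable_sum => a; exact: differentiableZl.
apply/funext => z; rewrite [LHS]row_sum_delta fct_sumE.
by apply: eq_bigr.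
Qed.

Lemma derive_comp (f : 'rV[R]_p -> R) (tau : 'rV[R]_m -> 'rV[R]_p) v y :
  differentiable f (tau y) -> differentiable tau y ->
  'D_v (f \o tau) y = \sum_a 'D_v (fun z => tau z 0 a) y * 'D_'e_a f (tau y).
Proof.
move=> df dt; have dc := differentiable_comp dt df.
rewrite deriveE // diff_comp //= -[X in 'd f _ X]deriveE // -deriveE // gradlE //.
apply: eq_bigr => a _; congr (_ * _).
by rewrite derive_mx; [rewrite mxE|exact: diff_derivable].
Qed.

Lemma C1_comp (U : set 'rV[R]_m) (U' : set 'rV[R]_p) (f : 'rV[R]_p -> R)
    (tau : 'rV[R]_m -> 'rV[R]_p) : open U ->
  (forall a, C1 U (fun z => tau z 0 a)) -> (forall y, U y -> U' (tau y)) -> C1 U' f ->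
  C1 U (f \o tau).
Proof.
move=> oU Ct tU Cf.
have dt y : U y -> differentiable tau y.
  by move=> Uy; apply: differentiable_row => a; exact: (C1_diff (Ct a) Uy).
apply: C1_intro => // [y Uy|i].
  by apply: differentiable_comp; [exact: dt|apply: (C1_diff Cf); exact: tU].
exists (fun z => \sum_a 'D_'e_i (fun z => tau z 0 a) z * 'D_'e_a f (tau z)) => y Uy.
  by rewrite derive_comp //; [apply: (C1_diff Cf); exact: tU|exact: dt].
apply: cont_sum => a _; apply: cont_mul; first exact: (C1_cont (Ct a) Uy).
apply: (@continuous_comp _ _ _ tau ('D_'e_a f)); first exact: (differentiable_continuous (dt _ Uy)).
by apply: (C1_cont Cf); exact: tU.
Qed.

End composition.

(** * Symmetry of second derivatives *)

Section second_order.
Context {R : realType} {m : nat}.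
Local Notation "''e_' i" := (delta_mx 0 i : 'rV[R]_m) (at level 8, i at level 2).

Lemma mvt_segment_line (f : 'rV[R]_m -> R) (a v : 'rV[R]_m) (s : R) : 0 <= s ->
  (forall t, 0 <= t <= s -> derivable f (a + t *: v) v) ->
  exists2 t, 0 <= t <= s & f (a + s *: v) - f a = s * 'D_v f (a + t *: v).
Proof.
move=> s0 df; pose g t := f (a + t *: v).
have [||u] := @MVT_segment _ g (derive1 g) 0 s s0.
- move=> x; rewrite in_itv /= => /andP[x0 xs].
  have [|d1 d2] := @is_derive_line _ _ _ f a v x; first by apply: df; rewrite !ltW.
  by rewrite derive1E; exact: derivableP.
- apply: derivable_within_continuous => x; rewrite in_itv /= => xs.
  by have [] := is_derive_line (df x xs).
rewrite in_itv /= => us E; exists u => //.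
by move: E; rewrite /g scale0r addr0 subr0 mulrC (is_derive_line (df u us)).2.
Qed.

(** Mean value theorem twice: along [u] for the difference of [f] over the step [s *: v], then along
    [v] for the derivative in direction [u]. Exchanging [u] and [v] leaves the left side unchanged
    and reverses the order of the derivatives on the right. *)
Lemma second_difference (f : 'rV[R]_m -> R) (y u v : 'rV[R]_m) (s : R) : 0 < s ->
  (forall a b, 0 <= a <= s -> 0 <= b <= s -> derivable f (y + a *: u + b *: v) u) ->
  (forall a b, 0 <= a <= s -> 0 <= b <= s -> derivable ('D_u f) (y + a *: u + b *: v) v) ->
  exists a b, [/\ 0 <= a <= s, 0 <= b <= s &
    f (y + s *: u + s *: v) - f (y + s *: u) - f (y + s *: v) + f y =
    s * s * 'D_v ('D_u f) (y + a *: u + b *: v)].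
Proof.
move=> s0 d1 d2.
pose G z := f (z + s *: v) - f z.
have s00 : 0 <= s <= s by rewrite lexx ltW.
have z00 : 0 <= (0 : R) <= s by rewrite lexx ltW.
have dG t : 0 <= t <= s -> derivable G (y + t *: u) u /\
    'D_u G (y + t *: u) = 'D_u f (y + t *: u + s *: v) - 'D_u f (y + t *: u).
  move=> ts.
  have da := d1 t s ts s00; have := d1 t 0 ts z00; rewrite scale0r addr0 => db.
  have dsh : derivable (fun z => f (z + s *: v)) (y + t *: u) u /\
      'D_u (fun z => f (z + s *: v)) (y + t *: u) = 'D_u f (y + t *: u + s *: v).
    have E : (fun h : R => h^-1 *: (((fun z => f (z + s *: v)) \o shift (y + t *: u)) (h *: u) -
        f (y + t *: u + s *: v))) =
      (fun h : R => h^-1 *: ((f \o shift (y + t *: u + s *: v)) (h *: u) - f (y + t *: u + s *: v))).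
      by apply/funext => h /=; rewrite !addrA.
    by split; [rewrite /derivable E; exact: da|rewrite /derive E].
  have [e1 e2] := dsh; split; first exact: (derivableB e1 db).
  by rewrite -e2; exact: (deriveB e1 db).
have [|a as_ Ea] := @mvt_segment_line G y u s (ltW s0); first by move=> t /dG[].
have [|b bs Eb] := @mvt_segment_line ('D_u f) (y + a *: u) v s (ltW s0).
  by move=> t ts; exact: d2.
exists a, b; split => //.
have -> : f (y + s *: u + s *: v) - f (y + s *: u) - f (y + s *: v) + f y =
    G (y + s *: u) - G y by rewrite /G; ring.
by rewrite Ea (dG a as_).2 Eb mulrA.
Qed.

Lemma near_limits_eq (p q t t' e : R) : `|t - p| <= e / 2 -> `|t' - q| <= e / 2 -> t = t' ->
  `|p - q| <= e.
Proof.
move=> h1 h2 tt; apply: (le_trans (ler_distD t _ _)).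
by rewrite distrC {2}tt [leRHS]splitr lerD.
Qed.

(** The second difference, evaluated in both orders, gives two points near [y] at which the two
    iterated derivatives take the same value. Both are continuous at [y], so they differ there by at
    most any [e]. *)
Lemma derive_commute (U : set 'rV[R]_m) (f : 'rV[R]_m -> R) i j y : open U ->
  C1 U f -> (forall k, C1 U ('D_'e_k f)) -> U y ->
  'D_'e_i ('D_'e_j f) y = 'D_'e_j ('D_'e_i f) y.
Proof.
move=> oU Cf CDf Uy; apply/eqP; rewrite -subr_eq0 -normr_le0; apply/ler_addgt0Pr => e e0.
rewrite add0r.
have e2 : 0 < e / 2 by rewrite divr_gt0.
have [r1 r10 H1] := open_radius oU Uy.
have [r2 r20 H2] := continuous_radius (@C1_cont _ _ _ _ (CDf j) i y Uy) e2.
have [r3 r30 H3] := continuous_radius (@C1_cont _ _ _ _ (CDf i) j y Uy) e2.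
pose r := Num.min r1 (Num.min r2 r3).
have r0 : 0 < r by rewrite !lt_min r10 r20.
have Hr z : `|z - y| < r -> [/\ U z,
    `|'D_'e_i ('D_'e_j f) z - 'D_'e_i ('D_'e_j f) y| <= e / 2 &
    `|'D_'e_j ('D_'e_i f) z - 'D_'e_j ('D_'e_i f) y| <= e / 2].
  rewrite !lt_min => /and3P[z1 z2 z3].
  by split; [exact: H1|exact/ltW/H2|exact/ltW/H3].
(* The sample points lie within [2 * s] of [y], hence inside the cube of radius [r]. *)
pose s := r / 3; have s0 : 0 < s by rewrite divr_gt0.
have inball a b k l : 0 <= a <= s -> 0 <= b <= s -> `|y + a *: 'e_k + b *: 'e_l - y| < r.
  move=> /andP[a0 as_] /andP[b0 bs]; rewrite addrAC (addrAC y) subrr add0r.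
  apply: (le_lt_trans (ler_normD _ _)); rewrite !normrZ !ger0_norm //.
  have ha : a * `|'e_k| <= a * 1 by apply: ler_wpM2l => //; exact: norm_delta.
  have hb : b * `|'e_l| <= b * 1 by apply: ler_wpM2l => //; exact: norm_delta.
  by apply: (@le_lt_trans _ _ (s + s)); rewrite /s in as_ bs *; lra.
have d1 k l a b : 0 <= a <= s -> 0 <= b <= s -> derivable f (y + a *: 'e_k + b *: 'e_l) 'e_k.
  move=> ha hb; apply: diff_derivable; have [Uz _ _] := Hr _ (inball a b k l ha hb).
  exact: (C1_diff Cf Uz).
have d2 k l a b : 0 <= a <= s -> 0 <= b <= s ->
    derivable ('D_'e_k f) (y + a *: 'e_k + b *: 'e_l) 'e_l.
  move=> ha hb; apply: diff_derivable; have [Uz _ _] := Hr _ (inball a b k l ha hb).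
  exact: (C1_diff (CDf k) Uz).
have [a [b [ha hb E1]]] := second_difference s0 (d1 j i) (d2 j i).
have [a' [b' [ha' hb' E2]]] := second_difference s0 (d1 i j) (d2 i j).
have E : 'D_'e_i ('D_'e_j f) (y + a *: 'e_j + b *: 'e_i) =
    'D_'e_j ('D_'e_i f) (y + a' *: 'e_i + b' *: 'e_j).
  have ss : s * s != 0 by rewrite mulf_neq0 // gt_eqF.
  have E12 : f (y + s *: 'e_j + s *: 'e_i) - f (y + s *: 'e_j) - f (y + s *: 'e_i) + f y =
      f (y + s *: 'e_i + s *: 'e_j) - f (y + s *: 'e_i) - f (y + s *: 'e_j) + f y.
    by rewrite (addrAC y (s *: 'e_j)) (addrAC (f _) (- f (y + s *: 'e_j))).
  by apply: (mulfI ss); exact: (etrans (esym E1) (etrans E12 E2)).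
have [_ h1 _] := Hr _ (inball a b j i ha hb).
have [_ _ h2] := Hr _ (inball a' b' i j ha' hb').
exact: (near_limits_eq h1 h2 E).
Qed.

End second_order.

(** * Determinants and inverses of matrix functions *)

Section determinants.
Context {R : realType} {m : nat}.

Lemma C1_det (U : set 'rV[R]_m) p (A : 'rV[R]_m -> 'M[R]_p) : open U ->
  (forall i j, C1 U (fun z => A z i j)) -> C1 U (fun z => \det (A z)).
Proof.
move=> oU CA; rewrite /determinant; apply: C1_sum => // s.
by apply: C1M => //; [exact: C1_cst|exact: C1_prod].
Qed.

Lemma C1_invmx (U : set 'rV[R]_m) p (A : 'rV[R]_m -> 'M[R]_p) i j : open U ->
  (forall y, U y -> A y \in unitmx) ->
  (forall i j, C1 U (fun z => A z i j)) -> C1 U (fun z => invmx (A z) i j).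
Proof.
move=> oU uA CA.
apply: (@C1_eq _ _ U _ (fun z => (\det (A z))^-1 * cofactor (A z) j i)) => //.
  by move=> z Uz; rewrite /invmx uA // !mxE.
apply: C1M => //; last first.
  rewrite /cofactor; apply: C1M => //; first exact: C1_cst.
  by apply: C1_det => // a b; apply: C1_eq (CA (lift j a) (lift i b)) => // z _; rewrite !mxE.
apply: C1V => //; last exact: C1_det.
by move=> y Uy; rewrite -unitfE; have := uA y Uy; rewrite unitmxE.
Qed.

(** Jacobi's formula. In the expansion over permutations the product rule differentiates one row [k]
    at a time; grouping the permutations by their value at [k] reassembles the cofactors. *)
Lemma derive_det p (A : 'rV[R]_m -> 'M[R]_p) v y :
  (forall i j, differentiable (fun z => A z i j : R) y) ->
  'D_v (fun z => \det (A z)) y =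
  \sum_k \sum_j 'D_v (fun z => A z k j) y * cofactor (A y) k j.
Proof.
move=> dA; rewrite /determinant.
pose T (s : {perm 'I_p}) z := (-1) ^+ s * \prod_i A z i (s i).
have dT s : differentiable (T s) y.
  by apply: differentiableM => //; exact: differentiable_bigprod.
rewrite -[X in 'D_v X y]/(fun z => \sum_s T s z) derive_bigsum //.
under [RHS]eq_bigr => k _ do under eq_bigr => j _ do rewrite expand_cofactor mulr_sumr.
under [LHS]eq_bigr => s _.
  rewrite derive_mul //; last exact: differentiable_bigprod.
  rewrite derive_cst mul0r add0r derive_bigprod ?index_enum_uniq // mulr_sumr.
  over.
rewrite exchange_big /=; apply: eq_bigr => k _.
rewrite (partition_big (fun s : {perm 'I_p} => s k) predT) //=.
apply: eq_bigr => j _; apply: eq_bigr => s /eqP <-.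
by rewrite mulrCA.
Qed.

End determinants.

(** * Lebesgue measure on row vectors *)

Notation borel T := (g_sigma_algebraType (@open T)).

Section borel.
Implicit Types (T : ptopologicalType).

Lemma borel_open T (A : set T) : open A -> measurable (A : set (borel T)).
Proof. by move=> oA; exact: sub_gen_smallest. Qed.

Lemma measurable_borel d (X : measurableType d) T (D : set X) (f : X -> T) :
  (forall A : set T, open A -> measurable (D `&` f @^-1` A)) ->
  measurable_fun D (f : X -> borel T).
Proof.
move=> H; apply: (@measurability _ _ X (borel T) D f (@open T) erefl) => _ [A oA <-]; exact: H.
Qed.

Lemma continuous_on_preimage T (T' : topologicalType) (U : set T) (f : T -> T') (A : set T') :
  open U -> (forall y, U y -> {for y, continuous f}) -> open A -> open (U `&` f @^-1` A).
Proof.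
move=> oU cf oA; rewrite openE => y [Uy Afy]; apply: filterI; first exact: open_nbhs_nbhs.
by apply: cf => //; exact: open_nbhs_nbhs.
Qed.

Lemma continuous_on_borel T T' (U : set T) (f : T -> T') :
  open U -> (forall y, U y -> {for y, continuous f}) ->
  measurable_fun (U : set (borel T)) (f : borel T -> borel T').
Proof.
by move=> oU cf; apply: measurable_borel => A oA; apply: borel_open; exact: continuous_on_preimage.
Qed.

Lemma measurable_borelR (R : realType) d (X : measurableType d) (D : set X) (f : X -> R) :
  (forall A : set R, open A -> measurable (D `&` f @^-1` A)) -> measurable_fun D f.
Proof.
move=> H; apply: (@measurability _ _ X (measurableTypeR R) D f _ (RGenOpens.measurableE R)) => _ [_ [a
  [b ->]] <-].
by apply: H; exact: interval_open.
Qed.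

Lemma continuous_on_borelR (R : realType) T (U : set T) (f : T -> R) :
  open U -> (forall y, U y -> {for y, continuous f}) ->
  measurable_fun (U : set (borel T)) f.
Proof.
by move=> oU cf; apply: measurable_borelR => A oA; apply: borel_open; exact: continuous_on_preimage.
Qed.

Lemma continuous_borelR (R : realType) T (f : T -> R) :
  continuous f -> measurable_fun setT (f : borel T -> R).
Proof. move=> cf; have oT := @openT T; exact: (continuous_on_borelR oT (fun y _ => cf y)). Qed.

End borel.

Lemma ge0_integral_change d1 d2 (X : measurableType d1) (Y : measurableType d2) (R : realType)
    (phi : X -> Y) (mu : {measure set X -> \bar R}) (nu : {measure set Y -> \bar R})
    (D : set Y) (f : Y -> \bar R) : measurable_fun setT phi ->
  (forall A, measurable A -> nu A = mu (phi @^-1` A)) ->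
  measurable D -> measurable_fun D f -> (forall y, D y -> 0 <= f y)%E ->
  (\int[nu]_(y in D) f y = \int[mu]_(x in phi @^-1` D) f (phi x))%E.
Proof.
move=> mphi E mD mf f0; have := ge0_integral_pushforward mphi mu mD mf.
move=> /(_ (fun y yD => f0 y (set_mem yD))) <-.
by apply: eq_measure_integral; try exact: mphi; move=> A mA _; exact: E.
Qed.

Section lebesgue_rV.
Context {R : realType}.
Local Notation mR := (measurableTypeR R).
Local Notation leb := (@lebesgue_measure R).

(** An open set is the union of the countably many cubes with rational center and radius
    [1 / (n + 1)] that it contains, and the preimage of a cube is cut out by finitely many
    conditions on the coordinates. *)
Lemma measurable_rV d (X : measurableType d) m (f : X -> 'rV[R]_m) :
  (forall i, measurable_fun setT (fun x => f x 0 i : mR)) ->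
  measurable_fun setT (f : X -> borel 'rV[R]_m).
Proof.
move=> mf; apply: measurable_borel => A oA; rewrite setTI.
pose P (k : nat * 'rV[rat]_m) := forall z : 'rV[R]_m,
  (forall i, `|z 0 i - ratr (k.2 0 i)| < k.1.+1%:R^-1) -> A z.
rewrite (_ : _ @^-1` _ = \bigcup_(k in P) \bigcap_(i in [set: 'I_m])
    [set t | `|f t 0 i - ratr (k.2 0 i)| < k.1.+1%:R^-1]).
  rewrite bigcup_mkcond; apply: countable_bigcupT_measurable; first exact: countableP.
  move=> k; case: ifP => // _; apply: fin_bigcap_measurable => // i _.
  have := mf i measurableT (ball (ratr (k.2 0 i) : R) (k.1.+1%:R^-1 : R)) (measurable_ball _ _).
  by rewrite setTI; congr measurable; apply/seteqP; split=> t /=; rewrite /ball /= distrC.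
apply/seteqP; split=> [t /= At|t /= [k Pk Ht]]; last first.
  by apply: Pk => i; exact: Ht.
have [r r0 Hr] := open_radius oA At.
pose n := Num.truncn (2 / r).
have n0 : 0 < n.+1%:R^-1 :> R by rewrite invr_gt0.
have nr : n.+1%:R^-1 < r / 2.
  by rewrite -[ltRHS]invrK ltf_pV2 ?posrE ?invr_gt0 ?divr_gt0 // invf_div truncnS_gt.
have Hq i : exists q : rat, `|f t 0 i - ratr q| < n.+1%:R^-1.
  have [|q] := @rat_in_itvoo R (f t 0 i - n.+1%:R^-1) (f t 0 i + n.+1%:R^-1).
    by apply: (@lt_trans _ _ (f t 0 i)); rewrite ?ltrDl // gtrDl oppr_lt0.
  by rewrite in_itv /= => /andP[q1 q2]; exists q; rewrite ltr_distlC q1 q2.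
pose q : 'rV[rat]_m := \row_i sval (cid (Hq i)).
exists (n, q) => /=; last by move=> i _ /=; rewrite mxE; case: cid.
move=> z Hz; apply: Hr; apply: (@le_lt_trans _ _ (2 * n.+1%:R^-1)); last by rewrite mulrC -ltr_pdivlMr.
apply: norm_le_coord => [|i]; first by rewrite mulr_ge0 // ltW.
rewrite !mxE; have := Hz i; rewrite /= mxE; case: cid => /= qi Hqi zi.
apply: (le_trans (ler_distD (ratr qi) _ _)).
by rewrite mulr_natl mulr2n; apply: lerD; apply: ltW => //; rewrite distrC.
Qed.

Lemma row_of_tuple_measurable m :
  measurable_fun setT (@row_of_tuple R m : m.-tuple mR -> borel 'rV[R]_m).
Proof.
apply: measurable_rV => i; rewrite (_ : (fun _ => _) = fun t : m.-tuple mR => tnth t i).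
  exact: measurable_tnth.
by apply/funext => t; rewrite mxE.
Qed.

Lemma measurable_coord m i : measurable_fun setT (fun z : borel 'rV[R]_m => (z : 'rV[R]_m) 0 i).
Proof. by apply: continuous_borelR; exact: coord_continuous. Qed.

(** Lebesgue measure moved to row vectors with their Borel sets, where it meets the topology used by
    the derivatives. *)
Definition lam m (A : set (borel 'rV[R]_m)) : \bar R :=
  @lebesgue_tuple R m ((@row_of_tuple R m : m.-tuple mR -> borel 'rV[R]_m) @^-1` A).

Section lam_measure.
Variable m : nat.

Let mpre (A : set (borel 'rV[R]_m)) : measurable A ->
  measurable ((@row_of_tuple R m : m.-tuple mR -> borel 'rV[R]_m) @^-1` A).
Proof. by move=> mA; rewrite -[X in measurable X]setTI; exact: row_of_tuple_measurable. Qed.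

Let lam0 : @lam m set0 = 0%E.
Proof. by rewrite /lam preimage_set0 measure0. Qed.

Let lam_ge0 A : (0 <= @lam m A)%E.
Proof. exact: measure_ge0. Qed.

Let lam_sigma_additive : semi_sigma_additive (@lam m).
Proof.
move=> F mF tF mUF; rewrite /lam preimage_bigcup.
apply: measure_semi_sigma_additive.
- by move=> i; exact: mpre.
- apply/trivIsetP => /= i j _ _ ij; rewrite -preimage_setI.
  by move/trivIsetP : tF => /(_ _ _ _ _ ij) ->//; rewrite preimage_set0.
- by rewrite -preimage_bigcup; exact: mpre.
Qed.

HB.instance Definition _ := isMeasure.Build _ _ _ (@lam m) lam0 lam_ge0 lam_sigma_additive.

Lemma lam_integral_tuple (D : set (borel 'rV[R]_m)) (f : borel 'rV[R]_m -> \bar R) :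
  measurable D -> measurable_fun D f -> (forall x, D x -> 0 <= f x)%E ->
  (\int[@lam m]_(x in D) f x =
   \int[@lebesgue_tuple R m]_(t in (@row_of_tuple R m) @^-1` D) f (row_of_tuple t))%E.
Proof.
move=> mD mf f0.
by apply: ge0_integral_change => //; exact: row_of_tuple_measurable.
Qed.

End lam_measure.

Section fibers.
Variable m : nat.

(** The dimension is written [1 + m] so that linear maps can be handled as block matrices. *)
Definition cons_row (x : R) (y : 'rV[R]_m) : 'rV[R]_(1 + m) := row_mx (const_mx x) y.

Lemma cons_rowE (x : R) (t : m.-tuple R) :
  row_of_tuple (cons_pair (x, t) : (1 + m).-tuple mR) = cons_row x (row_of_tuple t).
Proof.
apply/rowP => i; rewrite !mxE; case: splitP => j ij.
  by rewrite mxE (_ : i = ord0) ?tnth0 //; apply: val_inj; rewrite /= ij ord1.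
rewrite mxE (_ : i = lift ord0 j); last by apply: val_inj; rewrite /= ij.
by rewrite tnthS.
Qed.

Lemma measurable_lebesgue_section (f : borel 'rV[R]_(1 + m) -> \bar R) :
  measurable_fun setT f ->
  measurable_fun setT (fun p : mR * m.-tuple mR => f (cons_row p.1 (row_of_tuple p.2))).
Proof.
move=> mf; rewrite (_ : (fun _ => _) = f \o @row_of_tuple R (1 + m) \o @cons_pair R m).
  apply: measurableT_comp; last exact: measurable_cons_pair.
  by apply: measurableT_comp => //; exact: row_of_tuple_measurable.
by apply/funext => -[x t] /=; rewrite -cons_rowE.
Qed.

Lemma lam_prod (f : borel 'rV[R]_(1 + m) -> \bar R) :
  measurable_fun setT f -> (forall x, 0 <= f x)%E ->
  (\int[@lam (1 + m)]_z f z =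
   \int[leb \x @lebesgue_tuple R m]_p f (cons_row p.1 (row_of_tuple p.2)))%E.
Proof.
move=> mf f0; rewrite lam_integral_tuple // preimage_setT.
have mg : measurable_fun setT (f \o @row_of_tuple R (1 + m)).
  by apply: measurableT_comp => //; exact: row_of_tuple_measurable.
rewrite (ge0_integral_change (phi := @cons_pair R m) (mu := leb \x @lebesgue_tuple R m)%E) //.
  by rewrite preimage_setT; apply: eq_integral => -[x t] _ /=; rewrite cons_rowE.
exact: measurable_cons_pair.
Qed.

Lemma measurable_consr d (X : measurableType d) (f : X -> mR) (g : X -> borel 'rV[R]_m) :
  measurable_fun setT f -> measurable_fun setT g ->
  measurable_fun setT ((fun x => cons_row (f x) (g x)) : X -> borel 'rV[R]_(1 + m)).
Proof.
move=> mf mg; apply: measurable_rV => i; rewrite /cons_row.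
have [j ij|j ij] := splitP i.
  rewrite (_ : (fun _ => _) = f) //; apply/funext => x; rewrite mxE; case: splitP => k ik; first by rewrite mxE.
  by have := ltn_ord j; rewrite -ij ik.
rewrite (_ : (fun _ => _) = fun x => (g x : 'rV[R]_m) 0 j).
  exact: (measurableT_comp (@measurable_coord m j) mg).
apply/funext => x; rewrite mxE; case: splitP => k ik; first by have := ltn_ord k; rewrite -ik ij.
by congr (g x 0 _); apply: val_inj; apply/eqP; rewrite -(eqn_add2l 1) -ij ik.
Qed.

Lemma measurable_cons_row (f : borel 'rV[R]_(1 + m) -> \bar R) : measurable_fun setT f ->
  measurable_fun setT (fun p : mR * borel 'rV[R]_m => f (cons_row p.1 p.2)).
Proof.
move=> mf; have mg := @measurable_consr _ (mR * borel 'rV[R]_m)%type fst snd measurable_fst measurable_snd.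
exact: (measurableT_comp mf mg).
Qed.

Lemma measurable_section_snd (f : borel 'rV[R]_(1 + m) -> \bar R) (x : R) :
  measurable_fun setT f -> measurable_fun setT (fun y : borel 'rV[R]_m => f (cons_row x y)).
Proof.
move=> mf; have mg := @measurable_consr _ (borel 'rV[R]_m) (cst x) id (measurable_cst _) (@measurable_id _ _ _).
exact: (measurableT_comp mf mg).
Qed.

Lemma measurable_section_fst (f : borel 'rV[R]_(1 + m) -> \bar R) (y : 'rV[R]_m) :
  measurable_fun setT f -> measurable_fun setT (fun x : mR => f (cons_row x y)).
Proof.
move=> mf; have mg := @measurable_consr _ mR id (cst y) (@measurable_id _ _ _) (measurable_cst _).
exact: (measurableT_comp mf mg).
Qed.

Lemma measurable_lam_section (f : borel 'rV[R]_(1 + m) -> \bar R) :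
  measurable_fun setT f -> (forall x, 0 <= f x)%E ->
  measurable_fun setT (fun x : mR => \int[@lam m]_y f (cons_row x y))%E.
Proof.
move=> mf f0; have := @measurable_fun_fubini_tonelli_F _ _ mR _ R (@lebesgue_tuple R m)
  _ (measurable_lebesgue_section mf) (fun p => f0 _).
apply: eq_measurable_fun => x _ /=; rewrite /fubini_F lam_integral_tuple ?preimage_setT //.
exact: measurable_section_snd.
Qed.

(** Both orders of integration are kept: an upper triangular block matrix acts on the inner variable
    [y] of this one by [D] and a translation, a lower shear translates the inner variable [x] of
    [lam_fiber2]. *)
Lemma lam_fiber1 (f : borel 'rV[R]_(1 + m) -> \bar R) :
  measurable_fun setT f -> (forall x, 0 <= f x)%E ->
  (\int[@lam (1 + m)]_z f z = \int[leb]_x \int[@lam m]_y f (cons_row x y))%E.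
Proof.
move=> mf f0; rewrite lam_prod //.
rewrite (@fubini_tonelli1 _ _ _ _ _ leb (@lebesgue_tuple R m)) //; last exact: measurable_lebesgue_section.
apply: eq_integral => x _; rewrite /fubini_F lam_integral_tuple ?preimage_setT //.
exact: measurable_section_snd.
Qed.

Lemma lam_fiber2 (f : borel 'rV[R]_(1 + m) -> \bar R) :
  measurable_fun setT f -> (forall x, 0 <= f x)%E ->
  (\int[@lam (1 + m)]_z f z = \int[@lam m]_y \int[leb]_x f (cons_row x y))%E.
Proof.
move=> mf f0; rewrite lam_prod //.
have ms := measurable_lebesgue_section mf.
rewrite (@fubini_tonelli1 _ _ _ _ _ leb (@lebesgue_tuple R m)) //.
rewrite [LHS](@fubini_tonelli _ _ _ _ _ leb (@lebesgue_tuple R m) _ ms) //.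
have mi : measurable_fun setT (fun y : borel 'rV[R]_m => \int[leb]_x f (cons_row x y))%E.
  by have := @measurable_fun_fubini_tonelli_G _ _ mR (borel 'rV[R]_m) R leb (fun p => f (cons_row p.1
    p.2)) (measurable_cons_row mf); apply => x; exact: f0.
rewrite lam_integral_tuple ?preimage_setT //.
by move=> y _; apply: integral_ge0.
Qed.

End fibers.

(** The rescaled image measure agrees with Lebesgue measure on half-open intervals, which determines
    it. For [a < 0] the preimage is half-open at the other end, with the same length. *)
Lemma leb_affine (a b : R) (f : mR -> \bar R) : a != 0 -> measurable_fun setT f ->
  (forall x, 0 <= f x)%E ->
  (`|a|%:E * \int[leb]_x f (a * x + b)%R = \int[leb]_x f x)%E.
Proof.
move=> a0 mf f0.
have maff : measurable_fun setT ((fun x => a * x + b) : mR -> mR).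
  by apply: measurable_funD => //; exact: measurable_funM.
have an0 : 0 <= `|a| by [].
pose nu := mscale (NngNum an0) (pushforward leb ((fun x => a * x + b) : mR -> mR)).
have E A : measurable A -> leb A = nu maff A.
  apply: lebesgue_measure_unique => _ [[c d] /= _ <-].
  rewrite /nu /mscale /= /pushforward.
  have aN : 0 < `|a| by rewrite normr_gt0.
  have [ap|an|a00] := ltgtP 0 a; last by rewrite -a00 eqxx in a0.
    rewrite (_ : _ @^-1` _ = `]((c - b) / a), ((d - b) / a)]%classic); last first.
      apply/seteqP; split=> x /=; rewrite !in_itv /= ltr_pdivrMr // ler_pdivlMr // (mulrC x); lra.
    rewrite !lebesgue_measure_itv /= !lte_fin ltr_pM2r ?invr_gt0 // ltrD2r.
    case: ifP => _; last by rewrite mule0.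
    rewrite -!EFinB -EFinM gtr0_norm //; congr (_%:E); field; exact: a0.
  rewrite (_ : _ @^-1` _ = `[((d - b) / a), ((c - b) / a)[%classic); last first.
    apply/seteqP; split=> x /=; rewrite !in_itv /= ltr_ndivlMr // ler_ndivrMr // (mulrC x); lra.
  rewrite !lebesgue_measure_itv /= !lte_fin ltr_nM2r ?invr_lt0 // ltrD2r.
  case: ifP => _; last by rewrite mule0.
  rewrite -!EFinB -EFinM ltr0_norm //; congr (_%:E); field; exact: a0.
rewrite [RHS](eq_measure_integral (nu maff)); last by move=> A mA _; exact: E.
rewrite ge0_integral_mscale //; congr (_ * _)%E.
by rewrite (ge0_integral_pushforward maff) // preimage_setT.
Qed.

End lebesgue_rV.

(** * Linear changes of variables *)

Section linear.
Context {R : realType}.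
Local Notation mR := (measurableTypeR R).
Local Notation leb := (@lebesgue_measure R).

Lemma measurable_affine m p (A : 'M[R]_(m, p)) (b : 'rV[R]_p) :
  measurable_fun setT ((fun z => z *m A + b) : borel 'rV[R]_m -> borel 'rV[R]_p).
Proof.
apply: measurable_rV => i.
rewrite (_ : (fun _ => _) = fun z : borel 'rV[R]_m => \sum_j (z : 'rV[R]_m) 0 j * A j i + b 0 i).
  apply: measurable_funD => //.
  by apply: measurable_sum => j; apply: measurable_funM => //; exact: measurable_coord.
by apply/funext => z; rewrite !mxE.
Qed.

Lemma lam_translate m (v : 'rV[R]_m) (f : borel 'rV[R]_m -> \bar R) :
  measurable_fun setT f -> (forall z, 0 <= f z)%E ->
  (\int[@lam R m]_z f (z + v)%R = \int[@lam R m]_z f z)%E.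
Proof.
have mtr p (w : 'rV[R]_p) : measurable_fun setT ((fun z => z + w) : borel 'rV[R]_p -> borel 'rV[R]_p).
  have := @measurable_affine p p 1%:M w; apply: eq_measurable_fun => z _.
  by rewrite mulmx1.
elim: m v f => [|m IH] v f mf f0.
  by apply: eq_integral => z _; congr f; apply/rowP => -[].
have mfv : measurable_fun setT (fun z : borel 'rV[R]_m.+1 => f (z + v)%R).
  exact: (measurableT_comp mf (mtr _ v)).
rewrite (lam_fiber2 mfv (fun z => f0 _)) (lam_fiber2 mf f0).
pose v0 := v 0 0; pose v' : 'rV[R]_m := rsubmx (v : 'rV[R]_(1 + m)).
have vE x y : (cons_row x y : 'rV[R]_m.+1) + v = cons_row (x + v0) (y + v').
  apply/rowP => i; rewrite /cons_row !mxE; case: splitP => j ij; rewrite !mxE;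
    by congr (_ + v _ _); apply: val_inj; rewrite /= ij ?ord1.
transitivity (\int[@lam R m]_y (fun y => \int[leb]_x f (cons_row x y)) (y + v')%R)%E.
  apply: eq_integral => y _ /=.
  under eq_integral do rewrite vE.
  have := @leb_affine R 1 v0 (fun x => f (cons_row x (y + v'))) (oner_neq0 _).
  rewrite normr1 mul1e => <- //; last exact: measurable_section_fst.
  by apply: eq_integral => x _; rewrite mul1r.
apply: (IH v' (fun y => \int[leb]_x f (cons_row x y))%E).
  by have := @measurable_fun_fubini_tonelli_G _ _ mR (borel 'rV[R]_m) R leb
    (fun p => f (cons_row p.1 p.2)) (measurable_cons_row mf); apply => x; exact: f0.
by move=> y; apply: integral_ge0.
Qed.

(** As a predicate on matrices the formula is stable under products, so it can be proved on the
    factors of Gaussian elimination. *)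
Definition scales_lam m (A : 'M[R]_m) := forall f : borel 'rV[R]_m -> \bar R,
  measurable_fun setT f -> (forall z, 0 <= f z)%E ->
  (`|\det A|%:E * \int[@lam R m]_z f (z *m A) = \int[@lam R m]_z f z)%E.

Lemma measurable_mulmx m p (A : 'M[R]_(m, p)) :
  measurable_fun setT ((fun z => z *m A) : borel 'rV[R]_m -> borel 'rV[R]_p).
Proof.
by have := @measurable_affine m p A 0; apply: eq_measurable_fun => z _; rewrite addr0.
Qed.

Lemma scales_lamM m (A B : 'M[R]_m) : scales_lam A -> scales_lam B -> scales_lam (A *m B).
Proof.
move=> sA sB f mf f0; rewrite det_mulmx normrM EFinM (muleC `|\det A|%:E) -muleA.
have mfB : measurable_fun setT (fun z : borel 'rV[R]_m => f (z *m B)).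
  exact: (measurableT_comp mf (measurable_mulmx B)).
rewrite -(sB f) // -(sA (fun z => f (z *m B))) //; congr (_ * (_ * _))%E.
by apply: eq_integral => z _; rewrite mulmxA.
Qed.

Lemma scales_lam_upper m (a : R) (b : 'rV[R]_m) (D : 'M[R]_m) : a != 0 -> scales_lam D ->
  scales_lam (block_mx a%:M b 0 D : 'M[R]_(1 + m)).
Proof.
move=> a0 sD f mf f0; set A := block_mx _ _ _ _.
have detA : \det A = a * \det D by rewrite det_ublock det_scalar1.
have mfA : measurable_fun setT (fun z : borel 'rV[R]_(1 + m) => f (z *m A)).
  exact: (measurableT_comp mf (measurable_mulmx A)).
have AE x y : cons_row x y *m A = cons_row (a * x) (y *m D + x *: b).
  rewrite /cons_row mul_row_block mulmx0 addr0; congr row_mx.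
    by apply/rowP => i; rewrite ord1 !mxE big_ord1 !mxE eqxx mulr1n mulrC.
  rewrite addrC; congr (_ + _); apply/rowP => i; rewrite !mxE big_ord1 !mxE //.
rewrite (lam_fiber1 mfA (fun z => f0 _)) (lam_fiber1 mf f0).
rewrite detA normrM EFinM.
pose G x := (\int[@lam R m]_y f (cons_row x y))%E.
have mG : measurable_fun setT (G : mR -> \bar R).
  exact: measurable_lam_section.
have G0 x : (0 <= G x)%E by exact: integral_ge0.
rewrite -(leb_affine 0 a0 mG G0) -muleA; congr (_ * _)%E.
rewrite -ge0_integralZl //; last 2 first.
- exact: (measurable_lam_section mfA (fun z => f0 _)).
- by move=> x _; exact: integral_ge0.
apply: eq_integral => x _; rewrite addr0.
under eq_integral do rewrite AE.
have ms := measurable_section_snd (a * x) mf.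
rewrite (sD (fun y => f (cons_row (a * x) (y + x *: b)))) //; last first.
  have := @measurable_affine m m 1%:M (x *: b) => maf.
  by have := measurableT_comp ms maf; apply: eq_measurable_fun => z _ /=; rewrite mulmx1.
exact: (lam_translate (x *: b) ms).
Qed.

Lemma scales_lam_lower m (c : 'cV[R]_m) :
  scales_lam (block_mx 1%:M 0 c 1%:M : 'M[R]_(1 + m)).
Proof.
move=> f mf f0; set A := block_mx _ _ _ _.
have detA : \det A = 1 by rewrite det_lblock !det1 mulr1.
have mfA : measurable_fun setT (fun z : borel 'rV[R]_(1 + m) => f (z *m A)).
  exact: (measurableT_comp mf (measurable_mulmx A)).
have AE x y : cons_row x y *m A = cons_row (x + (y *m c) 0 0) y.
  rewrite /cons_row mul_row_block !mulmx1 mulmx0 add0r; congr row_mx.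
  by apply/rowP => i; rewrite ord1 !mxE.
rewrite detA normr1 mul1e (lam_fiber2 mfA (fun z => f0 _)) (lam_fiber2 mf f0).
apply: eq_integral => y _; under eq_integral do rewrite AE.
have := @leb_affine R 1 ((y *m c) 0 0) (fun x => f (cons_row x y)) (oner_neq0 _).
rewrite normr1 mul1e => <- //; last exact: measurable_section_fst.
by apply: eq_integral => x _; rewrite mul1r.
Qed.

(** Induction by elimination: a nonzero corner entry gives a lower shear times an upper block matrix
    whose lower right block is the Schur complement. A zero corner entry is first made nonzero by a
    shear. *)
Lemma lam_linear m (A : 'M[R]_m) : A \in unitmx -> scales_lam A.
Proof.
elim: m A => [|m IH] A uA.
  move=> f mf f0; rewrite det_mx00 normr1 mul1e; apply: eq_integral => z _.
  by congr f; apply/rowP => -[].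
have block_case (B : 'M[R]_(1 + m)) : B \in unitmx -> ulsubmx B 0 0 != 0 -> scales_lam B.
  move=> uB b0; set a := ulsubmx B 0 0 in b0.
  have BE : B = block_mx 1%:M 0 (a^-1 *: dlsubmx B) 1%:M *m
      block_mx a%:M (ursubmx B) 0 (drsubmx B - a^-1 *: dlsubmx B *m ursubmx B).
    rewrite mulmx_block !mul1mx !mul0mx !addr0 -[LHS]submxK.
    congr block_mx.
    - by rewrite [LHS]mx11_scalar.
    - by rewrite mul_mx_scalar scalerA mulfV // scale1r.
    - by rewrite addrC subrK.
  rewrite BE; apply: scales_lamM; first exact: scales_lam_lower.
  apply: scales_lam_upper => //; apply: IH.
  have := uB; rewrite {1}BE unitmx_mul => /andP[_].
  by rewrite !unitmxE det_ublock det_scalar1 unitrM => /andP[].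
have [a0|] := boolP (ulsubmx (A : 'M[R]_(1 + m)) 0 0 != 0); first exact: block_case.
rewrite negbK => /eqP a0.
have [i ci] : exists i, dlsubmx (A : 'M[R]_(1 + m)) i 0 != 0.
  apply: contrapT => /forallNP H; move: uA; rewrite unitmxE -(@submxK _ 1 m 1 m A).
  rewrite (_ : ulsubmx _ = 0); last by rewrite [LHS]mx11_scalar a0; apply/matrixP => ? ?; rewrite !mxE mul0rn.
  rewrite (_ : dlsubmx _ = 0); last first.
    by apply/colP => j; have /negP := H j; rewrite negbK [RHS]mxE => /eqP.
  by rewrite (@det_ublock _ 1 m) det_mx11 mxE mul0r unitr0.
(* The shear [T v] adds a multiple of a lower row to the first one and turns the corner entry into
   1. *)
pose v : 'rV[R]_m := (dlsubmx (A : 'M[R]_(1 + m)) i 0)^-1 *: delta_mx 0 i.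
pose T (w : 'rV[R]_m) : 'M[R]_(1 + m) := block_mx 1%:M w 0 1%:M.
have sT w : scales_lam (T w).
  by apply: scales_lam_upper; [exact: oner_neq0|apply: IH; exact: unitmx1].
have AE : A = T (- v) *m (T v *m (A : 'M[R]_(1 + m))).
  rewrite mulmxA /T mulmx_block !mulmx1 !mulmx0 !mul1mx !mul0mx !addr0 !add0r subrr.
  by rewrite -scalar_mx_block mul1mx.
rewrite AE; apply: scales_lamM; first exact: sT.
apply: block_case.
  have : T v *m (A : 'M[R]_(1 + m)) \in unitmx = (T v \in unitmx) by rewrite unitmx_mul uA andbT.
  by move=> ->; rewrite unitmxE det_ublock !det1 mulr1 unitr1.
rewrite -[A](@submxK _ 1 m 1 m) mulmx_block block_mxKul !mul1mx mxE a0 add0r.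
by rewrite /v -scalemxAl -rowE mxE [X in _ * X]mxE (mulVf ci) oner_neq0.
Qed.

End linear.

(** * Change of variables *)

Section density_pushforward.
Local Open Scope ereal_scope.
Context d1 d2 (X : measurableType d1) (Y : measurableType d2) (R : realType).
Variables (mu : {measure set X -> \bar R}) (D : set X) (phi : X -> Y) (g : X -> R).
Hypotheses (mD : measurable D) (mphi : measurable_fun D phi) (mg : measurable_fun D g).
Hypothesis g0 : forall x, D x -> (0 <= g x)%R.

(** Image under [phi] of the measure with density [g] on [D]. The change of variables compares two
    such measures, and the Riemannian measure is a sum of them. *)
Definition dpush (A : set Y) : \bar R := \int[mu]_(x in D `&` phi @^-1` A) (g x)%:E.

Let mgE : measurable_fun D (fun x => (g x)%:E). Proof. exact/measurable_EFinP. Qed.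

Let mDA A : measurable A -> measurable (D `&` phi @^-1` A). Proof. exact: mphi. Qed.

Let dpush0 : dpush set0 = 0.
Proof. by rewrite /dpush preimage_set0 setI0 integral_set0. Qed.

Let dpush_ge0 A : 0 <= dpush A.
Proof. by apply: integral_ge0 => x [/g0]; rewrite lee_fin. Qed.

Let dpush_sigma_additive : semi_sigma_additive dpush.
Proof.
move=> F mF tF mUF; rewrite /dpush preimage_bigcup setI_bigcupr.
rewrite ge0_integral_bigcup; last 4 first.
- by move=> k; exact: mDA.
- by apply: measurable_funS mgE => // x [k _ []].
- by move=> x [k _ [/g0]]; rewrite lee_fin.
- apply/trivIsetP => i j _ _ ij; rewrite setIACA setIid -preimage_setI.
  by move/trivIsetP : tF => /(_ _ _ _ _ ij) ->//; rewrite preimage_set0 setI0.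
apply: is_cvg_ereal_nneg_natsum_cond => n _ _; exact: dpush_ge0.
Qed.

Definition dpush_measure : {measure set Y -> \bar R} :=
  HB.pack dpush (isMeasure.Build _ _ _ dpush dpush0 dpush_ge0 dpush_sigma_additive).

Lemma dpush_measureE A : dpush_measure A = \int[mu]_(x in D `&` phi @^-1` A) (g x)%:E.
Proof. by []. Qed.

Import HBNNSimple.

(** For indicators this is the definition; simple functions follow by linearity and the general case
    by monotone convergence on both sides. *)
Lemma ge0_integral_dpush (f : Y -> \bar R) : measurable_fun setT f -> (forall y, 0 <= f y) ->
  \int[dpush_measure]_y f y = \int[mu]_(x in D) (f (phi x) * (g x)%:E).
Proof.
move=> mf f0; pose f_ := nnsfun_approx measurableT mf.
have mfphi n : measurable_fun D (fun x => (f_ n (phi x))%:E).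
  by apply/measurable_EFinP; apply: (measurable_comp measurableT) => //.
have homo n m x : (n <= m)%N -> (f_ n x <= f_ m x)%R.
  by move=> nm; exact/lefP/nd_nnsfun_approx.
transitivity (limn (fun n => \int[dpush_measure]_x (f_ n x)%:E)).
  rewrite -monotone_convergence//.
  - by apply: eq_integral => y _; apply/esym/cvg_lim => //; apply: cvg_nnsfun_approx.
  - by move=> n; exact/measurable_EFinP.
  - by move=> n y _; rewrite lee_fin.
  - by move=> y _ n m nm; rewrite lee_fin; exact: homo.
transitivity (limn (fun n => \int[mu]_(x in D) ((f_ n (phi x))%:E * (g x)%:E))); last first.
  rewrite -monotone_convergence//.
  - apply: eq_integral => x /set_mem Dx; apply/cvg_lim => //.
    by apply: cvgeZr => //; exact: cvg_nnsfun_approx.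
  - by move=> n; apply: emeasurable_funM.
  - by move=> n x Dx; apply: mule_ge0; rewrite lee_fin // g0.
  - by move=> x Dx n m nm; rewrite lee_wpmul2r ?lee_fin ?g0 //; exact: homo.
congr (limn _); apply/funext => n.
under [LHS]eq_integral do rewrite fimfunE -fsumEFin//.
rewrite [LHS]ge0_integral_fsum//; last 2 first.
  - by move=> r; exact/measurable_EFinP/measurableT_comp.
  - by move=> r x _; rewrite EFinM nnfun_muleindic_ge0.
under [RHS]eq_integral => x _.
  rewrite fimfunE -fsumEFin// ge0_mule_fsuml; last first.
    by move=> r; rewrite EFinM nnfun_muleindic_ge0.
  over.
rewrite [RHS]ge0_integral_fsum//; last 2 first.
  - move=> r; apply: emeasurable_funM => //; apply/measurable_EFinP.
    by apply: measurable_funM => //; apply: (measurable_comp measurableT).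
  - by move=> r x Dx; apply: mule_ge0; [rewrite EFinM nnfun_muleindic_ge0|rewrite lee_fin g0].
apply: eq_fsbigr => r _; rewrite integralZl_indic_nnsfun// integral_indic//= setIT.
have [r0|r0] := ltP r 0%R.
  rewrite preimage_nnfun0 // dpush0 mule0 integral0_eq // => x _.
  by rewrite indic0 mulr0 mul0e.
under [RHS]eq_integral do rewrite EFinM -muleA.
rewrite ge0_integralZl //; last 2 first.
- apply: emeasurable_funM => //; apply/measurable_EFinP.
  by apply: (measurable_comp measurableT).
- by move=> x Dx; apply: mule_ge0; rewrite lee_fin // g0.
congr (_ * _); rewrite -/dpush /dpush integral_mkcondr.
apply: eq_integral => x _; rewrite patchE indicE.
have -> : (x \in phi @^-1` (f_ n @^-1` [set r])) = (phi x \in f_ n @^-1` [set r]).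
  by apply/idP/idP; rewrite !inE.
by case: ifP => _; rewrite ?mul1e ?mul0e.
Qed.

End density_pushforward.

Section boxes.
Context {R : realType}.
Local Notation leb := (@lebesgue_measure R).

(** Half-open, so that the boxes of a bisection form a partition. *)
Definition box m (a b : 'rV[R]_m) : set 'rV[R]_m := [set z | forall i, a 0 i <= z 0 i < b 0 i].

Lemma measurable_box m (a b : 'rV[R]_m) : measurable (box a b : set (borel 'rV[R]_m)).
Proof.
rewrite (_ : box a b = \bigcap_(i in [set: 'I_m])
    (fun z : borel 'rV[R]_m => (z : 'rV[R]_m) 0 i) @^-1` `[a 0 i, b 0 i[%classic).
  apply: fin_bigcap_measurable => // i _; rewrite -[X in measurable X]setTI.
  exact: measurable_coord.
apply/seteqP; split=> z /=; first by move=> H i _ /=; rewrite in_itv /=; exact: H.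
by move=> H i; have := H i I; rewrite /= in_itv.
Qed.

Lemma boxI m (a b a' b' : 'rV[R]_m) : box a b `&` box a' b' =
  box (\row_i Num.max (a 0 i) (a' 0 i)) (\row_i Num.min (b 0 i) (b' 0 i)).
Proof.
apply/seteqP; split=> z /=.
  by move=> [H1 H2] i; rewrite !mxE ge_max lt_min; move: (H1 i) (H2 i) => /andP[-> ->] /andP[-> ->].
by move=> H; split=> i; have := H i; rewrite !mxE ge_max lt_min => /andP[/andP[? ?] /andP[? ?]]; apply/andP.
Qed.

Lemma lam_box m (a b : 'rV[R]_m) : (forall i, a 0 i <= b 0 i) ->
  @lam R m (box a b) = (\prod_i (b 0 i - a 0 i))%:E.
Proof.
elim: m a b => [|m IH] a b ab.
  rewrite big_ord0 (_ : box a b = setT); last by apply/seteqP; split=> // z _ [].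
  by rewrite /lam preimage_setT /= diracT.
have mi k (c d : 'rV[R]_k) : measurable_fun setT (EFin \o \1_(box c d) : borel 'rV[R]_k -> \bar R).
  by apply/measurable_EFinP; apply: measurable_indic; exact: measurable_box.
transitivity (\int[@lam R m.+1]_z (\1_(box a b) z)%:E)%E.
  by rewrite integral_indic ?setIT //; exact: measurable_box.
rewrite (@lam_fiber1 R m (EFin \o \1_(box a b)) (mi _ _ _)); last by move=> x; rewrite lee_fin.
pose a' : 'rV[R]_m := \row_i a 0 (lift 0 i); pose b' : 'rV[R]_m := \row_i b 0 (lift 0 i).
have E x y : \1_(box a b) (cons_row x y) = \1_(`[a 0 0, b 0 0[%classic) x * \1_(box a' b') y :> R.
  have L i : (cons_row x y) 0 (lift 0 i) = y 0 i.
    rewrite /cons_row mxE; case: splitP => j /= ij; first by have := ltn_ord j; rewrite -ij.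
    by congr (y 0 _); apply: val_inj; move: ij => [].
  have H0 : (cons_row x y) 0 0 = x.
    by rewrite /cons_row mxE; case: splitP => j // ij; rewrite mxE.
  rewrite !indicE -natrM mulnb; congr (_%:R); congr nat_of_bool.
  apply/idP/andP; rewrite !inE /=.
    move=> H; rewrite in_itv /=; have := H 0; rewrite H0 => ->; split=> // i.
    by have := H (lift 0 i); rewrite L !mxE.
  rewrite in_itv /= => -[Hx Hy] i; have [j ->|->] := unliftP 0 i; last by rewrite H0.
  by rewrite L; have := Hy j; rewrite !mxE.
have HI : (\int[@lam R m]_y (\1_(box a' b') y)%:E = (\prod_i (b' 0 i - a' 0 i))%:E)%E.
  rewrite integral_indic ?setIT //; last exact: measurable_box.
  by apply: IH => i; rewrite !mxE.
under eq_integral => x _.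
  under eq_integral => y _ do rewrite /= E EFinM.
  rewrite ge0_integralZl //; last exact: mi.
  rewrite HI; over.
rewrite ge0_integralZr //; last 2 first.
- by apply/measurable_EFinP; exact: measurable_indic.
- by rewrite lee_fin; apply: prodr_ge0 => i _; rewrite !mxE subr_ge0.
pose a0 := a 0 0; pose b0 := b 0 0.
transitivity (leb `[a0, b0[%classic * (\prod_i (b' 0%R i - a' 0%R i))%:E)%E.
  by congr (_ * _)%E; rewrite integral_indic ?setIT.
rewrite /a0 /b0.
rewrite lebesgue_measure_itv /= lte_fin big_ord_recl.
have [ab0|ab0] := ltP (a 0 0) (b 0 0).
  by rewrite -EFinB -EFinM; congr (_ * _)%:E; apply: eq_bigr => i _; rewrite !mxE.
have -> : a 0 0 = b 0 0 by apply/le_anti; rewrite ab ab0.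
by rewrite mul0e subrr mul0r.
Qed.

(** The closed boxes stay in [A] as well: in a bisection, the limit point of nested boxes may lie on
    the boundary. *)
Lemma open_bigcup_boxes m (A : set 'rV[R]_m) : open A ->
  exists P : set (nat * 'rV[rat]_m), A = \bigcup_(k in P)
    box (\row_i (ratr (k.2 0 i) - k.1.+1%:R^-1)) (\row_i (ratr (k.2 0 i) + k.1.+1%:R^-1)) /\
  forall k, P k -> forall z : 'rV[R]_m,
    (forall i, ratr (k.2 0 i) - k.1.+1%:R^-1 <= z 0 i <= ratr (k.2 0 i) + k.1.+1%:R^-1) -> A z.
Proof.
move=> oA; pose P (k : nat * 'rV[rat]_m) := forall z : 'rV[R]_m,
    (forall i, ratr (k.2 0 i) - k.1.+1%:R^-1 <= z 0 i <= ratr (k.2 0 i) + k.1.+1%:R^-1) -> A z.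
exists P; split=> //; apply/seteqP; split=> [t At|t [k Pk Ht]]; last first.
  by apply: Pk => i; have := Ht i; rewrite !mxE => /andP[-> /ltW ->].
have [r r0 Hr] := open_radius oA At.
pose n := Num.truncn (2 / r).
have n0 : 0 < n.+1%:R^-1 :> R by rewrite invr_gt0.
have nr : n.+1%:R^-1 < r / 2.
  by rewrite -[ltRHS]invrK ltf_pV2 ?posrE ?invr_gt0 ?divr_gt0 // invf_div truncnS_gt.
have Hq i : exists q : rat, `|t 0 i - ratr q| < n.+1%:R^-1.
  have [|q] := @rat_in_itvoo R (t 0 i - n.+1%:R^-1) (t 0 i + n.+1%:R^-1).
    by apply: (@lt_trans _ _ (t 0 i)); rewrite ?ltrDl // gtrDl oppr_lt0.
  by rewrite in_itv /= => /andP[q1 q2]; exists q; rewrite ltr_distlC q1 q2.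
pose q : 'rV[rat]_m := \row_i sval (cid (Hq i)).
have qt i : `|t 0 i - ratr (q 0 i)| < n.+1%:R^-1 by rewrite mxE; case: cid.
exists (n, q) => /=; last first.
  by by move=> i; rewrite !mxE /=; have := qt i; rewrite ltr_distl mxE => /andP[/ltW -> ->].
move=> z Hz; apply: Hr; apply: (@le_lt_trans _ _ (2 * n.+1%:R^-1)); last by rewrite mulrC -ltr_pdivlMr.
apply: norm_le_coord => [|i]; first by rewrite mulr_ge0 // ltW.
rewrite !mxE; apply: (le_trans (ler_distD (ratr (q 0 i)) _ _)).
rewrite mulr_natl mulr2n; apply: lerD; last by apply: ltW; rewrite distrC.
by rewrite ler_distl; exact: Hz.
Qed.

Lemma measurable_boxesE m : @measurable _ (borel 'rV[R]_m) =
  <<s [set A | exists a b : 'rV[R]_m, A = box a b] >>.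
Proof.
apply/seteqP; split.
  apply: smallest_sub; first exact: smallest_sigma_algebra.
  move=> A oA; have [P [-> _]] := open_bigcup_boxes oA.
  set G := [set A | _].
  suff : measurable (\bigcup_(k in P)
    box (\row_i (ratr (k.2 0 i) - k.1.+1%:R^-1)) (\row_i (ratr (k.2 0 i) + k.1.+1%:R^-1)) :
      set (g_sigma_algebraType G)) by [].
  rewrite bigcup_mkcond; apply: countable_bigcupT_measurable; first exact: countableP.
  move=> k; case: ifP => _ //; apply: sub_gen_smallest; by eexists; eexists.
apply: smallest_sub; first exact: sigma_algebra_measurable.
by move=> _ [a [b ->]]; exact: measurable_box.
Qed.

Lemma measure_unique_boxes m (m1 m2 : {measure set (borel 'rV[R]_m) -> \bar R}) :
  (forall a b, m1 (box a b) = m2 (box a b)) -> (forall a b, m1 (box a b) < +oo)%E ->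
  forall A : set (borel 'rV[R]_m), measurable A -> m1 A = m2 A.
Proof.
move=> E f1; apply: (@measure_unique _ R (borel 'rV[R]_m) [set A | exists a b : 'rV[R]_m, A = box a b]
    (fun n : nat => box (const_mx (- n%:R)) (const_mx n%:R))).
- exact: measurable_boxesE.
- by move=> _ _ [a [b ->]] [a' [b' ->]]; eexists; eexists; exact: boxI.
- by move=> n; eexists; eexists.
- apply/seteqP; split=> // z _; exists (Num.truncn `|z|).+1 => // i; rewrite !mxE.
  have zi : `|z 0 i| < (Num.truncn `|z|).+1%:R.
    by apply: le_lt_trans (truncnS_gt _); exact: norm_coord.
  by move: zi; rewrite ltr_norml => /andP[/ltW -> ->].
- by move=> _ [a [b ->]].
- by move=> n; exact: f1.
Qed.

End boxes.

Section change_of_variables.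
Context {R : realType} {m : nat}.
Local Notation T := (borel 'rV[R]_m).
Local Notation lam := (@lam R m).

Lemma lam_affine (A B : 'M[R]_m) (p q : 'rV[R]_m) (f : T -> \bar R) : A *m B = 1%:M ->
  measurable_fun setT f -> (forall z, 0 <= f z)%E ->
  (\int[lam]_z f (p + (z - q) *m B)%R = `|\det A|%:E * \int[lam]_z f z)%E.
Proof.
move=> AB mf f0.
have [uA uB] : A \in unitmx /\ B \in unitmx by apply/andP; rewrite -unitmx_mul AB unitmx1.
have mfB c : measurable_fun setT (fun z : T => f (z *m B + c)).
  exact: (measurableT_comp mf (measurable_affine B c)).
have mB c : measurable_fun setT (fun z : T => f (z + c)).
  have := mfB c => _; have := measurableT_comp mf (@measurable_affine R m m 1%:M c).
  by apply: eq_measurable_fun => z _ /=; rewrite mulmx1.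
transitivity (\int[lam]_z f ((z - q) *m B + p)%R)%E.
  by apply: eq_integral => z _; rewrite addrC.
rewrite (@lam_translate R m (- q) (fun z => f (z *m B + p)) (mfB p) (fun z => f0 _)).
rewrite -(lam_translate p mf f0) -(lam_linear uB (mB p) (fun z => f0 _)) muleA -EFinM.
by rewrite -normrM -det_mulmx AB det1 normr1 mul1e.
Qed.

(* The midpoint subdivision keeps the shape of a box, so the constants in the local estimates
   below do not degenerate. *)
Lemma box_bisection (P : set 'rV[R]_m -> Prop) (a b : 'rV[R]_m) :
  (forall i, a 0 i < b 0 i) ->
  (forall c d : 'rV[R]_m, (forall i, c 0 i < d 0 i) ->
    (forall e : {ffun 'I_m -> bool},
      P (box (\row_i (if e i then (c 0 i + d 0 i) / 2 else c 0 i))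
             (\row_i (if e i then d 0 i else (c 0 i + d 0 i) / 2)))) -> P (box c d)) ->
  (forall p : 'rV[R]_m, (forall i, a 0 i <= p 0 i <= b 0 i) ->
    exists2 h0 : R, 0 < h0 & forall h (c : 'rV[R]_m), 0 < h -> h < h0 ->
      (forall i, c 0 i <= p 0 i <= c 0 i + h * (b 0 i - a 0 i)) ->
      P (box c (c + h *: (b - a)))) ->
  P (box a b).
Proof.
move=> ab Psub Ploc; apply: contrapT => nP.
(* A state is a lower corner together with the number of bisections made so far; the good states are
   the boxes on which [P] fails. *)
pose good (x : 'rV[R]_m * nat) := ~ P (box x.1 (x.1 + (2 ^- x.2 : R) *: (b - a))).
pose half (x : 'rV[R]_m * nat) (e : {ffun 'I_m -> bool}) : 'rV[R]_m :=
  \row_i (x.1 0 i + (e i)%:R * (2 ^- x.2.+1 * (b 0 i - a 0 i))).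
have h2 k : 2 ^- k.+1 = 2 ^- k / 2 :> R by rewrite exprSr invfM.
have stepP x : good x -> exists e, good (half x e, x.2.+1).
  move=> gx; apply: contrapT => /forallNP H; apply: gx; apply: Psub.
    move=> i; rewrite !mxE ltrDl mulr_gt0 ?invr_gt0 ?exprn_gt0 // subr_gt0; exact: ab.
  move=> e; have /contrapT := H e; rewrite /good /half /=; congr (P (box _ _)); apply/rowP => i.
    by rewrite !mxE h2; case: (e i); rewrite ?mul1r ?mul0r ?addr0 //; field.
  by rewrite !mxE h2; case: (e i); rewrite ?mul1r ?mul0r ?addr0 //; field.
pose next x := if pselect (good x) is left g then (half x (sval (cid (stepP x g))), x.2.+1) else x.
pose u n := iter n next (a, 0%N).
have gu n : good (u n) /\ (u n).2 = n.
  elim: n => [|n [g e]]; first by split=> //; rewrite /good /= expr0 invr1 scale1r addrC subrK.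
  rewrite /u iterS -/(u n) /next; case: pselect => [g'|//].
  by split; [exact: svalP (cid (stepP _ g'))|rewrite /= e].
have ui n i : (u n).1 0 i <= (u n.+1).1 0 i /\
    (u n.+1).1 0 i + 2 ^- n.+1 * (b 0 i - a 0 i) <= (u n).1 0 i + 2 ^- n * (b 0 i - a 0 i).
  have [g e] := gu n; rewrite /u iterS -/(u n) /next; case: pselect => [g'|//].
  set ee := sval _; rewrite /half /= mxE e h2.
  have x0 : 0 < 2 ^- n * (b 0 i - a 0 i) by rewrite mulr_gt0 ?invr_gt0 ?exprn_gt0 // subr_gt0.
  by move: x0; set w := 2 ^- n; case: (ee i); rewrite ?mul1r ?mul0r; split; nra.
have mono n k i : (u n).1 0 i <= (u (n + k)%N).1 0 i /\
    (u (n + k)%N).1 0 i + 2 ^- (n + k) * (b 0 i - a 0 i) <= (u n).1 0 i + 2 ^- n * (b 0 i - a 0 i).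
  elim: k => [|k [IH1 IH2]]; first by rewrite addn0 !lexx.
  have [h1' h2'] := ui (n + k)%N i; rewrite addnS; split; [exact: le_trans h1'|exact: le_trans IH2].
have w0 n i : 0 < 2 ^- n * (b 0 i - a 0 i) by rewrite mulr_gt0 ?invr_gt0 ?exprn_gt0 // subr_gt0.
have le_all n k i : (u n).1 0 i <= (u k).1 0 i + 2 ^- k * (b 0 i - a 0 i).
  have [nk|/ltnW kn] := leqP n k.
    have [h1' _] := mono n (k - n)%N i; rewrite subnKC // in h1'.
    by apply: (le_trans h1'); rewrite lerDl ltW.
  have [_ h2'] := mono k (n - k)%N i; rewrite subnKC // in h2'.
  by apply: le_trans h2'; rewrite lerDl ltW.
pose S i := [set (u n).1 0 i | n in setT].
have supS i : has_sup (S i).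
  split; first by exists ((u 0%N).1 0 i); exists 0%N.
  by exists ((u 0%N).1 0 i + 2 ^- 0 * (b 0 i - a 0 i)) => _ [n _ <-]; exact: le_all.
(* The lower corners increase and stay below every upper corner, so their supremum lies in all the
   closed boxes. *)
pose p : 'rV[R]_m := \row_i sup (S i).
have pin n i : (u n).1 0 i <= p 0 i <= (u n).1 0 i + 2 ^- n * (b 0 i - a 0 i).
  rewrite mxE; apply/andP; split; first by apply: ub_le_sup; [exact: (supS i).2|exists n].
  by apply: ge_sup; [exact: (supS i).1|move=> _ [k _ <-]; exact: le_all].
have [|h0 h00 Hloc] := Ploc p.
  by move=> i; have := pin 0%N i; rewrite /= expr0 invr1 mul1r addrC subrK.
have [n Hn] : exists n, 2 ^- n < h0.
  exists (Num.truncn h0^-1).+1; rewrite invf_plt ?posrE ?exprn_gt0 //.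
  apply: (lt_trans (truncnS_gt _)); rewrite -natrX ltr_nat; exact: ltn_expl.
have [g e] := gu n; apply: g; rewrite e; apply: Hloc => //.
Qed.

Lemma box_split (c d : 'rV[R]_m) : (forall i, c 0 i < d 0 i) ->
  let Q (e : {ffun 'I_m -> bool}) := box (\row_i (if e i then (c 0 i + d 0 i) / 2 else c 0 i))
             (\row_i (if e i then d 0 i else (c 0 i + d 0 i) / 2)) in
  forall nu : {measure set T -> \bar R}, nu (box c d) = (\sum_(e \in [set: {ffun 'I_m -> bool}]) nu (Q e))%E.
Proof.
move=> cd Q nu.
have -> : box c d = \bigcup_(e in [set: {ffun 'I_m -> bool}]) Q e.
  apply/seteqP; split=> z.
    move=> zc; exists [ffun i => (c 0 i + d 0 i) / 2 <= z 0 i] => //.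
    move=> i; rewrite !mxE ffunE; have /andP[h1 h2] := zc i.
    by case: (leP ((c 0 i + d 0 i) / 2) (z 0 i)) => h; rewrite ?h ?h1 ?h2.
  move=> [e _ ze] i; have := ze i; rewrite !mxE; have := cd i.
  by case: (e i) => h /andP[h1 h2]; apply/andP; split; lra.
rewrite measure_fin_bigcup //.
- exact: finite_finset.
- apply/trivIsetP => e e' _ _ ee'; apply/seteqP; split=> // z [ze ze'].
  move/negP: ee'; apply; apply/eqP/ffunP => i; have := ze i; have := ze' i; rewrite !mxE.
  case: (e i) (e' i) => -[] //= /andP[h1 h2] /andP[h3 h4].
    by have := le_lt_trans h3 h2; rewrite ltxx.
  by have := le_lt_trans h1 h4; rewrite ltxx.
- by move=> e _; exact: measurable_box.
Qed.

(** The local error is proportional to [lam], hence additive: with [e] divided by the volume [V] of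
    the whole box, the inequality [m1 <= m3] passes from the halves to the box, and the accumulated
    error is [e]. *)
Lemma box_measure_le (m1 m2 : {measure set T -> \bar R}) (a b : 'rV[R]_m) :
  (forall i, a 0 i < b 0 i) ->
  (forall (e : R) (p : 'rV[R]_m), 0 < e -> (forall i, a 0 i <= p 0 i <= b 0 i) ->
    exists2 h0 : R, 0 < h0 & forall h (c : 'rV[R]_m), 0 < h -> h < h0 ->
      (forall i, c 0 i <= p 0 i <= c 0 i + h * (b 0 i - a 0 i)) ->
      (m1 (box c (c + h *: (b - a))) <= m2 (box c (c + h *: (b - a))) +
        e%:E * lam (box c (c + h *: (b - a))))%E) ->
  (m1 (box a b) <= m2 (box a b))%E.
Proof.
move=> ab H; apply/lee_addgt0Pr => e e0.
pose V := \prod_i (b 0 i - a 0 i).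
have V0 : 0 < V by apply: prodr_gt0 => i _; rewrite subr_gt0.
have eV : 0 < e / V by rewrite divr_gt0.
pose m3 : {measure set T -> \bar R} := measure_add m2 (mscale (NngNum (ltW eV)) lam).
have m3E A : m3 A = (m2 A + (e / V)%:E * lam A)%E.
  exact: measure_addE.
have : (m1 (box a b) <= m3 (box a b))%E.
  apply: (@box_bisection (fun A => (m1 A <= m3 A)%E)) => //.
    move=> c d cd Hsub; rewrite !(box_split cd); apply: lee_fsum => //; exact: finite_finset.
  move=> p pab; have [h0 h00 Hh] := H _ p eV pab; exists h0 => // h c h_gt0 hh0 pc.
  by rewrite m3E; exact: Hh.
rewrite m3E lam_box; last by move=> i; exact: ltW.
by rewrite -EFinM divfK // gt_eqF.
Qed.

Lemma mulmx_bound (p q : nat) (v : 'rV[R]_p) (B : 'M[R]_(p, q)) :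
  `|v *m B| <= (\sum_i \sum_j `|B i j|) * `|v|.
Proof.
apply: norm_le_coord => [|j]; first by rewrite mulr_ge0 // !sumr_ge0 // => i _; rewrite sumr_ge0.
rewrite mxE; apply: (le_trans (ler_norm_sum _ _ _)); rewrite mulr_suml; apply: ler_sum => i _.
rewrite normrM mulrC; apply: ler_pM => //; last exact: norm_coord.
by rewrite (bigD1 j) //= lerDl sumr_ge0.
Qed.

Lemma cont_prod (I : Type) (r : seq I) (F : I -> R -> R) (y : R) :
  (forall i, {for y, continuous (F i)}) -> {for y, continuous (fun z => \prod_(i <- r) F i z)}.
Proof.
move=> cF; elim: r => [|i r IH].
  rewrite (_ : (fun _ => _) = fun=> 1); first exact: cont_cst.
  by apply/funext => z; rewrite big_nil.
rewrite (_ : (fun _ => _) = fun z => F i z * \prod_(j <- r) F j z); first exact: cont_mul.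
by apply/funext => z; rewrite big_cons.
Qed.

Lemma measurable_preimage_affine (B : 'M[R]_m) (p q : 'rV[R]_m) (D : set T) :
  measurable D -> measurable ([set z | D (p + (z - q) *m B)] : set T).
Proof.
move=> mD; have := @measurable_affine R m m B (p - q *m B) measurableT D mD.
rewrite setTI; congr measurable; apply/seteqP; split=> z /=;
  by rewrite mulmxBl addrCA.
Qed.

Lemma lam_affine_set (A B : 'M[R]_m) (p q : 'rV[R]_m) (D : set T) : A *m B = 1%:M ->
  measurable D -> lam [set z | D (p + (z - q) *m B)] = (`|\det A|%:E * lam D)%E.
Proof.
move=> AB mD; set E := [set z | _].
have mE : measurable (E : set T) by exact: measurable_preimage_affine.
rewrite -[D in RHS]setIT -[E in LHS]setIT -!integral_indic //.
rewrite -(@lam_affine A B p q (EFin \o \1_D)) //.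
  by apply/measurable_EFinP; exact: measurable_indic.
by move=> z; rewrite lee_fin.
Qed.

Lemma ge0_integral_le_cst (D : set T) (f : T -> R) (k : R) : measurable D -> 0 <= k ->
  measurable_fun D f -> (forall z, D z -> 0 <= f z <= k) ->
  (\int[lam]_(z in D) (f z)%:E <= k%:E * lam D)%E.
Proof.
move=> mD k0 mf fk; rewrite -integral_cst //; apply: ge0_le_integral => //.
- by move=> z /fk /andP[]; rewrite lee_fin.
- exact/measurable_EFinP.
- by move=> z /fk /andP[_]; rewrite lee_fin.
Qed.

Lemma cst_le_integral (D : set T) (f : T -> R) (k : R) : measurable D -> 0 <= k ->
  measurable_fun D f -> (forall z, D z -> k <= f z) ->
  (k%:E * lam D <= \int[lam]_(z in D) (f z)%:E)%E.
Proof.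
move=> mD k0 mf fk; rewrite -integral_cst //; apply: ge0_le_integral => //.
exact/measurable_EFinP.
Qed.

End change_of_variables.

Lemma slope_bound (R : realType) (K e c x : R) : 0 <= K -> 0 <= e -> 0 <= x <= c ->
  K * x <= c * (K + e) /\ e * x + K * x <= c * (K + e).
Proof.
move=> K0 e0 /andP[x0 xc]; have := ler_wpM2l K0 xc; have := ler_wpM2l e0 xc.
by have := mulr_ge0 e0 (le_trans x0 xc); lra.
Qed.

Lemma box_diam (R : realType) (m : nat) (a b c p q : 'rV[R]_m) (h : R) : 0 <= h ->
  (forall i, c 0 i <= p 0 i <= c 0 i + h * (b 0 i - a 0 i)) ->
  box c (c + h *: (b - a)) q -> `|q - p| <= h * (`|b - a| + 1).
Proof.
move=> h0 pc Qq; apply: norm_le_coord => [|i]; first by rewrite mulr_ge0 // addr_ge0.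
have := Qq i; have := pc i; rewrite !mxE => /andP[p1 p2] /andP[q1 q2].
have sC : h * (b 0 i - a 0 i) <= h * (`|b - a| + 1).
  apply: ler_wpM2l => //.
  by have := norm_coord (b - a) i; rewrite !mxE; have := ler_norm (b 0 i - a 0 i); lra.
by rewrite ler_norml; apply/andP; split; lra.
Qed.

Lemma box_degenerate (R : realType) (m : nat) (a b : 'rV[R]_m) i : b 0 i <= a 0 i -> box a b = set0.
Proof.
move=> ba; apply/seteqP; split=> // z /(_ i) /andP[h1 h2].
by have := le_lt_trans h1 (lt_le_trans h2 ba); rewrite ltxx.
Qed.

Lemma subr_le_addr2 (R : realType) (x y k : R) : 0 <= k -> 0 <= y -> x - k <= x + y + k.
Proof. lra. Qed.

Lemma addr_le_subr2 (R : realType) (x y h n : R) : h * (2 * n) <= y -> x + h * n <= x + y - h * n.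
Proof. lra. Qed.

Lemma shift_weak (R : realType) (c d x k : R) : 0 < k -> c + k <= x < d - k -> c <= x < d.
Proof. by move=> k0 /andP[? ?]; apply/andP; split; lra. Qed.

Lemma shift_out (R : realType) (c d x y k : R) : 0 < k -> c <= x < d -> `|y - x| <= k / 2 ->
  c - k <= y < d + k.
Proof. by move=> k0 /andP[? ?]; rewrite ler_norml => /andP[? ?]; apply/andP; split; lra. Qed.

Lemma shift_in (R : realType) (c d x y k : R) : 0 < k -> c + k <= x < d - k -> `|y - x| <= k / 2 ->
  c <= y < d.
Proof. by move=> k0 /andP[? ?]; rewrite ler_norml => /andP[? ?]; apply/andP; split; lra. Qed.

(** The margin [n] absorbs at once the error of linearization, which widens or narrows each side by
    [2 * n], and the oscillation of both densities. It exists because the two excesses [F1] and [F2]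
    are continuous in [n] and vanish at 0. *)
Lemma density_margin (R : realType) (m : nat) (sg : 'I_m -> R) (d wp' e : R) : (forall i, 0 < sg i) -> 0 < e ->
  exists n : R, [/\ 0 < n, forall i, 2 * n < sg i,
    (wp' + n) * d * \prod_i (sg i + 2 * n) <= (d * wp' - n) * \prod_i sg i + e * \prod_i sg i &
    (d * wp' + n) * \prod_i sg i <= (wp' - n) * d * \prod_i (sg i - 2 * n) + e * \prod_i sg i].
Proof.
move=> sg0 e0.
have P0 : 0 < \prod_i sg i by exact: prodr_gt0.
have eP : 0 < e * \prod_i sg i by rewrite mulr_gt0.
have cid0 : {for (0 : R), continuous (fun x : R => x)} by exact: cvg_id.
have clin (a b : R) : {for 0, continuous (fun x : R => a + b * x)}.
  by apply: cont_add; [exact: cont_cst|apply: cont_mul; [exact: cont_cst|]].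
pose F1 n := (wp' + 1 * n) * d * \prod_i (sg i + 2 * n) + - ((d * wp' + (-1) * n) * \prod_i sg i).
pose F2 n := (d * wp' + 1 * n) * \prod_i sg i + - ((wp' + (-1) * n) * d * \prod_i (sg i + (-2) * n)).
have c1 : {for 0, continuous F1}.
  apply: cont_add; last by apply: cont_opp; apply: cont_mul; [exact: clin|exact: cont_cst].
  by apply: cont_mul; [apply: cont_mul; [exact: clin|exact: cont_cst]|apply: cont_prod => i; exact: clin].
have c2 : {for 0, continuous F2}.
  apply: cont_add; first by apply: cont_mul; [exact: clin|exact: cont_cst].
  apply: cont_opp; apply: cont_mul; [apply: cont_mul; [exact: clin|exact: cont_cst]|].
  by apply: cont_prod => i; exact: clin.
have z1 : F1 0 = 0.
  by rewrite /F1; under eq_bigr do rewrite mulr0 addr0; ring.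
have z2 : F2 0 = 0.
  by rewrite /F2; under [X in _ + - (_ * X)]eq_bigr do rewrite mulr0 addr0; ring.
have near_small (F : R -> R) : {for 0, continuous F} -> F 0 = 0 ->
    exists2 r : R, 0 < r & forall n, `|n| < r -> F n <= e * \prod_i sg i.
  move=> cF F0; have /cvgrPdist_lt /(_ _ eP) /nbhs_ballP[r /= r0 Hr] := cF.
  exists r => // n nr; have := Hr n; rewrite /ball /= sub0r normrN => /(_ nr).
  by rewrite F0 sub0r normrN => /ltW; apply: le_trans; exact: ler_norm.
have [r1 r10 H1] := near_small _ c1 z1; have [r2 r20 H2] := near_small _ c2 z2.
pose r3 := \big[Num.min/1]_i sg i.
have r30 : 0 < r3 by apply: lt_bigmin => // i _; exact: sg0.
have r3i i : r3 <= sg i by exact: bigmin_le_cond.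
pose n := Num.min (Num.min r1 r2) r3 / 4.
have mn0 : 0 < Num.min (Num.min r1 r2) r3 by rewrite !lt_min r10 r20 r30.
have n0 : 0 < n by rewrite divr_gt0.
have nlt (r : R) : Num.min (Num.min r1 r2) r3 <= r -> 4 * n <= r.
  by rewrite /n mulrC divfK.
have n1 : 4 * n <= r1 by apply: nlt; rewrite !ge_min lexx.
have n2 : 4 * n <= r2 by apply: nlt; rewrite !ge_min lexx orbT.
have n3 : 4 * n <= r3 by apply: nlt; rewrite !ge_min lexx orbT.
exists n; split=> //.
- by move=> i; apply: lt_le_trans (r3i i); lra.
- have := H1 n; rewrite gtr0_norm // => /(_ _)H; have {}H := H (ltac:(lra)).
  by move: H; rewrite /F1 mul1r; lra.
- have := H2 n; rewrite gtr0_norm // => /(_ _)H; have {}H := H (ltac:(lra)).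
  move: H; rewrite /F2 mul1r mulN1r.
  by rewrite (_ : \prod_i (sg i + - 2 * n) = \prod_i (sg i - 2 * n)); [lra|apply: eq_bigr => i _; ring].
Qed.

(** * Comparison of two densities under a change of coordinates *)

Section local_estimate.
Context {R : realType} {m : nat}.
Variables (U U' : set 'rV[R]_m) (t s : 'rV[R]_m -> 'rV[R]_m) (w w' : 'rV[R]_m -> R).
Hypotheses (oU : open U) (oU' : open U').
Hypothesis tU : forall z, U z -> U' (t z).
Hypothesis sU : forall z, U' z -> U (s z).
Hypothesis ts : forall z, U z -> s (t z) = z.
Hypothesis st : forall z, U' z -> t (s z) = z.
Hypothesis cs : forall z, U' z -> {for z, continuous s}.
Hypothesis lin : forall p, U p -> exists A B : 'M[R]_m, [/\ A *m B = 1%:M,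
  forall e, 0 < e -> exists2 r : R, 0 < r & forall v, `|v| < r -> `|t (p + v) - t p - v *m A| <= e * `|v|,
  forall e, 0 < e -> exists2 r : R, 0 < r & forall v, `|v| < r -> `|s (t p + v) - p - v *m B| <= e * `|v| &
  w p = `|\det A| * w' (t p)].
Hypothesis cw : forall z, U z -> {for z, continuous w}.
Hypothesis cw' : forall z, U' z -> {for z, continuous w'}.
Hypothesis w0 : forall z, U z -> 0 <= w z.
Hypothesis w'0 : forall z, U' z -> 0 <= w' z.

Local Notation T := (borel 'rV[R]_m).
Local Notation lam := (@lam R m).

Let mU : measurable (U : set T). Proof. exact: borel_open. Qed.
Let mU' : measurable (U' : set T). Proof. exact: borel_open. Qed.
Let mw : measurable_fun (U : set T) (w : T -> R). Proof. exact: continuous_on_borelR. Qed.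
Let mw' : measurable_fun (U' : set T) (w' : T -> R). Proof. exact: continuous_on_borelR. Qed.
Let ms : measurable_fun (U' : set T) (s : T -> T). Proof. exact: continuous_on_borel. Qed.
Let mid : measurable_fun (U : set T) (id : T -> T). Proof. exact: measurable_id. Qed.

Let nu1 : {measure set T -> \bar R} := dpush_measure lam mU mid mw w0.
Let nu2 : {measure set T -> \bar R} := dpush_measure lam mU' ms mw' w'0.

(** On a small box [Q] near [p] both maps are close to their linearizations. So the preimage of [Q]
    under [s] lies between affine preimages of a narrowed box [Qm] and a widened box [Qp']:
    differentiability of [t] gives the outer inclusion, that of [s] the inner one. The densities are
    almost constant there, and their values at [p] and [t p] are related by the determinant. *)
Lemma local_estimate (a b : 'rV[R]_m) (e : R) (p : 'rV[R]_m) : (forall i, a 0 i < b 0 i) -> U p -> 0 < e ->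
  exists2 h0 : R, 0 < h0 & forall h (c : 'rV[R]_m), 0 < h -> h < h0 ->
      (forall i, c 0 i <= p 0 i <= c 0 i + h * (b 0 i - a 0 i)) ->
      let Q := box c (c + h *: (b - a)) in
      (nu2 Q <= nu1 Q + e%:E * lam Q /\ nu1 Q <= nu2 Q + e%:E * lam Q)%E.
Proof.
move=> ab Up e0; have [A [B [AB linA linB wE]]] := lin Up.
pose sg i := b 0 i - a 0 i.
have sg0 i : 0 < sg i by rewrite subr_gt0.
pose d := `|\det A|; pose wp' := w' (t p).
have [n [n0 nsg D1 D2]] := density_margin d wp' sg0 e0.
pose C := `|b - a| + 1; have C0 : 0 < C by rewrite ltr_pwDr.
pose KA := \sum_i \sum_j `|A i j| + 1; pose KB := \sum_i \sum_j `|B i j| + 1.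
have sum0 (X : 'M[R]_m) : 0 <= \sum_i \sum_j `|X i j| by rewrite !sumr_ge0 // => i _; rewrite sumr_ge0.
have KA0 : 0 < KA by rewrite ltr_wpDl.
have KB0 : 0 < KB by rewrite ltr_wpDl.
have boundA (v : 'rV[R]_m) : `|v *m A| <= KA * `|v|.
  by apply: (le_trans (mulmx_bound _ _)); apply: ler_wpM2r => //; rewrite lerDl.
have boundB (v : 'rV[R]_m) : `|v *m B| <= KB * `|v|.
  by apply: (le_trans (mulmx_bound _ _)); apply: ler_wpM2r => //; rewrite lerDl.
have [rU rU0 HU] := open_radius oU Up.
have [rU' rU'0 HU'] := open_radius oU' (tU Up).
have [rw rw0 Hw] := continuous_radius (cw Up) n0.
have [rw' rw'0 Hw'] := continuous_radius (cw' (tU Up)) n0.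
(* With these slopes the linearization errors over [Q] move points by at most [h * n / 2] after
   multiplication by [B], respectively directly for [s]. *)
pose eA := n / (2 * KB * C); pose eB := n / (2 * KA * C).
have eA0 : 0 < eA by rewrite divr_gt0 // !mulr_gt0.
have eB0 : 0 < eB by rewrite divr_gt0 // !mulr_gt0.
have [rA rA0 HA] := linA _ eA0; have [rB rB0 HB] := linB _ eB0.
pose rho := Num.min (Num.min rU rw) (Num.min rA (Num.min (Num.min rU' rw') rB / (KA + eA))).
have Ke : 0 < KA + eA by rewrite addr_gt0.
have rho0 : 0 < rho by rewrite !lt_min rU0 rw0 rA0 divr_gt0 // !lt_min rU'0 rw'0 rB0.
exists (rho / C); first by rewrite divr_gt0.
move=> h c h0 hh0 pc Q.
have hC : h * C < rho by rewrite -ltr_pdivlMr.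
have [[hU hw] [hA hK]] : (h * C < rU /\ h * C < rw) /\ (h * C < rA /\
    h * C < Num.min (Num.min rU' rw') rB / (KA + eA)).
  by move: hC; rewrite /rho !lt_min -!andbA => /and4P[-> -> -> ?].
move: hK; rewrite ltr_pdivlMr // !lt_min -!andbA => /and3P[hU' hw' hB].
have Kpos x : 0 <= x <= h * C -> KA * x <= h * C * (KA + eA) /\ eA * x + KA * x <= h * C * (KA + eA).
  exact: slope_bound (ltW KA0) (ltW eA0).
have QC q : Q q -> `|q - p| <= h * C.
  exact: box_diam (ltW h0) pc.
have QU : Q `<=` U by move=> q /QC qC; apply: HU; exact: le_lt_trans hU.
have mQ : measurable (Q : set T) by exact: measurable_box.
pose Qp' := box (c - const_mx (h * n)) (c + h *: (b - a) + const_mx (h * n)).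
pose Qm := box (c + const_mx (h * n)) (c + h *: (b - a) - const_mx (h * n)).
have mQp : measurable (Qp' : set T) by exact: measurable_box.
have mQm : measurable (Qm : set T) by exact: measurable_box.
(* The affine approximation of [s] at [t p]. *)
pose E (z : 'rV[R]_m) := p + (z - t p) *m B.
have hm0 : 0 <= h ^+ m by rewrite exprn_ge0 // ltW.
have lamQ : lam Q = (h ^+ m * \prod_i sg i)%:E.
  rewrite lam_box => [|i]; last by rewrite !mxE lerDl; apply: mulr_ge0; apply: ltW => //; exact: sg0.
  congr (_%:E); rewrite -[X in h ^+ X]card_ord -prodr_const -big_split /=.
  by apply: eq_bigr => i _; rewrite !mxE /sg; ring.
have lamQp : lam Qp' = (h ^+ m * \prod_i (sg i + 2 * n))%:E.
  rewrite lam_box => [|i]; last first.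
    rewrite !mxE; have h1 : 0 <= h * n by apply: mulr_ge0; exact: ltW.
    have h2 : 0 <= h * (b 0 i - a 0 i) by apply: mulr_ge0; apply: ltW => //; exact: sg0.
    exact: subr_le_addr2.
  congr (_%:E); rewrite -[X in h ^+ X]card_ord -prodr_const -big_split /=.
  by apply: eq_bigr => i _; rewrite !mxE /sg; ring.
have lamQm : lam Qm = (h ^+ m * \prod_i (sg i - 2 * n))%:E.
  rewrite lam_box => [|i]; last first.
    rewrite !mxE; have : h * (2 * n) <= h * (b 0 i - a 0 i) by rewrite ler_pM2l // ltW // nsg.
    exact: addr_le_subr2.
  congr (_%:E); rewrite -[X in h ^+ X]card_ord -prodr_const -big_split /=.
  by apply: eq_bigr => i _; rewrite !mxE /sg; ring.
have sub1 : U' `&` s @^-1` Q `<=` [set z | Qp' (E z)] /\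
    forall z, (U' `&` s @^-1` Q) z -> w' z <= wp' + n.
  split=> [z [U'z Qsz]|z [U'z Qsz]]; set q := s z in Qsz; have qC := QC _ Qsz.
  - have qA : `|q - p| < rA by exact: le_lt_trans hA.
    have := HA _ qA; rewrite subrKC /q st // => H1.
    have H2 : `|E z - q| <= h * n / 2.
      have -> : E z - q = (z - t p - (q - p) *m A) *m B.
        by rewrite mulmxBl -mulmxA AB mulmx1 /E opprB addrCA addrA.
      apply: (le_trans (boundB _)); apply: (@le_trans _ _ (KB * (eA * (h * C)))).
        by rewrite ler_pM2l //; apply: (le_trans H1); rewrite ler_pM2l.
      by rewrite le_eqVlt; apply/orP; left; apply/eqP; rewrite /eA; field; rewrite !gt_eqF.
    have hn : 0 < h * n by rewrite mulr_gt0.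
    move=> i; have := norm_coord (E z - q) i; have := Qsz i; rewrite !mxE.
    move=> /andP[q1 q2] /le_trans /(_ H2); rewrite -/q in q1 q2 *.
    by move=> h1; apply: shift_out hn _ h1; rewrite q1 q2.
  - have qA : `|q - p| < rA by exact: le_lt_trans hA.
    have := HA _ qA; rewrite subrKC /q st // => H1.
    have H3 : `|z - t p| < rw'.
      apply: le_lt_trans hw'.
      rewrite -(subrK ((q - p) *m A) (z - t p)); apply: (le_trans (ler_normD _ _)).
      have [|_ K2] := Kpos `|q - p|; first by rewrite normr_ge0.
      by apply: le_trans K2; apply: lerD.
    by have := Hw' _ H3; rewrite ltr_distl => /andP[_ /ltW].
have sub2 : [set z | Qm (E z)] `<=` U' `&` s @^-1` Q /\ forall z, Qm (E z) -> wp' - n <= w' z.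
  have BA : B *m A = 1%:M by exact: mulmx1C.
  have hn : 0 < h * n by rewrite mulr_gt0.
  have zE z : z = t p + (E z - p) *m A.
    by rewrite /E (addrC p) addrK -mulmxA BA mulmx1 addrC subrK.
  have QmQ z : Qm z -> Q z.
    by move=> H i; have := H i; rewrite !mxE; exact: shift_weak.
  have zb z : Qm (E z) -> `|z - t p| <= KA * (h * C) /\ `|E z - p| <= h * C.
    move=> /QmQ /QC EC; split=> //; rewrite {1}(zE z) (addrC (t p)) addrK.
    by apply: (le_trans (boundA _)); rewrite ler_pM2l.
  have hC0 : 0 <= h * C <= h * C by rewrite lexx andbT mulr_ge0 // ltW.
  have [K1 _] := Kpos _ hC0.
  split=> [z Ez|z Ez]; have [z1 z2] := zb z Ez; last first.
    have /Hw' : `|z - t p| < rw' by apply: le_lt_trans hw'; exact: le_trans z1 K1.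
    by rewrite ltr_distl => /andP[/ltW].
  have U'z : U' z by apply: HU'; apply: le_lt_trans hU'; exact: le_trans z1 K1.
  split=> //; rewrite /preimage /=.
  have /HB : `|z - t p| < rB by apply: le_lt_trans hB; exact: le_trans z1 K1.
  rewrite subrKC => H1.
  have H2 : `|s z - E z| <= h * n / 2.
    have -> : s z - E z = s z - p - (z - t p) *m B by rewrite /E opprD addrA.
    apply: (le_trans H1); apply: (@le_trans _ _ (eB * (KA * (h * C)))); first by rewrite ler_pM2l.
    by rewrite le_eqVlt; apply/orP; left; apply/eqP; rewrite /eB; field; rewrite !gt_eqF.
  move=> i; have := norm_coord (s z - E z) i; have := Ez i; rewrite !mxE.
  move=> /andP[q1 q2] /le_trans /(_ H2).
  by move=> h1; apply: shift_in hn _ h1; rewrite q1 q2.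
have mUQ : measurable (U' `&` s @^-1` Q : set T) by exact: ms.
have mwU : measurable_fun (U' `&` s @^-1` Q : set T) (w' : T -> R) by apply: measurable_funS mw'.
have nu1E : nu1 Q = (\int[lam]_(z in Q) (w z)%:E)%E.
  by rewrite /nu1 dpush_measureE preimage_id setIC; congr (integral _ _ _); apply/setIidPl.
have mwQ : measurable_fun (Q : set T) (w : T -> R) by apply: measurable_funS mw.
have wQ q : Q q -> w p - n <= w q <= w p + n.
  move=> Qq; have /Hw : `|q - p| < rw by apply: le_lt_trans (QC _ Qq) hw.
  by rewrite ltr_distl => /andP[/ltW -> /ltW ->].
have wp0 : 0 <= w p by exact: w0.
have wp'0 : 0 <= wp' by exact: w'0 (tU Up).
have d0 : 0 <= d by exact: normr_ge0.
split.
- apply: (@le_trans _ _ ((wp' + n)%:E * (d%:E * lam Qp'))%E).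
    rewrite -(lam_affine_set p (t p) AB mQp) /nu2 dpush_measureE.
    apply: le_trans (ge0_integral_le_cst mUQ _ mwU _) _; last first.
    + apply: lee_wpmul2l; first by rewrite lee_fin addr_ge0 // ltW.
      apply: le_measure; rewrite ?inE //; last exact: sub1.1.
      exact: measurable_preimage_affine.
    + by move=> z Hz; rewrite sub1.2 // andbT; exact: w'0 Hz.1.
    + by rewrite addr_ge0 // ltW.
  (* Truncated at 0, because [cst_le_integral] asks for a nonnegative constant. *)
  pose th := Num.max 0 (w p - n).
  apply: (@le_trans _ _ (th%:E * lam Q + e%:E * lam Q)%E); last first.
    rewrite nu1E leeD2r //; apply: cst_le_integral => //; first by rewrite le_max lexx.
    by move=> z Qz; rewrite ge_max w0 /=; [case/andP: (wQ z Qz)|exact: QU].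
  rewrite lamQ lamQp -!EFinM -EFinD lee_fin.
  have th1 : d * wp' - n <= th by rewrite /th le_max wE lexx orbT.
  have P0 : 0 <= \prod_i sg i by apply: prodr_ge0 => i _; exact: ltW.
  have := ler_wpM2r P0 th1 => T1.
  have := ler_wpM2l hm0 (le_trans D1 (lerD T1 (lexx _))); lra.
- pose th := Num.max 0 (wp' - n).
  apply: (@le_trans _ _ ((w p + n)%:E * lam Q)%E).
    rewrite nu1E; apply: ge0_integral_le_cst => //; first by rewrite addr_ge0 // ltW.
    by move=> z Qz; case/andP: (wQ z Qz) => _ ->; rewrite andbT; apply: w0; exact: QU.
  apply: (@le_trans _ _ (th%:E * (d%:E * lam Qm) + e%:E * lam Q)%E); last first.
    rewrite leeD2r // -(lam_affine_set p (t p) AB mQm) /nu2 dpush_measureE.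
    pose Em : set T := [set z | Qm (E z)].
    have mEm : measurable Em by exact: measurable_preimage_affine.
    apply: (@le_trans _ _ (\int[lam]_(z in Em) (w' z)%:E)%E).
      apply: cst_le_integral => //; first by rewrite le_max lexx.
        by apply: measurable_funS mwU => //; exact: sub2.1.
      move=> z Ez; rewrite ge_max sub2.2 // andbT; by apply: w'0; case: (sub2.1 _ Ez).
    apply: ge0_subset_integral => //; first exact/measurable_EFinP.
      by move=> z [U'z _]; rewrite lee_fin w'0.
    exact: sub2.1.
  rewrite lamQ lamQm -!EFinM -EFinD lee_fin wE -/d -/wp'.
  have th1 : wp' - n <= th by rewrite /th le_max lexx orbT.
  have P0 : 0 <= \prod_i (sg i - 2 * n) by apply: prodr_ge0 => i _; rewrite subr_ge0 ltW.
  have := ler_wpM2r P0 (ler_wpM2r d0 th1) => T1.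
  have := ler_wpM2l hm0 (le_trans D2 (lerD T1 (lexx _))); lra.
Qed.

Let nu_le_box (a b : 'rV[R]_m) : (forall i, a 0 i < b 0 i) ->
  (forall z : 'rV[R]_m, (forall i, a 0 i <= z 0 i <= b 0 i) -> U z) ->
  nu1 (box a b) = nu2 (box a b).
Proof.
move=> ab abU; apply/le_anti/andP; split; apply: box_measure_le => // e p e0 /abU Up;
  by have [h0 h00 H] := local_estimate ab Up e0; exists h0 => // h c h1 h2 /(H h c h1 h2)[].
Qed.

(** The density is locally bounded, and finiteness passes from the pieces of a bisection to the
    whole box. *)
Let nu1_fin_box (a b : 'rV[R]_m) : (forall i, a 0 i < b 0 i) ->
  (forall z : 'rV[R]_m, (forall i, a 0 i <= z 0 i <= b 0 i) -> U z) ->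
  (nu1 (box a b) < +oo)%E.
Proof.
move=> ab abU; apply: (@box_bisection R m (fun A => (nu1 A < +oo)%E)) => //.
  move=> c d cd H; rewrite (box_split cd) fsbig_finite; last exact: finite_finset.
  by apply: lte_sum_pinfty => i _; exact: H.
move=> p /abU Up; have [r r0 Hr] := open_radius oU Up.
have [r1 r10 Hr1] := continuous_radius (cw Up) ltr01.
pose C := `|b - a| + 1; have C0 : 0 < C by rewrite ltr_pwDr.
exists (Num.min r r1 / C); first by rewrite divr_gt0 // lt_min r0 r10.
move=> h c h0; rewrite ltr_pdivlMr // lt_min => /andP[hr hr1] pc.
set Q := box _ _; have mQ : measurable (Q : set T) by exact: measurable_box.
have QC q : Q q -> `|q - p| <= h * C.
  exact: box_diam (ltW h0) pc.
have QU q : Q q -> U q by move=> /QC qC; apply: Hr; exact: le_lt_trans hr.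
rewrite /nu1 dpush_measureE preimage_id setIC (_ : Q `&` U = Q); last exact/setIidPl.
apply: (@le_lt_trans _ _ ((w p + 1)%:E * lam Q)%E); last first.
  rewrite lam_box -?EFinM ?ltry // => i.
  by rewrite !mxE lerDl mulr_ge0 // ltW // subr_gt0.
apply: ge0_integral_le_cst => //.
- by rewrite addr_ge0 // w0.
- by apply: measurable_funS mw.
- move=> q Qq; rewrite w0 /=; last exact: QU.
  have /Hr1 : `|q - p| < r1 by apply: le_lt_trans (QC _ Qq) hr1.
  by rewrite ltr_distl => /andP[_ /ltW].
Qed.

(** Restricted to the box, both measures are finite and agree on every box, since intersections of
    boxes are boxes, possibly degenerate and then empty. *)
Let nu_eq_sub (a b : 'rV[R]_m) : (forall i, a 0 i < b 0 i) ->
  (forall z : 'rV[R]_m, (forall i, a 0 i <= z 0 i <= b 0 i) -> U z) ->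
  forall A : set T, measurable A -> A `<=` box a b -> nu1 A = nu2 A.
Proof.
move=> ab abU A mA AB; have mB := measurable_box a b.
have H : forall D : set T, measurable D -> mrestr nu1 mB D = mrestr nu2 mB D.
  apply: measure_unique_boxes => c d; rewrite /= /mrestr; last first.
    by apply: le_lt_trans (nu1_fin_box ab abU); apply: le_measure; rewrite ?inE //;
      apply: measurableI => //; exact: measurable_box.
  rewrite boxI; set a' := \row_i _; set b' := \row_i _.
  have [lt|/forallPn[i]] := boolP [forall i, a' 0 i < b' 0 i]; last first.
    rewrite -leNgt => ba.
    have E0 (nu : {measure set T -> \bar R}) : nu (box a' b') = 0%E by rewrite (box_degenerate ba) measure0.
    by transitivity (0%E : \bar R); [exact: (E0 nu1)|exact/esym/(E0 nu2)].
  apply: nu_le_box => [i|z Hz]; first exact: (forallP lt).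
  apply: abU => i; have := Hz i; rewrite !mxE ge_max le_min.
  by move=> /andP[/andP[_ ->] /andP[_ ->]].
by have := H A mA; rewrite /mrestr; have -> : A `&` box a b = A by exact/setIidPl.
Qed.

(** Both measures live on [U], which is cut into countably many disjoint measurable parts of boxes
    with closure in [U]. *)
Let nu_eq (A : set T) : measurable A -> nu1 A = nu2 A.
Proof.
move=> mA; have [P [UE HP]] := @open_bigcup_boxes R m U oU.
pose G (k : nat * 'rV[rat]_m) : set T :=
  box (\row_i (ratr (k.2 0 i) - k.1.+1%:R^-1)) (\row_i (ratr (k.2 0 i) + k.1.+1%:R^-1)).
pose F n : set T := if unpickle n is Some k then (if pselect (P k) then G k else set0) else set0.
have mF n : measurable (F n).
  rewrite /F; case: (unpickle n) => [k|]; last exact: measurable0.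
  by case: (pselect (P k)) => Pk /=; [exact: measurable_box|exact: measurable0].
have UF : U = \bigcup_n seqDU F n.
  rewrite -seqDU_bigcup_eq UE; apply/seteqP; split=> z [k].
    by move=> Pk Gk; exists (pickle k) => //; rewrite /F pickleK; case: pselect.
  by move=> _; rewrite /F; case: unpickle => [k'|//]; case: pselect => // Pk Gk; exists k'.
have FE n (D : set T) : measurable D -> D `<=` F n -> nu1 D = nu2 D.
  move=> mD; rewrite /F; case: (unpickle n) => [k|]; last by rewrite subset0 => ->; rewrite !measure0.
  case: (pselect (P k)) => Pk; rewrite [X in _ `<=` X]/=; last by rewrite subset0 => ->; rewrite !measure0.
  have k0 : 0 < k.1.+1%:R^-1 :> R by rewrite invr_gt0.
  apply: nu_eq_sub => // [i|z Hz].
    by rewrite !mxE ltrD2l; apply: lt_trans k0; rewrite oppr_lt0.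
  by apply: (HP _ Pk) => i; have := Hz i; rewrite !mxE.
have mS n : measurable (seqDU F n) by exact: seqDU_measurable.
have nuE (nu : {measure set T -> \bar R}) : nu (A `&` U) = (\sum_(n <oo) nu (A `&` seqDU F n))%E.
  rewrite UF setI_bigcupr measure_semi_bigcup //.
  - by move=> n; exact: measurableI.
  - by apply: trivIset_setIl; exact: trivIset_seqDU.
  - by apply: bigcup_measurable => n _; exact: measurableI.
have -> : nu1 A = nu1 (A `&` U).
  by rewrite /nu1 !dpush_measureE !preimage_id; congr (integral _ _ _); apply/seteqP; split=> z /= [] // ? [].
have -> : nu2 A = nu2 (A `&` U).
  rewrite /nu2 !dpush_measureE; congr (integral _ _ _).
  by apply/seteqP; split=> z /= [U'z]; [move=> ?; do !split => //; exact: sU|case].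
rewrite !nuE; apply: eq_eseriesr => n _; apply: (FE n); first exact: measurableI.
by move=> z [_]; exact: subset_seqDU.
Qed.

Theorem change_of_variables (f : T -> \bar R) : measurable_fun setT f -> (forall z, (0 <= f z)%E) ->
  (\int[lam]_(z in U) (f z * (w z)%:E) = \int[lam]_(z in U') (f (s z) * (w' z)%:E))%E.
Proof.
move=> mf f0; rewrite -(ge0_integral_dpush lam mU mid mw w0 mf f0).
rewrite -(ge0_integral_dpush lam mU' ms mw' w'0 mf f0).
apply: eq_measure_integral => A mA _; exact: nu_eq.
Qed.

End local_estimate.

(** * Charts and the Riemannian measure *)

Section smooth_entries.
Context {R : realType} {m : nat}.

Lemma derivable_entry p q (f : 'rV[R]_m -> 'M[R]_(p, q)) (y v : 'rV[R]_m) i j : derivable f y v ->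
  derivable (fun z => f z i j) y v /\ 'D_v (fun z => f z i j) y = ('D_v f y) i j.
Proof.
move=> df; have cf : h^-1 *: (f (h *: v + y) - f y) @[h --> 0^'] --> 'D_v f y by exact: df.
have cc := cvg_comp _ _ cf (@coord_continuous R p q i j ('D_v f y)).
have E : (fun h : R => h^-1 *: (f (h *: v + y) i j - f y i j)) =
    (fun M : 'M[R]_(p, q) => M i j) \o (fun h : R => h^-1 *: (f (h *: v + y) - f y)).
  by apply/funext => h /=; rewrite !mxE.
have ce : h^-1 *: (f (h *: v + y) i j - f y i j) @[h --> 0^'] --> ('D_v f y) i j by rewrite E.
by split; [apply/cvg_ex; exists (('D_v f y) i j)|exact: cvg_lim].
Qed.

Lemma C1_entry p q (U : set 'rV[R]_m) (f : 'rV[R]_m -> 'M[R]_(p, q)) i j : open U ->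
  Ck_on 1 U f -> C1 U (fun z => f z i j).
Proof.
move=> oU [_ df]; apply: C1_partials => // k y Uy.
  by have [/(_ y Uy) /(derivable_entry i j)[]] := df k.
have [dk [ck _]] := df k.
apply: (@near_continuous _ _ _ (fun z => ('D_'e_k f z) i j)).
  by apply: filterS (open_near oU Uy) => z /dk /(derivable_entry i j)[].
by apply: (@continuous_comp _ _ _ ('D_'e_k f) (fun M : 'M[R]_(p, q) => M i j));
  [exact: ck|exact: coord_continuous].
Qed.

Lemma derive_entry p q (U : set 'rV[R]_m) (f : 'rV[R]_m -> 'M[R]_(p, q)) i j k y :
  Ck_on 1 U f -> U y -> 'D_'e_k (fun z => f z i j) y = ('D_'e_k f y) i j.
Proof. by move=> [_ df] Uy; have [/(_ y Uy) /(derivable_entry i j)[]] := df k. Qed.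

Lemma C1_derive_entry p q (U : set 'rV[R]_m) (f : 'rV[R]_m -> 'M[R]_(p, q)) i j k : open U ->
  smooth_on U f -> C1 U ('D_'e_k (fun z => f z i j)).
Proof.
move=> oU sf; apply: (@C1_eq _ _ _ _ (fun z => ('D_'e_k f z) i j)) => //.
  by move=> z Uz; exact: derive_entry (sf 1%N) Uz.
by apply: C1_entry => //; have [_ /(_ k)[]] := sf 2%N.
Qed.

Lemma jacobianE p (f : 'rV[R]_m -> 'rV[R]_p) y i a : differentiable f y ->
  'J f y i a = 'D_'e_i (fun z => f z 0 a) y.
Proof.
move=> df; have /(derivable_entry 0 a)[_ ->] : derivable f y 'e_i by exact: diff_derivable.
by rewrite deriveEjacobian // -rowE [RHS]mxE.
Qed.

Lemma C1_differentiable p (U : set 'rV[R]_m) (f : 'rV[R]_m -> 'rV[R]_p) y :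
  (forall a, C1 U (fun z => f z 0 a)) -> U y -> differentiable f y.
Proof. by move=> Cf Uy; apply: differentiable_row => a; exact: (C1_diff (Cf a) Uy). Qed.

Lemma differential_estimate p (f : 'rV[R]_m -> 'rV[R]_p) (y : 'rV[R]_m) (e : R) : differentiable f y -> 0 < e ->
  exists2 r : R, 0 < r & forall v : 'rV[R]_m, `|v| < r -> `|f (y + v) - f y - v *m 'J f y| <= e * `|v|.
Proof.
move=> df e0; have := iffLR (eqaddoP _ _ _ _) (diff_locally df) => /(_ e e0).
move=> /nbhs_ballP[r /= r0 Hr]; exists r => // v vr.
have := Hr v; rewrite -ball_normE /= sub0r normrN => /(_ vr).
by rewrite !fctE /= opprD addrA (addrC v) -deriveE // deriveEjacobian.
Qed.

Lemma jacobian_inverse (U U' : set 'rV[R]_m) (t s : 'rV[R]_m -> 'rV[R]_m) y : open U ->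
  (forall a, C1 U (fun z => t z 0 a)) -> (forall a, C1 U' (fun z => s z 0 a)) ->
  (forall z, U z -> U' (t z)) -> (forall z, U z -> s (t z) = z) -> U y ->
  'J t y *m 'J s (t y) = 1%:M.
Proof.
move=> oU Ct Cs tU st Uy; have dt := C1_differentiable Ct Uy.
have ds := C1_differentiable Cs (tU _ Uy).
apply/matrixP => i j; rewrite !mxE.
have : 'D_'e_i ((fun z => s z 0 j) \o t) y = 'D_'e_i (fun z : 'rV[R]_m => z 0 j) y.
  by apply: (derive_eq_on _ oU Uy) => z Uz /=; rewrite st.
rewrite derive_comp //; last exact: (C1_diff (Cs j) (tU _ Uy)).
rewrite derive_coord mxE eqxx (eq_sym j) => <-.
by apply: eq_bigr => a _; congr (_ * _); exact: jacobianE.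
Qed.

End smooth_entries.

(* Cholesky decomposition, with the Schur complement in the inductive step. *)
Lemma posdef_cong (R : realType) m (g : 'M[R]_m) : g^T = g ->
  (forall v : 'rV[R]_m, v != 0 -> 0 < (v *m g *m v^T) 0 0) ->
  exists2 A : 'M[R]_m, A \in unitmx & g = A *m A^T.
Proof.
elim: m g => [|m IH] g.
  by move=> _ _; exists 1%:M; [exact: unitmx1|apply/matrixP => -[]].
move=> gT gpos; pose a : 'M[R]_1 := @ulsubmx _ 1 m 1 m g; pose b : 'M[R]_(1, m) := @ursubmx _ 1 m 1 m g.
pose c : 'M[R]_(m, 1) := @dlsubmx _ 1 m 1 m g; pose D : 'M[R]_m := @drsubmx _ 1 m 1 m g.
have gE : g = block_mx a b c D :> 'M[R]_(1 + m) by rewrite (@submxK _ 1 m 1 m).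
have cE : c = b^T by apply/matrixP => i j; rewrite /c /b !mxE -[in LHS]gT mxE.
have DT : D^T = D by apply/matrixP => i j; rewrite /D !mxE -[in LHS]gT mxE.
pose al := a 0 0; have aE : a = al%:M by rewrite [LHS]mx11_scalar.
have q (v : 'rV[R]_1) (w : 'rV[R]_m) : (row_mx v w : 'rV[R]_(1 + m)) *m g *m (row_mx v w)^T =
    v *m a *m v^T + w *m b^T *m v^T + (v *m b *m w^T + w *m D *m w^T).
  by rewrite gE cE (@mul_row_block _ 1 1 m 1 m) (@tr_row_mx _ 1 1 m) (@mul_row_col _ 1 1 m 1) !mulmxDl.
have al0 : 0 < al.
  have := gpos (row_mx 1%:M 0 : 'rV[R]_(1 + m)); rewrite q !mul0mx !trmx0 !mulmx0 trmx1 mulmx1 mul1mx !addr0.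
  apply; apply/eqP => /(congr1 (@lsubmx _ 1 1 m)); rewrite row_mxKl => /matrixP /(_ 0 0).
  by rewrite !mxE /= => /eqP; rewrite oner_eq0.
pose S := D - al^-1 *: (b^T *m b).
have [||A uA SA] := IH S.
- by rewrite /S linearB /= DT linearZ /= trmx_mul trmxK.
- move=> w w0; pose v : 'rV[R]_1 := - (al^-1 *: (w *m b^T)).
  have := gpos (row_mx v w : 'rV[R]_(1 + m)); rewrite q => /(_ _).
  have E : v *m a *m v^T + w *m b^T *m v^T + (v *m b *m w^T + w *m D *m w^T) = w *m S *m w^T.
    rewrite aE mul_mx_scalar /v scalerN scalerA divff ?gt_eqF // scale1r !mulNmx addNr add0r.
    by rewrite /S mulmxBr mulmxBl addrC -scalemxAl -!scalemxAr -!scalemxAl mulmxA.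
  rewrite E; apply; apply/eqP => /(congr1 (@rsubmx _ 1 1 m)); rewrite row_mxKr => /eqP.
  by rewrite linear0 (negbTE w0).
have sa : Num.sqrt al * Num.sqrt al = al by rewrite -expr2 sqr_sqrtr // ltW.
have sa0 : Num.sqrt al != 0 by rewrite gt_eqF // sqrtr_gt0.
exists (block_mx (Num.sqrt al)%:M 0 ((Num.sqrt al)^-1 *: b^T) A : 'M[R]_(1 + m)).
  by rewrite unitmxE (@det_lblock _ 1 m) det_scalar1 unitrM unitfE sa0 /= -unitmxE.
rewrite (@tr_block_mx _ 1 m 1 m) (@mulmx_block _ 1 m 1 m 1 m) gE cE; apply: (f_equal4 (@block_mx R 1 m 1 m)).
- by rewrite tr_scalar_mx -scalar_mxM sa trmx0 mulmx0 addr0.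
- by rewrite mul0mx addr0 linearZ /= trmxK mul_scalar_mx scalerA divff // scale1r.
- by rewrite trmx0 mulmx0 addr0 tr_scalar_mx mul_mx_scalar scalerA divff // scale1r.
- rewrite -SA /S linearZ /= trmxK -scalemxAl -scalemxAr scalerA -invfM sa.
  by rewrite addrC subrK.
Qed.

(* The library puts a measurable structure on a topological space only if the space is pointed. *)
Definition pointed_at (T : topologicalType) (x0 : T) : Type := T.

HB.instance Definition _ (T : topologicalType) (x0 : T) := Topological.copy (pointed_at x0) T.
HB.instance Definition _ (T : topologicalType) (x0 : T) := isPointed.Build (pointed_at x0) x0.

Section charts.
Context {R : realType} {m : nat} {M : riemannian_manifold R m}.
Implicit Types (k l : nat).

Definition phi k : M -> 'rV[R]_m := cmap (atlas M k).
Definition psi k : 'rV[R]_m -> M := cinv (atlas M k).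
Definition dom k : set M := cdom (atlas M k).
Definition cod k : set 'rV[R]_m := ccod (atlas M k).
Definition overlap k l : set 'rV[R]_m := [set y | cod k y /\ dom l (psi k y)].
Definition transition k l : 'rV[R]_m -> 'rV[R]_m := phi l \o psi k.
Definition vol_density k (z : 'rV[R]_m) : R := Num.sqrt (\det (metric M k z)).

Lemma dom_open k : open (dom k). Proof. exact: cdom_open. Qed.
Lemma cod_open k : open (cod k). Proof. exact: ccod_open. Qed.
Lemma phi_cod k p : dom k p -> cod k (phi k p). Proof. exact: cmap_cod. Qed.
Lemma psi_dom k y : cod k y -> dom k (psi k y). Proof. exact: cinv_dom. Qed.
Lemma phiK k p : dom k p -> psi k (phi k p) = p. Proof. exact: cmapK. Qed.
Lemma psiK k y : cod k y -> phi k (psi k y) = y. Proof. exact: cinvK. Qed.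

Lemma phi_continuous k p : dom k p -> {for p, continuous (phi k)}.
Proof. exact: cmap_continuous. Qed.

Lemma psi_continuous k y : cod k y -> {for y, continuous (psi k)}.
Proof. exact: cinv_continuous. Qed.

Lemma overlap_open k l : open (overlap k l).
Proof.
exact: (@continuous_on_preimage _ M (cod k) (psi k) (dom l) (@cod_open k) (@psi_continuous k) (@dom_open l)).
Qed.

Lemma transition_overlap k l y : overlap k l y -> overlap l k (transition k l y).
Proof.
by move=> [ky ly]; split; [exact: phi_cod|rewrite /transition /= phiK //; exact: psi_dom].
Qed.

Lemma transitionK k l y : overlap k l y -> transition l k (transition k l y) = y.
Proof. by move=> [ky ly]; rewrite /transition /= phiK // psiK. Qed.

Lemma psi_transition k l y : overlap k l y -> psi l (transition k l y) = psi k y.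
Proof. by move=> [ky ly]; rewrite /transition /= phiK. Qed.

Lemma transition_C1 k l a : C1 (overlap k l) (fun z => transition k l z 0 a).
Proof. by apply: C1_entry; [exact: overlap_open|exact: (atlas_smooth M k l 1%N)]. Qed.

Lemma transition_differentiable k l y : overlap k l y -> differentiable (transition k l) y.
Proof. by apply: C1_differentiable => a; exact: transition_C1. Qed.

Lemma transition_jacobian k l y : overlap k l y ->
  'J (transition k l) y *m 'J (transition l k) (transition k l y) = 1%:M.
Proof.
move=> oy; apply: (@jacobian_inverse _ _ (overlap k l) (overlap l k)) => //.
- exact: overlap_open.
- by move=> a; exact: transition_C1.
- by move=> a; exact: transition_C1.
- by move=> z; exact: transition_overlap.
- by move=> z; exact: transitionK.
Qed.

Lemma metric_factor k y : cod k y -> exists2 A : 'M[R]_m, A \in unitmx & metric M k y = A *m A^T.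
Proof.
by move=> ky; apply: posdef_cong => [|v v0]; [exact: Defs.metric_sym|exact: metric_pos].
Qed.

Lemma metric_unit k y : cod k y -> metric M k y \in unitmx.
Proof. by move=> /metric_factor[A uA ->]; rewrite unitmx_mul uA unitmx_tr. Qed.

Lemma metric_det_gt0 k y : cod k y -> 0 < \det (metric M k y).
Proof.
move=> /metric_factor[A uA ->]; rewrite det_mulmx det_tr lt0r mulf_neq0 -?expr2 ?sqr_ge0 //;
by rewrite -unitfE -unitmxE.
Qed.

Lemma metric_C1 k i j : C1 (cod k) (fun z => metric M k z i j).
Proof. by apply: C1_entry; [exact: cod_open|exact: (metric_smooth M k 1%N)]. Qed.

Lemma vol_density_gt0 k y : cod k y -> 0 < vol_density k y.
Proof. by move=> /metric_det_gt0; rewrite sqrtr_gt0. Qed.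

Lemma vol_density_C1 k : C1 (cod k) (vol_density k).
Proof.
apply: C1_sqrt; [exact: cod_open|exact: metric_det_gt0|].
by apply: C1_det => [|i j]; [exact: cod_open|exact: metric_C1].
Qed.

Lemma metric_transition k l y : overlap k l y ->
  metric M k y = 'J (transition k l) y *m metric M l (transition k l y) *m ('J (transition k l) y)^T.
Proof. by move=> [ky ly]; exact: metric_compat. Qed.

Lemma vol_density_transition k l y : overlap k l y ->
  vol_density k y = `|\det ('J (transition k l) y)| * vol_density l (transition k l y).
Proof.
move=> oy; rewrite /vol_density (metric_transition oy) !det_mulmx det_tr.
rewrite mulrAC -expr2 sqrtrM ?sqr_ge0 // sqrtr_sqr //.
Qed.

Lemma piece_dom k : piece k `<=` dom k. Proof. exact: subset_seqDU. Qed.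

Lemma piece_cover : \bigcup_k (piece k : set M) = setT.
Proof.
rewrite /piece -seqDU_bigcup_eq; apply/seteqP; split=> // p _.
by have [k kp] := atlas_cover p; exists k.
Qed.

Lemma chart_atP (p : M) : piece (chart_at p) p.
Proof.
rewrite /chart_at; case: xgetP => [k //|H].
have : (\bigcup_k (piece k : set M)) p by rewrite piece_cover.
by move=> [k _ /H].
Qed.

Lemma chart_at_dom p : dom (chart_at p) p. Proof. exact/piece_dom/chart_atP. Qed.

End charts.

Section measure.
Context {R : realType} {m : nat} {M : riemannian_manifold R m} (x0 : M).
Local Notation T := (borel 'rV[R]_m).
Local Notation lam := (@lam R m).
Local Notation cod := (@cod R m M).
Local Notation dom := (@dom R m M).
Local Notation psi := (@psi R m M).
Local Notation phi := (@phi R m M).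
Local Notation piece := (@piece R m M).
Local Notation overlap := (@overlap R m M).
Local Notation transition := (@transition R m M).
Local Notation vol_density := (@vol_density R m M).

Definition bman := borel (pointed_at x0).

Lemma bman_open (A : set M) : open A -> measurable (A : set bman).
Proof. by move=> oA; exact: (@borel_open (pointed_at x0)). Qed.

Lemma measurable_psi k : measurable_fun (cod k : set T) (psi k : T -> bman).
Proof.
apply: (@continuous_on_borel _ (pointed_at x0)); [exact: cod_open|].
by move=> y; exact: psi_continuous.
Qed.

Lemma measurable_piece k : measurable (piece k : set bman).
Proof. by apply: seqDU_measurable => j; exact: bman_open (dom_open j). Qed.

Definition pcod k : set T := cod k `&` psi k @^-1` piece k.

Lemma measurable_cod k : measurable (cod k : set T). Proof. by apply: borel_open; exact: cod_open. Qed.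

Lemma measurable_pcod k : measurable (pcod k).
Proof. exact: measurable_psi (measurable_cod k) _ (measurable_piece k). Qed.

Lemma measurable_vol_density k : measurable_fun (cod k : set T) (vol_density k : T -> R).
Proof.
apply: continuous_on_borelR; [exact: cod_open|].
by move=> y; exact: C1_continuous (vol_density_C1 k).
Qed.

Let psi_pcod k : measurable_fun (pcod k) (psi k : T -> bman).
Proof. by apply: measurable_funS (@measurable_psi k); [exact: measurable_cod|move=> z []]. Qed.

Let density_pcod k : measurable_fun (pcod k) (vol_density k : T -> R).
Proof. by apply: measurable_funS (@measurable_vol_density k); [exact: measurable_cod|move=> z []]. Qed.

Let density_ge0 k z : pcod k z -> 0 <= vol_density k z.
Proof. by move=> [/vol_density_gt0/ltW]. Qed.

(** The Riemannian measure: each Borel piece carries the image of its coordinate density, and the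
    countable atlas makes the sum a measure. *)
Definition mu : {measure set bman -> \bar R} :=
  mseries (fun k => dpush_measure lam (measurable_pcod k) (psi_pcod (k:=k)) (density_pcod (k:=k))
    (@density_ge0 k)) 0.

Lemma ge0_integral_mu (f : bman -> \bar R) : measurable_fun setT f -> (forall p, (0 <= f p)%E) ->
  (\int[mu]_p f p = \sum_(k <oo) \int[lam]_(z in pcod k) (f (psi k z) * (vol_density k z)%:E))%E.
Proof.
move=> mf f0; rewrite ge0_integral_measure_series //.
by apply: eq_eseriesr => k _; rewrite ge0_integral_dpush.
Qed.

(** The definition integrates over images of parts of the pieces under [phi k]; rewritten as
    preimages under [psi k], these are Borel sets of coordinates. *)
Lemma riemann_integralE (A : set bman) (f : bman -> \bar R) : measurable A -> measurable_fun setT f ->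
  (forall p, (0 <= f p)%E) -> riemann_integral (A : set M) f = (\int[mu]_(p in A) f p)%E.
Proof.
move=> mA mf f0; rewrite integral_mkcond ge0_integral_mu; last 2 first.
- by apply/(measurable_restrictT _ mA); exact: measurable_funS mf.
- by move=> p; apply: erestrict_ge0.
apply: eq_eseriesr => k _.
pose B : set T := pcod k `&` psi k @^-1` A.
have mB : measurable B by exact: psi_pcod (measurable_pcod k) _ mA.
transitivity (\int[lam]_(z in B) (f (psi k z) * (vol_density k z)%:E))%E; last first.
  rewrite /B integral_mkcondr; apply: eq_integral => z _; rewrite !patchE.
  rewrite [in RHS](_ : (psi k z \in A) = (z \in psi k @^-1` A)); last by apply/idP/idP; rewrite !inE.
  by case: ifP => _; rewrite ?mul0e.
rewrite lam_integral_tuple //; last 2 first.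
- apply: emeasurable_funM.
    apply: (measurableT_comp mf); apply: measurable_funS (@psi_pcod k) => //;
      [exact: measurable_pcod|by move=> z []].
  by apply/measurable_EFinP; apply: measurable_funS (@density_pcod k) => //;
    [exact: measurable_pcod|move=> z []].
- by move=> z [kz _]; apply: mule_ge0 => //; rewrite lee_fin density_ge0.
congr (integral _ _ _); apply/seteqP; split=> t /=.
  move=> [p [Ap kp] <-]; have dp := piece_dom kp.
  by split; [split; [exact: phi_cod|rewrite /preimage /= phiK]|rewrite /preimage /= phiK].
by move=> [[kz pz] Az]; exists (psi k (row_of_tuple t)) => //; exact: psiK.
Qed.

(** Each piece is carried into the chart [l] by a transition map, and the Jacobian determinant is
    absorbed by the transformation rule of the volume density. The images of the pieces partition
    the codomain of [l]. *)
Lemma ge0_integral_chart l (f : bman -> \bar R) : measurable_fun setT f -> (forall p, (0 <= f p)%E) ->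
  (forall p, ~ dom l p -> f p = 0%E) ->
  (\int[mu]_p f p = \int[lam]_(z in cod l) (f (psi l z) * (vol_density l z)%:E))%E.
Proof.
move=> mf f0 fl; rewrite ge0_integral_mu //.
pose Q k : set T := cod l `&` psi l @^-1` piece k.
have mQ k : measurable (Q k) by exact: measurable_psi (measurable_cod l) _ (measurable_piece k).
have codE : cod l = \bigcup_k Q k.
  rewrite /Q -setI_bigcupr -preimage_bigcup piece_cover preimage_setT setIT //.
have mfl : measurable_fun (cod l : set T) (fun z => (f (psi l z) * (vol_density l z)%:E)%E).
  apply: emeasurable_funM; last by apply/measurable_EFinP; exact: measurable_vol_density.
  by apply: (measurableT_comp mf); exact: measurable_psi.
have fl0 z : cod l z -> (0 <= f (psi l z) * (vol_density l z)%:E)%E.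
  by move=> lz; apply: mule_ge0 => //; rewrite lee_fin ltW // vol_density_gt0.
transitivity (\int[lam]_(z in \bigcup_k Q k) (f (psi l z) * (vol_density l z)%:E))%E; last first.
  by rewrite -codE.
have tQ : trivIset setT Q.
  apply/trivIsetP => i j _ _ ij; rewrite /Q setIACA setIid -preimage_setI.
  have /trivIsetP /(_ i j I I ij) -> : trivIset setT piece by exact: trivIset_seqDU.
  by rewrite preimage_set0 setI0.
pose g (z : T) := (f (psi l z) * (vol_density l z)%:E)%E.
transitivity (\sum_(k <oo) \int[lam]_(z in Q k) g z)%E; last first.
  by apply/esym/ge0_integral_bigcup; rewrite -?codE.
rewrite {}/g.
apply: eq_eseriesr => k _.
have mov k' l' : measurable (overlap k' l' : set T) by apply: borel_open; exact: overlap_open.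
(* Cutting off by zero first to the piece and then to the overlap gives a total measurable function,
   to which the change of variables applies. *)
pose F : T -> \bar R := ((f \_ (piece k : set bman)) \o psi k) \_ (overlap k l : set T).
have mF : measurable_fun setT F.
  apply/(measurable_restrictT _ (mov k l)).
  apply: measurableT_comp; last first.
    by apply: measurable_funS (@measurable_psi k) => //; [exact: measurable_cod|move=> z []].
  by apply/(measurable_restrictT _ (measurable_piece k)); exact: measurable_funS mf.
have F0 z : (0 <= F z)%E.
  by rewrite /F patchE; case: ifP => // _ /=; exact: erestrict_ge0.
transitivity (\int[lam]_(z in overlap k l) (F z * (vol_density k z)%:E))%E.
  rewrite [LHS]integral_mkcond [RHS]integral_mkcond; apply: eq_integral => z _; rewrite !patchE.
  case: ifPn => kz; case: ifPn => oz //.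
  - move: kz oz; rewrite !inE => -[kz pz] oz; rewrite /F patchE ifT ?inE //= patchE ifT //; exact/mem_set.
  - move: kz oz; rewrite notin_setE inE => -[kz pz] oz; rewrite fl ?mul0e // => lz; exact: oz.
  - move: oz kz; rewrite notin_setE inE => oz kz; rewrite /F patchE ifT ?inE //= patchE ifF ?mul0e //.
    by apply/negP => /set_mem pz; apply: kz; split=> //; exact: oz.1.
transitivity (\int[lam]_(z in overlap l k) (F (transition l k z) * (vol_density l z)%:E))%E.
  apply: (@change_of_variables R m (overlap k l) (overlap l k) (transition k l) (transition l k)
    (vol_density k) (vol_density l)).
  - exact: overlap_open.
  - exact: overlap_open.
  - by move=> z; exact: transition_overlap.
  - by move=> z; exact: transition_overlap.
  - by move=> z; exact: transitionK.
  - by move=> z oz; apply: differentiable_continuous; exact: transition_differentiable.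
  - move=> p op; exists ('J (transition k l) p), ('J (transition l k) (transition k l p)); split.
    + exact: transition_jacobian.
    + by move=> e e0; apply: differential_estimate => //; exact: transition_differentiable.
    + move=> e e0; rewrite -{2}(transitionK op); apply: differential_estimate => //.
      exact/transition_differentiable/transition_overlap.
    + exact: vol_density_transition.
  - by move=> z [kz _]; exact: C1_continuous (vol_density_C1 k) kz.
  - by move=> z [kz _]; exact: C1_continuous (vol_density_C1 l) kz.
  - by move=> z [kz _]; exact/ltW/vol_density_gt0.
  - by move=> z [kz _]; exact/ltW/vol_density_gt0.
  - exact: mF.
  - exact: F0.
rewrite [LHS]integral_mkcond [RHS]integral_mkcond; apply: eq_integral => z _; rewrite !patchE.
case: ifPn => oz; case: ifPn => Qz //.
- move: oz Qz; rewrite !inE => oz [lz pz]; rewrite /F patchE ifT ?inE //; last exact: transition_overlap.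
  by rewrite /= psi_transition // patchE ifT // inE.
- move: oz Qz; rewrite notin_setE inE => oz Qz; rewrite /F patchE ifT ?inE //; last exact: transition_overlap.
  rewrite /= psi_transition // patchE ifF ?mul0e //; apply/negP => /set_mem pz; apply: Qz; split=> //.
  exact: oz.1.
- by move: oz Qz; rewrite notin_setE inE => oz [lz pz]; case: oz; split=> //; exact: piece_dom.
Qed.

End measure.

(** * Geodesic distance *)

Section euclid.
Context {R : realType}.

Definition dot n (u v : 'rV[R]_n) : R := \sum_i u 0 i * v 0 i.

Lemma dotC n (u v : 'rV[R]_n) : dot u v = dot v u.
Proof. by apply: eq_bigr => i _; rewrite mulrC. Qed.

Lemma dotDl n (u v w : 'rV[R]_n) : dot (u + v) w = dot u w + dot v w.
Proof. by rewrite -big_split; apply: eq_bigr => i _; rewrite mxE mulrDl. Qed.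

Lemma dotZl n a (u v : 'rV[R]_n) : dot (a *: u) v = a * dot u v.
Proof. by rewrite /dot mulr_sumr; apply: eq_bigr => i _; rewrite mxE mulrA. Qed.

Lemma dotBl n (u v w : 'rV[R]_n) : dot (u - v) w = dot u w - dot v w.
Proof. by rewrite dotDl -scaleN1r dotZl mulN1r. Qed.

Lemma dotE n (u v : 'rV[R]_n) : dot u v = (u *m v^T) 0 0.
Proof. by rewrite mxE; apply: eq_bigr => i _; rewrite mxE. Qed.

Lemma dot_ge0 n (u : 'rV[R]_n) : 0 <= dot u u.
Proof. by apply: sumr_ge0 => i _; rewrite -expr2 sqr_ge0. Qed.

Lemma enormE n (u : 'rV[R]_n) : enorm u = Num.sqrt (dot u u).
Proof. by congr Num.sqrt; apply: eq_bigr => i _; rewrite expr2. Qed.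

Lemma enorm_ge0 n (u : 'rV[R]_n) : 0 <= enorm u.
Proof. exact: sqrtr_ge0. Qed.

Lemma enorm_sqr n (u : 'rV[R]_n) : enorm u ^+ 2 = dot u u.
Proof. by rewrite enormE sqr_sqrtr // dot_ge0. Qed.

Lemma enormZ n a (u : 'rV[R]_n) : enorm (a *: u) = `|a| * enorm u.
Proof. by rewrite !enormE dotZl dotC dotZl mulrA -expr2 sqrtrM ?sqr_ge0 // sqrtr_sqr. Qed.

Lemma enormN n (u : 'rV[R]_n) : enorm (- u) = enorm u.
Proof. by rewrite -scaleN1r enormZ normrN1 mul1r. Qed.

Lemma enorm0 n : enorm (0 : 'rV[R]_n) = 0.
Proof. by rewrite -(scale0r 0) enormZ normr0 mul0r. Qed.

Lemma coord_le_enorm n (u : 'rV[R]_n) i : `|u 0 i| <= enorm u.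
Proof.
rewrite -ler_sqr ?nnegrE ?enorm_ge0 // enorm_sqr real_normK ?num_real // expr2 /dot (bigD1 i) //= lerDl.
by apply: sumr_ge0 => j _; rewrite -expr2 sqr_ge0.
Qed.

Lemma norm_le_enorm n (u : 'rV[R]_n) : `|u| <= enorm u.
Proof. by apply: norm_le_coord => [|i]; [exact: enorm_ge0|exact: coord_le_enorm]. Qed.

Lemma cauchy_schwarz n (u v : 'rV[R]_n) : dot u v <= enorm u * enorm v.
Proof.
have [u0|u0] := eqVneq (enorm u) 0.
  rewrite u0 mul0r /dot big1 // => i _; have := coord_le_enorm u i; rewrite u0 normr_le0 => /eqP ->.
  by rewrite mul0r.
have [v0|v0] := eqVneq (enorm v) 0.
  rewrite v0 mulr0 /dot big1 // => i _; have := coord_le_enorm v i; rewrite v0 normr_le0 => /eqP ->.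
  by rewrite mulr0.
have pu : 0 < enorm u by rewrite lt0r u0 enorm_ge0.
have pv : 0 < enorm v by rewrite lt0r v0 enorm_ge0.
have := dot_ge0 (enorm v *: u - enorm u *: v).
rewrite dotDl -scaleNr !dotZl ![dot _ (_ + _)]dotC !dotDl !dotZl (dotC v u) -!enorm_sqr.
rewrite (_ : _ + _ = 2 * (enorm u * enorm v) * (enorm u * enorm v - dot u v)); last by ring.
by rewrite pmulr_rge0 ?subr_ge0 // !mulr_gt0.
Qed.

Lemma enormD n (u v : 'rV[R]_n) : enorm (u + v) <= enorm u + enorm v.
Proof.
rewrite -ler_sqr ?nnegrE ?addr_ge0 ?enorm_ge0 // enorm_sqr dotDl ![dot _ (_ + _)]dotC !dotDl.
by have := cauchy_schwarz u v; rewrite (dotC v u) sqrrD !enorm_sqr; lra.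
Qed.

Lemma enormB n (u v : 'rV[R]_n) : enorm u - enorm v <= enorm (u - v).
Proof. by rewrite lerBlDr; apply: le_trans (enormD _ _); rewrite subrK. Qed.

Lemma norm_dot n (u v : 'rV[R]_n) : `|dot u v| <= enorm u * enorm v.
Proof.
rewrite ler_norml cauchy_schwarz andbT lerNl; have := cauchy_schwarz (- u) v.
by rewrite enormN -scaleN1r dotZl mulN1r.
Qed.

Lemma enorm_le_norm n (u : 'rV[R]_n) : enorm u <= n%:R * `|u|.
Proof.
rewrite -ler_sqr ?nnegrE ?mulr_ge0 ?enorm_ge0 // enorm_sqr /dot.
apply: (@le_trans _ _ (\sum_(i < n) `|u| ^+ 2)).
  by apply: ler_sum => i _; rewrite -expr2 -[leLHS]real_normK ?num_real // lerXn2r ?nnegrE // norm_coord.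
rewrite sumr_const card_ord -[leLHS]mulr_natl exprMn ler_wpM2r ?sqr_ge0 // -natrX ler_nat.
by case: n u => [|n] _ //; rewrite -[leqLHS]muln1 leq_mul.
Qed.

Lemma continuous_enorm n (T : topologicalType) (f : T -> 'rV[R]_n) (y : T) :
  (forall i, {for y, continuous (fun z => f z 0 i)}) -> {for y, continuous (fun z => enorm (f z))}.
Proof.
move=> cf; apply: cont_sqrt; apply: cont_sum => i _.
exact: (cont_mul (cf i) (cf i)).
Qed.

Lemma enorm_mulmx_bound m n (J : 'M[R]_(m, n)) : exists2 C, 0 < C &
  forall v, enorm (v *m J) <= C * `|v|.
Proof.
have s0 : 0 <= \sum_i \sum_j `|J i j| by apply: sumr_ge0 => i _; exact: sumr_ge0.
exists (n%:R * (\sum_i \sum_j `|J i j|) + 1) => [|v].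
  by rewrite ltr_wpDl // mulr_ge0.
apply: (le_trans (enorm_le_norm _)).
apply: (@le_trans _ _ (n%:R * ((\sum_i \sum_j `|J i j|) * `|v|))).
  by rewrite ler_wpM2l // mulmx_bound.
by rewrite mulrA ler_wpM2r // lerDl.
Qed.

(** A right inverse of [J] recovers [v] from [v *m J], so a bound for its size gives the
    constant. *)
Lemma enorm_row_free m n (J : 'M[R]_(m, n)) : row_free J -> exists2 c, 0 < c &
  forall v, c * `|v| <= enorm (v *m J).
Proof.
move=> /row_freeP[P JP].
have s0 : 0 <= \sum_i \sum_j `|P i j| by apply: sumr_ge0 => i _; exact: sumr_ge0.
exists (\sum_i \sum_j `|P i j| + 1)^-1 => [|v]; first by rewrite invr_gt0 ltr_wpDl.
rewrite mulrC ler_pdivrMr ?ltr_wpDl // -[X in `|X|](mulmx1 v) -JP mulmxA.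
apply: (le_trans (mulmx_bound _ _)); rewrite mulrC; apply: ler_pM => //.
  exact: norm_le_enorm.
by rewrite lerDl.
Qed.

End euclid.

Lemma nat_div_le (R : realType) n (e : R) : 0 <= e -> n%:R * (e / n.+1%:R) <= e.
Proof. by move=> e0; rewrite mulrA ler_pdivrMr // mulrC ler_wpM2l // ler_nat. Qed.

Section strict_differentiability.
Context {R : realType} {m : nat}.

Lemma ball_segment (y z v : 'rV[R]_m) (r t : R) : `|z - y| < r -> `|z + v - y| < r -> 0 <= t <= 1 ->
  `|z + t *: v - y| < r.
Proof.
move=> zy zvy /andP[t0 t1]; have -> : z + t *: v - y = (1 - t) *: (z - y) + t *: (z + v - y).
  by apply/rowP => i; rewrite !mxE; ring.
apply: (le_lt_trans (ler_normD _ _)); rewrite !normrZ !ger0_norm ?subr_ge0 //.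
have [t'|t'] := ltP t 1; last first.
  by rewrite (_ : t = 1) ?subrr ?mul0r ?add0r ?mul1r //; apply/le_anti; rewrite t1 t'.
apply: (@lt_le_trans _ _ ((1 - t) * r + t * r)); last by rewrite -mulrDl subrK mul1r.
by rewrite ltr_leD // ?ltr_pM2l ?subr_gt0 // ler_wpM2l // ltW.
Qed.

(** Strict differentiability: the base point [z] varies too. The increment is a derivative at an
    intermediate point of the segment, where all partial derivatives are close to those at [y]. *)
Lemma strict_differential (U : set 'rV[R]_m) (f : 'rV[R]_m -> R) (y : 'rV[R]_m) (e : R) : open U ->
  C1 U f -> U y -> 0 < e ->
  exists2 r : R, 0 < r & forall z v : 'rV[R]_m, `|z - y| < r -> `|z + v - y| < r ->
    `|f (z + v) - f z - 'D_v f y| <= e * `|v|.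
Proof.
move=> oU Cf Uy e0.
pose e1 := e / m.+1%:R; have e10 : 0 < e1 by rewrite divr_gt0.
have [r0 r00 H0] := open_radius oU Uy.
have Hi (i : 'I_m) : exists r : R, 0 < r /\ forall z, `|z - y| < r -> `|'D_'e_i f z - 'D_'e_i f y| < e1.
  have [r r0' Hr] := continuous_radius (@C1_cont _ _ _ _ Cf i y Uy) e10.
  by exists r.
have [rr Hrr] := choice Hi.
pose r := \big[Num.min/r0]_i rr i.
have r_gt0 : 0 < r by apply: lt_bigmin => // i _; exact: (Hrr i).1.
have rri i : r <= rr i by exact: bigmin_le_cond.
have rr0 : r <= r0 by exact: bigmin_le_id.
exists r => // z v zy zvy.
have seg t : 0 <= t <= 1 -> `|z + t *: v - y| < r by exact: ball_segment.
have [|t t01] := @mvt_segment_line _ _ f z v 1 ler01.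
  move=> t t01; apply: diff_derivable; apply: (C1_diff Cf); apply: H0.
  exact: lt_le_trans (seg t t01) rr0.
rewrite scale1r mul1r => ->.
have Ut : U (z + t *: v) by apply: H0; exact: lt_le_trans (seg t t01) rr0.
rewrite (gradlE _ (C1_diff Cf Ut)) (gradlE _ (C1_diff Cf Uy)) -sumrB.
apply: (le_trans (ler_norm_sum _ _ _)).
apply: (@le_trans _ _ (\sum_(i < m) `|v| * e1)).
  apply: ler_sum => i _; rewrite -mulrBr normrM; apply: ler_pM => //; first exact: norm_coord.
  by apply: ltW; apply: (Hrr i).2; exact: lt_le_trans (seg t t01) (rri i).
rewrite sumr_const card_ord -[leLHS]mulr_natl mulrCA mulrC ler_wpM2r //.
exact/nat_div_le/ltW.
Qed.

Lemma strict_jacobian n (U : set 'rV[R]_m) (G : 'rV[R]_m -> 'rV[R]_n) (y : 'rV[R]_m) (e : R) : open U ->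
  (forall a, C1 U (fun z => G z 0 a)) -> U y -> 0 < e ->
  exists2 r : R, 0 < r & forall z v : 'rV[R]_m, `|z - y| < r -> `|z + v - y| < r ->
    enorm (G (z + v) - G z - v *m 'J G y) <= e * `|v|.
Proof.
move=> oU CG Uy e0.
pose e1 := e / n.+1%:R; have e10 : 0 < e1 by rewrite divr_gt0.
have Hi (a : 'I_n) : exists r : R, 0 < r /\ forall z v : 'rV[R]_m, `|z - y| < r -> `|z + v - y| < r ->
    `|G (z + v) 0 a - G z 0 a - 'D_v (fun z => G z 0 a) y| <= e1 * `|v|.
  by have [r r0 Hr] := strict_differential oU (CG a) Uy e10; exists r.
have [rr Hrr] := choice Hi.
pose r := \big[Num.min/1]_i rr i.
have r_gt0 : 0 < r by apply: lt_bigmin => // i _; exact: (Hrr i).1.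
have rri i : r <= rr i by exact: bigmin_le_cond.
exists r => // z v zy zvy; apply: (le_trans (enorm_le_norm _)).
apply: (@le_trans _ _ (n%:R * (e1 * `|v|))).
  apply: ler_wpM2l => //; apply: norm_le_coord => [|a]; first by rewrite mulr_ge0 // ltW.
  have := (Hrr a).2 z v (lt_le_trans zy (rri a)) (lt_le_trans zvy (rri a)).
  have dG : differentiable G y by exact: C1_differentiable CG Uy.
  have [_ ->] := derivable_entry 0 a (@diff_derivable _ _ _ G y v dG).
  by rewrite deriveEjacobian // !mxE.
by rewrite mulrA ler_wpM2r //; exact/nat_div_le/ltW.
Qed.

End strict_differentiability.

Section interval_integrals.
Context {R : realType}.
Local Notation leb := (@lebesgue_measure R).
Implicit Types (f g : R -> R) (a b t : R).

Definition itv_int f a b : \bar R := (\int[leb]_(t in `[a, b]) (f t)%:E)%E.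

Let cont_meas f (A : set (measurableTypeR R)) : continuous f -> measurable_fun A (fun t => (f t)%:E).
Proof.
by move=> cf; apply/measurable_EFinP; apply: measurable_funTS; exact: continuous_measurable_fun.
Qed.

Let cont_within f a b : continuous f -> {within `[a, b], continuous f}.
Proof. exact: continuous_subspaceT. Qed.

Let itv_integrable f a b : continuous f -> leb.-integrable `[a, b] (EFin \o f).
Proof.
move=> cf; apply: continuous_compact_integrable; first exact: segment_compact.
exact: cont_within.
Qed.

Lemma itv_int_ge0 f a b : (forall t, 0 <= f t) -> (0 <= itv_int f a b)%E.
Proof. by move=> f0; apply: integral_ge0 => t _; rewrite lee_fin. Qed.

Lemma itv_int_fin f a b : continuous f -> itv_int f a b \is a fin_num.
Proof.
by move=> cf; apply: integrable_fin_num => //; exact: itv_integrable.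
Qed.

Lemma itv_int_nil f a : itv_int f a a = 0%E.
Proof. by rewrite /itv_int set_itv1 integral_set1. Qed.

Lemma itv_int_split f a t b : continuous f -> a <= t -> t <= b ->
  itv_int f a b = (itv_int f a t + itv_int f t b)%E.
Proof.
move=> cf at_ tb; rewrite /itv_int.
rewrite (_ : `[a, b]%classic = `[a, t]%classic `|` `]t, b]%classic); last first.
  apply/seteqP; split=> x /=; rewrite !in_itv /=.
    by move=> /andP[ax xb]; have [xt|tx] := leP x t; [left|right]; rewrite ?ax ?xb.
  by case=> /andP[h1 h2]; apply/andP; split=> //; [exact: le_trans tb|apply: le_trans at_ (ltW _)].
rewrite integral_setU //; first last.
- apply/disj_setPS => x /= []; rewrite !in_itv /= => /andP[_ h1] /andP[h2 _].
  by have := le_lt_trans h1 h2; rewrite ltxx.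
- exact: cont_meas.
by congr (_ + _)%E; rewrite integral_itv_obnd_cbnd //; exact: cont_meas.
Qed.

Lemma itv_int_le f g a b : continuous f -> continuous g -> (forall t, a <= t <= b -> f t <= g t) ->
  (itv_int f a b <= itv_int g a b)%E.
Proof.
move=> cf cg fg; apply: le_integral => //; [exact: itv_integrable|exact: itv_integrable|].
by move=> x /set_mem /=; rewrite in_itv /= lee_fin; exact: fg.
Qed.

Lemma itv_int_FTC f g a b : continuous f -> (forall t, derivable g t 1) ->
  (forall t, derive1 g t = f t) -> a <= b -> itv_int f a b = (g b - g a)%:E.
Proof.
move=> cf dg gf; rewrite le_eqVlt => /orP[/eqP ->|ab]; first by rewrite itv_int_nil subrr.
have cg t : {for t, continuous g}.
  by apply: differentiable_continuous; apply/derivable1_diffP.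
rewrite /itv_int (@continuous_FTC2 R f g a b ab (cont_within cf)) //.
split.
- by move=> x _; exact: dg.
- by apply: cvg_at_right_filter; exact: cg.
- by apply: cvg_at_left_filter; exact: cg.
Qed.

Lemma itv_int_opp f a b : continuous f -> (forall t, 0 <= f t) ->
  itv_int (fun t => f (- t)) (- b) (- a) = itv_int f a b.
Proof.
move=> cf f0; rewrite /itv_int integral_mkcond [RHS]integral_mkcond.
pose h : measurableTypeR R -> \bar R := (fun t => (f t)%:E) \_ `[a, b].
have mh : measurable_fun setT h.
  by apply/(measurable_restrictT _ (measurable_itv _)); exact: cont_meas.
have h0 t : (0 <= h t)%E by apply: erestrict_ge0 => s _; rewrite lee_fin.
have n1 : (-1 : R) != 0 by rewrite oppr_eq0 oner_eq0.
rewrite -[RHS](leb_affine 0 n1 mh h0) normrN1 mul1e; apply: eq_integral => t _.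
rewrite addr0 mulN1r /h !patchE; congr (if _ then _ else _).
by apply/idP/idP; rewrite !inE /= !in_itv /= lerNl lerNr andbC.
Qed.

End interval_integrals.

(** * Velocity and length of curves *)

Section curves.
Context {R : realType} {m n : nat} {M : riemannian_manifold R m} (F : M -> 'rV[R]_n).
Hypothesis isoF : isometric_immersion F.
Local Notation cod := (@cod R m M).
Local Notation dom := (@dom R m M).
Local Notation psi := (@psi R m M).
Local Notation phi := (@phi R m M).

Definition param k : 'rV[R]_m -> 'rV[R]_n := F \o psi k.

Lemma param_C1 k a : C1 (cod k) (fun z => param k z 0 a).
Proof. by apply: C1_entry; [exact: cod_open|exact: (isoF k).1]. Qed.

Lemma param_differentiable k y : cod k y -> differentiable (param k) y.
Proof. by apply: C1_differentiable => a; exact: param_C1. Qed.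

Lemma param_row_free k y : cod k y -> row_free ('J (param k) y).
Proof. by move=> /(isoF k).2[]. Qed.

Lemma metricE k y : cod k y -> metric M k y = 'J (param k) y *m ('J (param k) y)^T.
Proof. by move=> /(isoF k).2[]. Qed.

Lemma param_jacobian_continuous k y i j : cod k y -> {for y, continuous (fun z => 'J (param k) z i j)}.
Proof.
move=> ky; apply: (near_continuous (g := 'D_'e_i (fun z => param k z 0 j))).
  apply: filterS (open_near (@cod_open _ _ _ k) ky) => z kz; apply: jacobianE.
  exact: param_differentiable.
exact: (@C1_cont _ _ _ _ (param_C1 k j) i y ky).
Qed.

Lemma curve_dom (c : R -> M) t k : continuous c -> dom k (c t) -> \forall u \near t, dom k (c u).
Proof. by move=> cc kt; apply: cc; apply: open_nbhs_nbhs; split => //; exact: dom_open. Qed.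

Lemma curve_velocity (c : R -> M) t k : C1_curve c -> dom k (c t) ->
  derivable (F \o c) t 1 /\
  derive1 (F \o c) t = derive1 (phi k \o c) t *m 'J (param k) (phi k (c t)).
Proof.
move=> [cc dc] kt; have [dg _] := dc t k kt.
have FE : {near t, F \o c =1 param k \o (phi k \o c)}.
  apply: filterS (curve_dom cc kt) => u ku; rewrite /= /param /= phiK //.
have dg' : differentiable (phi k \o c) t by apply/derivable1_diffP.
have dp : differentiable (param k) ((phi k \o c) t) by apply: param_differentiable; exact: phi_cod.
have dcomp : differentiable (param k \o (phi k \o c)) t by exact: differentiable_comp.
split.
  apply: (near_eq_derivable (g := F \o c) (f := param k \o (phi k \o c))).
    by apply: filterS FE => u ->.
  by apply/derivable1_diffP.
rewrite !derive1E (near_eq_derive _ FE) deriveE // diff_comp //= -deriveEjacobian //.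
by rewrite deriveE // -(deriveE (f := phi k \o c)).
Qed.

(** Seen through the isometric immersion, the speed no longer depends on the choice [chart_at],
    which jumps along the curve; this is how its continuity is obtained. *)
Lemma speedE (c : R -> M) t : C1_curve c -> speed c t = enorm (derive1 (F \o c) t).
Proof.
move=> Cc; have kt := chart_at_dom (c t).
rewrite (curve_velocity Cc kt).2 enormE dotE /speed -/(phi _) (metricE (phi_cod kt)).
by rewrite trmx_mul !mulmxA.
Qed.

Lemma curve_coord (c : R -> M) i t : C1_curve c ->
  derivable (fun u => F (c u) 0 i) t 1 /\ derive1 (fun u => F (c u) 0 i) t = derive1 (F \o c) t 0 i.
Proof.
move=> Cc; have [dF _] := curve_velocity Cc (chart_at_dom (c t)).
have cf : h^-1 *: ((F \o c) (h *: 1 + t) - (F \o c) t) @[h --> 0^'] --> 'D_1 (F \o c) t by exact: dF.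
have cc := cvg_comp _ _ cf (@coord_continuous R 1 n 0 i ('D_1 (F \o c) t)).
have ce : h^-1 *: (F (c (h *: 1 + t)) 0 i - F (c t) 0 i) @[h --> 0^'] --> ('D_1 (F \o c) t) 0 i.
  rewrite (_ : (fun h : R => _) = (fun M : 'rV[R]_n => M 0 i) \o
    (fun h : R => h^-1 *: ((F \o c) (h *: 1 + t) - (F \o c) t))) //.
  by apply/funext => h /=; rewrite !mxE.
split; first by apply/cvg_ex; exists (('D_1 (F \o c) t) 0 i).
by rewrite !derive1E; exact: cvg_lim.
Qed.

Lemma velocity_continuous (c : R -> M) i : C1_curve c -> continuous (fun t => derive1 (F \o c) t 0 i).
Proof.
move=> Cc t; have kt := chart_at_dom (c t); set k := chart_at _ in kt; have [cc dc] := Cc.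
have [dg cg] := dc t k kt.
apply: (near_continuous (g := fun u => \sum_j derive1 (phi k \o c) u 0 j *
    'J (param k) (phi k (c u)) j i)).
  by apply: filterS (curve_dom cc kt) => u ku; rewrite (curve_velocity Cc ku).2 mxE.
apply: cont_sum => j _; apply: cont_mul.
  exact: (@continuous_comp _ _ _ _ (fun M : 'rV[R]_m => M 0 j) t cg (@coord_continuous R 1 m 0 j _)).
apply: (@continuous_comp _ _ _ (phi k \o c) (fun z => 'J (param k) z j i)).
  exact: (@continuous_comp _ _ _ c (phi k) t (cc t) (phi_continuous kt)).
exact/param_jacobian_continuous/phi_cod.
Qed.

Lemma speed_continuous (c : R -> M) : C1_curve c -> continuous (speed c).
Proof.
move=> Cc t; rewrite (_ : speed c = fun u => enorm (derive1 (F \o c) u)); last first.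
  by apply/funext => u; exact: speedE.
by apply: continuous_enorm => i; exact: velocity_continuous.
Qed.

Lemma speed_ge0 (c : R -> M) t : 0 <= speed c t. Proof. exact: sqrtr_ge0. Qed.

Lemma curve_lengthE (c : R -> M) a b : curve_length c a b = itv_int (speed c) a b.
Proof. by []. Qed.

Lemma curve_length_ge0 (c : R -> M) a b : (0 <= curve_length c a b)%E.
Proof. by apply: itv_int_ge0 => t; exact: speed_ge0. Qed.

Lemma curve_length_fin (c : R -> M) a b : C1_curve c -> curve_length c a b \is a fin_num.
Proof. by move=> Cc; apply: itv_int_fin; exact: speed_continuous. Qed.

Lemma curve_length_split (c : R -> M) a t b : C1_curve c -> a <= t -> t <= b ->
  curve_length c a b = (curve_length c a t + curve_length c t b)%E.
Proof. by move=> Cc; apply: itv_int_split; exact: speed_continuous. Qed.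

(* Integrate the component of the velocity along the chord. *)
Lemma chord_le_length (c : R -> M) a b : C1_curve c -> a <= b ->
  ((enorm (F (c b) - F (c a)))%:E <= curve_length c a b)%E.
Proof.
move=> Cc ab; set w := F (c b) - F (c a).
have [w0|w0] := eqVneq (enorm w) 0; first by rewrite w0 curve_length_ge0.
have wp : 0 < enorm w by rewrite lt0r w0 enorm_ge0.
pose f t := (enorm w)^-1 * dot (derive1 (F \o c) t) w.
pose g t := (enorm w)^-1 * dot (F (c t)) w.
have cf : continuous f.
  move=> t; apply: (@cont_mul R _ (fun=> (enorm w)^-1) (fun t => dot (derive1 (F \o c) t) w) t);
    first exact: cont_cst.
  by apply: cont_sum => i _; apply: cont_mul; [exact: velocity_continuous|exact: cont_cst].
have dgt (t : R) : is_derive t 1 g (f t).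
  have H i : is_derive t 1 (fun u => F (c u) 0 i * w 0 i) (derive1 (F \o c) t 0 i * w 0 i).
    have [d1 d2] := curve_coord i t Cc.
    have d3 : is_derive t 1 (fun u => F (c u) 0 i) (derive1 (F \o c) t 0 i).
      by apply: DeriveDef => //; rewrite -derive1E.
    have -> : (fun u => F (c u) 0 i * w 0 i) = w 0 i *: (fun u => F (c u) 0 i).
      by apply/funext => u /=; rewrite mulrC.
    by rewrite mulrC; exact: is_deriveZ.
  have H2 : is_derive t 1 (\sum_i (fun u => F (c u) 0 i * w 0 i)) (\sum_i (derive1 (F \o c) t 0 i * w 0 i)).
    exact: is_derive_sum.
  have -> : g = (enorm w)^-1 *: \sum_i (fun u => F (c u) 0 i * w 0 i).
    by apply/funext => u; rewrite /g /dot /= fct_sumE.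
  exact: is_deriveZ.
have E : itv_int f a b = (enorm w)%:E.
  rewrite (@itv_int_FTC _ f g) //.
    congr (_%:E); rewrite /g -mulrBr.
    by rewrite -dotBl -enorm_sqr expr2 mulKf.
  by move=> t; rewrite derive1E; exact: derive_val.
rewrite -E; apply: itv_int_le => // [|t _]; first exact: speed_continuous.
rewrite (speedE t Cc) /f mulrC ler_pdivrMr //; exact: cauchy_schwarz.
Qed.

End curves.

Lemma mxB (R : pzRingType) p q (A B : 'M[R]_(p, q)) i j : (A - B) i j = A i j - B i j.
Proof. by rewrite !mxE. Qed.

Section reparametrization.
Context {R : realType}.

Lemma continuous_row n (T : topologicalType) (f : T -> 'rV[R]_n) (y : T) :
  (forall i, {for y, continuous (fun z => f z 0 i)}) -> {for y, continuous f}.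
Proof.
move=> cf; apply/cvgrPdist_le => e e0.
have H (i : 'I_n) : \forall z \near y, `|f y 0 i - f z 0 i| <= e.
  by have /cvgrPdist_le /(_ e e0) := cf i.
apply: filterS (filter_forall _ H) => z Hz.
by apply: norm_le_coord => [|i]; [exact: ltW|rewrite !mxE; exact: Hz].
Qed.

Lemma derive_reparam (W : normedModType R) (h : R -> W) (th : R -> R) t :
  derivable h (th t) 1 -> derivable th t 1 ->
  derivable (h \o th) t 1 /\ derive1 (h \o th) t = derive1 th t *: derive1 h (th t).
Proof.
move=> /derivable1_diffP dh /derivable1_diffP dth.
have dht : differentiable (h \o th) t by exact: differentiable_comp.
split; first by apply/derivable1_diffP.
have E (W' : normedModType R) (f : R -> W') s : differentiable f s -> derive1 f s = 'd f s 1.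
  by move=> df; rewrite derive1E deriveE.
have e0 := congr1 (fun f : R -> W => f 1) (diff_comp dth dh).
rewrite (E _ _ _ dht) (E _ _ _ dh) (E _ _ _ dth) [LHS]e0.
transitivity ('d h (th t) ('d th t 1 *: (1 : R))); last exact: linearZ.
by congr ('d h (th t) _); apply/esym; exact: mulr1.
Qed.

(** A C1 curve is defined on the whole line, and an affine parametrization of a coordinate segment
    could leave the chart. The parameter [(1 - cos t) / 2] stays in [[0, 1]] for all [t] and runs
    through this interval on [[0, pi]]. *)
Lemma derive1_smoothstep (t : R) :
  derivable (fun t : R => (1 - cos t) / 2) t 1 /\ derive1 (fun t : R => (1 - cos t) / 2) t = sin t / 2.
Proof.
have d : is_derive t 1 (fun t : R => (1 - cos t) / 2) (sin t / 2).
  have d1 := @is_derive_cst R R R 1 t 1.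
  have d2 := is_deriveB d1 (is_derive_cos t).
  have := is_deriveZ 2^-1 d2; rewrite sub0r opprK [in X in is_derive _ _ _ X]/GRing.scale /= (mulrC 2^-1).
  rewrite (_ : (fun t : R => (1 - cos t) / 2) = 2^-1 \*: (cst 1 - cos)) //.
  by apply/funext => s /=; rewrite mulrC.
by split => //; rewrite derive1E; exact: derive_val.
Qed.

Lemma smoothstep01 (t : R) : 0 <= (1 - cos t) / 2 <= 1.
Proof.
have := cos_le1 t; have := cos_geN1 t => h1 h2.
by rewrite divr_ge0 ?subr_ge0 //= ler_pdivrMr // mul1r; lra.
Qed.

End reparametrization.

Section distance.
Context {R : realType} {m n : nat} {M : riemannian_manifold R m} (F : M -> 'rV[R]_n).
Hypothesis isoF : isometric_immersion F.
Local Notation cod := (@cod R m M).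
Local Notation dom := (@dom R m M).
Local Notation psi := (@psi R m M).
Local Notation phi := (@phi R m M).
Local Notation param := (@param R m n M F).
Local Notation overlap := (@overlap R m M).
Local Notation transition := (@transition R m M).
Local Notation gd := (@geodesic_dist R m M).
Implicit Types (p q r : M).

Lemma path_length p q l : piecewise_C1_path p q l -> [/\ (0 <= l)%E, l \is a fin_num &
  ((enorm (F q - F p))%:E <= l)%E].
Proof.
elim=> [|c a b {}l Cc ab _ [l0 lf lF]]; first by rewrite subrr enorm0.
split; first by rewrite adde_ge0 // curve_length_ge0.
  by rewrite fin_numD lf (curve_length_fin isoF).
rewrite -(subrKA (F (c a))) addrC; apply: (@le_trans _ _ (enorm (F (c a) - F p) + enorm (F (c b) - F (c
  a)))%:E).
  by rewrite lee_fin; exact: enormD.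
by rewrite EFinD; apply: leeD => //; exact: chord_le_length.
Qed.

Lemma path_cat p q r l l' : piecewise_C1_path p q l -> piecewise_C1_path q r l' ->
  piecewise_C1_path p r (l + l')%E.
Proof.
move=> pq; elim=> [|c a b {}l' Cc ab _ IH]; first by rewrite adde0.
by rewrite addeA; exact: path_snoc.
Qed.

Lemma path_segment (c : R -> M) a b : C1_curve c -> a <= b ->
  piecewise_C1_path (c a) (c b) (curve_length c a b).
Proof. by move=> Cc ab; rewrite -[curve_length _ _ _]add0e; apply: path_snoc => //; exact: path_refl. Qed.

Lemma curve_opp (c : R -> M) : C1_curve c -> C1_curve (c \o -%R) /\
  forall t, speed (c \o -%R) t = speed c (- t).
Proof.
move=> Cc; have [cc dc] := Cc.
have dN (t : R) : derivable -%R t 1 /\ derive1 (-%R : R -> R) t = -1.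
  have d : is_derive t 1 (-%R : R -> R) (- 1) by apply: is_deriveN; exact: is_derive_id.
  by split => //; rewrite derive1E; exact: derive_val.
have CN : C1_curve (c \o -%R).
  split; first by move=> t; apply: continuous_comp; [exact: oppr_continuous|exact: cc].
  move=> t k kt; have [d1 d2] := dc _ _ kt; rewrite compA.
  split; first by apply: (derive_reparam (th := -%R) d1 (dN t).1).1.
  apply: (near_continuous (g := fun u : R => - derive1 (phi k \o c) (- u))).
    have : \forall u \near t, dom k ((c \o -%R) u).
      have cN : continuous (c \o -%R) by move=> u; apply: continuous_comp; [exact: oppr_continuous|exact: cc].
      exact: curve_dom cN kt.
    apply: filterS => u ku; have [d3 _] := dc _ _ ku.
    by rewrite (derive_reparam (th := -%R) d3 (dN u).1).2 (dN u).2 scaleN1r.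
  apply: continuousN; apply: (@continuous_comp _ _ _ -%R (derive1 (phi k \o c)) t) => //.
  exact: oppr_continuous.
split; first exact: CN.
move=> t; rewrite (speedE isoF t CN) (speedE isoF (- t) Cc).
rewrite -[F \o (c \o -%R)]/((F \o c) \o -%R).
have [d1 _] := curve_velocity isoF Cc (chart_at_dom (c (- t))).
by rewrite (derive_reparam (th := -%R) d1 (dN t).1).2 (dN t).2 scaleN1r enormN.
Qed.

Lemma path_rev p q l : piecewise_C1_path p q l -> piecewise_C1_path q p l.
Proof.
elim=> [|c a b {}l Cc ab _ IH]; first exact: path_refl.
have [CN sN] := curve_opp Cc.
have := @path_segment _ (- b) (- a) CN; rewrite lerN2 /= !opprK => /(_ ab).
rewrite curve_lengthE (_ : speed (c \o -%R) = fun t => speed c (- t)); last exact/funext.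
rewrite itv_int_opp; [|exact: speed_continuous|by move=> t; exact: speed_ge0].
by move=> P; rewrite addeC; exact: path_cat IH.
Qed.

Lemma gd_ge0 p q : (0 <= gd p q)%E.
Proof. by apply: le_ereal_inf_tmp => l /path_length[]. Qed.

Lemma gd_le p q l : piecewise_C1_path p q l -> (gd p q <= l)%E.
Proof. by move=> pq; exact: ereal_inf_lbound. Qed.

Lemma gd_lt p q (x : \bar R) : (gd p q < x)%E -> exists2 l, piecewise_C1_path p q l & (l < x)%E.
Proof. by move=> /ereal_inf_lt[l pl lx]; exists l. Qed.

Lemma gdxx p : gd p p = 0%E.
Proof. by apply/le_anti; rewrite gd_ge0 andbT; apply: gd_le; exact: path_refl. Qed.

Lemma gd_sym p q : gd p q = gd q p.
Proof. by apply/le_anti/andP; split; apply: le_ereal_inf_tmp => l /path_rev; exact: gd_le. Qed.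

Lemma gd_triangle p q r : (gd p r <= gd p q + gd q r)%E.
Proof.
have [pqf|pqi] := boolP (gd p q \is a fin_num); last first.
  have -> : gd p q = +oo%E by apply/eqP; rewrite -leye_eq leNgt -ge0_fin_numE ?gd_ge0.
  by rewrite addye ?leey // -ltNye (lt_le_trans _ (gd_ge0 _ _)) // ltNyr.
have [qrf|qri] := boolP (gd q r \is a fin_num); last first.
  have -> : gd q r = +oo%E by apply/eqP; rewrite -leye_eq leNgt -ge0_fin_numE ?gd_ge0.
  by rewrite addey ?leey // -ltNye (lt_le_trans _ (gd_ge0 _ _)) // ltNyr.
apply/lee_addgt0Pr => e e0; have e2 : 0 < e / 2 by rewrite divr_gt0.
have [|l pl ll] := @gd_lt p q (gd p q + (e / 2)%:E)%E; first by rewrite lteDl // lte_fin.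
have [|l' pl' ll'] := @gd_lt q r (gd q r + (e / 2)%:E)%E; first by rewrite lteDl // lte_fin.
apply: (le_trans (gd_le (path_cat pl pl'))); apply: (le_trans (leeD (ltW ll) (ltW ll'))).
by rewrite addeACA -EFinD -splitr.
Qed.

Lemma chord_le_gd p q : ((enorm (F q - F p))%:E <= gd p q)%E.
Proof. by apply: le_ereal_inf_tmp => l /path_length[]. Qed.

(** Being a C1 curve is a condition in every chart [l]; the velocity there is computed through the
    transition map from [k]. *)
Lemma segment_curve k (z v : 'rV[R]_m) : (forall t, 0 <= t <= 1 -> cod k (z + t *: v)) ->
  let c := fun t : R => psi k (z + ((1 - cos t) / 2) *: v) in
  C1_curve c /\ forall t, speed c t = `|sin t / 2| * enorm (v *m 'J (param k) (z + ((1 - cos t) / 2) *: v)).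
Proof.
move=> kv c; pose th (t : R) := (1 - cos t) / 2.
have kth t : cod k (z + th t *: v) by apply: kv; exact: smoothstep01.
have cth : continuous th.
  by move=> t; apply: differentiable_continuous; apply/derivable1_diffP; exact: (derive1_smoothstep t).1.
have cline : continuous (fun t => z + th t *: v).
  move=> t; apply: (@continuous_row _ _ _ (fun t => z + th t *: v) t) => i.
  rewrite (_ : (fun _ => _) = fun t => z 0 i + th t * v 0 i); last by apply/funext => u; rewrite !mxE.
  apply: cont_add; first exact: cont_cst.
  by apply: cont_mul; [exact: cth|exact: cont_cst].
have cc : continuous c.
  by move=> t; apply: (@continuous_comp _ _ _ _ (psi k) t (cline t)); exact: psi_continuous.
have along (d : nat) (h : 'rV[R]_m -> 'rV[R]_d) t : differentiable h (z + th t *: v) ->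
    derivable (fun u => h (z + th u *: v)) t 1 /\
    derive1 (fun u => h (z + th u *: v)) t = (sin t / 2) *: (v *m 'J h (z + th t *: v)).
  move=> dh; have [d1 d2] := is_derive_comp_line dh.
  have [d3 d4] := derive_reparam d1 (derive1_smoothstep t).1.
  by split => //; rewrite d4 d2 (derive1_smoothstep t).2 deriveEjacobian.
have Cc : C1_curve c.
  split=> // t l lt; have ot (u : R) : dom l (c u) -> overlap k l (z + th u *: v) by move=> lu; split.
  have [d1 _] := along _ (transition k l) t (transition_differentiable (ot _ lt)).
  pose g (u : R) : 'rV[R]_m := (sin u / 2) *: (v *m 'J (transition k l) (z + th u *: v)).
  have eg : \forall u \near t, derive1 (phi l \o c) u = g u.
    apply: filterS (curve_dom cc lt) => u lu.
    by have [_] := along _ (transition k l) u (transition_differentiable (ot _ lu)).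
  have cg : {for t, continuous g}.
    apply: continuous_row => i.
    apply: (near_continuous (g := fun u => (sin u / 2) *
        \sum_j v 0 j * 'D_'e_j (fun y => transition k l y 0 i) (z + th u *: v))).
      apply: filterS (curve_dom cc lt) => u lu; rewrite !mxE; congr (_ * _); apply: eq_bigr => j _.
      by rewrite jacobianE //; apply: transition_differentiable; exact: ot.
    apply: cont_mul.
      by apply: cont_mul; [exact: continuous_sin|exact: cont_cst].
    apply: cont_sum => j _; apply: cont_mul; first exact: cont_cst.
    apply: (@continuous_comp _ _ _ _ ('D_'e_j (fun y => transition k l y 0 i)) t (cline t)).
    exact: (@C1_cont _ _ _ _ (transition_C1 k l i) j _ (ot _ lt)).
  by split; [exact: d1|exact: near_continuous eg cg].
split=> // t; rewrite (speedE isoF) //.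
by have [_ ->] := along _ (param k) t (param_differentiable isoF (kth t)); rewrite enormZ.
Qed.

Lemma segment_upper k (z v : 'rV[R]_m) (C : R) : (forall t, 0 <= t <= 1 -> cod k (z + t *: v)) ->
  (forall t, 0 <= t <= 1 -> enorm (v *m 'J (param k) (z + t *: v)) <= C) ->
  (gd (psi k z) (psi k (z + v)) <= C%:E)%E.
Proof.
move=> kv vC; have [Cc sc] := segment_curve kv; set c := (X in C1_curve X) in Cc sc.
have C0 : 0 <= C by apply: le_trans (vC 0 _); rewrite ?enorm_ge0 // lexx ler01.
have c0 : c 0 = psi k z by rewrite /c cos0 subrr mul0r scale0r addr0.
have c1 : c pi = psi k (z + v).
  by rewrite /c cospi opprK -[1 + 1]/(2%:R) divff // scale1r.
rewrite -c0 -c1; apply: (le_trans (gd_le (path_segment Cc (pi_ge0 R)))).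
(* The speed is at most [sin t / 2 * C] on [[0, pi]]; [g] is a primitive of this bound and increases
   by exactly [C]. *)
pose g (t : R) := ((1 - cos t) / 2) * C.
have dg t : derivable g t 1 /\ derive1 g t = sin t / 2 * C.
  have [d1 d2] := derive1_smoothstep t.
  have d3 : is_derive t 1 (fun t : R => (1 - cos t) / 2) (sin t / 2).
    by apply: DeriveDef => //; rewrite -derive1E.
  have d4 : is_derive t 1 g (sin t / 2 * C).
    have := is_deriveZ C d3; rewrite [in X in is_derive _ _ _ X]/GRing.scale /= mulrC.
    rewrite (_ : g = C \*: (fun t : R => (1 - cos t) / 2)) //.
    by apply/funext => u; rewrite /g /= mulrC.
  by split => //; rewrite derive1E; exact: derive_val.
have cs : continuous (fun t : R => sin t / 2 * C).
  move=> t; apply: (cont_mul (f := fun t => sin t / 2) (g := fun=> C)); last exact: cont_cst.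
  by apply: (cont_mul (f := sin) (g := fun=> 2^-1)); [exact: continuous_sin|exact: cont_cst].
apply: (@le_trans _ _ (itv_int (fun t => sin t / 2 * C) 0 pi)).
  apply: itv_int_le => // [|t /andP[t0 tpi]]; first exact: speed_continuous.
  have s0 : 0 <= sin t by apply: sin_ge0_pi; rewrite t0 tpi.
  rewrite sc ger0_norm ?divr_ge0 // ler_wpM2l ?divr_ge0 // vC //; exact: smoothstep01.
rewrite (itv_int_FTC cs (fun t => (dg t).1) (fun t => (dg t).2) (pi_ge0 R)) lee_fin /g cospi cos0.
by rewrite subrr !mul0r subr0 opprK -[1 + 1]/(2%:R) divff // mul1r.
Qed.

Lemma jacobian_near k z0 (e : R) : cod k z0 -> 0 < e -> exists2 r, 0 < r &
  forall z, `|z - z0| < r -> cod k z /\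
    forall v, enorm (v *m ('J (param k) z - 'J (param k) z0)) <= e * `|v|.
Proof.
move=> kz0 e0; have [r1 r10 Hr1] := open_radius (@cod_open _ _ M k) kz0.
pose f z := n%:R * \sum_i \sum_j `|'J (param k) z i j - 'J (param k) z0 i j|.
have cf : {for z0, continuous f}.
  apply: cont_mul; first exact: cont_cst.
  apply: cont_sum => i _; apply: cont_sum => j _.
  apply: (@continuous_comp _ _ _ (fun z => 'J (param k) z i j - 'J (param k) z0 i j) (fun x : R => `|x|)).
    by apply: cont_add; [exact: param_jacobian_continuous|exact: cont_cst].
  exact: norm_continuous.
have [r2 r20 Hr2] := continuous_radius cf e0.
exists (Num.min r1 r2); first by rewrite lt_min r10 r20.
move=> z; rewrite lt_min => /andP[z1 z2]; split; first exact: Hr1.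
move=> v; apply: (le_trans (enorm_le_norm _)); apply: (@le_trans _ _ (f z * `|v|)).
  rewrite /f -mulrA; apply: ler_wpM2l => //; apply: (le_trans (mulmx_bound _ _)).
  apply: ler_wpM2r => //; apply: ler_sum => i _; apply: ler_sum => j _; by rewrite mxB.
apply: ler_wpM2r => //; have := Hr2 z z2.
rewrite {2}/f big1 ?mulr0 ?subr0 => [|i _]; last by apply: big1 => j _; rewrite subrr normr0.
by move=> /ltW; apply: le_trans; exact: ler_norm.
Qed.

(** The Jacobian varies little near [z0], and [|v|] is controlled by [|v *m J|], so the error is a
    relative one. A factor close to 1 is what later keeps the Lipschitz constant sharp. *)
Lemma gd_local_upper k z0 (e : R) : cod k z0 -> 0 < e -> exists2 r, 0 < r &
  forall z v, `|z - z0| < r -> `|z + v - z0| < r ->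
    (gd (psi k z) (psi k (z + v)) <= ((1 + e) * enorm (v *m 'J (param k) z0))%:E)%E.
Proof.
move=> kz0 e0; have [c c0 Hc] := enorm_row_free (param_row_free isoF kz0).
have ec : 0 < e * c by rewrite mulr_gt0.
have [r r0 Hr] := jacobian_near kz0 ec.
exists r => // z v zr zvr; apply: segment_upper => t t01.
  by have [] := Hr _ (ball_segment zr zvr t01).
have [_ /(_ v) H] := Hr _ (ball_segment zr zvr t01).
rewrite -(subrK ('J (param k) z0) ('J (param k) (z + t *: v))) mulmxDr mulrDl mul1r addrC.
apply: (le_trans (enormD _ _)); rewrite lerD2l.
by apply: (le_trans H); rewrite -mulrA ler_wpM2l // ltW.
Qed.

End distance.

Lemma compact_finite_cover (T : topologicalType) (A : set T) (f : T -> set T) : compact A ->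
  (forall p, A p -> open (f p) /\ f p p) ->
  exists l : seq T, (forall y, y \in l -> A y) /\ forall q, A q -> exists2 y, y \in l & f y q.
Proof.
move=> cA fA; have [A0|/set0P[x0 Ax0]] := eqVneq A set0; first by exists [::]; split=> // q; rewrite A0.
have : compact (A : set (pointed_at x0)) by exact: cA.
rewrite compact_cover => /(_ (pointed_at x0) A f) H.
have [||D DA Dc] := H; first by move=> i /fA[].
  by move=> q Aq; exists q => //; have [] := fA _ Aq.
exists (finmap.enum_fset D); split=> [y yD|q /Dc[y yD fy]]; last by exists y.
by have := DA y yD; rewrite inE.
Qed.

Lemma cont_norm (R : realType) (T : topologicalType) (f : T -> R) y :
  {for y, continuous f} -> {for y, continuous (fun z => `|f z|)}.
Proof.
by move=> cf; apply: (@continuous_comp _ _ _ f (fun x : R => `|x|)) => //; exact: norm_continuous.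
Qed.

Lemma cont_min (R : realType) (T : topologicalType) (f : T -> R) (c : R) y :
  {for y, continuous f} -> {for y, continuous (fun z => Num.min (f z) c)}.
Proof.
move=> cf; rewrite (_ : (fun _ => _) = fun z => (f z + c + - `|f z + - c|) * 2^-1).
  apply: cont_mul; last exact: cont_cst.
  apply: cont_add; first by apply: cont_add => //; exact: cont_cst.
  by apply: cont_opp; apply: cont_norm; apply: cont_add => //; exact: cont_cst.
by apply/funext => z; rewrite minr_absE.
Qed.

(** * Extension of functions from a chart to the manifold *)

Section chart_extension.
Context {R : realType} {m : nat} {M : riemannian_manifold R m}.
Local Notation cod := (@cod R m M).
Local Notation dom := (@dom R m M).
Local Notation psi := (@psi R m M).
Local Notation phi := (@phi R m M).

Lemma closed_cube_compact (z0 : 'rV[R]_m) (r : R) : 0 <= r -> compact [set z : 'rV[R]_m | `|z - z0| <= r].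
Proof.
move=> r0; have := @rV_compact R m (fun i => `[z0 0 i - r, z0 0 i + r]%classic)
  (fun i => @segment_compact R _ _).
congr compact; apply/seteqP; split=> z /=.
  move=> H; apply: norm_le_coord => // i; rewrite mxB ler_distl.
  by have := H i; rewrite in_itv.
move=> H i; rewrite in_itv /= -ler_distl.
by apply: le_trans H; rewrite -mxB; exact: norm_coord.
Qed.

Lemma chart_cube_compact k z0 (r : R) : 0 <= r -> (forall z, `|z - z0| <= r -> cod k z) ->
  compact (psi k @` [set z | `|z - z0| <= r]).
Proof.
move=> r0 rk; apply: continuous_compact; last exact: closed_cube_compact.
apply: continuous_in_subspaceT => z; rewrite inE /= => /rk kz; exact: psi_continuous.
Qed.

Lemma chart_cube_closed k z0 (r : R) : 0 <= r -> (forall z, `|z - z0| <= r -> cod k z) ->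
  closed (psi k @` [set z | `|z - z0| <= r]).
Proof.
by move=> r0 rk; apply: compact_closed; [exact: carrier_hausdorff|exact: chart_cube_compact].
Qed.

Definition extend (T : Type) k (u : 'rV[R]_m -> T) (c : T) (q : M) : T :=
  if pselect (dom k q) then u (phi k q) else c.

Lemma extend_in T k (u : 'rV[R]_m -> T) c q : dom k q -> extend k u c q = u (phi k q).
Proof. by move=> kq; rewrite /extend; case: pselect. Qed.

Lemma extend_out T k (u : 'rV[R]_m -> T) c q : ~ dom k q -> extend k u c q = c.
Proof. by move=> kq; rewrite /extend; case: pselect. Qed.

(** The image of the closed cube is compact, hence closed in a Hausdorff space. A point outside the
    chart domain therefore has a neighborhood disjoint from it, where the extension is constant. *)
Lemma extend_near T k (u : 'rV[R]_m -> T) c z0 (r : R) q : 0 <= r -> (forall z, `|z - z0| <= r -> cod k z) ->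
  (forall z, r < `|z - z0| -> u z = c) -> ~ dom k q -> \forall q' \near q, extend k u c q' = c.
Proof.
move=> r0 rk uc kq; have cK := chart_cube_closed r0 rk.
have : nbhs q (~` (psi k @` [set z | `|z - z0| <= r])).
  apply: open_nbhs_nbhs; split; first exact: closed_openC.
  by move=> /= [z zr zq]; apply: kq; rewrite -zq; apply: psi_dom; exact: rk.
apply: filterS => q' /= Kq'; have [kq'|kq'] := pselect (dom k q'); last exact: extend_out.
rewrite extend_in // uc // ltNge; apply/negP => H; apply: Kq'.
by exists (phi k q') => //; exact: phiK.
Qed.

Lemma extend_continuous (T : topologicalType) k (u : 'rV[R]_m -> T) c z0 (r : R) : 0 <= r ->
  (forall z, `|z - z0| <= r -> cod k z) -> (forall z, r < `|z - z0| -> u z = c) ->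
  continuous u -> continuous (extend k u c).
Proof.
move=> r0 rk uc cu q; have [kq|kq] := pselect (dom k q).
  apply: (near_continuous (g := u \o phi k)).
    have : nbhs q (dom k) by apply: open_nbhs_nbhs; split => //; exact: dom_open.
    by apply: filterS => q' kq'; exact: extend_in.
  by apply: continuous_comp; [exact: phi_continuous|exact: cu].
apply: (near_continuous (g := fun=> c)); first exact: extend_near r0 rk uc kq.
exact: cvg_cst.
Qed.

Lemma near_chart k (p : M) (r : R) : dom k p -> 0 < r ->
  \forall q \near p, dom k q /\ `|phi k q - phi k p| < r.
Proof.
move=> kp r0; have kN : nbhs p (dom k) by apply: open_nbhs_nbhs; split => //; exact: dom_open.
have /cvgrPdist_lt /(_ _ r0) H := phi_continuous kp.
by apply: filterS2 kN H => q kq; rewrite distrC.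
Qed.

End chart_extension.

(** * The distance and the topology of the manifold *)

Section real_distance.
Context {R : realType} {m n : nat} {M : riemannian_manifold R m} (F : M -> 'rV[R]_n).
Hypothesis isoF : isometric_immersion F.
Local Notation cod := (@cod R m M).
Local Notation dom := (@dom R m M).
Local Notation psi := (@psi R m M).
Local Notation phi := (@phi R m M).
Local Notation param := (@param R m n M F).
Local Notation gd := (@geodesic_dist R m M).
Implicit Types (p q : M).

Lemma gd_near p (e : R) : 0 < e -> \forall q \near p, (gd p q < e%:E)%E.
Proof.
move=> e0; have kp := chart_at_dom p; set k := chart_at p in kp.
have [r r0 Hr] := gd_local_upper isoF (phi_cod kp) ltr01.
have [C C0 HC] := enorm_mulmx_bound ('J (param k) (phi k p)).
have r1 : 0 < Num.min r (e / (2 * C)) by rewrite lt_min r0 divr_gt0 // mulr_gt0.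
apply: filterS (near_chart kp r1) => q [kq]; rewrite lt_min => /andP[q1 q2].
have := Hr (phi k p) (phi k q - phi k p); rewrite subrr normr0 subrKC => /(_ r0 q1).
rewrite !phiK // => /le_lt_trans; apply; rewrite lte_fin.
apply: (@le_lt_trans _ _ (2 * (C * `|phi k q - phi k p|))); first by rewrite ler_pM2l.
by rewrite mulrA mulrC -ltr_pdivlMr // mulr_gt0.
Qed.

(* The points at finite distance of p form a clopen set. *)
Lemma gd_fin p q : gd p q \is a fin_num.
Proof.
suff : [set q | (gd p q < +oo)%E] = setT.
  by move=> /seteqP[_ /(_ q I)] /= pq; rewrite ge0_fin_numE // (gd_ge0 isoF).
have tri := gd_triangle isoF; have sym := gd_sym isoF.
apply: (carrier_connected (r := M)).
- by exists p; rewrite /= (gdxx isoF).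
- exists [set q | (gd p q < +oo)%E]; last by rewrite setTI.
  rewrite openE => q0 /= pq0; apply: filterS (gd_near q0 ltr01) => q' qq' /=.
  by apply: le_lt_trans (tri p q0 q') _; rewrite lte_add_pinfty // (lt_trans qq') // ltry.
- exists [set q | (gd p q < +oo)%E]; last by rewrite setTI.
  rewrite -openC openE => q0 /= pq0; apply: filterS (gd_near q0 ltr01) => q' qq' /= pq'.
  apply: pq0; apply: le_lt_trans (tri p q' q0) _; rewrite lte_add_pinfty // sym.
  by rewrite (lt_trans qq') // ltry.
Qed.

Definition dist p q : R := fine (gd p q).
Local Notation D := dist.

Lemma distE p q : gd p q = (D p q)%:E.
Proof. by rewrite fineK // gd_fin. Qed.

Lemma distxx p : D p p = 0.
Proof. by rewrite /D (gdxx isoF). Qed.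

Lemma dist_sym p q : D p q = D q p.
Proof. by rewrite /D (gd_sym isoF). Qed.

Lemma dist_triangle p q s : D p s <= D p q + D q s.
Proof. by rewrite -lee_fin EFinD -!distE; exact: gd_triangle. Qed.

Lemma dist_lipschitz p q s : `|D p q - D p s| <= D q s.
Proof.
have := dist_triangle p q s; have := dist_triangle p s q; rewrite (dist_sym s q) => h1 h2.
by rewrite ler_norml; apply/andP; split; lra.
Qed.

Lemma chord_le_dist p q : enorm (F q - F p) <= D p q.
Proof. by rewrite -lee_fin -distE; exact: chord_le_gd. Qed.

Lemma dist_near p (e : R) : 0 < e -> \forall q \near p, D p q < e.
Proof. by move=> e0; apply: filterS (gd_near p e0) => q; rewrite distE lte_fin. Qed.

Lemma dist_continuous p : continuous (D p).
Proof.
move=> q; apply/cvgrPdist_lt => e e0; apply: filterS (dist_near q e0) => s.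
by apply: le_lt_trans; exact: dist_lipschitz.
Qed.

Lemma geodesic_ballE p r : geodesic_ball p r = [set q | D p q < r].
Proof. by apply/seteqP; split=> q; rewrite /geodesic_ball /= distE lte_fin. Qed.

Lemma dist_ball_open p r : open [set q | D p q < r].
Proof.
rewrite openE => q /= qr; have r0 : 0 < r - D p q by rewrite subr_gt0.
apply: filterS (dist_near q r0) => s qs /=; apply: le_lt_trans (dist_triangle p q s) _.
by rewrite addrC -ltrBrDr.
Qed.

Lemma dist_closed_ball_closed p r : closed [set q | D p q <= r].
Proof.
rewrite -openC openE => q /= /negP; rewrite -ltNge => qr; have r0 : 0 < D p q - r by rewrite subr_gt0.
apply: filterS (dist_near q r0) => s qs /=; apply/negP; rewrite -ltNge.
by have := dist_triangle p s q; rewrite (dist_sym s q); lra.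
Qed.

Lemma dist_local_upper k z0 (e : R) : cod k z0 -> 0 < e -> exists2 r, 0 < r &
  forall z v, `|z - z0| < r -> `|z + v - z0| < r ->
    D (psi k z) (psi k (z + v)) <= (1 + e) * enorm (v *m 'J (param k) z0).
Proof.
move=> kz0 e0; have [r r0 H] := gd_local_upper isoF kz0 e0.
by exists r => // z v h1 h2; have := H z v h1 h2; rewrite distE lee_fin.
Qed.

(* A short path cannot leave a small chart: before doing so it meets a sphere of the chart, which F
   sends away from F p. *)
Lemma ball_nbhs p (W : set M) : open W -> W p -> exists2 s, 0 < s & forall q, D p q < s -> W q.
Proof.
move=> oW Wp; have kp := chart_at_dom p; set k := chart_at p in kp; set z0 := phi k p.
have kz0 : cod k z0 by exact: phi_cod.
have [c c0 Hc] := enorm_row_free (param_row_free isoF kz0).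
have c20 : 0 < c / 2 by rewrite divr_gt0.
have [r0 r00 Hr0] := strict_jacobian (@cod_open _ _ M k) (param_C1 isoF k) kz0 c20.
have oWk : open (cod k `&` psi k @^-1` W).
  exact: (@continuous_on_preimage _ M (cod k) (psi k) W (@cod_open _ _ _ k) (@psi_continuous _ _ _ k)).
have Wz0 : (cod k `&` psi k @^-1` W) z0 by split => //; rewrite /preimage /= phiK.
have [r1 r10 Hr1] := open_radius oWk Wz0.
pose r := Num.min r0 r1 / 2.
have m0 : 0 < Num.min r0 r1 by rewrite lt_min r00 r10.
have r_gt0 : 0 < r by rewrite divr_gt0.
have rlt : r < Num.min r0 r1 by rewrite /r ltr_pdivrMr // mulrC mulr2n mulrDl mul1r ltrDl.
move: rlt; rewrite lt_min => /andP[rr0 rr1].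
have rk z : `|z - z0| <= r -> cod k z.
  by move=> zr; have [] := Hr1 z (le_lt_trans zr rr1).
(* Half of the lower bound [c] of the Jacobian survives the linearization error. *)
have chord z : `|z - z0| <= r -> c / 2 * `|z - z0| <= enorm (param k z - param k z0).
  move=> zr; have := Hr0 z0 (z - z0); rewrite subrr normr0 subrKC => /(_ r00 (le_lt_trans zr rr0)) H1.
  have H2 := Hc (z - z0); have H3 := enormB ((z - z0) *m 'J (param k) z0) (param k z - param k z0).
  rewrite -[leRHS]enormN opprB in H3; move: H1 H2 H3.
  by set a := enorm _; set b := enorm _; set d := enorm _; set x := `|_|; lra.
have cu (z : 'rV[R]_m) : {for z, continuous (fun z : 'rV[R]_m => Num.min `|z - z0| r)}.
  apply: cont_min; apply: (@continuous_comp _ _ _ (fun z : 'rV[R]_m => z - z0) (fun x => `|x|)).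
    apply: continuous_row => i; rewrite (_ : (fun _ => _) = fun z : 'rV[R]_m => z 0 i + - z0 0 i).
      by apply: cont_add; [exact: coord_continuous|exact: cont_cst].
    by apply/funext => y; rewrite mxB.
  exact: norm_continuous.
(* The coordinate distance to [z0], capped at [r] and extended by [r]: it is continuous on all of
   [M], and [f q < r] forces [q] into the small cube. *)
pose f : M -> R := extend k (fun z => Num.min `|z - z0| r) r.
have cf : continuous f.
  apply: (@extend_continuous _ _ _ _ _ _ _ z0 r) => //; first exact: ltW.
    by move=> z zr; apply/min_idPr; exact: ltW.
have fr q : f q <= r.
  have [kq|kq] := pselect (dom k q); last by rewrite /f extend_out.
  by rewrite /f extend_in // ge_min lexx orbT.
have fin q : f q < r -> dom k q /\ `|phi k q - z0| = f q.
  have [kq|kq] := pselect (dom k q); last by rewrite /f extend_out // ltxx.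
  rewrite /f extend_in //.
  by rewrite gt_min ltxx orbF => zr; split=> //; apply/esym/min_idPl; exact: ltW.
have fpath q l : piecewise_C1_path p q l -> f q < r -> ((c / 2 * f q)%:E <= l)%E.
  move=> pl fq; have [kq E] := fin _ fq.
  have [_ _] := path_length isoF pl; apply: le_trans; rewrite lee_fin.
  have := chord (phi k q); rewrite E => /(_ (ltW fq)).
  by rewrite /param /= !phiK.
exists (c / 2 * r); first by rewrite mulr_gt0.
move=> q pq.
have {pq} [l pl lr] : exists2 l, piecewise_C1_path p q l & (l < (c / 2 * r)%:E)%E.
  by apply: gd_lt; rewrite distE lte_fin.
suff fq : f q < r.
  have [kq E] := fin _ fq; have := Hr1 (phi k q); rewrite E => /(_ (lt_trans fq rr1)) [_].
  by rewrite /preimage /= phiK.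
elim: pl lr => [_|cv a b {}l Cc ab pl IH lr].
  by rewrite /f extend_in // -/z0 subrr normr0 gt_min r_gt0.
have L0 := @curve_length_ge0 _ _ _ cv a b.
have lr' : (l < (c / 2 * r)%:E)%E by apply: le_lt_trans lr; rewrite leeDl.
have fa := IH lr'; have fal := fpath _ _ pl fa.
rewrite ltNge; apply/negP => rb; have fb : f (cv b) = r by apply/le_anti; rewrite fr rb.
have [l0 lfin _] := path_length isoF (path_snoc Cc ab pl).
have /fineK lE := lfin; set x := fine _ in lE.
rewrite -lE lte_fin in lr.
have x0 : x < c / 2 * r by exact: lr.
(* A value which [f] must take on its way to [r], although reaching it costs length [c / 2 * s],
   more than the total [x]. *)
pose s := (x / (c / 2) + r) / 2.
have xr : x / (c / 2) < r by rewrite ltr_pdivrMr // mulrC.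
have sr : s < r by rewrite /s; lra.
have xs : x / (c / 2) < s by rewrite /s; lra.
have fas : f (cv a) <= s.
  apply: ltW; apply: le_lt_trans xs; rewrite ler_pdivlMr // mulrC -lee_fin lE.
  by apply: (le_trans fal); rewrite leeDl.
have cfc : {within `[a, b], continuous (f \o cv)}.
  apply: continuous_subspaceT => t; apply: continuous_comp; [exact: (Cc.1 t)|exact: cf].
have [|t] := IVT (v := s) ab cfc.
  by rewrite /= fb (min_idPl (ltW fa)) (max_idPr (ltW fa)) fas ltW.
rewrite in_itv /= => /andP[at_ tb] ft.
have pt := path_snoc Cc at_ pl.
have := fpath _ _ pt; rewrite ft => /(_ sr) H.
have : (l + curve_length cv a t <= x%:E)%E.
  have Lt := @curve_length_ge0 _ _ _ cv t b.
  by rewrite lE (curve_length_split isoF Cc at_ tb); apply: leeD2l; rewrite leeDl.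
move=> /(le_trans H); rewrite lee_fin; apply/negP; rewrite -ltNge mulrC -ltr_pdivrMr //.
Qed.

(** By the intermediate value theorem the path meets the sphere of radius [s] about [p]. The part
    before that point has length at least [s], so at most [l - s] is left for the rest. *)
Lemma path_split p q l : piecewise_C1_path p q l -> forall s, 0 <= s -> s <= D p q ->
  exists z, D p z = s /\ ((D z q + s)%:E <= l)%E.
Proof.
elim=> [s s0|c a b {}l Cc ab pl IH s s0 sb].
  by rewrite distxx => s1; exists p; rewrite distxx add0r; split; [apply/le_anti;
    rewrite s0 s1|rewrite lee_fin].
have Dab t1 t2 : t1 <= t2 -> ((D (c t1) (c t2))%:E <= curve_length c t1 t2)%E.
  by move=> t12; rewrite -distE; apply: gd_le; exact: path_segment.
have [sa|sa] := leP s (D p (c a)).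
  have [z [zs zl]] := IH s s0 sa; exists z; split=> //.
  apply: (@le_trans _ _ ((D z (c a) + s) + D (c a) (c b))%:E).
    by rewrite lee_fin addrAC lerD2r dist_triangle.
  by rewrite EFinD; apply: leeD => //; exact: Dab.
have cD : {within `[a, b], continuous (D p \o c)}.
  by apply: continuous_subspaceT => t; apply: continuous_comp; [exact: (Cc.1 t)|exact: dist_continuous].
have [|t] := IVT (v := s) ab cD.
  have h := le_trans (ltW sa) sb.
  by rewrite /= (min_idPl h) (max_idPr h) (ltW sa) sb.
rewrite in_itv /= => /andP[at_ tb] pt; exists (c t); split=> //.
rewrite (curve_length_split isoF Cc at_ tb) addeA addrC EFinD; apply: leeD; last exact: Dab.
by rewrite -pt -distE; apply: gd_le; exact: path_snoc.
Qed.

(** Taken on an almost minimizing path, [z] is almost between [p] and [q] and stands in for a point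
    of a geodesic. *)
Lemma dist_split p q s e : 0 <= s -> s <= D p q -> 0 < e -> exists z, D p z = s /\ D z q + s <= D p q + e.
Proof.
move=> s0 sq e0; have [|l pl ll] := @gd_lt _ _ _ p q (D p q + e)%:E.
  by rewrite distE lte_fin ltrDl.
have [z [zs zl]] := path_split pl s0 sq; exists z; split=> //.
by rewrite -lee_fin; apply: (le_trans zl); exact: ltW.
Qed.

(** * Compactness of closed balls *)

Section complete.
Hypothesis complM : complete_manifold M.

Definition precompact_ball p r := exists2 K : set M, compact K & forall q, D p q <= r -> K q.

Lemma precompact_ballS p q r s : precompact_ball p r -> D p q + s <= r -> precompact_ball q s.
Proof.
move=> [K cK HK] h; exists K => // z qz; apply: HK; apply: le_trans (dist_triangle p q z) _; lra.
Qed.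

Lemma precompact_ball_compact p r : precompact_ball p r -> compact [set q | D p q <= r].
Proof. by move=> [K cK HK]; exact: (subclosed_compact (dist_closed_ball_closed (p:=p) (r:=r)) cK HK). Qed.

Lemma precompact_small p : exists2 r, 0 < r & precompact_ball p r.
Proof.
have kp := chart_at_dom p; set k := chart_at p in kp.
have [r r0 Hr] := open_radius (@cod_open _ _ M k) (phi_cod kp).
have r20 : 0 < r / 2 by rewrite divr_gt0.
have rk z : `|z - phi k p| <= r / 2 -> cod k z by move=> zr; apply: Hr; lra.
pose W := [set q | dom k q /\ `|phi k q - phi k p| < r / 2].
have oW : open W.
  rewrite openE => q [kq qr]; have d0 : 0 < r / 2 - `|phi k q - phi k p| by rewrite subr_gt0.
  apply: filterS (near_chart kq d0) => q' [kq' q'q]; split=> //.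
  by have := ler_distD (phi k q) (phi k q') (phi k p); lra.
have [|s s0 Hs] := ball_nbhs (p := p) oW; first by split=> //; rewrite subrr normr0.
exists (s / 2); first by rewrite divr_gt0.
exists (psi k @` [set z | `|z - phi k p| <= r / 2]).
  by apply: chart_cube_compact => //; exact: ltW.
move=> q qs; have [|kq qr] := Hs q; first lra.
by exists (phi k q); [exact: ltW|exact: phiK].
Qed.

(** If all the balls of radius [r / 2] about points of the ball were precompact, the radius of a
    precompact ball about [p] could grow from 0 to [r] in eight steps of [r / 8]. A point within
    [t + r / 8] of [p] is within [r / 4] of the compact ball of radius [t], hence within [3 * r / 8]
    of a finite net of that ball. *)
Lemma precompact_halving p r : 0 < r -> ~ precompact_ball p r ->
  exists q, D p q <= r /\ ~ precompact_ball q (r / 2).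
Proof.
move=> r0 np; apply: contrapT => /forallNP H; apply: np.
have {}H q : D p q <= r -> precompact_ball q (r / 2).
  by move=> pq; apply: contrapT => nq; apply: (H q).
have r80 : 0 < r / 8 by rewrite divr_gt0.
suff S j : (j <= 8)%N -> precompact_ball p (j%:R * (r / 8)).
  by have := S 8%N (leqnn _); rewrite mulrC divfK.
elim: j => [_|j IH j8].
  rewrite mul0r; apply: (@precompact_ballS p p (r / 2)); last by rewrite distxx; lra.
  by apply: H; rewrite distxx ltW.
have /precompact_ball_compact cK := IH (ltnW j8).
set t := j%:R * (r / 8) in cK *.
have t0 : 0 <= t by rewrite mulr_ge0 // ltW.
have tr : t <= r.
  apply: (@le_trans _ _ (8 * (r / 8))); last lra.
  by rewrite ler_pM2r // ler_nat ltnW.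
have [|l [lt Hl]] := @compact_finite_cover M _ (fun q => [set s | D q s < r / 8]) cK.
  by move=> q _; split; [exact: dist_ball_open|rewrite /= distxx].
have {}lt y : y \in l -> precompact_ball y (r / 2).
  by move=> /lt /= yt; apply: H; exact: le_trans tr.
have [K cK' HK] : exists2 K : set M, compact K & forall y q, y \in l -> D y q <= r / 2 -> K q.
  elim: l lt {Hl} => [_|y l IHl Hy]; first by exists set0 => //; exact: compact0.
  have [|K cK' HK] := IHl; first by move=> z zl; apply: Hy; rewrite inE zl orbT.
  have [|K' cK'' HK'] := Hy y; first by rewrite inE eqxx.
  exists (K' `|` K); first exact: compactU.
  move=> z q; rewrite inE => /orP[/eqP ->|zl] zq; first by left; exact: HK'.
  by right; exact: HK zq.
exists K => // z; rewrite (_ : j.+1%:R * (r / 8) = t + r / 8); last by rewrite /t -addn1 natrD mulrDl mul1r.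
move=> pz.
have [w [wt wz]] : exists w, D p w <= t /\ D w z <= r / 4.
  have [zt|zt] := leP (D p z) t; first by exists z; rewrite distxx; split=> //; lra.
  have [w [wt wz]] := dist_split t0 (ltW zt) r80.
  by exists w; split; [rewrite wt|lra].
have [y yl yw] := Hl w wt; apply: (HK y) => //.
by have := dist_triangle y w z; move: yw => /=; lra.
Qed.

(* Hopf-Rinow: a ball which is not precompact contains such balls at all smaller scales; their centers can
   be chosen to form a Cauchy sequence. *)
Lemma closed_ball_compact p r : compact [set q | D p q <= r].
Proof.
apply: precompact_ball_compact; apply: contrapT => np.
have r0 : 0 < r.
  rewrite ltNge; apply/negP => r0; apply: np; have [s s0 Hs] := precompact_small p.
  by apply: (@precompact_ballS p p s) => //; rewrite distxx; lra.
pose step (x : M * R) (y : M * R) := 0 < x.2 -> ~ precompact_ball x.1 x.2 ->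
  [/\ y.2 = x.2 / 2, D x.1 y.1 <= x.2 & ~ precompact_ball y.1 y.2].
have /choice[nx Hnx] : forall x, exists y, step x y.
  move=> [q s]; have [[s0 nq]|h] := pselect (0 < s /\ ~ precompact_ball q s); last first.
    by exists (q, s) => h1 h2; case: h.
  by have [q' [qq' nq']] := precompact_halving s0 nq; exists (q', s / 2).
pose u i := iter i nx (p, r).
have Hu i : [/\ (u i).2 = r / 2 ^+ i, ~ precompact_ball (u i).1 (u i).2 &
    D (u i).1 (u i.+1).1 <= r / 2 ^+ i].
  have P2 j : 0 < r / 2 ^+ j by rewrite divr_gt0 // exprn_gt0.
  elim: i => [|i [E nP _]].
    have [E D1 nP] := Hnx (p, r) r0 np.
    by rewrite /u /= expr0 divr1.
  have ui0 : 0 < (u i).2 by rewrite E.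
  have [E' D' nP'] := Hnx (u i) ui0 nP.
  have E1 : (u i.+1).2 = r / 2 ^+ i.+1 by rewrite /u iterS -/(u i) E' E exprS invfM mulrA mulrAC.
  have uj0 : 0 < (u i.+1).2 by rewrite E1.
  have [_ D2 _] := Hnx (u i.+1) uj0 nP'.
  by split=> //; move: D2; rewrite E1.
have dij i j : (i <= j)%N -> D (u i).1 (u j).1 <= 2 * (r / 2 ^+ i) - 2 * (r / 2 ^+ j).
  elim: j => [|j IH]; first by rewrite leqn0 => /eqP ->; rewrite distxx subrr.
  rewrite leq_eqVlt => /orP[/eqP ->|]; first by rewrite distxx subrr.
  rewrite ltnS => /IH h; have [_ _ h2] := Hu j.
  have h3 := dist_triangle (u i).1 (u j).1 (u j.+1).1.
  have h4 : r / 2 ^+ j.+1 = r / 2 ^+ j / 2 by rewrite exprS invfM mulrA mulrAC.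
  by rewrite h4; move: h h2 h3; set x := r / 2 ^+ j; set y := r / 2 ^+ i; lra.
have small e : 0 < e -> exists N, forall i, (N <= i)%N -> 4 * (r / 2 ^+ i) < e.
  move=> e0; exists (Num.truncn (4 * r / e)) => i Ni.
  rewrite mulrA ltr_pdivrMr ?exprn_gt0 // (mulrC e) -ltr_pdivrMr //.
  apply: (lt_le_trans (truncnS_gt _)); rewrite -natrX ler_nat.
  exact: leq_ltn_trans Ni (ltn_expl _ _).
have cauchy (e : R) : 0 < e -> exists N : nat, forall i j,
    (N <= i)%N -> (N <= j)%N -> (gd (u i).1 (u j).1 < e%:E)%E.
  move=> e0; have [N HN] := small e e0; exists N => i j Ni Nj; rewrite distE lte_fin.
  have P2 k : 0 < r / 2 ^+ k by rewrite divr_gt0 // exprn_gt0.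
  have hN := HN N (leqnn _).
  have h i' : (N <= i')%N -> D (u N).1 (u i').1 <= 2 * (r / 2 ^+ N).
    by move=> Ni'; apply: (le_trans (dij _ _ Ni')); rewrite gerBl mulr_ge0 // ltW.
  have := dist_triangle (u i).1 (u N).1 (u j).1; rewrite (dist_sym (u i).1 (u N).1).
  by have := h _ Ni; have := h _ Nj; move: hN; set x := r / 2 ^+ N; lra.
have [q /fine_cvgP[_ cq]] := complM cauchy.
have [s s0 Hs] := precompact_small q.
have s20 : 0 < s / 2 by rewrite divr_gt0.
have /cvgrPdist_lt /(_ _ s20) [N1 _ HN1] := cq.
have [N2 HN2] := small s s0.
(* From this index on, the balls of the sequence lie inside a small precompact ball about the limit
   [q], a contradiction. *)
pose N := maxn N1 N2.
have h1 := HN1 N (leq_maxl _ _); have h2 := HN2 N (leq_maxr _ _).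
have [E nP _] := Hu N; apply: nP; apply: precompact_ballS Hs _; rewrite E.
move: h1; rewrite /= sub0r normrN => /(le_lt_trans (ler_norm _)) h1.
rewrite dist_sym; move: h1 h2; rewrite /D /=; set x := fine _; set y := r / 2 ^+ N.
have y0 : 0 <= y by rewrite divr_ge0 ?exprn_ge0 // ltW.
by lra.
Qed.

(** Closed balls are compact, so a noncompact manifold has points arbitrarily far from [x]; an
    almost minimizing path to such a point crosses the sphere. *)
Lemma sphere_nonempty x r : ~ compact [set: M] -> 0 <= r -> exists y, D x y = r.
Proof.
move=> ncM r0; have [q rq] : exists q, r <= D x q.
  apply: contrapT => /forallNP H; apply: ncM.
  rewrite (_ : setT = [set q | D x q <= r]); first exact: closed_ball_compact.
  apply/seteqP; split=> // q _ /=; have /negP := H q; rewrite -ltNge; exact: ltW.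
by have [z [zr _]] := dist_split r0 rq ltr01; exists z.
Qed.

End complete.
End real_distance.

(** * Divergence of the tangential position field *)

Section matrix_entries.
Context {R : comPzRingType}.

Lemma mulmx_entry p q s (A : 'M[R]_(p, q)) (B : 'M[R]_(q, s)) i j : (A *m B) i j = \sum_k A i k * B k j.
Proof. by rewrite mxE. Qed.

Lemma trmx_entry p q (A : 'M[R]_(p, q)) i j : A^T i j = A j i.
Proof. by rewrite mxE. Qed.

End matrix_entries.

Lemma invmx_mul (R : comUnitRingType) p (A B : 'M[R]_p) : A \in unitmx -> B \in unitmx ->
  invmx (A *m B) = invmx B *m invmx A.
Proof.
move=> uA uB; have uAB : A *m B \in unitmx by rewrite unitmx_mul uA.
rewrite -[RHS]mul1mx -(mulVmx uAB) -!mulmxA (mulmxA B) mulmxV // mul1mx mulmxV // mulmx1 //.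
Qed.

Section matrix_derivatives.
Context {R : realType} {m : nat}.
Implicit Types (U : set 'rV[R]_m).

Definition C1mx p q U (A : 'rV[R]_m -> 'M[R]_(p, q)) := forall i j, C1 U (fun z => A z i j).

Definition dmx p q (v : 'rV[R]_m) (A : 'rV[R]_m -> 'M[R]_(p, q)) y : 'M[R]_(p, q) :=
  \matrix_(i, j) 'D_v (fun z => A z i j) y.

Lemma dmxE p q v (A : 'rV[R]_m -> 'M[R]_(p, q)) y i j : dmx v A y i j = 'D_v (fun z => A z i j) y.
Proof. by rewrite mxE. Qed.

Lemma C1mx_mul p q s U (A : 'rV[R]_m -> 'M[R]_(p, q)) (B : 'rV[R]_m -> 'M[R]_(q, s)) : open U ->
  C1mx U A -> C1mx U B -> C1mx U (fun z => A z *m B z).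
Proof.
move=> oU CA CB i j; apply: (C1_eq (g := fun z => \sum_k A z i k * B z k j)) => //.
  by move=> z _; rewrite mulmx_entry.
by apply: C1_sum => // k; exact: C1M.
Qed.

Lemma C1mx_tr p q U (A : 'rV[R]_m -> 'M[R]_(p, q)) : open U -> C1mx U A -> C1mx U (fun z => (A z)^T).
Proof. by move=> oU CA i j; apply: (C1_eq (g := fun z => A z j i)) => // z _; rewrite trmx_entry. Qed.

Lemma dmx_mul p q s U v (A : 'rV[R]_m -> 'M[R]_(p, q)) (B : 'rV[R]_m -> 'M[R]_(q, s)) y : open U -> U y ->
  C1mx U A -> C1mx U B -> dmx v (fun z => A z *m B z) y = dmx v A y *m B y + A y *m dmx v B y.
Proof.
move=> oU Uy CA CB; apply/matrixP => i j; rewrite dmxE [RHS]mxE !mulmx_entry -big_split /=.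
rewrite (derive_eq_on (g := fun z => \sum_k A z i k * B z k j) v oU Uy); last first.
  by move=> z _; rewrite mulmx_entry.
have dA k : differentiable (fun z => A z i k) y by exact: (C1_diff (CA i k) Uy).
have dB k : differentiable (fun z => B z k j) y by exact: (C1_diff (CB k j) Uy).
rewrite derive_bigsum => [|k]; last exact: (differentiableM (dA k) (dB k)).
by apply: eq_bigr => k _; rewrite derive_mul // !dmxE.
Qed.

Lemma dmx_tr p q v (A : 'rV[R]_m -> 'M[R]_(p, q)) y : dmx v (fun z => (A z)^T) y = (dmx v A y)^T.
Proof.
apply/matrixP => i j; rewrite trmx_entry !dmxE; congr ('D_v _ y).
by apply/funext => z; rewrite trmx_entry.
Qed.

Lemma dmx_eq p q U v (A B : 'rV[R]_m -> 'M[R]_(p, q)) y : open U -> U y -> (forall z, U z -> A z = B z) ->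
  dmx v A y = dmx v B y.
Proof.
move=> oU Uy AB; apply/matrixP => i j; rewrite !dmxE.
by apply: (derive_eq_on v oU Uy) => z Uz; rewrite AB.
Qed.

Lemma derive_sqrt_mul U (f : 'rV[R]_m -> R) v y : open U -> U y -> (forall z, U z -> 0 < f z) -> C1 U f ->
  'D_v f y = 2 * Num.sqrt (f y) * 'D_v (fun z => Num.sqrt (f z)) y.
Proof.
move=> oU Uy f0 Cf; have Cs := C1_sqrt oU f0 Cf.
rewrite (derive_eq_on (g := fun z => Num.sqrt (f z) * Num.sqrt (f z)) v oU Uy); last first.
  by move=> z Uz; rewrite -expr2 sqr_sqrtr // ltW // f0.
by rewrite derive_mul; [ring|exact: (C1_diff Cs Uy)|exact: (C1_diff Cs Uy)].
Qed.

End matrix_derivatives.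

(** * Projection to the normal space *)

Section normal_part.
Context {R : realType} {m n : nat}.
Implicit Types (J : 'M[R]_(m, n)) (v : 'rV[R]_n).

Lemma normal_partD J v v' : normal_part J (v + v') = normal_part J v + normal_part J v'.
Proof. by rewrite /normal_part !mulmxDl opprD addrACA. Qed.

Lemma normal_partZ J c v : normal_part J (c *: v) = c *: normal_part J v.
Proof. by rewrite /normal_part -!scalemxAl scalerBr. Qed.

Lemma normal_part_sum J (I : Type) (r : seq I) (f : I -> 'rV[R]_n) :
  normal_part J (\sum_(i <- r) f i) = \sum_(i <- r) normal_part J (f i).
Proof.
elim: r => [|i r IH]; last by rewrite !big_cons normal_partD IH.
by rewrite !big_nil -(scale0r 0) normal_partZ !scale0r.
Qed.

Lemma normal_part_tangent J (v : 'rV[R]_m) : J *m J^T \in unitmx -> normal_part J (v *m J) = 0.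
Proof. by move=> uJ; rewrite /normal_part -!mulmxA (mulmxA J) (mulmxA (J *m _)) mulmxV // mul1mx subrr. Qed.

Lemma dot_normal_part J v v' : dot (normal_part J v) v' = dot v (normal_part J v').
Proof.
rewrite !dotE /normal_part linearB /= mulmxBl mulmxBr; congr (fun_of_matrix (_ - _) 0 0).
by rewrite !trmx_mul trmxK trmx_inv trmx_mul trmxK !mulmxA.
Qed.

Lemma dot_orth (a b : 'rV[R]_n) : dot a b = 0 -> dot (a + b) (a + b) = dot a a + dot b b.
Proof.
by move=> o; rewrite dotDl ![dot _ (a + b)]dotC !dotDl (dotC b a) o addr0 add0r.
Qed.

Lemma normal_part_orth J v : J *m J^T \in unitmx -> dot (v - normal_part J v) (normal_part J v) = 0.
Proof.
move=> uJ; have -> : v - normal_part J v = v *m J^T *m invmx (J *m J^T) *m J.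
  by rewrite /normal_part opprB addrC subrK.
by rewrite -dot_normal_part normal_part_tangent // dotE mul0mx mxE.
Qed.

Lemma tangent_part_le J v : J *m J^T \in unitmx -> enorm (v - normal_part J v) <= enorm v.
Proof.
move=> uJ; have o := normal_part_orth v uJ; set a := v - normal_part J v in o *.
rewrite -ler_sqr ?nnegrE ?enorm_ge0 // !enorm_sqr.
have -> : dot v v = dot a a + dot (normal_part J v) (normal_part J v).
  by rewrite -(dot_orth o) subrK.
by rewrite lerDl dot_ge0.
Qed.

(** The projection depends on the row space of [J] only, that is, on the tangent space and not on
    the coordinates. *)
Lemma normal_part_change J (A : 'M[R]_m) v : A \in unitmx -> J *m J^T \in unitmx ->
  normal_part (A *m J) v = normal_part J v.
Proof.
move=> uA uJ; rewrite /normal_part; congr (_ - _).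
have -> : A *m J *m (A *m J)^T = A *m (J *m J^T) *m A^T by rewrite trmx_mul !mulmxA.
rewrite !invmx_mul ?unitmx_mul ?uA ?uJ ?unitmx_tr // trmx_mul.
by rewrite -!mulmxA (mulmxA (invmx A)) mulVmx // mul1mx (mulmxA A^T) mulmxV ?unitmx_tr // mul1mx.
Qed.

End normal_part.

Lemma mxD (R : pzRingType) p q (A B : 'M[R]_(p, q)) i j : (A + B) i j = A i j + B i j.
Proof. by rewrite mxE. Qed.

Lemma mxZ (R : pzRingType) p q c (A : 'M[R]_(p, q)) i j : (c *: A) i j = c * A i j.
Proof. by rewrite mxE. Qed.

Lemma mx_row (R : pzRingType) p q (A : 'M[R]_(p, q)) i i0 j : row i A i0 j = A i j.
Proof. by rewrite mxE. Qed.

Section geometry.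
Context {R : realType} {m n : nat} {M : riemannian_manifold R m} (F : M -> 'rV[R]_n).
Hypothesis isoF : isometric_immersion F.
Variable X0 : 'rV[R]_n.
Local Notation cod := (@cod R m M).
Local Notation psi := (@psi R m M).
Local Notation overlap := (@overlap R m M).
Local Notation transition := (@transition R m M).
Local Notation vol_density := (@vol_density R m M).
Local Notation param := (@param R m n M F).

Definition jac k z : 'M[R]_(m, n) := 'J (param k) z.
Definition ginv k z : 'M[R]_m := invmx (metric M k z).
(** Second derivatives sliced by the direction [i], so that [hess k i] is the derivative of the
    matrix [jac k] and symmetry exchanges [i] with the row index. *)
Definition hess k (i : 'I_m) z : 'M[R]_(m, n) :=
  \matrix_(j, a) 'D_'e_i ('D_'e_j (fun z => param k z 0 a)) z.
Definition pos k z : 'rV[R]_n := param k z - X0.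
(* The tangential part of the position vector, in coordinates. *)
Definition Vf k z : 'rV[R]_m := pos k z *m (jac k z)^T *m ginv k z.
Definition Hk k z : 'rV[R]_n := \sum_i \sum_j ginv k z i j *: normal_part (jac k z) (row j (hess k i z)).

Let oc := fun k => @cod_open R m M k.

Lemma jacE k z i a : cod k z -> jac k z i a = 'D_'e_i (fun z => param k z 0 a) z.
Proof. by move=> kz; apply: jacobianE; exact: param_differentiable. Qed.

Lemma param_C1_derive k i a : C1 (cod k) ('D_'e_i (fun z => param k z 0 a)).
Proof. by apply: C1_derive_entry; [exact: cod_open|exact: (isoF k).1]. Qed.

Lemma jac_C1 k : C1mx (cod k) (jac k).
Proof.
move=> i a; apply: (C1_eq (@oc k) _ (param_C1_derive k i a)) => z; exact: jacE.
Qed.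

Lemma hessE k i z j a : hess k i z j a = 'D_'e_i ('D_'e_j (fun z => param k z 0 a)) z.
Proof. by rewrite mxE. Qed.

Lemma dmx_jac k i z : cod k z -> dmx 'e_i (jac k) z = hess k i z.
Proof.
move=> kz; apply/matrixP => j a; rewrite dmxE hessE.
by apply: (derive_eq_on _ (@oc k) kz) => y; exact: jacE.
Qed.

Lemma hess_sym k i z j a : cod k z -> hess k i z j a = hess k j z i a.
Proof.
move=> kz; apply: (eq_trans (hessE k i z j a)); apply: (eq_trans _ (esym (hessE k j z i a))).
exact: (derive_commute i j (@oc k) (param_C1 isoF k a) (fun l => param_C1_derive k l a) kz).
Qed.

Lemma pos_C1 k : C1mx (cod k) (pos k).
Proof.
move=> i a; rewrite (ord1 i); apply: (C1_eq (g := fun z => param k z 0 a - X0 0 a)) => //.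
  by move=> z _; rewrite mxB.
by apply: C1B; [exact: oc|exact: param_C1|exact: C1_cst].
Qed.

Lemma dmx_pos k i z : cod k z -> dmx 'e_i (pos k) z = row i (jac k z).
Proof.
move=> kz; apply/matrixP => j a; rewrite dmxE (ord1 j) [RHS]mxE jacE //.
have dp : differentiable (fun z => param k z 0 a) z by exact: (C1_diff (param_C1 isoF k a) kz).
have dc : differentiable ((fun=> - X0 0 a) : 'rV[R]_m -> R) z by exact: differentiable_cst.
rewrite (derive_eq_on (g := fun z => param k z 0 a + - X0 0 a) _ (@oc k) kz).
  by rewrite derive_add // derive_cst addr0.
by move=> y _; rewrite mxB.
Qed.

Lemma metric_C1mx k : C1mx (cod k) (metric M k).
Proof. by move=> i j; exact: metric_C1. Qed.

Lemma jac_gram k z : cod k z -> metric M k z = jac k z *m (jac k z)^T.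
Proof. exact: metricE. Qed.

Lemma dmx_metric k i z : cod k z ->
  dmx 'e_i (metric M k) z = hess k i z *m (jac k z)^T + jac k z *m (hess k i z)^T.
Proof.
move=> kz; rewrite (dmx_eq (B := fun z => jac k z *m (jac k z)^T) _ (@oc k) kz); last exact: jac_gram.
rewrite (dmx_mul _ (@oc k) kz (jac_C1 k)); last by apply: C1mx_tr; [exact: oc|exact: jac_C1].
by rewrite dmx_tr dmx_jac.
Qed.

Lemma ginv_C1 k : C1mx (cod k) (ginv k).
Proof.
move=> i j; apply: C1_invmx; [exact: oc|by move=> y; exact: metric_unit|by move=> a b; exact: metric_C1].
Qed.

Lemma ginv_sym k z : cod k z -> (ginv k z)^T = ginv k z.
Proof. by move=> kz; rewrite /ginv trmx_inv Defs.metric_sym. Qed.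

Lemma Vf_C1 k : C1mx (cod k) (Vf k).
Proof.
apply: C1mx_mul (ginv_C1 k); first exact: oc.
apply: C1mx_mul (pos_C1 k) _; first exact: oc.
by apply: C1mx_tr; [exact: oc|exact: jac_C1].
Qed.

Lemma Vf_metric k z : cod k z -> Vf k z *m metric M k z = pos k z *m (jac k z)^T.
Proof. by move=> kz; rewrite /Vf mulmxKV // metric_unit. Qed.

(* Differentiate [Vf_metric]; the derivative of the inverse metric is not needed. *)
Lemma dmx_Vf k i z : cod k z -> dmx 'e_i (Vf k) z = row i 1%:M +
  (normal_part (jac k z) (pos k z) *m (hess k i z)^T - Vf k z *m hess k i z *m (jac k z)^T) *m ginv k z.
Proof.
move=> kz; have ug := metric_unit kz.
have := dmx_eq (A := fun z => Vf k z *m metric M k z) (B := fun z => pos k z *m (jac k z)^T) 'e_i (@oc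
  k) kz (@Vf_metric k).
rewrite (dmx_mul _ (@oc k) kz (Vf_C1 k) (metric_C1mx k)).
rewrite (dmx_mul _ (@oc k) kz (pos_C1 k)); last by apply: C1mx_tr; [exact: oc|exact: jac_C1].
rewrite dmx_tr dmx_jac // dmx_pos // dmx_metric // => E.
rewrite -[LHS](mulmxK ug) -/(ginv k z).
have -> : dmx 'e_i (Vf k) z *m metric M k z = row i (jac k z) *m (jac k z)^T +
   (normal_part (jac k z) (pos k z) *m (hess k i z)^T - Vf k z *m hess k i z *m (jac k z)^T).
  have -> : dmx 'e_i (Vf k) z *m metric M k z = row i (jac k z) *m (jac k z)^T + pos k z *m (hess k i z)^T -
      Vf k z *m (hess k i z *m (jac k z)^T + jac k z *m (hess k i z)^T).
    by rewrite -E addrK.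
  have -> : normal_part (jac k z) (pos k z) = pos k z - Vf k z *m jac k z by rewrite /normal_part -jac_gram.
  move: (pos k z) (Vf k z) (hess k i z) (jac k z) => p W S J.
  rewrite mulmxBl mulmxDr opprD !mulmxA -!addrA; congr (_ + (_ + _)); exact: addrC.
have E2 : row i (jac k z) *m (jac k z)^T *m ginv k z = row i 1%:M.
  by rewrite -!row_mul -jac_gram // /ginv mulmxV.
by rewrite (mulmxDl (row i (jac k z) *m (jac k z)^T)) E2.
Qed.

(** Jacobi's formula applied to the determinant, which is the square of the density. The two terms
    in the derivative of the metric are transposes of each other and have the same trace against
    [ginv], which cancels the factor 2. *)
Lemma derive_density k i z : cod k z ->
  'D_'e_i (vol_density k) z = vol_density k z * \tr (hess k i z *m (jac k z)^T *m ginv k z).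
Proof.
move=> kz; have ug := metric_unit kz.
have Cdet : C1 (cod k) (fun z => \det (metric M k z)).
  by apply: C1_det; [exact: oc|move=> a b; exact: metric_C1].
have w0 := vol_density_gt0 kz; have d0 := metric_det_gt0 kz.
have E1 : 'D_'e_i (fun z => \det (metric M k z)) z = 2 * vol_density k z * 'D_'e_i (vol_density k) z.
  have E := derive_sqrt_mul 'e_i (@oc k) kz (fun y ky => metric_det_gt0 ky) Cdet.
  exact E.
have E2 : 'D_'e_i (fun z => \det (metric M k z)) z =
    \det (metric M k z) * \tr (dmx 'e_i (metric M k) z *m ginv k z).
  rewrite derive_det => [|a b]; last exact: (C1_diff (metric_C1 k a b) kz).
  rewrite /mxtrace mulr_sumr; apply: eq_bigr => a _; rewrite mulmx_entry mulr_sumr.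
  apply: eq_bigr => b _; rewrite dmxE [RHS]mulrCA; congr (_ * _).
  by rewrite /ginv /invmx ug !mxE mulrA divff ?mul1r // gt_eqF.
have E3 : \tr (dmx 'e_i (metric M k) z *m ginv k z) = 2 * \tr (hess k i z *m (jac k z)^T *m ginv k z).
  rewrite dmx_metric // mulmxDl linearD /= mulr_natl mulr2n; congr (_ + _).
  by rewrite -mxtrace_tr !trmx_mul trmxK ginv_sym // mxtrace_mulC.
have w2 : \det (metric M k z) = vol_density k z ^+ 2 by rewrite sqr_sqrtr // ltW.
have := E1; rewrite E2 E3 w2 => E.
have wn : 2 * vol_density k z != 0 by rewrite mulf_neq0 // gt_eqF.
apply: (mulfI wn); rewrite -E; ring.
Qed.

Lemma row_mulmx_tr p (v : 'rV[R]_p) q (A : 'M[R]_(q, p)) i : (v *m A^T) 0 i = dot v (row i A).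
Proof. by rewrite mulmx_entry; apply: eq_bigr => a _; rewrite trmx_entry mxE. Qed.

(** The derivative of the density contributes the traces of [hess k i *m P] times the components of
    [Vf]. By symmetry of the second derivatives they cancel the tangential term in the derivative of
    [Vf]. What remains is [m] from the identity, and the trace of the second fundamental form paired
    with the position. *)
Lemma divergence_tangent k z : cod k z ->
  \sum_i 'D_'e_i (fun z => vol_density k z * Vf k z 0 i) z = vol_density k z * (m%:R + dot (Hk k z) (pos k z)).
Proof.
move=> kz; set w := vol_density k z; set N := normal_part (jac k z) (pos k z).
pose P := (jac k z)^T *m ginv k z.
have E i : 'D_'e_i (fun z => vol_density k z * Vf k z 0 i) z =
    w * (\tr (hess k i z *m P) * Vf k z 0 i + (1 + (N *m (hess k i z)^T *m ginv k z) 0 i -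
      (Vf k z *m (hess k i z *m P)) 0 i)).
  rewrite derive_mul; [|exact: (C1_diff (vol_density_C1 k) kz)|exact: (C1_diff (Vf_C1 k 0 i) kz)].
  rewrite derive_density // -(dmxE 'e_i (Vf k) z 0 i) dmx_Vf // mulmxBl mxD mxB.
  rewrite (_ : (row i 1%:M) 0 i = 1); last by rewrite !mxE eqxx.
  by rewrite /P !mulmxA -/w -/N; ring.
under eq_bigr do rewrite E.
rewrite -mulr_sumr; congr (w * _); rewrite big_split /= sumrB big_split /= sumr_const card_ord.
have -> : \sum_i (N *m (hess k i z)^T *m ginv k z) 0 i = dot (Hk k z) (pos k z).
  rewrite /Hk dotC; under [RHS]eq_bigr do rewrite summxE.
  transitivity (\sum_i \sum_j ginv k z i j * dot (row j (hess k i z)) N).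
    apply: eq_bigr => i _; rewrite mulmx_entry; apply: eq_bigr => j _.
    rewrite row_mulmx_tr dotC mulrC; congr (_ * _).
    by rewrite -[in LHS](ginv_sym kz) trmx_entry.
  transitivity (\sum_i \sum_j dot (pos k z) (ginv k z i j *: normal_part (jac k z) (row j (hess k i z)))).
    by apply: eq_bigr => i _; apply: eq_bigr => j _; rewrite (dotC (pos k z)) dotZl dot_normal_part.
  rewrite /dot; transitivity (\sum_i \sum_a \sum_j pos k z 0 a *
      (ginv k z i j *: normal_part (jac k z) (row j (hess k i z))) 0 a).
    by apply: eq_bigr => i _; rewrite exchange_big.
  rewrite exchange_big /=; apply: eq_bigr => a _; rewrite mulr_sumr; apply: eq_bigr => i _.
  by rewrite summxE mulr_sumr.
have -> : \sum_i (Vf k z *m (hess k i z *m P)) 0 i = \sum_i \tr (hess k i z *m P) * Vf k z 0 i.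
  transitivity (\sum_i \sum_j Vf k z 0 j * (hess k i z *m P) j i).
    by apply: eq_bigr => i _; rewrite mulmx_entry.
  rewrite exchange_big /=; apply: eq_bigr => j _; rewrite -mulr_sumr mulrC; congr (_ * _).
  rewrite /mxtrace; apply: eq_bigr => i _.
  apply: (eq_trans (mulmx_entry _ _ _ _)); apply: (eq_trans _ (esym (mulmx_entry _ _ _ _))).
  by apply: eq_bigr => a _; congr (_ * _); exact: hess_sym.
by rewrite addrC subrK.
Qed.

Lemma second_fundamental_formE k z i j : cod k z ->
  second_fundamental_form F k z i j = normal_part (jac k z) (row j (hess k i z)).
Proof.
move=> kz; rewrite /second_fundamental_form; congr (normal_part _ _).
have C2 := (isoF k).1 2%N; have [_ C2'] := C2; have [_ Cj] := C2' j.
apply/rowP => a; rewrite -(derive_entry 0 a i Cj kz) [RHS]mxE hessE.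
by apply: (derive_eq_on _ (@oc k) kz) => y ky; rewrite -(derive_entry 0 a j ((isoF k).1 1%N) ky).
Qed.

Lemma jac_transition k l z : overlap k l z -> jac k z = 'J (transition k l) z *m jac l (transition k l z).
Proof.
move=> oz; have lz := (transition_overlap oz).1; apply/matrixP => i a.
have dt := transition_differentiable oz.
rewrite (jacE i a oz.1) mulmx_entry.
rewrite (derive_eq_on (g := (fun y => param l y 0 a) \o transition k l) _ (@overlap_open _ _ M k l) oz).
  rewrite derive_comp //; last exact: (C1_diff (param_C1 isoF l a) lz).
  by apply: eq_bigr => b _; rewrite (jacE b a lz) (jacobianE i b dt).
by move=> y oy; rewrite /param /= psi_transition.
Qed.

(** The derivative of the transition Jacobian multiplies [jac l], so it contributes a tangent vector
    only, which the normal projection will kill; the double sum is tensorial. *)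
Lemma hess_transition k l z i j : overlap k l z ->
  row j (hess k i z) = row j (dmx 'e_i (fun z => 'J (transition k l) z) z) *m jac l (transition k l z) +
    \sum_a \sum_b ('J (transition k l) z i a * 'J (transition k l) z j b) *:
      row b (hess l a (transition k l z)).
Proof.
move=> oz; have lz := (transition_overlap oz).1; have oo := @overlap_open _ _ M k l.
have dt := transition_differentiable oz.
have CJ : C1mx (overlap k l) (fun z => 'J (transition k l) z).
  move=> a b; apply: (C1_eq (g := 'D_'e_a (fun y => transition k l y 0 b))) => //.
    by move=> y oy; apply: jacobianE; exact: transition_differentiable.
  by apply: C1_derive_entry => //; exact: (atlas_smooth M k l).
have Cl : C1mx (overlap k l) (fun z => jac l (transition k l z)).
  move=> b c; apply: (@C1_comp _ _ _ (overlap k l) (cod l) (fun y => jac l y b c) (transition k l)) => //.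
  - by move=> d; exact: transition_C1.
  - by move=> y /transition_overlap[].
  - exact: jac_C1.
have -> : hess k i z = dmx 'e_i (jac k) z by rewrite dmx_jac //; exact: oz.1.
rewrite (dmx_eq (B := fun z => 'J (transition k l) z *m jac l (transition k l z)) _ oo oz); last first.
  by move=> y; exact: jac_transition.
rewrite (dmx_mul _ oo oz CJ Cl) linearD /= row_mul; congr (_ + _).
apply/rowP => c; rewrite mx_row mulmx_entry summxE.
under [RHS]eq_bigr do rewrite summxE.
rewrite exchange_big /=; apply: eq_bigr => b _.
rewrite dmxE (derive_comp (f := fun y => jac l y b c)) //; last exact: (C1_diff (jac_C1 l b c) lz).
rewrite mulr_sumr; apply: eq_bigr => a _; rewrite mxZ mx_row -(dmxE 'e_a (jac l) _ b c) dmx_jac //.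
by rewrite (jacobianE i a dt) mulrCA mulrA.
Qed.

Lemma transition_jacobian_unit k l z : overlap k l z -> 'J (transition k l) z \in unitmx.
Proof.
move=> oz; have := transition_jacobian oz; move: ('J (transition k l) z) ('J _ _) => A B.
by move=> /mulmx1_unit[].
Qed.

(** The two Jacobians coming from the second derivatives turn the inverse metric of [k] into that of
    [l]. Hence the mean curvature, defined through the chart chosen at each point, can be computed
    in any chart. *)
Lemma Hk_transition k l z : overlap k l z -> Hk k z = Hk l (transition k l z).
Proof.
move=> oz; have lz := (transition_overlap oz).1; have kz := oz.1.
set A := 'J (transition k l) z; set z' := transition k l z.
have uA : A \in unitmx.
  exact: transition_jacobian_unit.
have uJ : jac l z' *m (jac l z')^T \in unitmx by rewrite -jac_gram //; exact: metric_unit.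
have NE v : normal_part (jac k z) v = normal_part (jac l z') v.
  by rewrite (jac_transition oz) normal_part_change.
have G : A^T *m ginv k z *m A = ginv l z'.
  rewrite /ginv (metric_transition oz) -/A -/z' !invmx_mul ?unitmx_mul ?uA ?unitmx_tr ?uA ?metric_unit //.
  by rewrite !mulmxA mulmxV ?unitmx_tr // mul1mx mulmxKV.
pose NN b a := normal_part (jac l z') (row b (hess l a z')).
rewrite /Hk.
transitivity (\sum_i \sum_j \sum_a \sum_b (ginv k z i j * (A i a * A j b)) *: NN b a).
  apply: eq_bigr => i _; apply: eq_bigr => j _; rewrite NE (hess_transition _ _ oz) normal_partD.
  rewrite normal_part_tangent // add0r normal_part_sum scaler_sumr; apply: eq_bigr => a _.
  rewrite normal_part_sum scaler_sumr; apply: eq_bigr => b _.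
  by rewrite normal_partZ scalerA.
transitivity (\sum_a \sum_b (\sum_i \sum_j ginv k z i j * (A i a * A j b)) *: NN b a).
  under eq_bigr do rewrite exchange_big /=.
  rewrite exchange_big /=; apply: eq_bigr => a _.
  under eq_bigr do rewrite exchange_big /=.
  rewrite exchange_big /=; apply: eq_bigr => b _.
  by rewrite scaler_suml; apply: eq_bigr => i _; rewrite scaler_suml.
apply: eq_bigr => a _; apply: eq_bigr => b _; congr (_ *: _).
rewrite -G mulmx_entry exchange_big /=; apply: eq_bigr => j _; rewrite mulmx_entry mulr_suml.
by apply: eq_bigr => i _; rewrite trmx_entry; ring.
Qed.

Lemma mean_curvature_chart k z : cod k z -> mean_curvature F (psi k z) = Hk k z.
Proof.
move=> kz; have lz := chart_at_dom (psi k z); set l := chart_at _ in lz.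
have oz : overlap k l z by split.
rewrite (Hk_transition oz) /mean_curvature -/l /Hk.
have lz' : cod l (transition k l z) by exact: phi_cod.
by apply: eq_bigr => i _; apply: eq_bigr => j _; rewrite second_fundamental_formE.
Qed.

Lemma Vf_transition k l z : overlap k l z -> Vf k z *m 'J (transition k l) z = Vf l (transition k l z).
Proof.
move=> oz; have lz := (transition_overlap oz).1; have kz := oz.1.
set A := 'J (transition k l) z; set z' := transition k l z.
have uA : A \in unitmx.
  exact: transition_jacobian_unit.
have pE : pos k z = pos l z' by rewrite /pos /param /= psi_transition.
rewrite /Vf pE (jac_transition oz) -/A -/z' trmx_mul /ginv (metric_transition oz) -/A -/z'.
rewrite !invmx_mul ?unitmx_mul ?uA ?unitmx_tr ?uA ?metric_unit //.
by rewrite -!mulmxA mulVmx // mulmx1 (mulmxA A^T) mulmxV ?unitmx_tr // mul1mx.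
Qed.

Lemma Vf_jac k z : cod k z -> enorm (Vf k z *m jac k z) <= enorm (pos k z).
Proof.
move=> kz; have uJ : jac k z *m (jac k z)^T \in unitmx by rewrite -jac_gram //; exact: metric_unit.
have -> : Vf k z *m jac k z = pos k z - normal_part (jac k z) (pos k z).
  by rewrite /normal_part opprB addrC subrK -jac_gram.
exact: tangent_part_le.
Qed.

End geometry.

(** * Integration by parts and cutoffs *)

Notation integ mu f := (mu.-integrable setT (EFin \o f)).

Lemma bounded_integrable d (T : measurableType d) (R : realType) (mu : {measure set T -> \bar R})
    (A : set T) (f : T -> R) (C : R) : measurable A -> (mu A < +oo)%E -> measurable_fun setT f ->
  (forall x, `|f x| <= C) -> (forall x, ~ A x -> f x = 0) -> integ mu f.
Proof.
move=> mA Afin mf fC f0.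
have -> : EFin \o f = (EFin \o f) \_ A.
  apply/funext => x; rewrite patchE; case: ifPn => //=; rewrite notin_setE => /f0 ->; by [].
apply/(integrable_mkcond (EFin \o f) mA).1.
apply: measurable_bounded_integrable => //; first exact: measurable_funS mf.
exists C; split; first exact: num_real.
by move=> x Cx y _; apply: le_trans (fC y) (ltW Cx).
Qed.

Section real_integrable.
Context d (T : measurableType d) (R : realType) (mu : {measure set T -> \bar R}).
Implicit Types f g : T -> R.

Lemma integD f g : integ mu f -> integ mu g -> integ mu (fun x => f x + g x).
Proof. by move=> h1 h2; exact: (integrableD measurableT h1 h2). Qed.

Lemma integB f g : integ mu f -> integ mu g -> integ mu (fun x => f x - g x).
Proof. by move=> h1 h2; exact: (integrableB measurableT h1 h2). Qed.

Lemma integZ (c : R) f : integ mu f -> integ mu (fun x => c * f x).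
Proof. by move=> h; exact: (integrableZl measurableT c h). Qed.

Lemma integ_sum (I : Type) (s : seq I) (f : I -> T -> R) :
  (forall i, integ mu (f i)) -> integ mu (fun x => \sum_(i <- s) f i x).
Proof.
move=> h; elim: s => [|i s IH].
  rewrite (_ : (EFin \o _) = cst 0%E); first exact: integrable0.
  by apply/funext => x; rewrite /= big_nil.
rewrite (_ : (fun x => _) = fun x => f i x + \sum_(j <- s) f j x); first exact: integD.
by apply/funext => x; rewrite big_cons.
Qed.

Lemma integ_int_sum (I : Type) (s : seq I) (f : I -> T -> R) : (forall i, integ mu (f i)) ->
  \int[mu]_x (\sum_(i <- s) f i x) = \sum_(i <- s) \int[mu]_x f i x.
Proof.
move=> h; elim: s => [|i s IH].
  rewrite big_nil /Rintegral (eq_integral (fun=> 0%E)) ?integral0 // => x _.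
  by rewrite /= big_nil.
rewrite big_cons -IH -RintegralD //; last exact: integ_sum.
by apply: eq_Rintegral => x _; rewrite big_cons.
Qed.

End real_integrable.

Section integration_by_parts.
Context {R : realType} {m : nat}.
Local Notation T := (borel 'rV[R]_m).
Local Notation lam := (@lam R m).

Lemma lam_cube_fin (z0 : 'rV[R]_m) (r : R) : exists A : set T,
  [/\ measurable A, (lam A < +oo)%E & forall z, `|z - z0| <= r -> A z].
Proof.
pose s := `|r| + 1; have s0 : 0 < s by rewrite ltr_wpDl.
exists (box (z0 - const_mx s) (z0 + const_mx s)); split; first exact: measurable_box.
  rewrite lam_box ?ltry // => i; rewrite !mxE; lra.
move=> z zr i; rewrite !mxE.
have := norm_coord (z - z0) i; rewrite mxB => /le_trans /(_ zr) h.
have h1 := ler_norm r; move: h; rewrite ler_norml /s => /andP[h2 h3].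
by apply/andP; split; lra.
Qed.

Lemma cube_integrable (f : T -> R) z0 (r C : R) : measurable_fun setT f ->
  (forall z, `|f z| <= C) -> (forall z, r < `|z - z0| -> f z = 0) -> integ lam f.
Proof.
move=> mf fC f0; have [A [mA Af HA]] := lam_cube_fin z0 r.
apply: (bounded_integrable mA Af mf fC) => z Az; apply: f0; rewrite ltNge; apply/negP => /HA.
exact: Az.
Qed.

Lemma measurable_translate (v : 'rV[R]_m) : measurable_fun setT (fun z : T => (z + v : T)).
Proof.
have := @measurable_affine R m m 1%:M v; apply: eq_measurable_fun => z _.
by rewrite mulmx1.
Qed.

Lemma Rintegral_translate (f : T -> R) (v : 'rV[R]_m) : measurable_fun setT f ->
  \int[lam]_z f (z + v) = \int[lam]_z f z.
Proof.
move=> mf; have mfE : measurable_fun setT (EFin \o f : T -> \bar R) by apply/measurable_EFinP.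
rewrite /Rintegral integralE [in RHS]integralE; congr (fine (_ - _)).
  have E := lam_translate v (measurable_funepos mfE).
  rewrite -[RHS]E => [|z]; last exact: funepos_ge0.
  by apply: eq_integral => z _; rewrite !funeposE.
have E := lam_translate v (measurable_funeneg mfE).
rewrite -[RHS]E => [|z]; last exact: funeneg_ge0.
by apply: eq_integral => z _; rewrite !funenegE.
Qed.

Lemma compact_bound (f : 'rV[R]_m -> R) z0 (r : R) : continuous f -> (forall z, r < `|z - z0| -> f z = 0) ->
  exists C : R, forall z, `|f z| <= C.
Proof.
move=> cf f0; have [r0|r0] := ltP r 0.
  by exists 0 => z; rewrite f0 ?normr0 // (lt_le_trans r0).
have cK := @closed_cube_compact R m z0 r r0.
have [||c _ Hc] := EVT_max_rV (f := fun z => `|f z|) _ cK.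
- by exists z0; rewrite /= subrr normr0.
- by apply: continuous_subspaceT => z; apply: cont_norm; exact: cf.
exists (`|f c|) => z; have [zr|zr] := leP `|z - z0| r; last by rewrite f0 // normr0.
by apply: Hc; rewrite inE.
Qed.

Lemma derive_support (Q : 'rV[R]_m -> R) (z0 v : 'rV[R]_m) (r : R) : (forall z, r < `|z - z0| -> Q z = 0) ->
  forall z, r < `|z - z0| -> 'D_v Q z = 0.
Proof.
move=> Q0 z zr; have oU : open [set y : 'rV[R]_m | r < `|y - z0|].
  rewrite openE => y /= yr; have d0 : 0 < `|y - z0| - r by rewrite subr_gt0.
  apply/nbhs_ballP; exists (`|y - z0| - r) => // y'; rewrite -ball_normE /= => h.
  by have := ler_distD y' y z0; rewrite /=; lra.
rewrite (derive_eq_on (g := fun=> 0) v oU zr) ?derive_cst // => y yr; exact: Q0.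
Qed.

Lemma derive_continuous (Q : 'rV[R]_m -> R) (v : 'rV[R]_m) : C1 setT Q -> continuous ('D_v Q).
Proof.
move=> CQ z; rewrite (_ : 'D_v Q = fun z => \sum_i v 0 i * 'D_'e_i Q z).
  apply: cont_sum => i _; apply: cont_mul; first exact: cont_cst.
  exact: (@C1_cont _ _ _ _ CQ i z I).
by apply/funext => y; apply: gradlE; exact: (C1_diff CQ I).
Qed.

Lemma derive_integ (Q : 'rV[R]_m -> R) (ze : T -> R) (z0 v : 'rV[R]_m) (r B : R) :
  C1 setT Q -> (forall z, r < `|z - z0| -> Q z = 0) ->
  measurable_fun setT ze -> (forall z, `|ze z| <= B) -> integ lam (fun z => ze z * 'D_v Q z).
Proof.
move=> CQ Q0 mze zeB; have cD := @derive_continuous Q v CQ.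
have mD : measurable_fun setT ('D_v Q : T -> R) by exact: continuous_borelR.
have [C HC] := compact_bound cD (derive_support v Q0).
apply: (cube_integrable (z0 := z0) (r := r) (C := B * C)); first exact: measurable_funM.
  by move=> z; rewrite normrM; apply: ler_pM.
by move=> z zr; rewrite (derive_support v Q0) ?mulr0.
Qed.

(* Integration by parts against a Lipschitz function, through difference quotients. *)
Lemma integral_lipschitz_derive (Q : 'rV[R]_m -> R) (ze : T -> R) (z0 v : 'rV[R]_m) (r l h0 B : R) :
  C1 setT Q -> (forall z, r < `|z - z0| -> Q z = 0) ->
  measurable_fun setT ze -> (forall z, `|ze z| <= B) -> 0 < h0 ->
  (forall z h, `|z - z0| <= r -> 0 < h -> h < h0 -> `|ze z - ze (z - h *: v)| <= h * l) ->
  \int[lam]_z (ze z * 'D_v Q z) <= l * \int[lam]_z `|Q z|.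
Proof.
move=> CQ Q0 mze zeB h00 Hze.
have cQ : continuous Q by move=> z; exact: (C1_continuous CQ I).
have mQ : measurable_fun setT (Q : T -> R) by exact: continuous_borelR.
have cD := @derive_continuous Q v CQ.
have mD : measurable_fun setT ('D_v Q : T -> R) by exact: continuous_borelR.
have [C HC] := compact_bound cD (derive_support v Q0).
have [CQ' HQ] := compact_bound cQ Q0.
have B0 : 0 <= B by apply: le_trans (zeB 0).
have C0 : 0 <= C by apply: le_trans (HC 0).
(* The denominator [k.+2] keeps the step strictly below [h0], already for [k = 0]. *)
pose hn (k : nat) : R := h0 / k.+2%:R.
have hn0 k : 0 < hn k by rewrite divr_gt0.
have hnh k : hn k < h0 by rewrite ltr_pdivrMr // ltr_pMr // ltr1n.
pose f k (z : T) : R := ze z * ((Q (z + hn k *: v) - Q z) / hn k).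
have mtr k : measurable_fun setT (fun z : T => Q (z + hn k *: v)).
  exact: (measurableT_comp mQ (measurable_translate _)).
have mf k : measurable_fun setT (f k).
  by apply: measurable_funM => //; apply: measurable_funM => //; exact: measurable_funB.
have fC k z : `|f k z| <= B * C.
  rewrite normrM; apply: ler_pM => //.
  have [|t _ ->] := @mvt_segment_line _ _ Q z v (hn k) (ltW (hn0 k)).
    by move=> t _; apply: diff_derivable; exact: (C1_diff CQ I).
  by rewrite mulrC mulKf ?gt_eqF.
have f0 k z : r + h0 * `|v| < `|z - z0| -> f k z = 0.
  move=> zr; have vn : 0 <= h0 * `|v| by rewrite mulr_ge0 // ltW.
  rewrite /f !Q0 ?subrr ?mul0r ?mulr0 //; first lra.
  have := ler_distD (z + hn k *: v) z z0; rewrite opprD addrA subrr add0r normrN normrZ (gtr0_norm (hn0 k)).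
  have : hn k * `|v| <= h0 * `|v| by rewrite ler_wpM2r // ltW.
  move: zr; move: (`|z - z0|) (`|z + hn k *: v - z0|) (hn k * `|v|) (h0 * `|v|) => a b c d; lra.
have [A [mA Af HA]] := lam_cube_fin z0 (r + h0 * `|v|).
have f_out k z : ~ A z -> f k z = 0.
  by move=> Az; apply: f0; rewrite ltNge; apply/negP => /HA; exact: Az.
have If k : integ lam (f k) by exact: bounded_integrable mA Af (mf k) (fC k) (f_out k).
have fcv z : f k z @[k --> \oo] --> ze z * 'D_v Q z.
  apply: cvgMr; have dQ : derivable Q z v by apply: diff_derivable; exact: (C1_diff CQ I).
  have H : h^-1 *: (Q (h *: v + z) - Q z) @[h --> 0^'] --> 'D_v Q z by exact: dQ.
  have hc : hn k @[k --> \oo] --> 0^'.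
    move=> P [e /= e0 HP].
    change (\forall k \near \oo, P (hn k)); near=> k.
    apply: HP; last by rewrite gt_eqF //; exact: (hn0 k).
    rewrite /=.
    rewrite sub0r normrN gtr0_norm //.
    rewrite /hn ltr_pdivrMr // mulrC -ltr_pdivrMr //.
    apply: (@lt_trans _ _ k%:R); last by rewrite ltr_nat.
    by near: k; exact: nbhs_infty_gtr.
  have := cvg_comp _ _ hc H; apply: cvg_trans; apply: near_eq_cvg; apply: nearW => k.
  by rewrite /= (addrC z); exact: mulrC.
have DCT : (\int[lam]_z (f k z)%:E)%E @[k --> \oo] --> (\int[lam]_z (ze z * 'D_v Q z)%:E)%E.
  have IA : lam.-integrable setT (fun z => (B * C * \1_A z)%:E).
    have := @bounded_integrable _ _ R lam A (fun z => B * C * \1_A z) (B * C) mA Af; apply.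
    - by apply: measurable_funM => //; exact: measurable_indic.
    - move=> z; rewrite indicE; case: (z \in A); rewrite ?mulr1 ?mulr0 ?normr0 ?mulr_ge0 //.
      by rewrite ger0_norm // mulr_ge0.
    - by move=> z Az; rewrite indicE memNset // mulr0.
  have [|||||[_ _ DC]] := @dominated_convergence _ _ R lam setT measurableT (fun k z => (f k z)%:E)
    (fun z => (ze z * 'D_v Q z)%:E) (fun z => (B * C * \1_A z)%:E).
  - by move=> k; apply/measurable_EFinP.
  - by apply/measurable_EFinP; exact: measurable_funM.
  - by apply: aeW => z _; apply: cvg_EFin; [apply: nearW|exact: fcv].
  - exact: IA.
  - apply: aeW => z k _; rewrite lee_fin indicE; have [Az|Az] := boolP (z \in A).
      by rewrite mulr1.
    by rewrite mulr0 f_out ?normr0 //; move: Az; rewrite notin_setE.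
  - exact: DC.
have ineq k : \int[lam]_z (f k z) <= l * \int[lam]_z `|Q z|.
  have Ig1 : integ lam (fun z => ze z * Q (z + hn k *: v)).
    have m1 : measurable_fun setT (fun z : T => ze z * Q (z + hn k *: v)) by exact: measurable_funM.
    apply: (bounded_integrable (C := B * CQ') mA Af m1).
      by move=> z; rewrite normrM; apply: ler_pM.
    move=> z Az; rewrite Q0 ?mulr0 // ltNge; apply/negP => H; apply: Az; apply: HA.
    have := ler_distD (z + hn k *: v) z z0; rewrite opprD addrA subrr add0r normrN normrZ (gtr0_norm (hn0 k)).
    have : hn k * `|v| <= h0 * `|v| by rewrite ler_wpM2r // ltW.
    move: H; move: (`|z - z0|) (`|z + hn k *: v - z0|) (hn k * `|v|) (h0 * `|v|) => a b c d; lra.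
  have Ig2 : integ lam (fun z => ze z * Q z).
    have m1 : measurable_fun setT (fun z : T => ze z * Q z) by exact: measurable_funM.
    apply: (cube_integrable (z0 := z0) (r := r) (C := B * CQ') m1).
      by move=> z; rewrite normrM; apply: ler_pM.
    by move=> z zr; rewrite Q0 ?mulr0.
  have mzt : measurable_fun setT (fun z : T => ze (z - hn k *: v)).
    exact: (measurableT_comp mze (measurable_translate _)).
  have Ig3 : integ lam (fun z => ze (z - hn k *: v) * Q z).
    have m1 : measurable_fun setT (fun z : T => ze (z - hn k *: v) * Q z) by exact: measurable_funM.
    apply: (cube_integrable (z0 := z0) (r := r) (C := B * CQ') m1).
      by move=> z; rewrite normrM; apply: ler_pM.
    by move=> z zr; rewrite Q0 ?mulr0.
  have IQ : integ lam (fun z => `|Q z|).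
    apply: (cube_integrable (z0 := z0) (r := r) (C := CQ')).
    - exact: measurableT_comp.
    - by move=> z; rewrite normr_id.
    - by move=> z zr; rewrite Q0 ?normr0.
  rewrite (_ : f k = fun z => (hn k)^-1 * (ze z * Q (z + hn k *: v) - ze z * Q z)); last first.
    by apply/funext => z; rewrite /f; ring.
  rewrite RintegralZl //; last exact: integB.
  rewrite RintegralB //.
  (* Translation invariance moves the difference from [Q] to [ze], where the Lipschitz bound is
     available. *)
  have -> : \int[lam]_z (ze z * Q (z + hn k *: v)) = \int[lam]_z (ze (z - hn k *: v) * Q z).
    rewrite -(Rintegral_translate (hn k *: v) (f := fun z => ze (z - hn k *: v) * Q z)).
      by apply: eq_Rintegral => z _; rewrite addrK.
    exact: measurable_funM.
  rewrite -[leRHS](mulKf (lt0r_neq0 (hn0 k))) ler_wpM2l //; first by rewrite invr_ge0 ltW.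
  rewrite -RintegralB // -!RintegralZl //; last exact: integZ.
  apply: le_Rintegral => //; first exact: integB.
    by apply: integZ; exact: integZ.
  move=> z _; have [zr|zr] := leP `|z - z0| r; last by rewrite Q0 // normr0 !mulr0 subrr.
  rewrite -mulrBl; apply: (le_trans (ler_norm _)); rewrite normrM mulrA ler_wpM2r //.
  by rewrite distrC; exact: Hze.
have ID := derive_integ v CQ Q0 mze zeB.
have cv : \int[lam]_z (f k z) @[k --> \oo] --> \int[lam]_z (ze z * 'D_v Q z).
  apply: fine_cvg; rewrite fineK //; exact: integrable_fin_num.
rewrite -(cvg_lim _ cv) //; apply: limr_le; first by apply/cvg_ex; eexists; exact: cv.
by apply: nearW => k; exact: ineq.
Unshelve. all: by end_near. Qed.

End integration_by_parts.

(** * Bump functions of class C1 *)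

Section bumps.
Context {R : realType} {m : nat}.
Local Notation "''e_' i" := (delta_mx 0 i : 'rV[R]_m) (at level 8, i at level 2).

Definition pos_sqr (x : R) : R := Num.max x 0 ^+ 2.

Lemma pos_sqr_taylor (x h : R) : `|pos_sqr (x + h) - pos_sqr x - 2 * Num.max x 0 * h| <= h ^+ 2.
Proof.
rewrite /pos_sqr ler_norml; case: (leP x 0) => hx; case: (leP (x + h) 0) => hxh; apply/andP; split; nra.
Qed.

Lemma is_derive_pos_sqr (x : R) : is_derive x 1 pos_sqr (2 * Num.max x 0).
Proof.
have H : h^-1 *: (pos_sqr (h *: 1 + x) - pos_sqr x) @[h --> 0^'] --> 2 * Num.max x 0.
  apply/cvgrPdist_le => e e0; near=> h.
  have h0 : h != 0 by near: h; exact: nbhs_dnbhs_neq.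
  have he : `|h| <= e.
    by near: h; apply: dnbhs0_le.
  apply: (le_trans _ he); rewrite (_ : h *: 1 + x = x + h); last by rewrite addrC; congr (_ + _); exact: mulr1.
  have -> : 2 * Num.max x 0 - h^-1 *: (pos_sqr (x + h) - pos_sqr x) =
      - (h^-1 * (pos_sqr (x + h) - pos_sqr x - 2 * Num.max x 0 * h)).
    rewrite -[h^-1 *: _]/(h^-1 * _); move: (pos_sqr _) (pos_sqr _) (Num.max _ _) => u v w.
    by rewrite (mulrBr _ (v - u)) (mulrC (2 * w)) mulKf // opprB.
  rewrite normrN normrM normfV ler_pdivrMl ?normr_gt0 //; apply: (le_trans (pos_sqr_taylor _ _)).
  by rewrite -expr2 real_normK // num_real.
by apply: DeriveDef; [apply/cvg_ex; eexists; exact: H|exact: (cvg_lim _ H)].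
Unshelve. all: by end_near. Qed.

Lemma C1_pos_sqr U (f : 'rV[R]_m -> R) : open U -> C1 U f -> C1 U (fun z => pos_sqr (f z)).
Proof.
move=> oU Cf.
have ds y : differentiable pos_sqr (f y).
  by apply/derivable1_diffP; have [] := is_derive_pos_sqr (f y).
apply: C1_intro => // [y Uy|i].
  exact: (differentiable_comp (C1_diff Cf Uy) (ds y)).
exists (fun z => 2 * Num.max (f z) 0 * 'D_'e_i f z) => y Uy.
  have df := C1_diff Cf Uy.
  have dcomp := differentiable_comp df (ds y).
  rewrite -[LHS]/('D_'e_i (pos_sqr \o f) y) deriveE // diff_comp //=.
  rewrite -[X in 'd _ _ X](deriveE _ df) -[X in 'd _ _ X = _]mulr1 [LHS]linearZ mulrC; congr (_ * _).
  by have [dd <-] := is_derive_pos_sqr (f y); symmetry; apply: deriveE; apply/derivable1_diffP.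
apply: cont_mul; last exact: (C1_cont Cf Uy).
apply: cont_mul; first exact: cont_cst.
rewrite (_ : (fun z => Num.max (f z) 0) = fun z => - Num.min (- f z) 0).
  by apply: cont_opp; apply: cont_min; apply: cont_opp; exact: (C1_continuous Cf Uy).
by apply/funext => z; rewrite oppr_min opprK oppr0.
Qed.

(** A piecewise quadratic transition from 0 to 1, whose derivative is the tent function of height 2
    on [[0, 1]]. *)
Definition smooth_step (x : R) : R := 2 * (pos_sqr x - 2 * pos_sqr (x - 2^-1) + pos_sqr (x - 1)).

Lemma smooth_step_le0 x : x <= 0 -> smooth_step x = 0.
Proof.
move=> x0; rewrite /smooth_step /pos_sqr !max_r; first by lra.
all: by lra.
Qed.

Lemma smooth_step_ge1 x : 1 <= x -> smooth_step x = 1.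
Proof. by move=> x1; rewrite /smooth_step /pos_sqr !max_l; [field|lra..]. Qed.

Lemma smooth_step01 x : 0 <= smooth_step x <= 1.
Proof.
rewrite /smooth_step /pos_sqr; case: (leP x 0) => h1; case: (leP (x - 2^-1) 0) => h2;
  case: (leP (x - 1) 0) => h3; apply/andP; split; nra.
Qed.

Lemma C1_smooth_step U (f : 'rV[R]_m -> R) : open U -> C1 U f -> C1 U (fun z => smooth_step (f z)).
Proof.
move=> oU Cf; have Cc c := C1_cst U c.
have Cs c : C1 U (fun z => pos_sqr (f z - c)) by apply: C1_pos_sqr => //; exact: C1B.
apply: (C1M oU) => //; apply: (C1D oU) => //; apply: (C1B oU); first exact: C1_pos_sqr.
exact: (C1M oU).
Qed.

(** The argument [4 / 3 * (1 - t ^+ 2)] equals 1 for [|t| = 1 / 2] and 0 for [|t| = 1]; being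
    polynomial in the coordinate, it keeps the bump of class C1. *)
Definition cube_bump (z0 : 'rV[R]_m) (r : R) (z : 'rV[R]_m) : R :=
  \prod_i smooth_step (4 / 3 * (1 - ((z 0 i - z0 0 i) / r) ^+ 2)).

Lemma bump01 z0 r z : 0 <= cube_bump z0 r z <= 1.
Proof.
rewrite /cube_bump; apply/andP; split; first by apply: prodr_ge0 => i _;
  have /andP[] := smooth_step01 (4 / 3 * (1 - ((z 0 i - z0 0 i) / r) ^+ 2)).
rewrite -[leRHS](big1 (op := *%R) (index_enum 'I_m) xpredT (fun=> 1)) //.
by apply: ler_prod => i _; exact: smooth_step01.
Qed.

Lemma bump_inside z0 r z : 0 < r -> `|z - z0| <= r / 2 -> cube_bump z0 r z = 1.
Proof.
move=> r0 zr; rewrite /cube_bump big1 // => i _; apply: smooth_step_ge1.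
have h : `|z 0 i - z0 0 i| <= r / 2 by apply: le_trans zr; rewrite -mxB norm_coord.
have {h} : `|(z 0 i - z0 0 i) / r| <= 1 / 2.
  by rewrite normrM normfV (gtr0_norm r0) ler_pdivrMr //; apply: (le_trans h); rewrite mul1r mulrC.
move: ((z 0 i - z0 0 i) / r) => t; rewrite ler_norml => /andP[t1 t2]; nra.
Qed.

Lemma bump_outside z0 r z : 0 < r -> r <= `|z - z0| -> cube_bump z0 r z = 0.
Proof.
move=> r0 zr.
have [i zi] : exists i, r <= `|z 0 i - z0 0 i|.
  apply: contrapT => H; move: zr; apply/negP; rewrite -ltNge.
  apply: (@le_lt_trans _ _ (\big[Num.max/0]_i `|(z - z0) 0 i|)).
    apply: norm_le_coord => [|i]; first exact: bigmax_ge_id.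
    exact: le_bigmax.
  apply: bigmax_lt => // i _; rewrite ltNge mxB; apply/negP => zi; apply: H; by exists i.
rewrite /cube_bump (bigD1 i) //= smooth_step_le0 ?mul0r //.
have : 1 <= `|(z 0 i - z0 0 i) / r| by rewrite normrM normfV (gtr0_norm r0) ler_pdivlMr // mul1r.
move: ((z 0 i - z0 0 i) / r) => t; rewrite ler_normr => /orP[]; nra.
Qed.

Lemma bump_C1 z0 r U : open U -> C1 U (cube_bump z0 r).
Proof.
move=> oU; apply: C1_prod => // i; apply: C1_smooth_step => //; apply: (C1M oU); first exact: C1_cst.
apply: (C1B oU); first exact: C1_cst.
have Cz : C1 U (fun z => (z 0 i - z0 0 i) / r).
  by apply: (C1M oU); [apply: (C1B oU); [exact: C1_coord|exact: C1_cst]|exact: C1_cst].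
exact: (C1M oU).
Qed.

(* The first factor localizes, so the second one may be junk outside [U]. *)
Lemma C1_bumpM z0 r s (U : set 'rV[R]_m) (g : 'rV[R]_m -> R) : open U -> 0 < r -> r < s ->
  (forall z, `|z - z0| < s -> U z) -> C1 U g -> C1 setT (fun z => cube_bump z0 r z * g z).
Proof.
move=> oU r0 rs sU Cg; have Cu := C1M oU (bump_C1 z0 r oU) Cg.
have oV : open [set y : 'rV[R]_m | r < `|y - z0|].
  rewrite openE => y /= yr; have d0 : 0 < `|y - z0| - r by rewrite subr_gt0.
  apply/nbhs_ballP; exists (`|y - z0| - r) => // y'; rewrite -ball_normE /= => h.
  by have := ler_distD y' y z0; rewrite /=; lra.
have Cv : C1 [set y : 'rV[R]_m | r < `|y - z0|] (fun z => cube_bump z0 r z * g z).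
  apply: (C1_eq oV _ (C1_cst _ 0)) => z /= zr; by rewrite bump_outside ?mul0r // ltW.
split=> [y _|i y _]; have [h|h] := ltP r `|y - z0|.
- exact: (C1_diff Cv h).
- by apply: (C1_diff Cu); apply: sU; exact: le_lt_trans rs.
- by apply: (C1_cont Cv).
- by apply: (C1_cont Cu); apply: sU; exact: le_lt_trans rs.
Qed.

End bumps.

Lemma C1_local {R : realType} {m : nat} (U : set 'rV[R]_m) (f : 'rV[R]_m -> R) :
  (forall y, U y -> exists V, V y /\ C1 V f) -> C1 U f.
Proof.
move=> H; split=> [y Uy|i y Uy]; have [V [Vy CV]] := H y Uy; first exact: (C1_diff CV).
exact: (C1_cont CV).
Qed.

Section functions.
Context {R : realType} {m n : nat} {M : riemannian_manifold R m} (F : M -> 'rV[R]_n).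
Hypothesis isoF : isometric_immersion F.
Variable X0 : 'rV[R]_n.

Local Notation cod := (@cod R m M).
Local Notation dom := (@dom R m M).
Local Notation psi := (@psi R m M).
Local Notation phi := (@phi R m M).
Local Notation overlap := (@overlap R m M).
Local Notation transition := (@transition R m M).
Local Notation vol_density := (@vol_density R m M).
Local Notation Vf := (@Vf R m n M F X0).
Local Notation "''e_' i" := (delta_mx 0 i : 'rV[R]_m) (at level 8, i at level 2).

Let oc := fun k => @cod_open R m M k.

Definition C1_man (f : M -> R) := forall k, C1 (cod k) (f \o psi k).

Lemma C1_man_cst c : C1_man (fun=> c).
Proof. by move=> k; exact: C1_cst. Qed.

Lemma C1_manM f g : C1_man f -> C1_man g -> C1_man (fun q => f q * g q).
Proof. by move=> Cf Cg k; exact: (C1M (@oc k) (Cf k) (Cg k)). Qed.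

Lemma C1_manB f g : C1_man f -> C1_man g -> C1_man (fun q => f q - g q).
Proof. by move=> Cf Cg k; exact: (C1B (@oc k) (Cf k) (Cg k)). Qed.

Lemma near_dom k p : dom k p -> \forall q \near p, dom k q.
Proof. by move=> kp; apply: open_nbhs_nbhs; split => //; exact: dom_open. Qed.

Lemma near_psi k z (P : M -> Prop) : cod k z -> (\forall q \near psi k z, P q) -> \forall z' \near z,
  P (psi k z').
Proof. by move=> kz H; exact: (psi_continuous kz). Qed.

Lemma chart_continuous k p (f : M -> R) (g : 'rV[R]_m -> R) : dom k p ->
  (\forall q \near p, f q = g (phi k q)) -> {for phi k p, continuous g} -> {for p, continuous f}.
Proof.
move=> kp H cg; apply: (near_continuous H).
by apply: continuous_comp cg; exact: phi_continuous.
Qed.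

Lemma C1_man_continuous f : C1_man f -> continuous f.
Proof.
move=> Cf p; have kp := chart_at_dom p.
apply: (chart_continuous kp (g := f \o psi (chart_at p))).
  by apply: filterS (near_dom kp) => q kq; rewrite /= phiK.
exact: (C1_continuous (Cf _) (phi_cod kp)).
Qed.

Lemma extend_C1 k (u : 'rV[R]_m -> R) z0 (r : R) : 0 <= r -> (forall z, `|z - z0| <= r -> cod k z) ->
  (forall z, r < `|z - z0| -> u z = 0) -> C1 setT u -> C1_man (extend k u 0).
Proof.
move=> r0 rk u0 Cu l; apply: C1_local => y ly; have [kq|kq] := pselect (dom k (psi l y)).
  exists (overlap l k); split; first by split.
  apply: (C1_eq (g := u \o transition l k)) => [|z [lz kz]|]; first exact: overlap_open.
    by rewrite /= extend_in.
  apply: (C1_comp (U' := setT)) => //; first exact: overlap_open.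
  by move=> a; exact: transition_C1.
have := near_psi ly (extend_near r0 rk u0 kq).
rewrite -[X in X -> _]/(nbhs y [set z | extend k u 0 (psi l z) = 0]) => H.
exists (interior [set z | extend k u 0 (psi l z) = 0]); split; first exact: H.
apply: (C1_eq (@open_interior _ _) _ (C1_cst _ 0)) => z; exact: interior_subset.
Qed.

(* The derivative of [f] along the tangential part of [F - X0]. *)
Definition dV (f : M -> R) (q : M) : R :=
  'D_(Vf (chart_at q) (phi (chart_at q) q)) (f \o psi (chart_at q)) (phi (chart_at q) q).

(** [Vf] transforms as a vector field, so by the chain rule the derivative along it does not depend
    on the chart. *)
Lemma dV_chart f k z : C1_man f -> cod k z -> dV f (psi k z) = 'D_(Vf k z) (f \o psi k) z.
Proof.
move=> Cf kz; rewrite /dV; set q := psi k z; set l := chart_at q.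
have lq : dom l q by exact: chart_at_dom.
have ov : overlap k l z by split.
rewrite -[phi l q]/(transition k l z) -(Vf_transition isoF X0 ov).
have lt : cod l (transition k l z) by exact: phi_cod.
have dfl := C1_diff (Cf l) lt.
rewrite (gradlE _ dfl) (derive_eq_on (g := (f \o psi l) \o transition k l) _ (@overlap_open _ _ _ k l)
  ov); last first.
  by move=> z' ov' /=; rewrite psi_transition.
have dt := transition_differentiable ov.
rewrite (derive_comp _ dfl dt); apply: eq_bigr => a _; congr (_ * _).
have dta : differentiable (fun z => transition k l z 0 a) z by exact: (C1_diff (@transition_C1 _ _ _ k l a)).
rewrite (gradlE _ dta); apply: (eq_trans (mulmx_entry _ _ _ _)); apply: eq_bigr => i _; congr (_ * _).
exact: jacobianE.
Qed.

Lemma dV_continuous f : C1_man f -> continuous (dV f).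
Proof.
move=> Cf p; set k := chart_at p; have kp : dom k p := chart_at_dom p.
apply: (chart_continuous kp (g := fun z => \sum_i Vf k z 0 i * 'D_'e_i (f \o psi k) z)).
  apply: filterS (near_dom kp) => q kq; have kz := phi_cod kq.
  by rewrite -{1}(phiK kq) dV_chart // gradlE //; exact: (C1_diff (Cf k)).
apply: cont_sum => i _; apply: cont_mul; last exact: (C1_cont (Cf k) (phi_cod kp)).
exact: (C1_continuous (@Vf_C1 _ _ _ _ _ isoF X0 k 0 i) (phi_cod kp)).
Qed.

Lemma dVD f g q : C1_man f -> C1_man g -> dV (fun p => f p + g p) q = dV f q + dV g q.
Proof.
move=> Cf Cg; have kz := phi_cod (chart_at_dom q).
by apply: derive_add; [exact: (C1_diff (Cf _) kz)|exact: (C1_diff (Cg _) kz)].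
Qed.

Lemma dV_cst c q : dV (fun=> c) q = 0.
Proof. exact: derive_cst. Qed.

Lemma dV_near0 f q : (\forall p \near q, f p = 0) -> dV f q = 0.
Proof.
move=> H; have kq := chart_at_dom q; have kz := phi_cod kq.
have := near_psi (P := fun p => f p = 0) kz; rewrite phiK // => /(_ H) H'.
rewrite /dV (derive_eq_on (g := fun=> 0) _ (@open_interior _ [set z | f (psi (chart_at q) z) = 0]) H').
  exact: derive_cst.
by move=> z; exact: interior_subset.
Qed.

(** The divergence of the tangential part of [F - X0]. *)
Definition kappa (q : M) : R := m%:R + dot (mean_curvature F q) (F q - X0).

Lemma kappa_chart k z : cod k z ->
  \sum_i 'D_'e_i (fun z => vol_density k z * Vf k z 0 i) z = vol_density k z * kappa (psi k z).
Proof.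
move=> kz; apply: (eq_trans (divergence_tangent isoF X0 kz)).
by rewrite -(mean_curvature_chart isoF kz).
Qed.

(** The divergence formula in a fixed chart is continuous, whereas the definition of
    [mean_curvature] goes through the discontinuous choice [chart_at]. *)
Lemma kappa_continuous : continuous kappa.
Proof.
move=> p; set k := chart_at p; have kp : dom k p := chart_at_dom p.
have CwV i : C1 (cod k) (fun z => vol_density k z * Vf k z 0 i).
  by apply: C1M => //; [exact: vol_density_C1|exact: Vf_C1].
apply: (chart_continuous kp (g := fun z => (vol_density k z)^-1 *
    \sum_i 'D_'e_i (fun z => vol_density k z * Vf k z 0 i) z)).
  apply: filterS (near_dom kp) => q kq; have kz := phi_cod kq.
  by rewrite kappa_chart // phiK // mulKf // gt_eqF // vol_density_gt0.
have kz := phi_cod kp; apply: cont_mul; last first.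
  by apply: cont_sum => i _; exact: (C1_cont (CwV i)).
apply: cont_inv; first by rewrite gt_eqF // vol_density_gt0.
exact: (C1_continuous (@vol_density_C1 _ _ _ k)).
Qed.

End functions.

Section curvature_norm.
Context {R : realType} {m n : nat} {M : riemannian_manifold R m} (F : M -> 'rV[R]_n).
Hypothesis isoF : isometric_immersion F.

(** [kappa] is affine in the base point [X0], so moving it by a unit vector isolates one component
    of the mean curvature. *)
Lemma mean_curvature_entry_continuous a : continuous (fun q => mean_curvature F q 0 a).
Proof.
rewrite (_ : (fun q => _) = fun q => kappa F (- delta_mx 0 a) q - kappa F 0 q).
  move=> p; apply: cont_add; first exact: kappa_continuous.
  by apply: cont_opp; exact: kappa_continuous.
apply/funext => q; rewrite /kappa opprK subr0 dotC dotDl opprD addrACA subrr add0r dotC addrAC subrr add0r.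
rewrite /dot (bigD1 a) //= big1 => [|i /negbTE ia]; first by rewrite !mxE !eqxx mul1r addr0.
by rewrite mxE ia andbF mul0r.
Qed.

Lemma curvature_norm_continuous : continuous (fun q => enorm (mean_curvature F q)).
Proof.
by move=> p; apply: continuous_enorm => a; exact: mean_curvature_entry_continuous.
Qed.

End curvature_norm.

(** * Integration on the manifold *)

Section manifold_integral.
Context {R : realType} {m : nat} {M : riemannian_manifold R m} (x0 : M).

Local Notation cod := (@cod R m M).
Local Notation dom := (@dom R m M).
Local Notation psi := (@psi R m M).
Local Notation phi := (@phi R m M).
Local Notation vol_density := (@vol_density R m M).
Local Notation mu := (@mu R m M x0).
Local Notation T := (borel 'rV[R]_m).
Local Notation lam := (@lam R m).
Local Notation bman := (bman x0).

Lemma Rintegral_chart l (g : bman -> R) (G : T -> R) : measurable_fun setT g ->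
  (forall p, ~ dom l p -> g p = 0) -> (forall z, cod l z -> G z = g (psi l z) * vol_density l z) ->
  (forall z, ~ cod l z -> G z = 0) -> \int[mu]_p g p = \int[lam]_z G z.
Proof.
move=> mg g0 GE G0.
have mgE : measurable_fun setT (EFin \o g : bman -> \bar R) by apply/measurable_EFinP.
have w0 z : cod l z -> 0 <= vol_density l z by move=> kz; rewrite ltW // vol_density_gt0.
rewrite /Rintegral integralE [in RHS]integralE; congr (fine (_ - _)).
- have -> := @ge0_integral_chart _ _ _ x0 l ((EFin \o g)^\+)%E (measurable_funepos mgE) (fun p =>
  funepos_ge0 _ p).
    rewrite [LHS]integral_mkcond; apply: eq_integral => z _.
    rewrite patchE; case: ifPn => [|]; rewrite ?inE ?notin_setE => kz.
      by rewrite !funeposE /= GE // EFinM maxeMl ?lee_fin ?w0 // mul0e.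
    by rewrite funeposE /= G0 // maxxx.
  by move=> p kp; rewrite funeposE /= g0 // maxxx.
- have -> := @ge0_integral_chart _ _ _ x0 l ((EFin \o g)^\-)%E (measurable_funeneg mgE) (fun p =>
  funeneg_ge0 _ p).
    rewrite [LHS]integral_mkcond; apply: eq_integral => z _.
    rewrite patchE; case: ifPn => [|]; rewrite ?inE ?notin_setE => kz.
      by rewrite !funenegE /= GE // -mulNr EFinM maxeMl ?lee_fin ?w0 // mul0e.
    by rewrite funenegE /= G0 // oppr0 maxxx.
  by move=> p kp; rewrite funenegE /= g0 // oppr0 maxxx.
Qed.

(** On a small cube of a chart the volume density is at most its value at the center plus 1. *)
Lemma mu_local_fin p : exists A : set M, [/\ open A, A p & (mu A < +oo)%E].
Proof.
set k := chart_at p; have kp : dom k p := chart_at_dom p; have kz := phi_cod kp.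
set z0 := phi k p.
have cw := C1_continuous (@vol_density_C1 _ _ M k) kz.
have [r r0 Hr] := continuous_radius cw ltr01.
pose A := interior [set q | dom k q /\ `|phi k q - z0| < r].
have oA : open A by exact: open_interior.
have sA q : A q -> dom k q /\ `|phi k q - z0| < r by exact: interior_subset.
exists A; split => //; first exact: near_chart.
have mA : measurable (A : set bman) := @bman_open _ _ _ x0 _ oA.
have [B [mB Bfin HB]] := lam_cube_fin z0 r.
rewrite -[A]setIT -integral_indic // (@ge0_integral_chart _ _ _ x0 k (fun q => (\1_A q)%:E)); last 3 first.
- by apply/measurable_EFinP; exact: measurable_indic.
- by move=> q; rewrite lee_fin.
- by move=> q kq; rewrite indicE memNset // => /sA[].
apply: (@le_lt_trans _ _ (\int[lam]_z ((vol_density k z0 + 1)%:E * (\1_B z)%:E))%E).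
  rewrite integral_mkcond; apply: ge0_le_integral => //.
  - move=> z _; rewrite patchE; case: ifPn => //; rewrite inE => kz'.
    by rewrite mule_ge0 // lee_fin // ltW // vol_density_gt0.
  - apply/(measurable_restrictT _ (measurable_cod k)).
    apply: emeasurable_funM; last by apply/measurable_EFinP; exact: measurable_vol_density.
    have m1 : measurable_fun setT (fun q : bman => (\1_A q : R)%:E) by apply/measurable_EFinP;
      exact: measurable_indic.
    by apply: (measurableT_comp m1); exact: measurable_psi.
  - by apply: measurable_funeM; apply/measurable_EFinP; exact: measurable_indic.
  - move=> z _; have c0 : 0 <= vol_density k z0 + 1 by rewrite addr_ge0 // ltW // vol_density_gt0.
    rewrite patchE; case: ifPn => [|_]; last by rewrite mule_ge0 // lee_fin.
    rewrite inE => kz'; rewrite -!EFinM lee_fin [\1_A _]indicE.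
    have [Az|Az] := pselect (A (psi k z)); last by rewrite (memNset Az) mul0r mulr_ge0.
    rewrite (mem_set Az); have [_] := sA _ Az; rewrite psiK // => zr.
    rewrite indicE mem_set; last by apply: HB; exact: ltW.
    rewrite mul1r mulr1 -lerBlDl; have := Hr z zr.
    by move/ltW; apply: le_trans; exact: ler_norm.
rewrite ge0_integralZl //; last 2 first.
- by apply/measurable_EFinP; exact: measurable_indic.
- by rewrite lee_fin addr_ge0 // ltW // vol_density_gt0.
by rewrite integral_indic // setIT lte_mul_pinfty // lee_fin addr_ge0 // ltW // vol_density_gt0.
Qed.

Lemma measurable_compact (K : set M) : compact K -> measurable (K : set bman).
Proof.
move=> cK; have oK := closed_openC (compact_closed (@carrier_hausdorff _ _ M) cK).
by have := measurableC (@bman_open _ _ _ x0 _ oK); rewrite setCK.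
Qed.

Lemma mu_compact_fin (K : set M) : compact K -> (mu K < +oo)%E.
Proof.
move=> cK; have mK := measurable_compact cK.
have /choice[f Hf] := mu_local_fin.
have [l [_ Hl]] := compact_finite_cover (f := f) cK (fun p _ => let: And3 o fp _ := Hf p in conj o fp).
have [A [mA Afin HA]] : exists A : set bman, [/\ measurable A, (mu A < +oo)%E &
    forall q y, y \in l -> f y q -> A q].
  elim: l {Hl} => [|y l [A [mA Afin HA]]]; first by exists set0; split => //; rewrite measure0.
  have [ofy _ fyfin] := Hf y; have mf : measurable (f y : set bman) := @bman_open _ _ _ x0 _ ofy.
  exists (f y `|` A); split.
  - exact: measurableU.
  - by apply: (le_lt_trans (measureU2 _ mf mA)); rewrite lte_add_pinfty.
  - move=> q y'; rewrite inE => /orP[/eqP ->|y'l fq]; [by left|right; exact: HA fq].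
apply: le_lt_trans Afin; apply: le_measure; rewrite ?inE // => q /Hl[y yl fq].
exact: HA fq.
Qed.

Lemma integ_continuous (K : set M) (f : bman -> R) : compact K -> continuous (f : M -> R) ->
  (forall p, ~ K p -> f p = 0) -> integ mu f.
Proof.
move=> cK cf f0; have mK := measurable_compact cK.
have cfK : compact ((f : M -> R) @` K).
  by apply: continuous_compact cK; exact: continuous_subspaceT.
have [C [_ HC]] := compact_bounded cfK.
apply: (@bounded_integrable _ bman R mu (K : set bman) f (`|C| + 1) mK (mu_compact_fin cK)) => [|p|];
  last exact: f0.
  exact: (@continuous_borelR R (pointed_at x0)).
have [Kp|Kp] := pselect (K p); last by rewrite f0 // normr0 addr_ge0.
by apply: (HC (`|C| + 1)); [rewrite (le_lt_trans (ler_norm C)) // ltrDl|exists p].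
Qed.

End manifold_integral.

(** * First variation *)

Lemma near_radius {R : realType} {m : nat} (P : 'rV[R]_m -> Prop) (z0 : 'rV[R]_m) : (\forall z \near z0, P z) ->
  exists2 r : R, 0 < r & forall z, `|z - z0| < r -> P z.
Proof.
move=> /nbhs_ballP[r /= r0 Hr]; exists r => // z zr; apply: Hr.
by rewrite -ball_normE /= distrC.
Qed.

Lemma ratio_bound {R : realFieldType} (a d e : R) : 0 <= a -> 0 < d -> 0 < e ->
  a * (e / (2 * (a + d))) <= e / 2.
Proof.
move=> a0 d0 e0; have ad : 0 < a + d by rewrite ltr_wpDl.
have -> : a * (e / (2 * (a + d))) = a / (a + d) * (e / 2) by field; rewrite gt_eqF //.
rewrite ler_piMl ?divr_ge0 ?(ltW e0) // ler_pdivrMr // mul1r lerDl ltW //.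
Qed.

Section local_estimate.
Context {R : realType} {m n : nat} {M : riemannian_manifold R m} (F : M -> 'rV[R]_n).
Hypothesis isoF : isometric_immersion F.
Variables (X0 : 'rV[R]_n) (x0 : M).

Local Notation cod := (@cod R m M).
Local Notation dom := (@dom R m M).
Local Notation psi := (@psi R m M).
Local Notation phi := (@phi R m M).
Local Notation vol_density := (@vol_density R m M).
Local Notation mu := (@mu R m M x0).
Local Notation T := (borel 'rV[R]_m).
Local Notation lam := (@lam R m).
Local Notation Vf := (@Vf R m n M F X0).
Local Notation kappa := (@kappa R m n M F X0).
Local Notation dV := (@dV R m n M F X0).
Local Notation D := (@dist R m M).
Local Notation "''e_' i" := (delta_mx 0 i : 'rV[R]_m) (at level 8, i at level 2).

(** The product rule [div (f V) = f div V + V f] in coordinates, multiplied by the volume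
    density. *)
Lemma flow_density_chart (f : M -> R) k z : C1_man f -> cod k z ->
  \sum_i 'D_'e_i (fun z => f (psi k z) * (vol_density k z * Vf k z 0 i)) z =
  (f (psi k z) * kappa (psi k z) + dV f (psi k z)) * vol_density k z.
Proof.
move=> Cf kz; have df := C1_diff (Cf k) kz.
have CwV i : C1 (cod k) (fun z => vol_density k z * Vf k z 0 i).
  by apply: C1M; [exact: cod_open|exact: vol_density_C1|exact: Vf_C1].
rewrite (dV_chart isoF X0 Cf kz) (gradlE _ df).
under eq_bigr => i _ do rewrite (derive_mul 'e_i df (C1_diff (CwV i) kz)).
rewrite big_split /= -mulr_sumr (kappa_chart isoF X0 kz) mulrDl addrC; congr (_ + _).
  by rewrite mulrA mulrAC.
by rewrite mulr_suml; apply: eq_bigr => i _; ring.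
Qed.

Lemma C1_integ (Q : 'rV[R]_m -> R) z0 (r : R) : C1 setT Q -> (forall z, r < `|z - z0| -> Q z = 0) ->
  integ lam (fun z : T => `|Q z|).
Proof.
move=> CQ Q0; have cQ : continuous Q by move=> z; exact: (C1_continuous CQ I).
have [C HC] := compact_bound cQ Q0.
apply: (cube_integrable (z0 := z0) (r := r) (C := C)).
- by apply: measurableT_comp => //; exact: continuous_borelR.
- by move=> z; rewrite normr_id.
- by move=> z zr; rewrite Q0 ?normr0.
Qed.

(* Freezing the field at [p] costs [e], and makes the constant [l0 |F p - X0|] sharp. *)
Lemma lipschitz_bump (ze : M -> R) (p : M) (N : set M) (l0 e : R) :
  open N -> N p -> 0 <= l0 -> 0 < e -> continuous ze -> (forall q, 0 <= ze q <= 1) ->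
  (forall q q', N q -> N q' -> `|ze q - ze q'| <= l0 * D q q') ->
  exists b : M -> R, [/\ C1_man b, (forall q, 0 <= b q <= 1), (\forall q \near p, b q = 1),
    (forall q, ~ N q -> b q = 0) &
    forall eta, C1_man eta -> (forall q, 0 <= eta q) ->
      \int[mu]_q (ze q * (eta q * b q * kappa q + dV (fun p => eta p * b p) q)) <=
      (l0 * enorm (F p - X0) + e) * \int[mu]_q (eta q * b q)].
Proof.
move=> oN Np l00 e0 cze ze01 Lip.
set k := chart_at p; have kp : dom k p := chart_at_dom p.
have kz0 := phi_cod kp; set z0 := phi k p in kz0 *.
pose c := Vf k z0; pose J0 := 'J (param F k) z0.
have cJ : enorm (c *m J0) <= enorm (F p - X0).
  by have := Vf_jac isoF X0 kz0; rewrite /pos /param /= /z0 phiK.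
have [C C0 HC] := enorm_mulmx_bound J0.
pose A := l0 * enorm (F p - X0); have A0 : 0 <= A by rewrite mulr_ge0 // enorm_ge0.
(* The allowance [e] is halved: [e1] pays for the distortion of the distance in the chart, [e2] for
   the variation of the components of [Vf] about [c]. *)
pose e1 := e / (2 * (A + e)); have Ae : 0 < A + e by rewrite ltr_wpDl.
have e10 : 0 < e1 by rewrite divr_gt0 // mulr_gt0.
have e1le : e1 <= 1 by rewrite ler_pdivrMr ?mulr_gt0 // mul1r; lra.
have Ae1 : A * e1 <= e / 2 by exact: ratio_bound.
pose K := 2 * l0 * C * m%:R; have K0 : 0 <= K by rewrite !mulr_ge0 // ltW.
pose e2 := e / (2 * (K + 1)); have K1 : 0 < K + 1 by rewrite ltr_wpDl.
have e20 : 0 < e2 by rewrite divr_gt0 // mulr_gt0.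
have Ke2 : K * e2 <= e / 2 by exact: ratio_bound.
have [rb rb0 Hrb] := dist_local_upper isoF kz0 e10.
have [ra ra0 Hra] : exists2 r : R, 0 < r & forall z, `|z - z0| < r ->
    [/\ cod k z, N (psi k z) & forall i, `|Vf k z 0 i - c 0 i| <= e2].
  apply: near_radius.
  have n1 : \forall z \near z0, cod k z by exact: open_near (@cod_open _ _ M k) kz0.
  have n2 : \forall z \near z0, N (psi k z).
    by apply: (near_psi kz0); rewrite /z0 phiK //; apply: open_nbhs_nbhs.
  have n3 : \forall z \near z0, forall i, `|Vf k z 0 i - c 0 i| <= e2.
    apply: (@filter_forall _ 'I_m (fun i z => `|Vf k z 0 i - c 0 i| <= e2) (nbhs z0)) => i.
    have cV := C1_continuous (@Vf_C1 _ _ _ _ _ isoF X0 k 0 i) kz0.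
    by have /cvgrPdist_le /(_ e2 e20) := cV; apply: filterS => z; rewrite distrC.
  by apply: filterS3 n1 n2 n3 => z.
pose s := Num.min ra rb; have s0 : 0 < s by rewrite lt_min ra0.
have sa z : `|z - z0| < s -> `|z - z0| < ra by rewrite lt_min => /andP[].
have sb z : `|z - z0| < s -> `|z - z0| < rb by rewrite lt_min => /andP[].
pose r := s / 2; have r0 : 0 < r by rewrite divr_gt0.
have rs : r < s by rewrite /r ltr_pdivrMr // ltr_pMr // ltr1n.
have scod z : `|z - z0| < s -> cod k z by move/sa/Hra => [].
have rcod z : `|z - z0| <= r -> cod k z by move=> zr; apply: scod; exact: le_lt_trans rs.
pose u := cube_bump z0 r.
have u0 z : r < `|z - z0| -> u z = 0 by move=> zr; exact: bump_outside (ltW zr).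
have Cu : C1 setT u by apply: bump_C1; exact: openT.
pose b : M -> R := extend k u 0.
have Cb : C1_man b by exact: extend_C1 (ltW r0) rcod u0 Cu.
have b01 q : 0 <= b q <= 1.
  have [kq|kq] := pselect (dom k q); first by rewrite /b extend_in // bump01.
  by rewrite /b extend_out // lexx ler01.
exists b; split => //.
- have r20 : 0 < r / 2 by rewrite divr_gt0.
  apply: filterS (near_chart kp r20) => q [kq qr].
  rewrite /b extend_in //; exact: (bump_inside r0 (ltW qr)).
- move=> q Nq; have [kq|kq] := pselect (dom k q); last exact: extend_out.
  rewrite /b extend_in //; apply: bump_outside => //; rewrite leNgt; apply/negP => qr; apply: Nq.
  by have [_ + _] := Hra _ (sa _ (lt_trans qr rs)); rewrite phiK.
move=> eta Ceta eta0; pose f q := eta q * b q.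
have Cf : C1_man f by exact: C1_manM.
have f0 q : 0 <= f q by rewrite mulr_ge0 //; case/andP: (b01 q).
have bpsi z : cod k z -> b (psi k z) = u z by move=> kz; rewrite /b extend_in ?psiK //; exact: psi_dom.
pose w := vol_density k; have w0 z : cod k z -> 0 <= w z by move=> kz; rewrite ltW // vol_density_gt0.
have oc := @cod_open _ _ M k.
have Cg : C1 (cod k) (fun z => eta (psi k z) * w z).
  by apply: (C1M oc (Ceta k)); exact: vol_density_C1.
have CVc i : C1 (cod k) (fun z => Vf k z 0 i - c 0 i).
  by apply: (C1B oc); [exact: Vf_C1|exact: C1_cst].
(* The components of the weighted field are [c 0 i * Q + Qi i]: a constant vector times a function,
   plus a remainder with [|Qi i| <= e2 * |Q|]. *)
pose Q z := u z * (eta (psi k z) * w z).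
pose Qi i z := u z * ((eta (psi k z) * w z) * (Vf k z 0 i - c 0 i)).
have CQ : C1 setT Q by exact: C1_bumpM oc r0 rs scod Cg.
have CQi i : C1 setT (Qi i) by exact: (C1_bumpM oc r0 rs scod (C1M oc Cg (CVc i))).
have Q0 z : r < `|z - z0| -> Q z = 0 by move=> zr; rewrite /Q u0 // mul0r.
have Qi0 i z : r < `|z - z0| -> Qi i z = 0 by move=> zr; rewrite /Qi u0 // mul0r.
pose zeT : T -> R := (fun z => ze (psi k z)) \_ (cod k).
have zeTE z : cod k z -> zeT z = ze (psi k z) by move=> kz; rewrite /zeT patchE mem_set.
have zeT0 z : ~ cod k z -> zeT z = 0 by move=> kz; rewrite /zeT patchE memNset.
have mzeT : measurable_fun setT zeT.
  apply/(measurable_restrictT _ (measurable_cod k)); apply: continuous_on_borelR => // y ky.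
  by apply: continuous_comp; [exact: psi_continuous|exact: cze].
have zeT1 z : `|zeT z| <= 1.
  have [kz|kz] := pselect (cod k z); last by rewrite zeT0 // normr0.
  by rewrite zeTE //; have /andP[h1 h2] := ze01 (psi k z); rewrite ger0_norm.
(* Along a straight step [h *: v] the cutoff changes by at most [l0] times the distance, which
   [dist_local_upper] bounds by [h] times the Euclidean length of [v *m J0], up to the factor
   [1 + e1]. *)
have key (v : 'rV[R]_m) (Q' : 'rV[R]_m -> R) : C1 setT Q' -> (forall z, r < `|z - z0| -> Q' z = 0) ->
    \int[lam]_z (zeT z * 'D_v Q' z) <= l0 * ((1 + e1) * enorm (v *m J0)) * \int[lam]_z `|Q' z|.
  move=> CQ' Q'0; have v0 : 0 < `|v| + 1 by rewrite ltr_wpDl.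
  have h00 : 0 < r / (`|v| + 1) by rewrite divr_gt0.
  apply: (integral_lipschitz_derive CQ' Q'0 mzeT zeT1 h00) => z h zr h0.
  rewrite ltr_pdivlMr // => hv.
  have zs : `|z - z0| < s := le_lt_trans zr rs.
  have zs' : `|z - h *: v - z0| < s.
    rewrite addrAC; apply: (le_lt_trans (ler_normB _ _)); rewrite normrZ (gtr0_norm h0).
    have : h * `|v| < r by apply: le_lt_trans hv; rewrite ler_pM2l // lerDl.
    have -> : s = r + r by rewrite /r -splitr.
    by move: (h * `|v|) => t ht; exact: ler_ltD.
  have [kz Nz _] := Hra _ (sa _ zs); have [kz' Nz' _] := Hra _ (sa _ zs').
  rewrite zeTE // zeTE //; apply: (le_trans (Lip _ _ Nz Nz')).
  have := Hrb z (- (h *: v)) (sb _ zs) (sb _ zs').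
  rewrite mulNmx enormN -scalemxAl enormZ (gtr0_norm h0) => Hd.
  by rewrite mulrCA ler_wpM2l //; apply: (le_trans Hd); rewrite mulrCA.
pose S := \int[lam]_z `|Q z|.
have SE : S = \int[mu]_q f q.
  apply/esym/(Rintegral_chart (l := k)).
  - by apply: (@continuous_borelR R (pointed_at x0)); exact: C1_man_continuous.
  - by move=> q kq; rewrite /f /b extend_out // mulr0.
  - move=> z kz; rewrite /Q /f bpsi // ger0_norm; first by rewrite mulrA (mulrC (u z)).
    by rewrite !mulr_ge0 // ?w0 //; have /andP[] := bump01 z0 r z.
  - by move=> z kz; rewrite Q0 ?normr0 // ltNge; apply/negP => /rcod.
have SQi i : \int[lam]_z `|Qi i z| <= e2 * S.
  have I1 := C1_integ CQ Q0.
  rewrite -RintegralZl //; apply: le_Rintegral => //; first exact: C1_integ (CQi i) (Qi0 i).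
    exact: integZ.
  move=> z _; have [zr|zr] := leP `|z - z0| r; last by rewrite Qi0 // normr0 mulr_ge0 // ltW.
  have [_ _ Hz] := Hra _ (sa _ (le_lt_trans zr rs)).
  by rewrite /Qi mulrA normrM mulrC ler_wpM2r.
have S0 : 0 <= S by apply: Rintegral_ge0.
have cI : continuous (fun q : M => ze q * (f q * kappa q + dV f q)).
  move=> q; have c1 : {for q, continuous f} by exact: C1_man_continuous.
  have c2 : {for q, continuous kappa} by exact: kappa_continuous.
  have c3 : {for q, continuous (dV f)} by exact: dV_continuous.
  have c4 : {for q, continuous ze} by exact: cze.
  exact: (cont_mul c4 (cont_add (cont_mul c1 c2) c3)).
rewrite -SE (@Rintegral_chart _ _ _ x0 k _ (fun z => zeT z * ('D_c Q z + \sum_i 'D_'e_i (Qi i) z)));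
  last 4 first.
- exact: (@continuous_borelR R (pointed_at x0) _ cI).
- move=> q kq; have fq : \forall q' \near q, f q' = 0.
    by apply: filterS (extend_near (ltW r0) rcod u0 kq) => q' bq; rewrite /f /b bq mulr0.
  have := dV_near0 F X0 fq; rewrite -/(f q) => ->; by rewrite (nbhs_singleton fq) mul0r addr0 mulr0.
- move=> z kz; rewrite zeTE // -mulrA; congr (_ * _).
  rewrite -(flow_density_chart Cf kz) (gradlE _ (C1_diff CQ I)) -big_split /=; apply: eq_bigr => i _.
  have dQ := C1_diff CQ (I : setT z); have dc : differentiable (fun=> c 0 i : R) z by exact: differentiable_cst.
  have E : forall z', cod k z' -> f (psi k z') * (vol_density k z' * Vf k z' 0 i) = c 0 i * Q z' + Qi i z'.
    move=> z' kz'; rewrite /f bpsi // /Q /Qi -/(w z').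
    by move: (u z') (eta _) (w z') (Vf k z' 0 i) (c 0 i) => t1 t2 t3 t4 t5; ring.
  apply/esym/(eq_trans (derive_eq_on 'e_i oc kz E)).
  rewrite derive_add; [|exact: differentiableM|exact: (C1_diff (CQi i))].
  by rewrite (derive_mul _ dc dQ) derive_cst mul0r add0r.
- by move=> z kz; rewrite zeT0 // mul0r.
have I1 := derive_integ c CQ Q0 mzeT zeT1.
have I2 i := derive_integ 'e_i (CQi i) (Qi0 i) mzeT zeT1.
have -> : \int[lam]_z (zeT z * ('D_c Q z + \sum_i 'D_'e_i (Qi i) z)) =
    \int[lam]_z (zeT z * 'D_c Q z) + \sum_i \int[lam]_z (zeT z * 'D_'e_i (Qi i) z).
  rewrite -integ_int_sum // -RintegralD //; last exact: integ_sum.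
  by apply: eq_Rintegral => z _; rewrite mulrDr mulr_sumr.
rewrite -/A.
have B1 : \int[lam]_z (zeT z * 'D_c Q z) <= (A + e / 2) * S.
  apply: (le_trans (key c Q CQ Q0)); rewrite -/S ler_wpM2r //.
  apply: (@le_trans _ _ (A * (1 + e1))); last by rewrite mulrDr mulr1 lerD2l.
  by rewrite /A -mulrA ler_wpM2l // mulrC ler_wpM2r // addr_ge0 // ltW.
have B2 i : \int[lam]_z (zeT z * 'D_'e_i (Qi i) z) <= 2 * l0 * C * e2 * S.
  apply: (le_trans (key 'e_i (Qi i) (CQi i) (Qi0 i))).
  have -> : 2 * l0 * C * e2 * S = l0 * (2 * C) * (e2 * S) by rewrite (mulrC 2) !mulrA.
  apply: ler_pM => //.
  - by rewrite !mulr_ge0 ?enorm_ge0 ?addr_ge0 ?(ltW e10).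
  - exact: Rintegral_ge0.
  - rewrite ler_wpM2l //; apply: ler_pM; rewrite ?enorm_ge0 ?addr_ge0 ?(ltW e10) //.
      by rewrite -[2]/(1 + 1) lerD2l.
    by apply: (le_trans (HC _)); rewrite ler_piMr ?norm_delta // ltW.
have B3 : \sum_i \int[lam]_z (zeT z * 'D_'e_i (Qi i) z) <= e / 2 * S.
  apply: (@le_trans _ _ (\sum_(i < m) 2 * l0 * C * e2 * S)); first exact: ler_sum.
  rewrite sumr_const card_ord -[leLHS]mulr_natl.
  have -> : m%:R * (2 * l0 * C * e2 * S) = K * e2 * S.
    by rewrite /K; move: (m%:R) (e2) (S) => t1 t2 t3; ring.
  by rewrite ler_wpM2r.
apply: (le_trans (lerD B1 B3)); rewrite -mulrDl -addrA -splitr //.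
Qed.

End local_estimate.

Section ramp.
Context {R : realType}.
Implicit Types a b t : R.

Definition ramp a b t : R := Num.min (Num.max ((b - t) / (b - a)) 0) 1.

Lemma ramp01 a b t : 0 <= ramp a b t <= 1.
Proof. by rewrite /ramp le_min ge_min ler01 lexx orbT le_max lexx orbT. Qed.

Lemma ramp_left a b t : a < b -> t <= a -> ramp a b t = 1.
Proof.
move=> ab ta; have ba : 0 < b - a by rewrite subr_gt0.
have h : 1 <= (b - t) / (b - a) by rewrite ler_pdivlMr // mul1r lerD2l lerN2.
by rewrite /ramp max_l ?min_r // (le_trans ler01).
Qed.

Lemma ramp_right a b t : a < b -> b <= t -> ramp a b t = 0.
Proof.
move=> ab bt; have ba : 0 < b - a by rewrite subr_gt0.
have h : (b - t) / (b - a) <= 0 by rewrite pmulr_lle0 ?invr_gt0 // subr_le0.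
by rewrite /ramp max_r ?min_l.
Qed.

Lemma clip_lipschitz (x y : R) :
  `|Num.min (Num.max x 0) 1 - Num.min (Num.max y 0) 1| <= `|x - y|.
Proof.
have h3 := ler_norm (x - y); have := ler_norm (y - x); rewrite distrC.
move: h3; move: `|x - y| => d h3 h4; rewrite ler_norml.
case: (leP x 0) => hx; case: (leP y 0) => hy; rewrite ?(min_l (@ler01 R));
  try (case: (leP x 1) => h1); try (case: (leP y 1) => h2); lra.
Qed.

Lemma ramp_lipschitz a b t t' : a < b -> `|ramp a b t - ramp a b t'| <= (b - a)^-1 * `|t - t'|.
Proof.
move=> ab; have ba : 0 < (b - a)^-1 by rewrite invr_gt0 subr_gt0.
apply: (le_trans (clip_lipschitz _ _)); rewrite -mulrBl normrM (gtr0_norm ba) mulrC.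
by rewrite (_ : b - t - (b - t') = - (t - t')) ?normrN //; ring.
Qed.

End ramp.

(** * Integrated divergence against a cutoff of the distance *)

Section cutoff.
Context {R : realType} {m n : nat} {M : riemannian_manifold R m} (F : M -> 'rV[R]_n).
Hypothesis isoF : isometric_immersion F.
Hypothesis complM : complete_manifold M.
Variables (x0 y : M).

Local Notation mu := (@mu R m M x0).
Local Notation bman := (bman x0).
Local Notation kappa := (@kappa R m n M F (F y)).
Local Notation dV := (@dV R m n M F (F y)).
Local Notation D := (@dist R m M).
Local Notation Ball r := [set q | D y q < r].

Lemma measurable_dist_ball r : measurable (Ball r : set bman).
Proof. by apply: (@bman_open _ _ _ x0); exact: dist_ball_open. Qed.

Lemma ball_fin r : (mu (Ball r) < +oo)%E.
Proof.
apply: (le_lt_trans _ (mu_compact_fin x0 (@closed_ball_compact _ _ _ _ F isoF complM y r))).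
apply: le_measure; rewrite ?inE; first exact: measurable_dist_ball.
  exact: (@measurable_compact _ _ M x0 _ (@closed_ball_compact _ _ _ _ F isoF complM y r)).
by move=> q /ltW.
Qed.

Lemma integ_ball (g : bman -> R) r C : measurable_fun setT g -> (forall q, `|g q| <= C) ->
  (forall q, ~ Ball r q -> g q = 0) -> integ mu g.
Proof. exact: (bounded_integrable (measurable_dist_ball r) (ball_fin r)). Qed.

Variables (a a' b' b e : R).
Hypotheses (aa' : a < a') (ab' : a' < b') (bb' : b' < b) (e0 : 0 < e).

Let b0 : 0 <= b' -> 0 <= b. Proof. by move=> h; apply: (le_trans h); exact: ltW. Qed.

Let ze (q : M) := ramp a' b' (D y q).
Let L := (b' - a')^-1.
(** Bound for the slope of the cutoff times the length of the field, plus the error [e]: the slope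
    is at most [L], and the field is at most as long as the distance to [y]. The gaps between [a]
    and [a'] and between [b'] and [b] leave room for neighborhoods. *)
Let Lam (q : M) : R := e * \1_(Ball b) q + L * b * (\1_(Ball b) q - \1_(Ball a) q).
Let T (eta : M -> R) := \int[mu]_q (ze q * (eta q * kappa q + dV eta q)).

Let L0 : 0 < L. Proof. by rewrite invr_gt0 subr_gt0. Qed.

Let ze_lip q q' : `|ze q - ze q'| <= L * D q q'.
Proof.
apply: (le_trans (ramp_lipschitz _ _ ab')); rewrite ler_wpM2l // ?(ltW L0) //.
exact: (dist_lipschitz isoF).
Qed.

Let ze_continuous : continuous ze.
Proof.
move=> p; apply/cvgrPdist_le => d d0.
have dL : 0 < d / L by rewrite divr_gt0.
apply: filterS (dist_near isoF p dL) => q pq; apply: (le_trans (ze_lip _ _)).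
by rewrite -ler_pdivlMl // mulrC ltW.
Qed.

Let T_integ eta : C1_man eta -> integ mu (fun q => ze q * (eta q * kappa q + dV eta q)).
Proof.
move=> Ceta; apply: (@integ_continuous _ _ M x0 _ (fun q => ze q * (eta q * kappa q + dV eta q))
  (@closed_ball_compact _ _ _ _ F isoF complM y b')) => [q|q qb].
  have c1 : {for q, continuous eta} by exact: C1_man_continuous.
  have c2 : {for q, continuous kappa} by exact: kappa_continuous.
  have c3 : {for q, continuous (dV eta)} by exact: dV_continuous.
  have c4 : {for q, continuous ze} by exact: ze_continuous.
  exact: (cont_mul c4 (cont_add (cont_mul c1 c2) c3)).
rewrite /ze ramp_right ?mul0r // leNgt; apply/negP => H; apply: qb; exact: ltW.
Qed.

Let good eta := C1_man eta /\ forall q : M, 0 <= eta q <= 1.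

Let measurable_good eta : good eta -> measurable_fun setT (eta : bman -> R).
Proof. by move=> [Ceta _]; apply: (@continuous_borelR R (pointed_at x0)); exact: C1_man_continuous. Qed.

Let LamE q : D y q < b -> Lam q = if D y q < a then e else e + L * b.
Proof.
move=> qb; rewrite /Lam !indicE mem_set // mulr1; case: ifP => qa.
  by rewrite mem_set // subrr mulr0 addr0.
by rewrite memNset ?subr0 ?mulr1 //= qa.
Qed.

Let Lam_out q : ~ Ball b q -> Lam q = 0.
Proof.
move=> qb; rewrite /Lam !indicE !memNset ?subr0 ?mulr0 ?addr0 // => qa; apply: qb.
apply: (lt_trans qa); exact: lt_trans (lt_trans aa' ab') bb'.
Qed.

Let measurable_Lam : measurable_fun setT (Lam : bman -> R).
Proof.
have mI r : measurable_fun setT (fun q : bman => \1_(Ball r) q : R).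
  by apply: measurable_indic; exact: measurable_dist_ball.
apply: measurable_funD; apply: measurable_funM => //.
by apply: measurable_funB.
Qed.

Hypothesis b'0 : 0 <= b'.

Let Lam_ge q : Ball b q -> e <= Lam q.
Proof. by move=> qb; rewrite LamE //; case: ifP => // _; rewrite lerDl mulr_ge0 ?b0 // ltW. Qed.

Let Lam_ge0 q : 0 <= Lam q.
Proof.
have [qb|qb] := pselect (Ball b q); last by rewrite Lam_out.
exact: le_trans (ltW e0) (Lam_ge qb).
Qed.

Let Lam_integ (g : bman -> R) : measurable_fun setT g -> (forall q, 0 <= g q <= 1) ->
  integ mu (fun q => Lam q * g q).
Proof.
move=> mg g01; apply: (@integ_ball _ b (e + L * b)).
- exact: measurable_funM.
- move=> q; have /andP[g0 g1] := g01 q.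
  have LbO : 0 <= L * b by rewrite mulr_ge0 ?b0 // ltW.
  rewrite ger0_norm ?mulr_ge0 //; have [qb|qb] := pselect (Ball b q).
    apply: (@le_trans _ _ (Lam q)); first by rewrite ler_piMr.
    by rewrite LamE //; case: ifP => // _; rewrite lerDl.
  by rewrite Lam_out // mul0r addr_ge0 // ltW.
- by move=> q qb; rewrite Lam_out // mul0r.
Qed.

(** Points with [D y p < a'] have a neighborhood where the cutoff is constant; around the others, a
    neighborhood inside the annulus between [a] and [b] allows the slope [L]. *)
Let local_bump p : D y p <= b' -> exists f : M -> R, [/\ good f, (\forall q \near p, f q = 1) &
  forall eta, good eta -> T (fun q => eta q * f q) <= \int[mu]_q (Lam q * (eta q * f q))].
Proof.
move=> pb; have [N [l0 [oN Np l00 Lip HN]]] : exists (N : set M) (l0 : R), [/\ open N, N p, 0 <= l0,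
    (forall q q', N q -> N q' -> `|ze q - ze q'| <= l0 * D q q') &
    forall q, N q -> l0 * enorm (F p - F y) + e <= Lam q].
  have [pa|pa] := ltP (D y p) a'.
    exists (Ball a'), 0; split => //; first exact: (dist_ball_open isoF).
      move=> q q' /= qa qa'; rewrite mul0r /ze !ramp_left ?(ltW qa) ?(ltW qa') //.
      by rewrite subrr normr0.
    move=> q /= qa; rewrite mul0r add0r; apply: Lam_ge; apply: (lt_trans qa).
    exact: lt_trans bb'.
  exists ([set q | a < D y q] `&` Ball b), L; split.
  - apply: openI; last exact: (dist_ball_open isoF).
    apply: (@open_comp _ _ (D y) [set t : R | a < t]); last exact: open_gt.
    by move=> q _; exact: (dist_continuous isoF).
  - by split => /=; [apply: lt_le_trans pa|apply: le_lt_trans bb'].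
  - exact: ltW.
  - by move=> q q' _ _; exact: ze_lip.
  - move=> q [/= qa qb]; rewrite LamE // ltNge (ltW qa) /= addrC lerD2l ler_wpM2l // ?ltW //.
    by apply: (le_lt_trans (chord_le_dist isoF _ _)); exact: le_lt_trans bb'.
have [f [Cf f01 fp fN Hf]] := lipschitz_bump isoF (F y) x0 oN Np l00 e0 ze_continuous
  (fun q => ramp01 _ _ _) Lip.
exists f; split => // eta [Ceta eta01].
have g0 q : 0 <= eta q * f q.
  by apply: mulr_ge0; [have /andP[] := eta01 q|have /andP[] := f01 q].
have g1 q : eta q * f q <= 1.
  by have /andP[h1 h2] := eta01 q; have /andP[h3 h4] := f01 q; rewrite mulr_ile1.
have mg : measurable_fun setT (fun q : bman => eta q * f q).
  by apply: measurable_funM; [exact: (measurable_good (conj Ceta eta01))|exact: (measurable_good (conj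
    Cf f01))].
have eta0 q : 0 <= eta q by have /andP[] := eta01 q.
apply: (le_trans (Hf eta Ceta eta0)).
have Ig : integ mu (fun q : bman => eta q * f q).
  apply: (@integ_ball _ b 1) => // q; first by rewrite ger0_norm.
  move=> qb; rewrite fN ?mulr0 // => Nq; apply: qb; rewrite /=.
  apply: contrapT => qb; have := HN q Nq; rewrite Lam_out // leNgt => /negP; apply.
  by rewrite ltr_wpDl // mulr_ge0 // enorm_ge0.
rewrite -RintegralZl //; apply: le_Rintegral => //.
- exact: integZ.
- by apply: Lam_integ => // q; rewrite g0 g1.
- move=> q _; have [Nq|Nq] := pselect (N q); last by rewrite fN // !mulr0.
  by rewrite ler_wpM2r // HN.
Qed.

(** The local bounds are added over a partition built by products: starting from 1, each bump [f p]
    takes away its share [eta * f p] of the remainder [eta]. The shares are nonnegative with sum at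
    most 1, so their bounds add up to at most the integral of [Lam]. *)
Lemma cutoff_estimate : integ mu (fun q => ze q * kappa q) /\
  \int[mu]_q (ze q * kappa q) <= \int[mu]_q Lam q.
Proof.
split.
  have := T_integ (C1_man_cst 1); congr (_.-integrable _ (EFin \o _)); apply/funext => q.
  by rewrite dV_cst mul1r addr0.
have /choice[f Hf] : forall p, exists f : M -> R, D y p <= b' -> [/\ good f, (\forall q \near p, f q = 1) &
  forall eta, good eta -> T (fun q => eta q * f q) <= \int[mu]_q (Lam q * (eta q * f q))].
  move=> p; have [pb|pb] := pselect (D y p <= b'); last by exists (fun=> 0).
  by have [f Hf] := local_bump pb; exists f.
have [l [lb lcov]] : exists l : seq M, (forall p, p \in l -> D y p <= b') /\
    forall q, D y q <= b' -> exists2 p, p \in l & interior [set q | f p q = 1] q.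
  apply: (compact_finite_cover (f := fun p => interior [set q | f p q = 1]) (@closed_ball_compact _ _ _
    _ F isoF complM y b')) => p pb.
  by split; [exact: open_interior|have [_ h _] := Hf p pb; exact: h].
(* Peel off the bumps one at a time: the remainder vanishes near the support of the cutoff. *)
have H : forall eta, good eta -> exists eta', [/\ good eta',
    T eta - T eta' <= \int[mu]_q (Lam q * (eta q - eta' q)), (forall q, eta' q <= eta q) &
    forall p q, p \in l -> f p q = 1 -> eta' q = 0].
  elim: l lb {lcov} => [_|p l IH lb] eta Geta.
    exists eta; split => //; rewrite subrr; apply: Rintegral_ge0 => q _.
    by rewrite subrr mulr0.
  have pb : D y p <= b' by apply: lb; rewrite mem_head.
  have [Gf _ Hp] := Hf p pb; have [Ceta eta01] := Geta; have [Cf f01] := Gf.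
  pose eta1 q := eta q - eta q * f p q.
  have Cef : C1_man (fun q => eta q * f p q) by exact: C1_manM.
  have Ceta1 : C1_man eta1 by exact: C1_manB.
  have g01 q : 0 <= eta q * f p q <= eta q.
    by have /andP[h1 h2] := eta01 q; have /andP[h3 h4] := f01 q; rewrite mulr_ge0 // ler_piMr.
  have Geta1 : good eta1.
    split=> // q; have /andP[h1 h2] := g01 q; have /andP[h3 h4] := eta01 q; rewrite /eta1.
    by rewrite subr_ge0 h2 (le_trans _ h4) // gerBl.
  have lb' q : q \in l -> D y q <= b' by move=> ql; apply: lb; rewrite inE ql orbT.
  have [eta' [Geta' ineq le1 van]] := IH lb' eta1 Geta1.
  have le1' q : eta' q <= eta q.
    by apply: (le_trans (le1 q)); rewrite /eta1 gerBl; have /andP[] := g01 q.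
  exists eta'; split => //; last first.
    move=> p' q; rewrite inE => /orP[/eqP ->|p'l] f1; last exact: van p'l f1.
    have := le1 q; rewrite /eta1 f1 mulr1 subrr => h; apply: le_anti; rewrite h.
    by have /andP[] := Geta'.2 q.
  have Tsplit : T eta = T (fun q => eta q * f p q) + T eta1.
    rewrite /T -RintegralD //; [|exact: T_integ|exact: T_integ].
    apply: eq_Rintegral => q _; rewrite -mulrDr; congr (_ * _).
    have E q' : eta q' * f p q' + eta1 q' = eta q' by rewrite /eta1 addrC subrK.
    rewrite addrACA -mulrDl -(dVD _ _ _ Cef Ceta1) E; congr (_ * _ + dV _ q).
    by apply/funext => q'; rewrite E.
  have Ggef : good (fun q => eta q * f p q).
    split=> // q; have /andP[h1 h2] := g01 q; have /andP[h3 h4] := eta01 q.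
    by rewrite h1 (le_trans h2).
  have I1 : integ mu (fun q => Lam q * (eta q * f p q)).
    by apply: Lam_integ => [|q]; [exact: measurable_good|exact: Ggef.2].
  have I2 : integ mu (fun q => Lam q * (eta1 q - eta' q)).
    apply: Lam_integ => [|q]; first by apply: measurable_funB; exact: measurable_good.
    rewrite subr_ge0 le1 /=; have /andP[_ h] := Geta1.2 q; have /andP[h' _] := Geta'.2 q.
    by rewrite (le_trans _ h) // gerBl.
  rewrite Tsplit -addrA.
  have -> : \int[mu]_q (Lam q * (eta q - eta' q)) =
      \int[mu]_q (Lam q * (eta q * f p q)) + \int[mu]_q (Lam q * (eta1 q - eta' q)).
    rewrite -RintegralD //; apply: eq_Rintegral => q _; rewrite -mulrDr; congr (_ * _).
    by rewrite /eta1 addrA (addrC _ (eta q - _)) subrK.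
  by apply: lerD => //; exact: Hp.
have good1 : good (fun=> 1).
  by split=> [|q]; [exact: C1_man_cst|rewrite lexx ler01].
have [eta' [[Ceta' eta'01] ineq le1 van]] := H _ good1.
have T0 : T eta' = 0.
  rewrite /T /Rintegral (eq_integral (fun=> 0%E)) ?integral0 // => q _;
    congr EFin. have [qb|qb] := ltP b' (D y q); first by rewrite /ze ramp_right ?mul0r // ltW.
  have [p pl fq] := lcov q qb.
  have eq0 : \forall q' \near q, eta' q' = 0 by apply: filterS fq => q' /=; exact: van.
  by rewrite (dV_near0 F (F y) eq0) (nbhs_singleton eq0) mul0r addr0 mulr0.
have T1 : T (fun=> 1) = \int[mu]_q (ze q * kappa q).
  by apply: eq_Rintegral => q _; rewrite dV_cst mul1r addr0.
move: ineq; rewrite T0 subr0 T1 => /le_trans; apply; apply: le_Rintegral => //.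
- apply: Lam_integ => [|q]; first by apply: measurable_funB => //; exact: measurable_good.
  by rewrite subr_ge0 le1 gerBl; have /andP[] := eta'01 q.
- rewrite (_ : Lam = fun q => Lam q * 1); last by apply/funext => q; rewrite mulr1.
  by apply: Lam_integ => // q; rewrite lexx ler01.
- by move=> q _; rewrite ler_piMr // gerBl; have /andP[] := eta'01 q.
Qed.

End cutoff.

Section monotonicity.
Context {R : realType} {m n : nat} {M : riemannian_manifold R m} (F : M -> 'rV[R]_n).
Hypothesis isoF : isometric_immersion F.
Hypothesis complM : complete_manifold M.
Variables (x0 : M).

Local Notation mu := (@mu R m M x0).
Local Notation bman := (bman x0).
Local Notation D := (@dist R m M).
Local Notation H := (fun q => enorm (mean_curvature F q)).

Definition ball_integral (g : M -> R) (y : M) (r : R) : R := \int[mu]_q (g q * \1_[set q | D y q < r] q).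
Local Notation W := ball_integral.
Local Notation V := (ball_integral (fun=> 1)).

Lemma measurable_ball_indic y r : measurable_fun setT (fun q : bman => \1_[set q | D y q < r] q : R).
Proof. by apply: measurable_indic; exact: measurable_dist_ball. Qed.

Lemma ball_integral_integ g y r : continuous (g : M -> R) ->
  integ mu (fun q : bman => g q * \1_[set q | D y q < r] q).
Proof.
move=> cg; have cK := @closed_ball_compact _ _ _ _ F isoF complM y r.
have cgK : compact (g @` [set q | D y q <= r]).
  by apply: continuous_compact cK; exact: continuous_subspaceT.
have [C [_ HC]] := compact_bounded cgK.
apply: (integ_ball isoF complM (y := y) (r := r) (C := `|C| + 1)).
- apply: measurable_funM; last exact: measurable_ball_indic.
  exact: (@continuous_borelR R (pointed_at x0)).
- move=> q; rewrite indicE; have [qr|qr] := pselect (D y q < r).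
    rewrite mem_set // mulr1; apply: (HC (`|C| + 1)); last by exists q => //=; exact: ltW.
    by rewrite (le_lt_trans (ler_norm C)) // ltrDl.
  by rewrite memNset // mulr0 normr0 addr_ge0.
- by move=> q qr; rewrite indicE memNset // mulr0.
Qed.

Let cst_cont (c : R) : continuous ((fun=> c) : M -> R).
Proof. by move=> p; exact: cont_cst. Qed.

Lemma ball_integral_ge0 g y r : (forall q, 0 <= g q) -> 0 <= W g y r.
Proof. by move=> g0; apply: Rintegral_ge0 => q _; rewrite mulr_ge0 // g0. Qed.

(** The cutoff is 1 on the ball of radius [a] and vanishes outside that of radius [b], while
    [|F - F y| <= D y <= b] on the latter. So the cutoff times [kappa] is at least [m] on the small
    ball minus [b * |H|] on the large one. *)
Lemma volume_deficit y a a' b' b e : a < a' -> a' < b' -> b' < b -> 0 < e -> 0 <= b' ->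
  m%:R * V y a - b * W H y b <= e * V y b + (b' - a')^-1 * b * (V y b - V y a).
Proof.
move=> aa' ab' bb' e0 b'0; have b0 : 0 <= b := le_trans b'0 (ltW bb').
have [I1 le1] := cutoff_estimate isoF complM x0 y aa' ab' bb' e0 b'0.
have IV r := ball_integral_integ y r (@cst_cont 1).
have IH := ball_integral_integ y b (curvature_norm_continuous isoF).
apply: (@le_trans _ _ (\int[mu]_q (ramp a' b' (D y q) * kappa F (F y) q))).
  rewrite /ball_integral -!RintegralZl // -RintegralB //; [|exact: integZ..].
  apply: le_Rintegral => //; first by apply: integB; exact: integZ.
  move=> q _; have Hq := enorm_ge0 (mean_curvature F q).
  rewrite /kappa !indicE mul1r; have [qb|qb] := ltP (D y q) b; last first.
    have qa : ~ (D y q < a) by move=> qa; have := lt_trans (lt_trans (lt_trans qa aa') ab') bb';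
      rewrite ltNge qb.
    rewrite memNset //= memNset /=; last by apply/negP; rewrite -leNgt.
    by rewrite !mulr0 subrr ramp_right ?mul0r // (le_trans (ltW bb')).
  rewrite [_ \in [set q | D y q < b]]mem_set // mulr1.
  have dotle : `|dot (mean_curvature F q) (F q - F y)| <= b * enorm (mean_curvature F q).
    apply: (le_trans (norm_dot _ _)); rewrite mulrC ler_wpM2r //.
    exact: (le_trans (chord_le_dist isoF _ _) (ltW qb)).
  have /andP[z0 z1] := ramp01 a' b' (D y q).
  have i1 : (q \in [set q | D y q < a])%:R <= ramp a' b' (D y q).
    have [qa|qa] := pselect (D y q < a); last by rewrite memNset.
    by rewrite ramp_left ?mem_set // ltW // (lt_trans qa).
  rewrite mulrDr; apply: lerD; first by rewrite mulrC ler_wpM2r.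
  move: dotle; rewrite ler_norml => /andP[dl _].
  move: dl z0 z1 (mulr_ge0 b0 Hq); move: (ramp _ _ _) (dot _ _) (b * _) => t d c dl t0 t1 c0.
  nra.
apply: (le_trans le1); rewrite /ball_integral -RintegralB // -!RintegralZl //; last exact: integB.
rewrite -RintegralD //; [|exact: integZ|by apply: integZ; exact: integB].
by under [leRHS]eq_Rintegral => q _ do rewrite !mul1r.
Qed.

(** Lets the margins of the cutoff tend to 0: an explicit [d] makes the loss at most [e]. *)
Lemma limit_ineq (c A v C : R) : 0 < c -> 0 <= v ->
  (forall d, 0 < d -> 2 * d < c -> (c - 2 * d) * (A - d * v) <= C) -> c * A <= C.
Proof.
move=> c0 v0 Hd; apply/ler_addgt0Pr => e e0.
pose B := 2 * `|A| + c * v + 1.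
have B0 : 0 < B by rewrite ltr_wpDl // addr_ge0 // mulr_ge0 // ltW.
pose d := Num.min (c / 4) (e / B); have d0 : 0 < d by rewrite lt_min !divr_gt0.
have dc : d <= c / 4 by rewrite ge_min lexx.
have dB : d * B <= e by rewrite -ler_pdivlMr // ge_min lexx orbT.
have H1 : 2 * d < c by lra.
have H2 := Hd d d0 H1; have h := ler_norm A.
have h1 : 0 <= d * (`|A| - A) by rewrite mulr_ge0 ?subr_ge0 // ltW.
have h2 : 0 <= d * d * v by rewrite !mulr_ge0 // ltW.
by rewrite /B in dB; nra.
Qed.

(* The first variation formula against the cutoff of the distance to [y]. *)
Lemma volume_monotonicity y a b : 0 < a -> a < b ->
  m%:R * V y a * ((b - a) / b) <= V y b - V y a + (b - a) * W H y b.
Proof.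
move=> a0 ab; have b0 : 0 < b := lt_trans a0 ab.
have c0 : 0 < b - a by rewrite subr_gt0.
have V0 r : 0 <= V y r by exact: ball_integral_ge0.
have key : (b - a) * (m%:R * V y a - b * W H y b) <= b * (V y b - V y a).
  (* The ramp runs from [a + d] to [b - d], and the error [e] of [volume_deficit] is taken to be [d]
     as well. *)
  apply: (limit_ineq c0 (V0 b)) => d d0 dc.
  have h1 : a < a + d by rewrite ltrDl.
  have h2 : a + d < b - d by lra.
  have h3 : b - d < b by rewrite ltrBlDr ltrDl.
  have h4 : 0 <= b - d by lra.
  have := volume_deficit y h1 h2 h3 d0 h4.
  have -> : b - d - (a + d) = b - a - 2 * d by ring.
  have c1 : 0 < b - a - 2 * d by rewrite subr_gt0.
  by rewrite -lerBlDl -mulrA ler_pdivlMl.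
have -> : m%:R * V y a * ((b - a) / b) = ((b - a) * (m%:R * V y a)) / b by ring.
rewrite ler_pdivrMr //.
have E (t u v w : R) : (t - u + v * w) * b = b * (t - u) + v * (b * w) by ring.
by rewrite E -lerBlDr -mulrBr.
Qed.

End monotonicity.

(** * Volume of small balls *)

Section density.
Context {R : realType} {m n : nat} {M : riemannian_manifold R m} (F : M -> 'rV[R]_n).
Hypothesis isoF : isometric_immersion F.
Hypothesis complM : complete_manifold M.
Variables (x0 : M).

Local Notation cod := (@cod R m M).
Local Notation dom := (@dom R m M).
Local Notation psi := (@psi R m M).
Local Notation phi := (@phi R m M).
Local Notation vol_density := (@vol_density R m M).
Local Notation mu := (@mu R m M x0).
Local Notation T := (borel 'rV[R]_m).
Local Notation lam := (@lam R m).
Local Notation bman := (bman x0).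
Local Notation D := (@dist R m M).

(** In coordinates orthonormal at the center, a cube of side [s / (m + 1)] fits into every small
    ball of radius [s]; the factor 1/2 pays for the variation of the volume density. *)
Definition ball_density : R := 2^-1 * (m.+1%:R^-1) ^+ m.

Lemma ball_density_gt0 : 0 < ball_density.
Proof. by rewrite mulr_gt0 ?exprn_gt0 // invr_gt0. Qed.

Lemma ball_integral_volume y r : (ball_integral x0 (fun=> 1) y r)%:E = mu [set q | D y q < r].
Proof.
have mB : measurable ([set q | D y q < r] : set bman) by exact: (measurable_dist_ball isoF).
rewrite /ball_integral /Rintegral (eq_integral (fun q : bman => (\1_[set q | D y q < r] q)%:E)).
  rewrite integral_indic // setIT fineK // ge0_fin_numE //; exact: (ball_fin isoF complM).
by move=> q _; rewrite mul1r.
Qed.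

Lemma small_ball_volume y : exists2 s1, 0 < s1 & forall s, 0 < s -> s < s1 ->
  ball_density * s ^+ m <= ball_integral x0 (fun=> 1) y s.
Proof.
set k := chart_at y; have ky : dom k y := chart_at_dom y; have kz0 := phi_cod ky; set z0 := phi k y in kz0.
have [A uA gA] := metric_factor kz0.
have w0E : vol_density k z0 = `|\det A|.
  by rewrite /vol_density gA det_mulmx det_tr -expr2 sqrtr_sqr.
set w0 := vol_density k z0 in w0E; have w00 : 0 < w0 by exact: vol_density_gt0.
pose Cb := \sum_i \sum_j `|invmx A i j| + 1.
have Cb0 : 0 < Cb by rewrite ltr_wpDl // sumr_ge0 // => i _; rewrite sumr_ge0.
have HCb (v : 'rV[R]_m) : `|v *m invmx A| <= Cb * `|v|.
  by apply: (le_trans (mulmx_bound _ _)); rewrite ler_wpM2r // lerDl.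
have [ra ra0 Hra] := dist_local_upper isoF kz0 (@ltr01 R).
have [rb rb0 Hrb] := open_radius (@cod_open _ _ M k) kz0.
have w20 : 0 < w0 / 2 by rewrite divr_gt0.
have [rc rc0 Hrc] := continuous_radius (C1_continuous (@vol_density_C1 _ _ M k) kz0) w20.
pose r := Num.min ra (Num.min rb rc); have r0 : 0 < r by rewrite !lt_min ra0 rb0.
exists (r / Cb); first by rewrite divr_gt0.
move=> s s0 sr; pose rho := s / (2 * m.+1%:R); have rho0 : 0 < rho by rewrite divr_gt0 // mulr_gt0.
have rhos : rho <= s.
  by rewrite ler_pdivrMr ?mulr_gt0 // ler_peMr ?(ltW s0) // -natrM ler1n.
(* The factor [m] passes from the sup norm to the Euclidean norm, and 2 is the distortion [1 + e] of
   the distance with [e = 1]. *)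
have mrho : 2 * (m%:R * rho) < s.
  rewrite /rho; have -> : 2 * (m%:R * (s / (2 * m.+1%:R))) = s * (m%:R / m.+1%:R) :> R.
    have : (m.+1%:R : R) != 0 by rewrite pnatr_eq0.
    by move: (m.+1%:R : R) => t t0; field.
  by rewrite gtr_pMr // ltr_pdivrMr // mul1r ltr_nat.
pose Bx : set T := box (const_mx (- rho)) (const_mx rho).
have mBx : measurable Bx by exact: measurable_box.
pose B := [set q | D y q < s]; have mB : measurable (B : set bman) by exact: (measurable_dist_ball isoF).
have inB z : Bx ((z - z0) *m A) -> [/\ cod k z, w0 / 2 <= vol_density k z & B (psi k z)].
  move=> Hz; set v := z - z0 in Hz; have zE : z = z0 + v by rewrite /v addrC subrK.
  have vA : `|v *m A| <= rho.
    apply: norm_le_coord; first exact: ltW.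
    by move=> i; have := Hz i; rewrite !mxE ler_norml => /andP[-> /ltW ->].
  have vr : `|v| < r.
    have -> : v = (v *m A) *m invmx A by rewrite mulmxK.
    apply: (le_lt_trans (HCb _)); apply: (@le_lt_trans _ _ (Cb * s)); last by rewrite -ltr_pdivlMl // mulrC.
    by rewrite ler_pM2l // (le_trans vA).
  have [va vb vc] : [/\ `|v| < ra, `|v| < rb & `|v| < rc] by move: vr; rewrite !lt_min => /and3P[].
  split; first exact: Hrb.
    have := Hrc z vc; rewrite -/w0 ltr_norml => /andP[h _].
    by move: h; move: (vol_density k z) (w0) => t1 t2; lra.
  have := Hra z0 v; rewrite subrr normr0 zE addrAC subrr add0r => /(_ ra0 va).
  rewrite /B /= /z0 phiK // => Hd; apply: (le_lt_trans Hd); rewrite -[1 + 1]/2.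
  apply: le_lt_trans mrho; rewrite ler_wpM2l //.
  apply: (@le_trans _ _ (enorm (v *m A))).
    rewrite !enormE !dotE !trmx_mul !mulmxA -(mulmxA v _ _^T) -(metricE isoF kz0) gA.
    by rewrite !mulmxA.
  apply: (le_trans (enorm_le_norm _)); by rewrite ler_wpM2l.
pose chi (z : T) : \bar R := (\1_Bx ((z - z0) *m A))%:E.
have mI : measurable_fun setT (fun z : T => (\1_Bx z : R)%:E).
  by apply/measurable_EFinP; exact: measurable_indic.
have mchi : measurable_fun setT chi.
  apply: (measurableT_comp mI).
  exact: (measurableT_comp (measurable_mulmx A) (measurable_translate (- z0))).
have chi0 z : (0 <= chi z)%E by rewrite lee_fin.
have Ichi : (w0%:E * \int[lam]_z chi z = ((s / m.+1%:R) ^+ m)%:E)%E.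
  rewrite -(lam_translate z0 mchi chi0) w0E.
  transitivity (`|\det A|%:E * \int[lam]_z (\1_Bx (z *m A))%:E)%E.
    by congr (_ * _)%E; apply: eq_integral => z _; rewrite /chi addrK.
  rewrite (lam_linear uA mI) => [|z]; last by rewrite lee_fin.
  transitivity (lam Bx); first by rewrite integral_indic // setIT.
  rewrite lam_box => [|i]; last by rewrite !mxE ge0_cp // ltW.
  congr EFin; rewrite (eq_bigr (fun=> s / m.+1%:R)); first by rewrite prodr_const card_ord.
  move=> i _; rewrite !mxE opprK /rho; have : (m.+1%:R : R) != 0 by rewrite pnatr_eq0.
  by move: (m.+1%:R : R) => t t0; field.
pose B' := B `&` dom k; have mB' : measurable (B' : set bman).
  by apply: measurableI => //; apply: (@bman_open _ _ _ x0); exact: dom_open.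
have m1 : measurable_fun setT (fun q : bman => (\1_B' q : R)%:E).
  by apply/measurable_EFinP; exact: measurable_indic.
rewrite -lee_fin ball_integral_volume; apply: (@le_trans _ _ (mu B')); last first.
  by apply: le_measure; rewrite ?inE // => q [].
rewrite -[B']setIT -integral_indic // (@ge0_integral_chart _ _ _ x0 k (fun q => (\1_B' q)%:E)) //; last first.
  by move=> q kq; rewrite indicE memNset // => -[].
apply: (@le_trans _ _ (\int[lam]_z ((w0 / 2)%:E * chi z))%E).
  rewrite ge0_integralZl //; last by rewrite lee_fin ltW.
  have -> : (w0 / 2)%:E = (2^-1%:E * w0%:E)%E by rewrite -EFinM mulrC.
  rewrite -muleA Ichi -EFinM lee_fin /ball_density -mulrA ler_wpM2l ?invr_ge0 //.
  by rewrite -exprMn mulrC.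
rewrite [leRHS]integral_mkcond; apply: ge0_le_integral => //.
- by move=> z _; rewrite mule_ge0 // lee_fin ltW.
- exact: measurable_funeM.
- apply/(measurable_restrictT _ (measurable_cod k)).
  apply: emeasurable_funM; last by apply/measurable_EFinP; exact: measurable_vol_density.
  by apply: (measurableT_comp m1); exact: measurable_psi.
- move=> z _; rewrite /chi indicE; have [Hz|Hz] := pselect (Bx ((z - z0) *m A)); last first.
    rewrite memNset // mule0 patchE; case: ifPn => //; rewrite inE => kz.
    by rewrite mule_ge0 // lee_fin // ltW // vol_density_gt0.
  have [kz wz Bz] := inB z Hz.
  rewrite mem_set // mule1 patchE mem_set // indicE mem_set ?mul1e ?lee_fin //.
  by split => //; exact: psi_dom.
Qed.

End density.

(** * Linear growth from a volume deficit *)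

Lemma one_sub_exp_ge (R : realType) (x : R) n : 0 <= x <= 1 -> 1 - n%:R * x <= (1 - x) ^+ n.
Proof.
move=> /andP[x0 x1]; elim: n => [|n IH]; first by rewrite mul0r subr0 expr0.
rewrite exprS; apply: (@le_trans _ _ ((1 - x) * (1 - n%:R * x))).
  rewrite -subr_ge0 (_ : _ - _ = n%:R * x ^+ 2); last by rewrite -(natr1 n); ring.
  by rewrite mulr_ge0 // sqr_ge0.
by apply: ler_wpM2l => //; rewrite subr_ge0.
Qed.

(** Divide the inequality by [b ^+ m] and put [x = (b - a) / b]. The ratio at [a] then carries the
    factor [(1 - x) ^+ m * (1 + m%:R * x)], which is at least [1 - (m * x)^2], so a step costs only
    a quadratic error. *)
Lemma ratio_step (R : realType) (m : nat) (Va Vb hb a b sg A K : R) :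
  0 < sg -> sg <= a -> a < b -> 0 <= Va -> Va / a ^+ m <= A ->
  hb <= K * b ^+ m ->
  m%:R * Va * ((b - a) / b) <= Vb - Va + (b - a) * hb ->
  Va / a ^+ m <= Vb / b ^+ m + (b - a) * K + A * m%:R ^+ 2 * ((b - a) / sg) ^+ 2.
Proof.
move=> sg0 sga ab Va0 uA hK HM.
have a0 : 0 < a by exact: lt_le_trans sga.
have b0 : 0 < b by exact: lt_trans ab.
have am0 : 0 < a ^+ m by exact: exprn_gt0.
have bm0 : 0 < b ^+ m by exact: exprn_gt0.
set x := (b - a) / b in HM *.
have x0 : 0 <= x by rewrite divr_ge0 // ?subr_ge0 ltW.
have x1 : x <= 1 by rewrite ler_pdivrMr // mul1r; lra.
have xab : 1 - x = a / b by rewrite /x mulrBl divff ?gt_eqF //; ring.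
set u := Va / a ^+ m in uA *.
have u0 : 0 <= u by rewrite divr_ge0 // ltW.
have Vau : Va = u * a ^+ m by rewrite /u divfK // gt_eqF.
have e1 : u * (1 - x) ^+ m * (1 + m%:R * x) <= Vb / b ^+ m + (b - a) * K.
  rewrite xab expr_div_n mulrA -Vau mulrAC ler_pdivrMr // mulrDl divfK ?gt_eqF //.
  have : (b - a) * hb <= (b - a) * (K * b ^+ m) by apply: ler_wpM2l => //; rewrite subr_ge0 ltW.
  by rewrite mulrDr mulr1; nra.
have e2 : 1 - m%:R ^+ 2 * x ^+ 2 <= (1 - x) ^+ m * (1 + m%:R * x).
  have := @one_sub_exp_ge _ x m; rewrite x0 x1 => /(_ isT) H.
  have mx : 0 <= m%:R * x by rewrite mulr_ge0.
  by nra.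
have e3 : u * (1 - m%:R ^+ 2 * x ^+ 2) <= u * ((1 - x) ^+ m * (1 + m%:R * x)).
  exact: ler_wpM2l.
have xs : x <= (b - a) / sg.
  rewrite /x; apply: ler_wpM2l; first by rewrite subr_ge0 ltW.
  by rewrite lef_pV2 ?posrE //; lra.
have e4 : u * (m%:R ^+ 2 * x ^+ 2) <= A * m%:R ^+ 2 * ((b - a) / sg) ^+ 2.
  rewrite -mulrA; apply: ler_pM => //; first by rewrite mulr_ge0 // ?sqr_ge0.
  apply: ler_wpM2l; first by rewrite sqr_ge0.
  by rewrite lerXn2r // ?nnegrE // divr_ge0 // ?subr_ge0 ltW.
by lra.
Qed.

(* Summing [ratio_step] over a fine subdivision integrates the monotonicity inequality. *)
Lemma ratio_integrated (R : realType) (m : nat) (V h : R -> R) (sg s0 A K : R) :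
  0 < sg -> sg <= s0 ->
  (forall s, 0 < s -> 0 <= V s) ->
  (forall a b, 0 < a -> a < b ->
    m%:R * V a * ((b - a) / b) <= V b - V a + (b - a) * h b) ->
  (forall s, sg <= s <= s0 -> V s / s ^+ m <= A) ->
  (forall s, sg <= s <= s0 -> h s <= K * s ^+ m) ->
  0 <= K ->
  V sg / sg ^+ m <= V s0 / s0 ^+ m + s0 * K.
Proof.
move=> sg0 ss V0 HM HA HK K0.
have A0 : 0 <= A.
  apply: le_trans (HA sg _); last by rewrite lexx.
  by rewrite divr_ge0 ?V0 // exprn_ge0 // ltW.
have [ss'|ss'] := eqVneq sg s0.
  by rewrite -ss' lerDl mulr_ge0 // ltW.
have lts : sg < s0 by rewrite lt_neqAle ss'.
apply/ler_addgt0Pr => e e0.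
(* Over [N] equal steps the quadratic errors add up to [B / N]. *)
set B := A * m%:R ^+ 2 * ((s0 - sg) / sg) ^+ 2.
have B0 : 0 <= B by apply: mulr_ge0; [apply: mulr_ge0|]; rewrite // ?sqr_ge0.
pose N := (Num.truncn (B / e)).+1.
have BN : B / N%:R <= e.
  rewrite ler_pdivrMr ?ltr0n // mulrC -ler_pdivrMr //.
  exact/ltW/truncnS_gt.
pose d := (s0 - sg) / N%:R.
have d0 : 0 < d by rewrite divr_gt0 ?subr_gt0 ?ltr0n.
have dN : N%:R * d = s0 - sg by rewrite /d mulrC divfK // pnatr_eq0.
have step i : (i <= N)%N -> V sg / sg ^+ m <=
    V (sg + i%:R * d) / (sg + i%:R * d) ^+ m + i%:R * d * K + i%:R * (A * m%:R ^+ 2 * (d / sg) ^+ 2).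
  elim: i => [_|i IH iN]; first by rewrite !mul0r !addr0.
  apply: (le_trans (IH (ltnW iN))).
  set a := sg + i%:R * d; set b := sg + i.+1%:R * d.
  have bE : b - a = d by rewrite /a /b -natr1; ring.
  have sa : sg <= a by rewrite lerDl mulr_ge0 // ltW.
  have ab : a < b by rewrite -subr_gt0 bE.
  have bs : b <= s0.
    have : i.+1%:R * d <= N%:R * d by rewrite ler_pM2r // ler_nat.
    by rewrite dN /b; lra.
  have := @ratio_step _ m (V a) (V b) (h b) a b sg A K sg0 sa ab.
  have a0 : 0 < a by exact: lt_le_trans sa.
  move=> /(_ (V0 _ a0)).
  have /HA H1 : sg <= a <= s0 by apply/andP; split; lra.
  have /HK H2 : sg <= b <= s0 by apply/andP; split; lra.
  move=> /(_ H1 H2 (HM _ _ a0 ab)); rewrite bE -natr1.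
  by nra.
have := step N (leqnn _).
rewrite dN (_ : sg + (s0 - sg) = s0); last by ring.
move=> /le_trans; apply; apply: lerD.
  by rewrite lerD2l; apply: ler_wpM2r => //; lra.
apply: le_trans BN; rewrite le_eqVlt; apply/orP; left; apply/eqP.
by rewrite /B /d; field; rewrite (gt_eqF sg0) /= ?pnatr_eq0.
Qed.

(** If no radius works, let [A] be the supremum of [V s / s ^+ m] on [[sg, s0]]. Failure at [s]
    bounds [h s] by [A / (2 * s0) * s ^+ m], and integration from any such [s] up to [s0] gives
    [A <= c / 4 + A / 2]. Hence [A < c], whereas the density at the small radius [sg] gives
    [A >= c]. *)
Lemma radius_selection (R : realType) (m : nat) (V h : R -> R) (c s0 : R) :
  0 < c -> 0 < s0 ->
  (forall s, 0 < s -> 0 <= V s) ->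
  (forall a b, 0 < a -> a <= b -> V a <= V b) ->
  (forall s, 0 < s -> 0 <= h s) ->
  (forall a b, 0 < a -> a < b ->
    m%:R * V a * ((b - a) / b) <= V b - V a + (b - a) * h b) ->
  (exists2 s1, 0 < s1 & forall s, 0 < s -> s < s1 -> c * s ^+ m <= V s) ->
  V (3 * s0) <= c / 4 * s0 ^+ m ->
  exists s, [/\ 0 < s, s <= s0 & V (3 * s) <= 2 * 3 ^+ m * s0 * h s].
Proof.
move=> c0 s00 V0 Vmon h0 HM [s1 s10 HD] V3.
apply: contrapT => Hno.
have Hlt s : 0 < s -> s <= s0 -> 2 * 3 ^+ m * s0 * h s < V (3 * s).
  by move=> s_gt0 s_le; rewrite ltNge; apply/negP => H; apply: Hno; exists s.
pose sg := Num.min (s1 / 2) s0.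
have sg0 : 0 < sg by rewrite lt_min s00 andbT divr_gt0.
have sgs0 : sg <= s0 by rewrite ge_min lexx orbT.
have sgs1 : sg < s1.
  apply: (@le_lt_trans _ _ (s1 / 2)); first by rewrite ge_min lexx.
  by lra.
pose S := [set V s / s ^+ m | s in [set s | sg <= s <= s0]].
have supS : has_sup S.
  split; first by exists (V sg / sg ^+ m); exists sg => //=; rewrite lexx.
  exists (V s0 / sg ^+ m) => _ [s /= /andP[s1' s2'] <-].
  have ss0 : 0 < s by exact: lt_le_trans s1'.
  apply: ler_pM; [exact: V0|by rewrite invr_ge0 exprn_ge0 // ltW|exact: Vmon|].
  rewrite lef_pV2 ?posrE ?exprn_gt0 //.
  by rewrite lerXn2r // nnegrE ltW.
pose A := sup S.
have uA s : sg <= s <= s0 -> V s / s ^+ m <= A.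
  by move=> H; apply: ub_le_sup; [exact: supS.2|exists s].
have cA : c <= A.
  apply: (@le_trans _ _ (V sg / sg ^+ m)); last by apply: uA; rewrite lexx.
  by rewrite ler_pdivlMr ?exprn_gt0 //; exact: HD.
have m3 : 0 < 3 ^+ m :> R by exact: exprn_gt0.
(* If [3 * s] exceeds [s0], the supremum says nothing about it, and the assumption on [V (3 * s0)]
   takes over. *)
have hK s : sg <= s <= s0 -> h s <= A / (2 * s0) * s ^+ m.
  move=> /andP[sgs ss0]; have ps : 0 < s by exact: lt_le_trans sgs.
  have : V (3 * s) <= A * 3 ^+ m * s ^+ m.
    have [le3|gt3] := leP (3 * s) s0.
      have : V (3 * s) / (3 * s) ^+ m <= A by apply: uA; apply/andP; split; lra.
      by rewrite ler_pdivrMr ?exprn_gt0 ?mulr_gt0 // exprMn mulrA.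
    apply: (@le_trans _ _ (V (3 * s0))); first by apply: Vmon; lra.
    apply: (le_trans V3); rewrite -[leRHS]mulrA; apply: ler_pM.
    - by lra.
    - by rewrite exprn_ge0 // ltW.
    - by lra.
    - by rewrite -exprMn lerXn2r // ?nnegrE; lra.
  move=> /(lt_le_trans (Hlt _ ps ss0)) /ltW.
  rewrite [A / _ * _]mulrAC ler_pdivlMr ?mulr_gt0 // => H.
  rewrite -(ler_pM2l m3); apply: le_trans (_ : _ <= A * 3 ^+ m * s ^+ m) _; last by lra.
  by apply: le_trans H; lra.
have A0 : 0 < A by exact: lt_le_trans cA.
have K0 : 0 <= A / (2 * s0) by rewrite divr_ge0 ?mulr_ge0 // ltW.
have key s : sg <= s <= s0 -> V s / s ^+ m <= c / 4 + A / 2.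
  move=> /andP[sgs ss0]; have ps : 0 < s by exact: lt_le_trans sgs.
  have As : forall t, s <= t <= s0 -> V t / t ^+ m <= A.
    by move=> t /andP[st ts]; apply: uA; rewrite ts (le_trans sgs).
  have hs : forall t, s <= t <= s0 -> h t <= A / (2 * s0) * t ^+ m.
    by move=> t /andP[st ts]; apply: hK; rewrite ts (le_trans sgs).
  apply: (le_trans (ratio_integrated ps ss0 V0 HM As hs K0)).
  apply: lerD.
    rewrite ler_pdivrMr ?exprn_gt0 //; apply: le_trans V3.
    by apply: Vmon => //; lra.
  by rewrite le_eqVlt; apply/orP; left; apply/eqP; field; rewrite gt_eqF.
have : A <= c / 4 + A / 2.
  apply: ge_sup; first exact: supS.1.
  by move=> _ [s Hs <-]; exact: key.
by lra.
Qed.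

Lemma seq_max (R : realType) (T : eqType) (rad : T -> R) (x : T) (s : seq T) :
  exists2 e, e \in x :: s & forall a, a \in x :: s -> rad a <= rad e.
Proof.
elim: s x => [|y s IH] x.
  by exists x => [|a]; rewrite inE // => /eqP ->.
have [e es He] := IH y.
have [xe|ex] := leP (rad x) (rad e).
  exists e; first by rewrite inE es orbT.
  by move=> a; rewrite inE => /predU1P[->//|]; exact: He.
exists x; first by rewrite inE eqxx.
move=> a; rewrite inE => /predU1P[->//|/He]; move/le_trans; apply; exact: ltW.
Qed.

(** Greedy selection: keep an element of largest radius, discard everything that meets it, and
    continue with the rest. The relation is abstract because it is applied to balls of [M] and to
    intervals of radii. *)
Lemma finite_vitali (R : realType) (T : eqType) (rad : T -> R) (meet : rel T) (s : seq T) :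
  reflexive meet -> symmetric meet ->
  exists t : seq T, [/\ {subset t <= s}, pairwise (fun a b => ~~ meet a b) t &
    forall a, a \in s -> exists2 b, b \in t & meet a b && (rad a <= rad b)].
Proof.
move=> mr ms; have [n] := ubnP (size s).
elim: n s => // n IH [|x s] sn; first by exists [::]; split.
have [e es He] := seq_max rad x s.
have sz : (size [seq a <- x :: s | ~~ meet e a] < n)%N.
  apply: (@leq_trans (size (x :: s))); last by [].
  rewrite size_filter -(count_predC (meet e) (x :: s)).
  rewrite -[X in (X < _)%N]add0n ltn_add2r -has_count.
  by apply/hasP; exists e => //; exact: mr.
have [t [ts pt Ht]] := IH _ sz.
exists (e :: t); split.
- move=> a; rewrite inE => /predU1P[->//|/ts]; by rewrite mem_filter => /andP[].
- rewrite /= pt andbT; apply/allP => a /ts; by rewrite mem_filter => /andP[].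
- move=> a ax; have [mea|nea] := boolP (meet e a).
    by exists e; rewrite ?inE ?eqxx // ms mea He.
  have [|b bt Hb] := Ht a; first by rewrite mem_filter nea.
  by exists b => //; rewrite inE bt orbT.
Qed.

(** Remove an interval containing the right end [b]; the segment up to its left end is covered by
    the others, as the intervals are open. *)
Lemma interval_cover_length (R : realType) (T : eqType) (ctr rad : T -> R) (s : seq T) (a b : R) :
  (forall i, i \in s -> 0 <= rad i) ->
  (forall t, a <= t <= b -> exists2 i, i \in s & `|t - ctr i| < rad i) ->
  b - a <= \sum_(i <- s) 2 * rad i.
Proof.
have [n] := ubnP (size s).
elim: n s b => // n IH s b sn r0 cov.
have s_ge0 (s' : seq T) : {subset s' <= s} -> 0 <= \sum_(i <- s') 2 * rad i.
  by move=> ss'; rewrite big_seq sumr_ge0 // => i /ss' /r0 ?; rewrite mulr_ge0.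
have [ab|ba] := leP a b; last by apply: (@le_trans _ _ 0); [lra|exact: s_ge0].
have [|i iS] := cov b; first by rewrite ab lexx.
rewrite ltr_norml => /andP[i1 i2].
rewrite (big_rem i) //=.
have [ai|ia] := leP a (ctr i - rad i).
  have : ctr i - rad i - a <= \sum_(j <- rem i s) 2 * rad j.
    apply: IH.
    - rewrite size_rem // prednK //; by case: (s) iS.
    - by move=> j /mem_rem /r0.
    - move=> t /andP[t1 t2]; have [|j js Hj] := cov t; first by rewrite t1 /=; lra.
      exists j => //; have : j \in i :: rem i s by rewrite -(perm_mem (perm_to_rem iS)).
      rewrite inE => /predU1P[ji|//]; move: Hj; rewrite ji ltr_norml => /andP[]; lra.
  lra.
have := s_ge0 (rem i s) (fun j => @mem_rem _ i s j); lra.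
Qed.

(** [C] is the constant of [half_ball_bound] and [kp] its smallness threshold. The choice of [mu]
    gives [2 * C * mu = 2^-m], exactly the factor gained by halving the radius, and the result is
    [kp * mu^(m-1)]. For [m = 1] the curvature integral is the volume, whose density is [c]. *)
Definition curvature_ratio (R : realType) (m : nat) (c : R) : R :=
  let C := 3 ^+ m / 3 in
  let kp := c / 4 / 6 ^+ m in
  if m == 1%N then c else
  let mu := (2 ^+ m.+1 * C)^-1 in
  kp * mu ^+ m.-2 / (2 ^+ m.+1 * C).

(** * Covering argument for functions of balls in a metric space *)

Section metric_measure.
Variables (R : realType) (m : nat) (c : R) (M : choiceType) (D : M -> M -> R).
Variables V h E : M -> R -> R.
Hypothesis m0 : (0 < m)%N.
Hypothesis c0 : 0 < c.
Hypothesis Dxx : forall x, D x x = 0.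
Hypothesis D_sym : forall x y, D x y = D y x.
Hypothesis D_tri : forall x y z, D x z <= D x y + D y z.

Definition ball_subadditive (W : M -> R -> R) := forall x r (s : seq (M * R)),
  (forall q, D x q < r -> exists2 i, i \in s & D i.1 q < i.2) ->
  W x r <= \sum_(i <- s) W i.1 i.2.

Definition balls_disjoint (i j : M * R) := forall q, ~ (D i.1 q < i.2 /\ D j.1 q < j.2).

Definition ball_superadditive (W : M -> R -> R) := forall x r (s : seq (M * R)),
  pairwise (fun i j => `[< balls_disjoint i j >]) s ->
  (forall i, i \in s -> forall q, D i.1 q < i.2 -> D x q < r) ->
  \sum_(i <- s) W i.1 i.2 <= W x r.

Hypothesis subV : ball_subadditive V.
Hypothesis supV : ball_superadditive V.
Hypothesis suph : ball_superadditive h.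
Hypothesis supE : ball_superadditive E.
Hypothesis V_ge0 : forall x r, 0 <= V x r.
Hypothesis h_ge0 : forall x r, 0 <= h x r.
Hypothesis finite_cover : forall x r (s : M -> R), (forall y, 0 < s y) ->
  exists l : seq M, (forall y, y \in l -> D x y <= r) /\
    forall q, D x q <= r -> exists2 y, y \in l & D y q < s y.
Hypothesis monotonicity : forall y a b, 0 < a -> a < b ->
  m%:R * V y a * ((b - a) / b) <= V y b - V y a + (b - a) * h y b.
Hypothesis density : forall y, exists2 s1, 0 < s1 &
  forall s, 0 < s -> s < s1 -> c * s ^+ m <= V y s.
Hypothesis young : (1 < m)%N -> forall x r lam, 0 < lam ->
  h x r <= lam * V x r + (lam ^+ m.-2)^-1 * E x r.
Hypothesis E1 : m = 1%N -> E = V.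

Lemma superadditive_mono (W : M -> R -> R) (x y : M) (r s : R) : ball_superadditive W ->
  D x y + s <= r -> W y s <= W x r.
Proof.
move=> supW H; have := supW x r [:: (y, s)]; rewrite big_seq1 /=; apply => //.
move=> i; rewrite inE => /eqP -> /= q yq.
by apply: le_lt_trans (D_tri x y q) _; lra.
Qed.

(* A disjoint subfamily of the balls given by [radius_selection] controls V on the half ball. *)
Lemma half_ball_bound (x : M) (r : R) : 0 < r -> V x r <= c / 4 / 6 ^+ m * r ^+ m ->
  V x (r / 2) <= 3 ^+ m / 3 * r * h x r.
Proof.
(* As [3 * s0 = r / 2], the balls of radius [3 * s0] about points of the half ball lie in the ball
   of radius [r], and the threshold becomes [c / 4 * s0 ^+ m]. *)
move=> r0 Vr; set s0 := r / 6.
have s00 : 0 < s0 by rewrite divr_gt0.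
have sel y : D x y <= r / 2 ->
    exists s, [/\ 0 < s, s <= s0 & V y (3 * s) <= 2 * 3 ^+ m * s0 * h y s].
  move=> xy; apply: (@radius_selection R m (V y) (h y) c s0) => //.
  - by move=> a b a0 ab; apply: superadditive_mono => //; rewrite Dxx add0r.
  - exact: monotonicity.
  - apply: (@le_trans _ _ (V x r)); first by apply: superadditive_mono; rewrite // /s0; lra.
    by apply: (le_trans Vr); rewrite /s0 expr_div_n mulrA mulrAC.
(* Outside the half ball the radius gets the default value 1, since [finite_cover] expects a
   positive radius at every point. *)
have selT y : {s | 0 < s /\ (D x y <= r / 2 -> s <= s0 /\ V y (3 * s) <= 2 * 3 ^+ m * s0 * h y s)}.
  apply: cid; have [xy|xy] := leP (D x y) (r / 2).
    by have [s [? ? ?]] := sel y xy; exists s.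
  by exists 1; split=> // ?; exfalso; lra.
pose s y := sval (selT y).
have s_gt0 y : 0 < s y by rewrite /s; case: (selT y) => /= ? [].
have sP y : D x y <= r / 2 -> s y <= s0 /\ V y (3 * s y) <= 2 * 3 ^+ m * s0 * h y (s y).
  by rewrite /s; case: (selT y) => /= ? [].
have [l [lr cov]] := finite_cover x (r / 2) s_gt0.
pose meet y z := ~~ `[< balls_disjoint (y, s y) (z, s z) >].
have mr : reflexive meet.
  move=> y; apply/negP => /asboolP /(_ y) /=; rewrite Dxx; by apply.
have ms : symmetric meet.
  move=> y z; rewrite /meet; congr negb; apply: asbool_equiv_eq.
  by split=> H q [] ? ?; apply: (H q).
have [t [tl pt tP]] := finite_vitali s l mr ms.
have tr y : y \in t -> D x y <= r / 2 by move=> /tl /lr.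
apply: (@le_trans _ _ (\sum_(i <- [seq (y, 3 * s y) | y <- t]) V i.1 i.2)).
  apply: subV => q xq; have [y yl yq] := cov q (ltW xq).
  have [z zt /andP[/asboolPn mz rz]] := tP y yl.
  exists (z, 3 * s z); first by apply/mapP; exists z.
  move: mz => /existsNP [w /contrapT [/= yw zw]].
  have := D_tri z w q; have := D_tri w y q; rewrite (D_sym w y); lra.
rewrite big_map /=.
apply: (@le_trans _ _ (\sum_(y <- t) 2 * 3 ^+ m * s0 * h y (s y))).
  rewrite big_seq [leRHS]big_seq; apply: ler_sum => y /tr /sP []; by [].
rewrite -mulr_sumr.
have -> : 2 * 3 ^+ m * s0 = 3 ^+ m / 3 * r :> R by rewrite /s0; field.
apply: ler_wpM2l; first by rewrite mulr_ge0 ?divr_ge0 ?exprn_ge0 // ltW.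
have := suph (x := x) (r := r) (s := [seq (y, s y) | y <- t]); rewrite big_map /=; apply.
  rewrite pairwise_map; apply: sub_pairwise pt => y z /=.
  by rewrite /meet negbK.
move=> i /mapP[y /tr yr ->] /= q yq.
have [s1 _] := sP _ yr.
apply: le_lt_trans (D_tri x y q) _; move: s1; rewrite /s0; lra.
Qed.

Lemma curvature_ratio_gt0 : 0 < curvature_ratio m c.
Proof.
rewrite /curvature_ratio; case: eqP => // _.
by rewrite !(divr_gt0, mulr_gt0, exprn_gt0, invr_gt0).
Qed.

(** Otherwise the bound [V x s <= kp * s ^+ m] would pass from [s] to [s / 2] forever, but [kp < c]
    contradicts the density at small radii. For [m = 1] the density itself provides the radius. *)
Lemma curvature_concentration (x : M) (r : R) : 0 < r ->
  V x r <= c / 4 / 6 ^+ m * r ^+ m ->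
  exists s, [/\ 0 < s, s <= r & curvature_ratio m c * s <= E x s].
Proof.
move=> r0 Vr; have [m1|m1] := eqVneq m 1%N.
  have [s1 s10 Hs] := density x; pose s := Num.min (s1 / 2) r.
  exists s; have s0 : 0 < s by rewrite lt_min r0 divr_gt0.
  split=> //; first by rewrite ge_min lexx orbT.
  rewrite /curvature_ratio m1 /= (E1 m1).
  have := Hs s s0; rewrite m1 expr1; apply.
  by rewrite gt_min; apply/orP; left; lra.
have m2 : (1 < m)%N by rewrite ltn_neqAle eq_sym m1.
apply: contrapT => Hno.
have EB s : 0 < s -> s <= r -> E x s <= curvature_ratio m c * s.
  move=> s0 sr; rewrite leNgt; apply/negP => H; apply: Hno; exists s; split => //; exact: ltW.
set kp := c / 4 / 6 ^+ m in Vr *.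
have kp0 : 0 < kp by rewrite !divr_gt0 ?exprn_gt0.
set C : R := 3 ^+ m / 3.
have C0 : 0 < C by rewrite divr_gt0 ?exprn_gt0.
pose mu := (2 ^+ m.+1 * C)^-1.
have mu0 : 0 < mu by rewrite invr_gt0 mulr_gt0 ?exprn_gt0.
have epsE : curvature_ratio m c = kp * mu ^+ m.-2 * mu.
  by rewrite /curvature_ratio (negPf m1).
have stepV s : 0 < s -> s <= r -> V x s <= kp * s ^+ m -> V x (s / 2) <= kp * (s / 2) ^+ m.
  move=> s0 sr Vs; apply: (le_trans (half_ball_bound s0 Vs)).
  (* This parameter balances Young's inequality: both terms are at most [kp * mu * s^(m-1)]. *)
  have lam0 : 0 < mu / s by rewrite divr_gt0.
  have := young m2 x s lam0 => Y.
  have e1 : mu / s * V x s <= mu / s * (kp * s ^+ m) by rewrite ler_pM2l.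
  have e2 : ((mu / s) ^+ m.-2)^-1 * E x s <= ((mu / s) ^+ m.-2)^-1 * (kp * mu ^+ m.-2 * mu * s).
    by rewrite -epsE; apply: ler_wpM2l; [rewrite invr_ge0 exprn_ge0 // ltW|exact: EB].
  apply: (@le_trans _ _ (C * s * (mu / s * (kp * s ^+ m) +
      ((mu / s) ^+ m.-2)^-1 * (kp * mu ^+ m.-2 * mu * s)))).
    apply: ler_wpM2l; first by rewrite mulr_ge0 // ltW.
    by apply: le_trans Y _; exact: lerD.
  rewrite le_eqVlt; apply/orP; left; apply/eqP.
  have Cmu : C * mu = (2 ^+ m.+1)^-1 by rewrite /mu invfM mulrCA divff ?mulr1 // gt_eqF.
  have sE : s ^+ m = s ^+ m.-2 * s ^+ 2 by rewrite -exprD; congr (_ ^+ _);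
    case: (m) m2 => [|[|k]] //= _; rewrite addn2.
  have mun : mu ^+ m.-2 != 0 by rewrite gt_eqF // exprn_gt0.
  have sn : s ^+ m.-2 != 0 by rewrite gt_eqF // exprn_gt0.
  rewrite !expr_div_n invf_div sE.
  transitivity (2 * (C * mu) * kp * (s ^+ m.-2 * s ^+ 2)).
    field; by rewrite ?mun ?sn ?(gt_eqF s0).
  rewrite Cmu exprS; field; by rewrite gt_eqF // exprn_gt0.
have Vj j : V x (r / 2 ^+ j) <= kp * (r / 2 ^+ j) ^+ m.
  elim: j => [|j IH]; first by rewrite expr0 divr1.
  rewrite exprSr invfM mulrA; apply: stepV => //; first by rewrite divr_gt0 ?exprn_gt0.
  by rewrite ler_pdivrMr ?exprn_gt0 // ler_peMr ?(ltW r0) // exprn_ege1 // ler1n.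
have [s1 s10 Hs] := density x.
have [j Hj] : exists j, r / 2 ^+ j < s1.
  exists (Num.truncn (r / s1)).+1; rewrite ltr_pdivrMr ?exprn_gt0 // mulrC -ltr_pdivrMr //.
  apply: (lt_trans (truncnS_gt _)); rewrite -natrX ltr_nat; exact: ltn_expl.
have rj0 : 0 < r / 2 ^+ j by rewrite divr_gt0 ?exprn_gt0.
have := le_trans (Hs _ rj0 Hj) (Vj j); rewrite ler_pM2r ?exprn_gt0 //.
rewrite leNgt => /negP; apply; rewrite /kp -mulrA gtr_pMr //.
rewrite -invfM invf_lt1 ?mulr_gt0 ?exprn_gt0 //.
have : 1 <= 6 ^+ m :> R by rewrite exprn_ege1 // ler1n.
lra.
Qed.

(** Choose a point [y t] at each distance [t] from [x], with a radius [s t] of concentration. If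
    [|t - u| >= s t + s u], the two balls are disjoint, because their points have different
    distances to [x]. So the selection is made among intervals: tripled, the selected ones cover
    [[0, r]], and each has length [6 * s t], which gives the factor 1/6. *)
Lemma linear_growth (x : M) (r : R) : 0 < r ->
  (forall t, 0 <= t <= r -> exists y, D x y = t) ->
  V x (2 * r) <= c / 4 / 6 ^+ m * r ^+ m ->
  curvature_ratio m c / 6 * r <= E x (2 * r).
Proof.
move=> r0 sph Vr.
have Hy t : {y | 0 <= t <= r -> D x y = t}.
  apply: cid; have [/sph[y]|] := boolP (0 <= t <= r); first by exists y.
  by move=> /negP ?; exists x.
pose y t := sval (Hy t).
have yP t : 0 <= t <= r -> D x (y t) = t by rewrite /y; case: (Hy t).
(* All balls stay in the ball of radius [2 * r], since [t <= r] and [s t <= r]; the value 1 outside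
   [[0, r]] only keeps the radius positive. *)
have Hs t : {s | 0 < s /\ (0 <= t <= r -> s <= r /\ curvature_ratio m c * s <= E (y t) s)}.
  apply: cid; have [tr|] := boolP (0 <= t <= r); last by move=> /negP ?; exists 1; split.
  have [|s [? ? ?]] := @curvature_concentration (y t) r r0; last by exists s.
  apply: le_trans Vr; apply: superadditive_mono => //; rewrite yP //; lra.
pose s t := sval (Hs t).
have s0 t : 0 < s t by rewrite /s; case: (Hs t) => ? [].
have sP t : 0 <= t <= r -> s t <= r /\ curvature_ratio m c * s t <= E (y t) (s t).
  by rewrite /s; case: (Hs t) => ? [].
have [l [lr lc]] : exists l : seq R, (forall t, t \in l -> 0 <= t <= r) /\
    forall t, 0 <= t <= r -> exists2 u, u \in l & `|t - u| < s u.
  have : compact `[0, r]%classic by exact: segment_compact.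
  rewrite compact_cover => /(_ R `[0, r]%classic (fun t => ball t (s t))).
  case.
  - by move=> t _; exact: ball_open.
  - by move=> t tr; exists t => //; exact: ballxx.
  - move=> L LS cov; exists (finmap.enum_fset L); split.
      by move=> t /LS; rewrite inE /= in_itv.
    move=> t tr; have [|u uL] := cov t; first by rewrite /= in_itv.
    by rewrite /= /ball /= distrC => H; exists u.
pose meet (t u : R) := `|t - u| < s t + s u.
have mr : reflexive meet by move=> t; rewrite /meet subrr normr0 addr_gt0.
have ms : symmetric meet by move=> t u; rewrite /meet distrC (addrC (s t)).
have [T [Tl pT TP]] := finite_vitali s l mr ms.
have Tr t : t \in T -> 0 <= t <= r by move=> /Tl /lr.
have rS : r - 0 <= \sum_(t <- T) 2 * (3 * s t).
  apply: (@interval_cover_length R R id (fun t => 3 * s t)).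
    by move=> t _; rewrite mulr_ge0 // ltW.
  move=> t tr; have [u ul tu] := lc t tr.
  have [v vT /andP[uv rv]] := TP u ul; exists v => //.
  by have := ler_distD u t v; move: uv; rewrite /meet; lra.
have : \sum_(t <- T) curvature_ratio m c * s t <= E x (2 * r).
  apply: (@le_trans _ _ (\sum_(t <- T) E (y t) (s t))).
    by rewrite big_seq [leRHS]big_seq; apply: ler_sum => t /Tr /sP [].
  have := supE (x := x) (r := 2 * r) (s := [seq (y t, s t) | t <- T]); rewrite big_map /=; apply.
    rewrite pairwise_map; apply: (@sub_in_pairwise _ (mem T)) pT; last by apply/allP.
    move=> t u /= tT uT; rewrite /meet -leNgt => H; apply/asboolP => q /= [tq uq].
    have := D_tri x (y t) q; have := D_tri x (y u) q.
    have := D_tri x q (y t); have := D_tri x q (y u).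
    rewrite (D_sym q (y t)) (D_sym q (y u)) !yP ?Tr //.
    by move: H; rewrite lter_normr => /orP[]; lra.
  move=> i /mapP[t /Tr tr ->] /= q tq; have [st _] := sP _ tr.
  have := D_tri x (y t) q; rewrite yP //; move: tr => /andP[]; lra.
rewrite -mulr_sumr; apply: le_trans.
rewrite -mulrA ler_pM2l ?curvature_ratio_gt0 //.
move: rS; under eq_bigr do rewrite mulrA; rewrite -mulr_sumr; lra.
Qed.

End metric_measure.

(** * Curvature integrals over balls *)

Section ball_integrals.
Context {R : realType} {m n : nat} {M : riemannian_manifold R m} (F : M -> 'rV[R]_n).
Hypothesis isoF : isometric_immersion F.
Hypothesis complM : complete_manifold M.
Variables (x0 : M).

Local Notation mu := (@mu R m M x0).
Local Notation bman := (bman x0).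
Local Notation D := (@dist R m M).
Local Notation W := (@ball_integral R m M x0).

Variable g : M -> R.
Hypotheses (g_cont : continuous g) (g_ge0 : forall q, 0 <= g q).

Let g_integ y r := ball_integral_integ isoF complM x0 y r g_cont.

Let sum_integ (s : seq (M * R)) :
  \sum_(i <- s) W g i.1 i.2 = \int[mu]_q (\sum_(i <- s) g q * \1_[set q | D i.1 q < i.2] q).
Proof. by rewrite integ_int_sum. Qed.

Lemma ball_integral_subadditive : ball_subadditive D (W g).
Proof.
move=> x r s cov; rewrite sum_integ /ball_integral; apply: le_Rintegral => //.
  by apply: integ_sum => i; exact: g_integ.
move=> q _; have [qr|qr] := pselect (D x q < r); last first.
  by rewrite [\1_ _ q]indicE memNset // mulr0 sumr_ge0 // => i _; rewrite mulr_ge0 // g_ge0.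
have [i si qi] := cov q qr; rewrite (big_rem i si) /= !indicE !mem_set // lerDl.
by apply: sumr_ge0 => j _; rewrite mulr_ge0 // g_ge0.
Qed.

Lemma ball_integral_superadditive : ball_superadditive D (W g).
Proof.
move=> x r s dis sub; rewrite sum_integ /ball_integral; apply: le_Rintegral => //; last first.
- move=> q _; rewrite -mulr_sumr ler_wpM2l //; move: dis sub; elim: s => [|i s IH].
    by rewrite big_nil.
  rewrite pairwise_cons => /andP[/allP di dis] sub; rewrite big_cons [X in X + _]indicE.
  have [qi|qi] := pselect (D i.1 q < i.2); last first.
    rewrite memNset // add0r; apply: IH => // j sj; apply: sub; by rewrite inE sj orbT.
  have qx : D x q < r by apply: (sub i) => //; rewrite mem_head.
  rewrite mem_set // [\1_ _ q]indicE mem_set // big_seq big1 ?addr0 // => j sj.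
  rewrite indicE memNset //= => qj; have /asboolP dij := di j sj.
  exact: (dij q (conj qi qj)).
- by apply: integ_sum => i; exact: g_integ.
Qed.

Lemma riemann_integral_ball y r :
  riemann_integral (geodesic_ball y r) (fun p => (g p)%:E) = (W g y r)%:E.
Proof.
have mB : measurable ([set q | D y q < r] : set bman) by exact: (measurable_dist_ball isoF).
have mg : measurable_fun setT (g : bman -> R) by exact: (@continuous_borelR R (pointed_at x0)).
rewrite (geodesic_ballE isoF) (riemann_integralE mB); last 2 first.
- exact/measurable_EFinP.
- by move=> p; rewrite lee_fin.
rewrite /ball_integral /Rintegral fineK; last by apply: integrable_fin_num => //; exact: g_integ.
rewrite [LHS]integral_mkcond; apply: eq_integral => q _; rewrite patchE indicE.
by case: (q \in _); rewrite ?mulr1 ?mulr0.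
Qed.

Lemma ball_integral_le y r : ((W g y r)%:E <= riemann_integral [set: M] (fun p => (g p)%:E))%E.
Proof.
have mB : measurable ([set q | D y q < r] : set bman) by exact: (measurable_dist_ball isoF).
have mg : measurable_fun setT (g : bman -> R) by exact: (@continuous_borelR R (pointed_at x0)).
have mgE : measurable_fun setT (EFin \o g : bman -> \bar R) by exact/measurable_EFinP.
have g0 (p : bman) : (0 <= (EFin \o g) p)%E by rewrite lee_fin.
rewrite -riemann_integral_ball (geodesic_ballE isoF) (riemann_integralE mB mgE g0).
rewrite (riemann_integralE (@measurableT _ bman) mgE g0).
by apply: ge0_subset_integral.
Qed.

End ball_integrals.

Lemma cont_exp (R : realType) (T : topologicalType) (f : T -> R) k : continuous f ->
  continuous (fun q => f q ^+ k).
Proof.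
move=> cf; elim: k => [|k IH] q; first by rewrite (_ : (fun _ => _) = fun=> 1) //; exact: cont_cst.
rewrite (_ : (fun _ => _) = fun q => f q * f q ^+ k); last by apply/funext => p; rewrite exprS.
have c1 : {for q, continuous f} by exact: cf.
have c2 : {for q, continuous (fun q => f q ^+ k)} by exact: IH.
exact: (cont_mul c1 c2).
Qed.

(** If [x] exceeds [lam], then [(x / lam)^k] is at least 1 and may be inserted as a factor. *)
Lemma young_power (R : realFieldType) (x lam : R) k : 0 <= x -> 0 < lam ->
  x <= lam + (lam ^+ k)^-1 * x ^+ k.+1.
Proof.
move=> x0 lam0; have lk : 0 < lam ^+ k by rewrite exprn_gt0.
have p0 : 0 <= (lam ^+ k)^-1 * x ^+ k.+1 by rewrite mulr_ge0 ?invr_ge0 ?exprn_ge0 // ltW.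
have [xl|xl] := leP x lam; first by rewrite ler_wpDr.
apply: (@le_trans _ _ ((lam ^+ k)^-1 * x ^+ k.+1)); last by rewrite lerDr ltW.
by rewrite exprS mulrCA ler_peMr // ler_pdivlMl // mulr1 lerXn2r ?nnegrE ?ltW // (lt_trans lam0 xl).
Qed.

Section curvature_growth.
Context {R : realType} {m n : nat} (hm : (0 < m)%N) {M : riemannian_manifold R m} (F : M -> 'rV[R]_n).
Hypothesis isoF : isometric_immersion F.
Hypothesis complM : complete_manifold M.
Hypothesis ncM : ~ compact [set: M].
Variables (x : M).

Local Notation D := (@dist R m M).
Local Notation H := (fun q => enorm (mean_curvature F q)).
Local Notation V := (@ball_integral R m M x (fun=> 1)).
Local Notation E := (@ball_integral R m M x (fun q => H q ^+ m.-1)).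
Local Notation c := (@ball_density R m).

Let cst_cont : continuous ((fun=> 1) : M -> R).
Proof. by move=> p; exact: cont_cst. Qed.

Let H_cont : continuous (H : M -> R).
Proof. exact: (curvature_norm_continuous isoF). Qed.

Let E_cont : continuous ((fun q => H q ^+ m.-1) : M -> R).
Proof. exact: cont_exp. Qed.

Let H_ge0 (q : M) : 0 <= H q. Proof. exact: enorm_ge0. Qed.

Let E_ge0 (q : M) : 0 <= H q ^+ m.-1. Proof. by rewrite exprn_ge0. Qed.

Lemma curvature_growth r : 0 < r -> V x (2 * r) <= c / 4 / 6 ^+ m * r ^+ m ->
  curvature_ratio m c / 6 * r <= E x (2 * r).
Proof.
move=> r0; apply: (@linear_growth R m c M D V (@ball_integral R m M x H) E hm ball_density_gt0 _ _ _ _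
  _ _ _ _ _ _ _ _ _ _ x r r0).
- exact: distxx.
- exact: dist_sym.
- exact: dist_triangle.
- exact: ball_integral_subadditive.
- exact: ball_integral_superadditive.
- exact: ball_integral_superadditive.
- exact: ball_integral_superadditive.
- by move=> y s; exact: ball_integral_ge0.
- by move=> y s; exact: ball_integral_ge0.
- move=> y s t t0; apply: (compact_finite_cover (f := fun p => [set q | D p q < t p])
    (@closed_ball_compact _ _ _ _ F isoF complM y s)) => p _.
  by split; [exact: (dist_ball_open isoF)|rewrite /= (distxx isoF)].
- by move=> y a b; exact: volume_monotonicity.
- by move=> y; exact: (small_ball_volume isoF complM).
- move=> m1 y s lam lam0.
  have I1 := ball_integral_integ isoF complM x y s H_cont.
  have I2 := ball_integral_integ isoF complM x y s cst_cont.
  have I3 := ball_integral_integ isoF complM x y s E_cont.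
  rewrite /ball_integral -!RintegralZl // -RintegralD //; [|exact: integZ..].
  apply: le_Rintegral => //; first by apply: integD; exact: integZ.
  move=> q _; rewrite mul1r mulrA -mulrDl ler_wpM2r //.
  have -> : m.-1 = m.-2.+1 by case: (m) m1 => [|[]].
  exact: young_power.
- by move=> m1; have -> : m.-1 = 0%N by rewrite m1.
- by move=> t /andP[t0 _]; exact: (sphere_nonempty isoF complM).
Qed.

End curvature_growth.

Theorem theoremC (R : realType) (m : nat) (hm : (0 < m)%N) :
  exists delta : R, 0 < delta /\
    forall (n : nat) (M : riemannian_manifold R m) (F : M -> 'rV[R]_n) (x : M),
      isometric_immersion F -> complete_manifold M -> ~ compact [set: M] ->
      (limf_esup (fun r : R => volume (geodesic_ball x r) * (r ^- m)%:E)
         (pinfty_nbhs R) < delta%:E)%E ->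
      (0 < limf_esup
             (fun r : R =>
                riemann_integral (geodesic_ball x r)
                  (fun p => (enorm (mean_curvature F p) ^+ m.-1)%:E) *
                (r^-1)%:E)
             (pinfty_nbhs R))%E /\
      riemann_integral [set: M]
        (fun p => (enorm (mean_curvature F p) ^+ m.-1)%:E) = +oo%E.
Proof.
pose c := @ball_density R m; have c0 : 0 < c := ball_density_gt0.
(* [curvature_growth] is applied with radius [r / 2], which accounts for the factor [2 ^+ m] here
   and for 12 instead of 6 in [eta]. *)
exists (c / 4 / 6 ^+ m / 2 ^+ m); split; first by rewrite !divr_gt0 ?exprn_gt0.
move=> n M F x isoF complM ncM Hlim.
pose E r := ball_integral x (fun q => enorm (mean_curvature F q) ^+ m.-1) x r.
have E_cont : continuous (fun q : M => enorm (mean_curvature F q) ^+ m.-1).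
  by apply: cont_exp; exact: (curvature_norm_continuous isoF).
have E_ge0 (q : M) : 0 <= enorm (mean_curvature F q) ^+ m.-1 by rewrite exprn_ge0 // enorm_ge0.
have Eball r : riemann_integral (geodesic_ball x r)
    (fun p => (enorm (mean_curvature F p) ^+ m.-1)%:E) = (E r)%:E.
  exact: (riemann_integral_ball isoF complM).
have cst_cont : continuous ((fun=> 1) : M -> R) by move=> p; exact: cont_cst.
have Vball r : volume (geodesic_ball x r) = (ball_integral x (fun=> 1) x r)%:E.
  exact: (riemann_integral_ball isoF complM x cst_cont).
pose eta := curvature_ratio m c / 12.
have eta0 : 0 < eta by rewrite divr_gt0 // curvature_ratio_gt0.
have [r0 r00 growth] : exists2 r0 : R, 0 < r0 & forall r, r0 < r -> eta * r <= E r.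
  (* The upper limit is an infimum over neighborhoods of infinity, so one of them keeps the volume
     ratio below the constant at all large radii. *)
  have [_ [B [r0 [_ Hr0]] <-] Hsup] := ereal_inf_lt Hlim.
  exists (Num.max r0 1) => [|r]; first by rewrite lt_max ltr01 orbT.
  rewrite gt_max => /andP[rr0 r1]; have rp : 0 < r := lt_trans ltr01 r1.
  have Vr : ball_integral x (fun=> 1) x r <= c / 4 / 6 ^+ m * (r / 2) ^+ m.
    have h : ((ball_integral x (fun=> 1) x r * r ^- m)%:E < (c / 4 / 6 ^+ m / 2 ^+ m)%:E)%E.
      apply: le_lt_trans Hsup; apply: ereal_sup_ubound; exists r; first exact: Hr0.
      by rewrite Vball.
    move: h; rewrite lte_fin ltr_pdivrMr ?exprn_gt0 // => /ltW.
    by rewrite expr_div_n mulrA mulrAC.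
  have E2 : r = 2 * (r / 2) by rewrite mulrC divfK // pnatr_eq0.
  have := @curvature_growth R m n hm M F isoF complM ncM x (r / 2); rewrite -E2 => H.
  apply: le_trans (H _ Vr); last by rewrite divr_gt0.
  by rewrite /eta le_eqVlt; apply/orP; left; apply/eqP; field.
split.
  apply: (@lt_le_trans _ _ eta%:E); first by rewrite lte_fin.
  apply: le_ereal_inf_tmp => _ [B [s [_ Hs]] <-].
  pose r := Num.max r0 s + 1; have rr0 : r0 < r by rewrite /r ltr_pwDr // le_max lexx.
  have rs : s < r by rewrite /r ltr_pwDr // le_max lexx orbT.
  have rp := lt_trans r00 rr0.
  apply: (@le_trans _ _ ((E r)%:E * (r^-1)%:E)%E).
    by rewrite -EFinM lee_fin ler_pdivlMr // growth.
  by apply: ereal_sup_ubound; exists r; [exact: Hs|rewrite Eball].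
(* A radius at which the linear lower bound [eta * r] exceeds [A]. *)
apply/eqyP => A A0; pose r := r0 + A / eta.
have rr0 : r0 < r by rewrite ltrDl divr_gt0.
apply: le_trans (ball_integral_le isoF complM x E_cont E_ge0 x r).
rewrite lee_fin; apply: le_trans (growth r rr0).
by rewrite /r mulrDr [eta * (A / _)]mulrC divfK ?gt_eqF // lerDr mulr_ge0 // ltW.
Qed.
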